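(* Suppose that Assumptions A and B (stated in the context) hold. Let $W$ be the centered Brownian motion with sample paths in $\mathcal{C}_0(I_2,\mathbb{R}^d)$, defined by the covariance kernel $c$ (the long-run variance kernel given in the context). Then there exist some $C,\tau>0$ such that $$\pi_\infty(P_N,W)\le C N^{-\tau}.$$ The constants $C,\tau$ depend only on the constants $C_i, J,\nu,\xi,\gamma,\rho,\kappa$ (appearing in Assumptions A and B) and on $d$.
   Context: Notation. $|\cdot|$ denotes the maximum norm on $\mathbb{R}^d$, $d\ge 1$. $I_2\subset I_1$ are non-empty intervals, each either compact or equal to $\mathbb{R}$. For compact $I$, $\mathcal{C}_0(I,\mathbb{R}^d)$ is the space of continuous functions $I\to\mathbb{R}^d$; $\mathcal{C}_0(\mathbb{R},\mathbb{R}^d)$ is the space of continuous functions $f:\mathbb{R}\to\mathbb{R}^d$ with $\lim_{y\to\infty}\sup_{|u|>y}|f(u)|=0$. Components are written $f[1],\dots,f[d]$; $\|f\|$ is the supremum of $|f|$ over its domain. A function on $I_1$ is identified with its restriction to $I_2$ when compared with a function on $I_2$. $L^\infty([0,1]\times I_2,\mathbb{R}^d)$ is the space of bounded functions with the sup-norm. Sparse estimators. $(X_n)_{n\in\mathbb{N}}$ is a sequence of random functions in $\mathcal{C}_0(I_1,\mathbb{R}^d)$. For each $M\in\mathbb{N}$, $(\delta_{n,M})_{n}$ are random variables in a metric space $\mathcal{S}_M$, $\mathscr{A}_M:\mathcal{C}_0(I_1,\mathbb{R}^d)\times\mathcal{S}_M\to\mathcal{C}_0(I_2,\mathbb{R}^d)$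 is a deterministic measurable map, and $X_{n,M}:=\mathscr{A}_M(X_n,\delta_{n,M})$. $(M_N)_{N}$ is a sequence of natural numbers with $M_N\to\infty$ as $N\to\infty$. Mixing and stationarity. For a sequence $(Y_n)$ the $\alpha$-mixing coefficients are $\alpha_Y(k)=\sup|\mathbb{P}(A\cap B)-\mathbb{P}(A)\mathbb{P}(B)|$, over $m\ge1$, $A\in\sigma(Y_i:1\le i\le m)$, $B\in\sigma(Y_i:i\ge m+k)$; $(Y_n)$ is $\alpha$-mixing if $\alpha_Y(k)\to0$. Weak stationarity is meant in the usual sense: the mean functions and the lag-$h$ covariances do not depend on the time index. Assumption A. (i) $(X_n)$ is weakly stationary in $\mathcal{C}_0(I_1,\mathbb{R}^d)$; for every $M$ the sequence $(X_n,\delta_{n,M})_n$ is $\alpha$-mixing with coefficients $\alpha_{X,\delta,M}$, and there are $C_1,\nu>0$ with $\sup_M\alpha_{X,\delta,M}(n)\le C_1n^{-\nu}$ for all $n\in\mathbb{N}$. (ii) $J>4$ and $\xi>1/2$ are constants with $3+\frac{9}{J-4}<\nu$, and for some $C_2>0$: $\sup_n\mathbb{E}\|X_n\|^J\le C_2$ and $\sup_n\sup_{u\ne v}\mathbb{E}\big(|X_n(u)-X_n(v)|/|u-v|^\xi\big)^J\le C_2$. (iii) There are $C_3,\gamma>0$ such that $\sup_n\mathbb{E}\|X_n-X_{n,M_N}\|^J\le C_3N^{-\gamma}$ and $\sup_{n,N}\sup_{u\ne v}\mathbb{E}\big(|X_{n,M_N}(u)-X_{n,M_N}(v)|/|u-v|^\xi\big)^J\le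 C_3$. Assumption B. One of the following three scenarios holds. (i) (Fixed domain) $I_2$ is a fixed compact interval. (ii) (Increasing domain) $I_1=\mathbb{R}$, and $I_2=I_2(N)$ depends on $N$ and is monotonically increasing, $I_2(N)\subset I_2(N+1)$; there exists a sufficiently small $\rho>0$ such that $|I_2(N)|\le C_4N^\rho$, where $\rho$ depends only on the constants $C_i,J,\nu,\xi,\gamma$ from Assumption A. (iii) (Infinite domain) $I_1=I_2=\mathbb{R}$ and there are $\kappa,C_5>0$ such that for any $y>0$: $\sup_n\mathbb{E}\sup_{|u|>y}|X_n(u)|^2\le C_5\exp(-y^\kappa)$ and $\sup_{n,M}\mathbb{E}\sup_{|u|>y}|X_{n,M}(u)|^2\le C_5\exp(-y^\kappa)$. Partial sum process: $P_N(\lambda,u)=\frac1{\sqrt N}\sum_{i=1}^{\lfloor\lambda N\rfloor}\{X_{i,M_N}(u)-\mathbb{E}[X_{i,M_N}(u)]\}$, $\lambda\in[0,1]$, $u\in I_2$, a random element of $L^\infty([0,1]\times I_2,\mathbb{R}^d)$. Long-run variance kernel: for $u,v\in I_2$, $1\le k,\ell\le d$, $$c[k,\ell](u,v)=\mathbb{E}\big[(X_1[k](u)-\mathbb{E}X_1[k](u))(X_1[\ell](v)-\mathbb{E}X_1[\ell](v))\big]+2\sum_{n\ge2}\mathbb{E}\big[(X_1[k](u)-\mathbb{E}X_1[k](u))(X_n[\ell](v)-\mathbb{E}X_n[\ell](v))\big].$$ Brownian motion: $W=\{W(x):x\in[0,1]\}$ is the process with $W(0)=0$, continuous sample paths in $\mathcal{C}_0(I_2,\mathbb{R}^d)$,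 and stationary, independent, normally distributed increments, characterized by $\mathbb{E}W(1)=0$ and by the covariance $c$ of $W(1)$; it is also viewed as a random element of $L^\infty([0,1]\times I_2,\mathbb{R}^d)$. Prokhorov metric: on a metric space $(\mathcal{M},d_{\mathcal M})$, with $A^\chi=\{x:\exists a\in A,\ d_{\mathcal M}(x,a)<\chi\}$, $\pi(\mathbb{P}_1,\mathbb{P}_2)=\inf\{\chi>0:\mathbb{P}_1(A)\le\mathbb{P}_2(A^\chi)+\chi,\ \mathbb{P}_2(A)\le\mathbb{P}_1(A^\chi)+\chi\text{ for all Borel }A\}$; for random variables it is applied to their laws. $\pi_\infty$ is the Prokhorov metric for the sup-norm, here on $L^\infty([0,1]\times I_2,\mathbb{R}^d)$.
   Formalization: In the fixed-domain scenario the constant C (but not τ) may also depend on the length of I_2; uniformly over all compact intervals the bound fails, e.g. for exp(N²) independent Rademacher bumps on an interval of that length. *)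

(* Defs.v *)
From HB Require Import structures.
From mathcomp Require Import all_boot all_order all_algebra.
From mathcomp Require Import all_classical all_reals all_analysis.

Set Implicit Arguments.
Unset Strict Implicit.
Unset Printing Implicit Defensive.
Import Order.TTheory GRing.Theory Num.Theory.
Import numFieldNormedType.Exports numFieldTopology.Exports.

Local Open Scope classical_set_scope.
Local Open Scope ring_scope.

(** * Function spaces *)

Section supnorm.
Context {R : realType} {T : Type} {V : normedModType R}.
Implicit Types (A : set T) (f g : T -> V).

(* Real-valued supremum: meaningful when f is bounded on A, and 0 when A is
   empty. *)
Definition supnorm A f : R := sup [set `|f t| | t in A].

Definition bounded_on A f := exists K : R, forall t, A t -> `|f t| <= K.

Lemma supnorm_ub A f t : bounded_on A f -> A t -> `|f t| <= supnorm A f.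
Proof.
move=> [K fK] At; apply: ub_le_sup; last by exists t.
by exists K => _ [s As <-]; exact: fK.
Qed.

Lemma supnorm_le A f (K : R) : 0 <= K -> (forall t, A t -> `|f t| <= K) ->
  supnorm A f <= K.
Proof.
move=> K0 fK; have [->|/set0P[t At]] := eqVneq A set0.
  by rewrite /supnorm image_set0 sup0.
apply: ge_sup; first by exists `|f t|, t.
by move=> _ [s As <-]; exact: fK.
Qed.

Lemma supnorm_ge0 A f : 0 <= supnorm A f.
Proof.
rewrite /supnorm; have [h|/sup_out->//] := pselect (has_sup [set `|f t| | t in A]).
have [[_ [t At _]] _] := h.
apply: (@le_trans _ _ `|f t|) => //.
by apply: ub_le_sup; [exact: h.2|exists t].
Qed.

Lemma bounded_on_lin A (a : R) f g : bounded_on A f -> bounded_on A g ->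
  bounded_on A (fun t => a *: f t + g t).
Proof.
move=> [K fK] [L gL]; exists (`|a| * K + L) => t At.
rewrite (le_trans (ler_normD _ _))// lerD ?gL// normrZ.
by rewrite ler_wpM2l// fK.
Qed.

Lemma supnorm_lin A (a : R) f g : bounded_on A f -> bounded_on A g ->
  supnorm A (fun t => a *: f t + g t) <= `|a| * supnorm A f + supnorm A g.
Proof.
move=> bf bg; apply: supnorm_le => [|t At].
  by rewrite addr_ge0 ?mulr_ge0 ?supnorm_ge0.
rewrite (le_trans (ler_normD _ _))// lerD ?supnorm_ub// normrZ.
by rewrite ler_wpM2l// supnorm_ub.
Qed.

End supnorm.

Section Linf.
Context {R : realType} {T : Type} (D : set T) (V : normedModType R).

(* A bounded function on D is represented by its extension by 0 outside D. *)
Definition Linf_pred : {pred T -> V} :=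
  mem [set f : T -> V | (forall t, ~ D t -> f t = 0) /\ bounded_on D f].

Record Linf := MkLinf { Linf_fun :> T -> V ; _ : Linf_fun \in Linf_pred }.

HB.instance Definition _ := [isSub for Linf_fun].
HB.instance Definition _ := [Choice of Linf by <:].

Lemma Linf_submod_closed : submod_closed Linf_pred.
Proof.
split; first by rewrite inE; split => //; exists 0 => t _; rewrite normr0.
move=> a f g; rewrite !inE => -[f0 bf] [g0 bg]; split; last exact: bounded_on_lin.
by move=> t nDt; change (a *: f t + g t = 0 :> V); rewrite f0// g0// scaler0 addr0.
Qed.

HB.instance Definition _ := GRing.isSubmodClosed.Build _ _ Linf_pred
  Linf_submod_closed.
HB.instance Definition _ := [SubChoice_isSubLmodule of Linf by <:].

Definition Linf_norm (f : Linf) : R := supnorm D f.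

Lemma Linf_out (f : Linf) t : ~ D t -> f t = 0.
Proof. by case: f => f /=; rewrite inE => -[+ _]; exact. Qed.

Lemma Linf_bounded (f : Linf) : bounded_on D f.
Proof. by case: f => f /=; rewrite inE => -[]. Qed.

Lemma Linf_normD (f g : Linf) : Linf_norm (f + g) <= Linf_norm f + Linf_norm g.
Proof.
have := supnorm_lin 1 (Linf_bounded f) (Linf_bounded g).
rewrite normr1 mul1r; apply: le_trans.
by under [X in _ <= supnorm _ X]eq_fun do rewrite scale1r.
Qed.

Lemma Linf_normZ (a : R) (f : Linf) : Linf_norm (a *: f) = `|a| * Linf_norm f.
Proof.
have le (b : R) (g : Linf) : Linf_norm (b *: g) <= `|b| * Linf_norm g.
  apply: supnorm_le => [|t Dt]; first by rewrite mulr_ge0 ?supnorm_ge0.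
  rewrite [X in `|X|](_ : _ = b *: g t)// normrZ ler_wpM2l// supnorm_ub//.
  exact: Linf_bounded.
apply/eqP; rewrite eq_le le/=; have [->|a0] := eqVneq a 0.
  by rewrite normr0 mul0r supnorm_ge0.
rewrite -ler_pdivlMl ?normr_gt0//.
by have := le a^-1 (a *: f); rewrite scalerA mulVf// scale1r normfV.
Qed.

Lemma Linf_norm_eq0 (f : Linf) : Linf_norm f = 0 -> f = 0.
Proof.
move=> f0; apply/val_inj/funext => t /=; rewrite [RHS](_ : _ = 0)//.
have [Dt|/Linf_out//] := pselect (D t).
apply/eqP; rewrite -normr_le0 -f0; apply: supnorm_ub => //.
exact: Linf_bounded.
Qed.

HB.instance Definition _ := Lmodule_isNormed.Build R Linf
  Linf_normD Linf_normZ Linf_norm_eq0.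

(* Junk value 0 when f is not bounded on D. *)
Definition to_Linf (f : T -> V) : Linf :=
  insubd (0 : Linf) (fun t => if t \in D then f t else 0).

End Linf.

Section C0.
Context {R : realType} (I : set R) (V : normedModType R).

(* For compact I the condition at infinity holds trivially, by the convention
   that functions are extended by 0 outside I. *)
Definition C0_pred : {pred Linf I V} :=
  mem [set f : Linf I V | {within I, continuous (f : R -> V)} /\
    supnorm [set u | y < `|u|] (f : R -> V) @[y --> +oo] --> (0 : R)].

Record C0 := MkC0 { C0_fun :> Linf I V ; _ : C0_fun \in C0_pred }.

HB.instance Definition _ := [isSub for C0_fun].
HB.instance Definition _ := [Choice of C0 by <:].

Lemma Linf_bounded_on (f : Linf I V) A : bounded_on A (f : R -> V).
Proof.
have [K fK] := Linf_bounded f; exists (Num.max K 0) => t _.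
have [It|nIt] := pselect (I t); first by rewrite le_max fK.
by rewrite Linf_out// normr0 le_max lexx orbT.
Qed.

Lemma C0_submod_closed : submod_closed C0_pred.
Proof.
split.
  rewrite inE; split; first exact: cst_continuous.
  rewrite (_ : (fun y => _) = cst 0); first exact: cvg_cst.
  apply/funext => y; apply/eqP; rewrite eq_le supnorm_ge0 andbT.
  by apply: supnorm_le => // t _; rewrite normr0.
move=> a f g; rewrite !inE => -[cf vf] [cg vg]; split.
  apply: (@within_continuousD _ _ _ _ (fun t => a *: f t) g) => // x.
  by apply: cvgZl_tmp; exact: cf.
apply: (@squeeze_cvgr _ _ _ _ (cst 0) (fun y => `|a| *
    supnorm [set u | y < `|u|] (f : R -> V) +
    supnorm [set u | y < `|u|] (g : R -> V))).
- near=> y; rewrite supnorm_ge0/=.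
  by apply: supnorm_lin; exact: Linf_bounded_on.
- exact: cvg_cst.
- rewrite -[X in _ --> X]addr0 -[X in X + _](mulr0 `|a|).
  by apply: cvgD => //; apply: cvgMr.
Unshelve. all: by end_near. Qed.

HB.instance Definition _ := GRing.isSubmodClosed.Build _ _ C0_pred
  C0_submod_closed.
HB.instance Definition _ := [SubChoice_isSubLmodule of C0 by <:].

Definition C0_norm (f : C0) : R := `|\val f|.

Lemma C0_normD (f g : C0) : C0_norm (f + g) <= C0_norm f + C0_norm g.
Proof. exact: ler_normD. Qed.

Lemma C0_normZ (a : R) (f : C0) : C0_norm (a *: f) = `|a| * C0_norm f.
Proof. exact: normrZ. Qed.

Lemma C0_norm_eq0 (f : C0) : C0_norm f = 0 -> f = 0.
Proof. by move=> /normr0_eq0 f0; exact: val_inj. Qed.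

HB.instance Definition _ := Lmodule_isNormed.Build R C0
  C0_normD C0_normZ C0_norm_eq0.

End C0.

(** * Metric spaces and the Prokhorov metric *)

(* measurableType requires a base point; every metric space that carries a
   random variable is non-empty. *)
#[short(type="pmetricType")]
HB.structure Definition PointedMetric (K : numDomainType) :=
  {M of Metric K M & isPointed M}.

Notation borel T := (g_sigma_algebraType (@open T)).

Section prokhorov.
Context {R : realType} {T : pseudoPMetricType R}.

Definition enlargement (A : set T) (chi : R) : set T :=
  [set x | exists2 a, A a & ball a chi x].

Definition prokhorov (mu nu : set (borel T) -> \bar R) : R :=
  inf [set chi : R | 0 < chi /\ forall A : set (borel T), measurable A ->
    (mu A <= nu (enlargement A chi) + chi%:E)%E /\
    (nu A <= mu (enlargement A chi) + chi%:E)%E].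

End prokhorov.

(** * Mixing, stationarity, long-run variance. Sequences are indexed by n >= 1,
   so that the term of index 0 of a sequence on nat never plays a role. *)

Section sequences.
Context {R : realType} {dO : measure_display} {Omega : measurableType dO}.
Variable P : probability Omega R.

Definition sigma_gen {dT} {T : measurableType dT} (Y : nat -> Omega -> T)
    (D : set nat) : set (set Omega) :=
  <<s \bigcup_(i in D) preimage_set_system setT (Y i) measurable >>.

Definition alpha_coef {dT} {T : measurableType dT} (Y : nat -> Omega -> T)
    (k : nat) : \bar R :=
  ereal_sup [set a | exists m A B, [/\ (1 <= m)%N,
    sigma_gen Y [set i | (1 <= i <= m)%N] A,
    sigma_gen Y [set i | (m + k <= i)%N] B &
    a = `|P (A `&` B) - P A * P B|%E]].

Definition alpha_mixing {dT} {T : measurableType dT} (Y : nat -> Omega -> T) :=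
  alpha_coef Y k @[k --> \oo] --> 0%E.

Context {d : nat}.

Definition mean {T : Type} (f : Omega -> T -> 'rV[R]_d) : T -> 'rV[R]_d :=
  fun u => \row_k fine 'E_P[fun w => f w u ord0 k].

Definition cov {T : Type} (f g : Omega -> T -> 'rV[R]_d) (k l : 'I_d) (u v : T) :
    \bar R :=
  covariance P (fun w => f w u ord0 k) (fun w => g w v ord0 l).

Definition weakly_stationary {I : set R}
    (X : nat -> Omega -> C0 I 'rV[R]_d) : Prop :=
  (forall n m u, (0 < n)%N -> (0 < m)%N -> I u ->
    mean (X n) u = mean (X m) u) /\
  (forall n m h k l u v, (0 < n)%N -> (0 < m)%N -> I u -> I v ->
    cov (X n) (X (n + h)%N) k l u v = cov (X m) (X (m + h)%N) k l u v).

(* One-sided, hence a covariance function only if it satisfies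
   c[k,l](u,v) = c[l,k](v,u), in which case it coincides with the two-sided sum
   of the lagged covariances. *)
Definition long_run_variance {I : set R} (X : nat -> Omega -> C0 I 'rV[R]_d)
    (k l : 'I_d) (u v : R) : R :=
  fine (cov (X 1%N) (X 1%N) k l u v) +
  2 * limn (fun m => \sum_(2 <= n < m) fine (cov (X 1%N) (X n) k l u v)).

(* Under finite first moments of the sup-norms the process is bounded, so that
   the junk value of to_Linf is not taken. *)
Definition partial_sum_process {I : set R} (Y : nat -> Omega -> C0 I 'rV[R]_d)
    (N : nat) (w : Omega) : Linf (`[0, 1] `*` I) 'rV[R]_d :=
  to_Linf (`[0, 1] `*` I) (fun p : R * R => (Num.sqrt N%:R)^-1 *:
    \sum_(1 <= i < (Num.truncn (p.1 * N%:R)).+1)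
      (Y i w p.2 - mean (Y i) p.2)).

End sequences.

(** * Brownian motion in C0 *)

Section brownian_motion.
Context {R : realType} {dO : measure_display} {Omega : measurableType dO}.
Variable P : probability Omega R.

(* The degenerate case is treated separately because normal_prob m 0 is not the
   Dirac measure at m. *)
Definition normally_distributed (Z : Omega -> R) : Prop :=
  exists m s : R, forall B : set R, measurable B ->
    pushforward P Z B = if s == 0 then dirac m B else normal_prob m s B.

Context {d : nat} {I : set R}.
Implicit Types W : R -> Omega -> C0 I 'rV[R]_d.

Definition increment W (s t : R) : Omega -> borel (C0 I 'rV[R]_d) :=
  fun w => W t w - W s w.

Record brownian_motion (c : 'I_d -> 'I_d -> R -> R -> R) W : Prop := {
  bm_measurable : forall x : R, 0 <= x <= 1 ->
    measurable_fun setT (W x : Omega -> borel (C0 I 'rV[R]_d)) ;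
  bm_start : forall w, W 0 w = 0 ;
  bm_continuous : forall w, {within `[0, 1], continuous (fun x => W x w)} ;
  bm_stationary : forall (s t h : R) (B : set (borel (C0 I 'rV[R]_d))),
    0 <= s <= t -> 0 <= h -> t + h <= 1 ->
    measurable B ->
    pushforward P (increment W (s + h) (t + h)) B =
    pushforward P (increment W s t) B ;
  bm_independent : forall (m : nat) (t : nat -> R)
      (B : nat -> set (borel (C0 I 'rV[R]_d))),
    (forall i, (i <= m)%N -> 0 <= t i <= 1) ->
    (forall i, (i < m)%N -> t i <= t i.+1) ->
    (forall i, measurable (B i)) ->
    P (\bigcap_(i in `I_m) (increment W (t i) (t i.+1) @^-1` B i)) =
    (\prod_(i < m) P (increment W (t i) (t i.+1) @^-1` B i))%E ;
  (* joint normality: all linear combinations of coordinates are normal *)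
  bm_normal : forall (s t : R) (m : nat) (a : 'I_m -> R) (k : 'I_m -> 'I_d)
      (u : 'I_m -> R),
    0 <= s <= t -> t <= 1 -> (forall i, I (u i)) ->
    normally_distributed
      (fun w => \sum_(i < m) a i * increment W s t w (u i) ord0 (k i)) ;
  bm_mean : forall u, I u -> mean P (W 1) u = 0 ;
  bm_covariance : forall k l u v, I u -> I v ->
    cov P (W 1) (W 1) k l u v = (c k l u v)%:E
}.

Definition as_Linf W (w : Omega) : Linf (`[0, 1] `*` I) 'rV[R]_d :=
  to_Linf (`[0, 1] `*` I) (fun p : R * R => W p.1 w p.2).

End brownian_motion.

Definition prokhorov_rv {R : realType} {T : pseudoPMetricType R}
    {d1 d2 : measure_display}
    {Omega1 : measurableType d1} (P1 : probability Omega1 R) (Y1 : Omega1 -> T)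
    {Omega2 : measurableType d2} (P2 : probability Omega2 R) (Y2 : Omega2 -> T)
    : R :=
  prokhorov (pushforward P1 (Y1 : Omega1 -> borel T))
            (pushforward P2 (Y2 : Omega2 -> borel T)).

(** * Sparse estimators *)

Definition compact_interval {R : realType} (I : set R) (a b : R) : Prop :=
  a <= b /\ I = `[a, b]%classic.

Definition domain {R : realType} (I : set R) : Prop :=
  I = setT \/ exists a b, compact_interval I a b.

Section assumptions.
Context {R : realType} {dO : measure_display} {Omega : measurableType dO}.
Variable P : probability Omega R.
Context {d : nat} {I1 : set R}.
Local Notation V := 'rV[R]_d.
Variables (X : nat -> Omega -> C0 I1 V) (S : nat -> pmetricType R).
Variable delta : nat -> forall M : nat, Omega -> S M.
(* I_2 may depend on N, in which case so does the codomain of the M-th map. *)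
Variable A : forall (M : nat) (I : set R), C0 I1 V * S M -> C0 I V.
Variables (I2 : nat -> set R) (MN : nat -> nat).

Definition sparse (M : nat) (I : set R) (n : nat) (w : Omega) : C0 I V :=
  A I (X n w, delta n M w).

Record sparse_estimators : Prop := {
  se_domain1 : domain I1 ;
  se_domain2 : forall N, (0 < N)%N -> domain (I2 N) /\ I2 N `<=` I1 ;
  se_measurable_X : forall n, (0 < n)%N ->
    measurable_fun setT (X n : Omega -> borel (C0 I1 V)) ;
  se_measurable_delta : forall n M, (0 < n)%N -> (0 < M)%N ->
    measurable_fun setT (delta n M : Omega -> borel (S M)) ;
  se_measurable_A : forall M N, (0 < M)%N -> (0 < N)%N ->
    measurable_fun setT
      (@A M (I2 N) : borel (C0 I1 V) * borel (S M) -> borel (C0 (I2 N) V)) ;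
  se_MN_gt0 : forall N, (0 < N)%N -> (0 < MN N)%N ;
  se_MN_cvg : MN N @[N --> \oo] --> \oo
}.

Definition joint (M n : nat) (w : Omega) : borel (C0 I1 V) * borel (S M) :=
  (X n w, delta n M w).

Record assumptionA (C1 C2 C3 J nu xi gamma : R) : Prop := {
  A_stationary : weakly_stationary P X ;
  A_mixing : forall M, (0 < M)%N -> alpha_mixing P (joint M) ;
  A_mixing_rate : forall M n, (0 < M)%N -> (0 < n)%N ->
    (alpha_coef P (joint M) n <= (C1 * n%:R `^ (- nu))%:E)%E ;
  A_moment : forall n, (0 < n)%N ->
    ('E_P[fun w => (`|X n w| `^ J)%R] <= C2%:E)%E ;
  A_hoelder : forall n (u v : R), (0 < n)%N -> I1 u -> I1 v -> u != v ->
    ('E_P[fun w => ((`|X n w u - X n w v| / `|u - v| `^ xi) `^ J)%R] <= C2%:E)%E ;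
  A_sparse_error : forall n N, (0 < n)%N -> (0 < N)%N ->
    ('E_P[fun w => (supnorm (I2 N)
        (fun u => X n w u - sparse (MN N) (I2 N) n w u) `^ J)%R]
      <= (C3 * N%:R `^ (- gamma))%:E)%E ;
  A_sparse_hoelder : forall n N (u v : R), (0 < n)%N -> (0 < N)%N ->
    I2 N u -> I2 N v -> u != v ->
    ('E_P[fun w => ((`|sparse (MN N) (I2 N) n w u - sparse (MN N) (I2 N) n w v|
        / `|u - v| `^ xi) `^ J)%R] <= C3%:E)%E
}.

Definition fixed_domain (ell : R) : Prop :=
  exists a b, [/\ b - a = ell &
    forall N, (0 < N)%N -> compact_interval (I2 N) a b].

Definition increasing_domain (C4 rho : R) : Prop :=
  [/\ I1 = setT,
    forall N, (0 < N)%N -> I2 N `<=` I2 N.+1 &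
    forall N, (0 < N)%N -> exists a b,
      compact_interval (I2 N) a b /\ b - a <= C4 * N%:R `^ rho].

Definition infinite_domain (C5 kappa : R) : Prop :=
  [/\ I1 = setT,
    forall N, (0 < N)%N -> I2 N = setT,
    forall n (y : R), (0 < n)%N -> 0 < y ->
      ('E_P[fun w => ((supnorm [set u | y < `|u|] (X n w)) ^+ 2)%R]
        <= (C5 * expR (- (y `^ kappa)))%:E)%E &
    forall n M (y : R), (0 < n)%N -> (0 < M)%N -> 0 < y ->
      ('E_P[fun w => ((supnorm [set u | y < `|u|] (sparse M setT n w)) ^+ 2)%R]
        <= (C5 * expR (- (y `^ kappa)))%:E)%E].

Definition assumptionB (ell C4 rho C5 kappa : R) : Prop :=
  [\/ fixed_domain ell, increasing_domain C4 rho | infinite_domain C5 kappa].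

End assumptions.

(* Main.v *)
(** Both processes are reduced to their values on a finite grid of times and
    points: fourth moments and dyadic chaining control the fluctuations inside
    the cells. The indicator of a set of grid values is replaced by a product of
    splines whose derivatives are polynomial in the size of the grid, and its
    expectations under the partial sums and under the Brownian motion are compared
    by Lindeberg's method, over long blocks separated by gaps; mixing replaces
    independence, and only the first two moments of the blocks have to match,
    which they do because the covariance of a block sum is close to the long-run
    variance. With a scale k = N^(1/b) and b large, all blocks and cells are sized
    by powers of k so that every polynomial loss is absorbed and the total error
    is O(1/k). On the infinite domain the core is [-k, k]: outside, the partial sums
    are small by assumption, and the Brownian motion because its variance decays
    faster than any power. *)

Require Import Defs.
From mathcomp Require Import all_boot all_order all_algebra.
From mathcomp Require Import all_classical all_reals all_analysis.
From mathcomp Require Import measurable_realfun ring lra zify.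
Import Order.TTheory GRing.Theory Num.Theory.
Import numFieldNormedType.Exports numFieldTopology.Exports.
Local Open Scope classical_set_scope.
Local Open Scope ring_scope.

Set Implicit Arguments.
Unset Strict Implicit.
Unset Printing Implicit Defensive.

(** * Expectations as real numbers *)

(** The number of grid values grows with N, so a limit theorem in a fixed dimension does not help:
    every constant has to be polynomial in that number. This is why the splines form a partition of
    unity: the derivatives of their tensor products cost powers of the mesh, whatever the dimension.
    The sums and the Brownian motion live on unrelated probability spaces and no coupling is built:
    both are compared, by the same lemma, with one deterministic iterated average over the
    increments of W; for W itself the mixing coefficient is 0. The exponent 9/8 that recurs in the
    moment bounds is what the hypotheses on J and nu leave: nu (J - 4)/(2 J) > (3/2)(1 - 1/J) > 9/8.
    Its series yields the rates n^(-1/8) and n^(7/8). The long-run variance is a one-sided sum,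
    which describes the covariance of the sums only if it is symmetric; the existence of a Brownian
    motion with this covariance supplies the symmetry. Suprema over times and points are not known
    to be measurable, hence bad events are bounded through measurable supersets. *)

Section expectation.
Context {R : realType} {d : measure_display} {T : measurableType d}.
Variable P : probability T R.
Implicit Types f g h : T -> R.

Definition Ex f : R := \int[P]_w f w.

Definition L1 f : Prop := P.-integrable setT (EFin \o f).

Lemma L1_mf f : L1 f -> measurable_fun setT f.
Proof. by move=> /integrableP[/measurable_EFinP]. Qed.

Lemma L1_dom g f : measurable_fun setT f -> (forall w, `|f w| <= g w) ->
  L1 g -> L1 f.
Proof.
move=> mf fg Lg; apply: (le_integrable measurableT _ _ Lg).
  exact/measurable_EFinP.
by move=> w _ /=; rewrite lee_fin (le_trans (fg w))// ler_norm.
Qed.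

Lemma L1_cst c : L1 (cst c).
Proof. exact: finite_measure_integrable_cst. Qed.

Lemma L1_bounded c f : measurable_fun setT f -> (forall w, `|f w| <= c) -> L1 f.
Proof. by move=> mf fc; apply: (@L1_dom (cst c)) => //; exact: L1_cst. Qed.

Lemma L1D f g : L1 f -> L1 g -> L1 (fun w => f w + g w).
Proof. by move=> Lf Lg; exact: (integrableD measurableT Lf Lg). Qed.

Lemma L1Z c f : L1 f -> L1 (fun w => c * f w).
Proof. by move=> Lf; exact: (integrableZl measurableT c Lf). Qed.

Lemma L1N f : L1 f -> L1 (fun w => - f w).
Proof. by move=> Lf; under eq_fun do rewrite -mulN1r; exact: L1Z. Qed.

Lemma L1B f g : L1 f -> L1 g -> L1 (fun w => f w - g w).
Proof. by move=> Lf Lg; apply: L1D => //; exact: L1N. Qed.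

Lemma L1_norm f : L1 f -> L1 (fun w => `|f w|).
Proof. by move=> Lf; exact: integrable_norm. Qed.

Lemma L1_sum I (r : seq I) (Q : pred I) (F : I -> T -> R) :
  (forall i, L1 (F i)) -> L1 (fun w => \sum_(i <- r | Q i) F i w).
Proof.
move=> LF; elim: r => [|i r IH].
  by under eq_fun do rewrite big_nil; exact: L1_cst.
under eq_fun do rewrite big_cons.
by case: (Q i) => //; exact: L1D.
Qed.

Lemma Ex_cst c : Ex (cst c) = c.
Proof. rewrite /Ex Rintegral_cst// [X in fine X](_ : _ = 1%E) ?mulr1//.
exact: probability_setT. Qed.

Lemma ExD f g : L1 f -> L1 g -> Ex (fun w => f w + g w) = Ex f + Ex g.
Proof. by move=> Lf Lg; exact: RintegralD. Qed.

Lemma ExB f g : L1 f -> L1 g -> Ex (fun w => f w - g w) = Ex f - Ex g.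
Proof. by move=> Lf Lg; exact: RintegralB. Qed.

Lemma ExZ c f : L1 f -> Ex (fun w => c * f w) = c * Ex f.
Proof. by move=> Lf; exact: RintegralZl. Qed.

Lemma Ex_sum I (r : seq I) (Q : pred I) (F : I -> T -> R) :
  (forall i, L1 (F i)) ->
  Ex (fun w => \sum_(i <- r | Q i) F i w) = \sum_(i <- r | Q i) Ex (F i).
Proof.
move=> LF; elim: r => [|i r IH].
  by rewrite big_nil; under [X in Ex X]eq_fun do rewrite big_nil; rewrite Ex_cst.
rewrite big_cons; under [X in Ex X]eq_fun do rewrite big_cons.
by case: (Q i) => //; rewrite ExD ?IH//; exact: L1_sum.
Qed.

Lemma Ex_le f g : L1 f -> L1 g -> (forall w, f w <= g w) -> Ex f <= Ex g.
Proof. by move=> Lf Lg fg; apply: le_Rintegral => // w _; exact: fg. Qed.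

Lemma Ex_ge0 f : (forall w, 0 <= f w) -> 0 <= Ex f.
Proof. by move=> f0; apply: Rintegral_ge0 => w _; exact: f0. Qed.

Lemma Ex_norm f : L1 f -> `|Ex f| <= Ex (fun w => `|f w|).
Proof. by move=> Lf; exact: le_normr_Rintegral. Qed.

Lemma Ex_norm_le g f : L1 f -> L1 g -> (forall w, `|f w| <= g w) -> `|Ex f| <= Ex g.
Proof.
by move=> Lf Lg fg; rewrite (le_trans (Ex_norm Lf))// Ex_le//; exact: L1_norm.
Qed.

Lemma Ex_bounded c f : measurable_fun setT f -> (forall w, `|f w| <= c) -> `|Ex f| <= c.
Proof.
move=> mf fc; rewrite -(Ex_cst c); apply: Ex_norm_le => //; last exact: L1_cst.
exact: (@L1_bounded c).
Qed.

Lemma L1_expectation c f : measurable_fun setT f -> (forall w, 0 <= f w) ->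
  ('E_P[f] <= c%:E)%E -> L1 f /\ Ex f <= c.
Proof.
move=> mf f0 Efc.
have Lf : L1 f.
  apply/integrableP; split; first exact/measurable_EFinP.
  rewrite (le_lt_trans _ (ltry c))//; apply: le_trans Efc.
  rewrite unlock le_eqVlt; apply/orP; left; apply/eqP; apply: eq_integral => w _ /=.
  by rewrite ger0_norm.
split=> //; rewrite -lee_fin; apply: le_trans Efc.
rewrite unlock /Ex /Rintegral fineK//; exact: (integrable_fin_num measurableT Lf).
Qed.

Definition Pr (A : set T) : R := fine (P A).

Lemma PrE A : measurable A -> (Pr A)%:E = P A.
Proof. by move=> mA; rewrite /Pr fineK// fin_num_measure. Qed.

Lemma Pr_indic A : measurable A -> Ex (\1_A) = Pr A.
Proof.
move=> mA; rewrite /Ex /Rintegral /Pr; congr fine.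
by rewrite integral_indic// setIT.
Qed.

Lemma L1_indic A : measurable A -> L1 (\1_A).
Proof.
move=> mA; apply: (@L1_bounded 1) => // w.
by rewrite indicE; case: (_ \in _); rewrite ?normr1 ?normr0.
Qed.

Lemma Pr_ge0 A : 0 <= Pr A. Proof. by rewrite fine_ge0. Qed.

Lemma Pr_le1 A : measurable A -> Pr A <= 1.
Proof. by move=> mA; rewrite -lee_fin PrE// probability_le1. Qed.

Lemma Pr_le A B : measurable A -> measurable B -> A `<=` B -> Pr A <= Pr B.
Proof. by move=> mA mB AB; rewrite -lee_fin !PrE// le_measure ?inE. Qed.

Lemma PrU A B : measurable A -> measurable B -> Pr (A `|` B) <= Pr A + Pr B.
Proof.
by move=> mA mB; rewrite -lee_fin EFinD !PrE//; [exact: measureU2|exact: measurableU].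
Qed.

Lemma Pr_bigU (I : finType) (A : I -> set T) (c : I -> R) :
  (forall i, measurable (A i)) -> (forall i, Pr (A i) <= c i) ->
  Pr [set w | exists i, A i w] <= \sum_i c i.
Proof.
move=> mA Ac.
have E s : measurable [set w | exists2 i, i \in s & A i w] /\
    Pr [set w | exists2 i, i \in s & A i w] <= \sum_(i <- s) c i.
  elim: s => [|i s [ms IH]].
    rewrite big_nil (_ : [set w | _] = set0); first by rewrite /Pr measure0.
    by apply/seteqP; split => // w [].
  have -> : [set w | exists2 j, j \in i :: s & A j w] =
      A i `|` [set w | exists2 i, i \in s & A i w].
    apply/seteqP; split => w /=.
      by move=> [j]; rewrite inE => /predU1P[->|js] Aj; [left|right; exists j].
    move=> [Ai|[j js Aj]]; first by exists i; rewrite ?mem_head.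
    by exists j; rewrite // inE js orbT.
  split; first exact: measurableU.
  by rewrite big_cons (le_trans (PrU _ _))// lerD.
have [_] := E (enum I); rewrite big_enum/=; apply: le_trans.
rewrite le_eqVlt; apply/orP; left; apply/eqP; congr Pr.
by apply/seteqP; split => w [i]; exists i => //; rewrite mem_enum.
Qed.

Lemma Pr_bigcup (A : nat -> set T) (c : R) : (forall n, measurable (A n)) ->
  (forall n, A n `<=` A n.+1) -> (forall n, Pr (A n) <= c) ->
  Pr (\bigcup_n A n) <= c.
Proof.
move=> mA ndA Ac.
have ndA' : {homo A : n m / (n <= m)%N >-> (n <= m)%O}.
  apply: homo_leq => [B|B D F BD DF|n]; first exact: lexx.
    exact: le_trans BD DF.
  exact/subsetPset/ndA.
have mU : measurable (\bigcup_n A n) by exact: bigcupT_measurable.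
have cP : P \o A @ \oo --> P (\bigcup_n A n) by exact: nondecreasing_cvg_mu.
rewrite -lee_fin PrE// -(cvg_lim _ cP)//; apply: lime_le; first exact: cvgP cP.
by apply: nearW => n /=; rewrite -PrE// lee_fin.
Qed.

Lemma Pr_markov c f : 0 < c -> (forall w, 0 <= f w) -> L1 f ->
  Pr [set w | c < f w] <= Ex f / c.
Proof.
move=> c0 f0 Lf.
have mA : measurable [set w | c < f w].
  rewrite (_ : [set w | _] = f @^-1` `]c, +oo[).
    by rewrite -[X in measurable X]setTI; apply: (L1_mf Lf).
  by apply/seteqP; split => w /=; rewrite in_itv/= andbT.
rewrite ler_pdivlMr// mulrC -Pr_indic// -ExZ; last exact: L1_indic.
apply: Ex_le => //; first by apply: L1Z; exact: L1_indic.
move=> w; rewrite indicE; case: (boolP (w \in _)) => [|_]; last by rewrite mulr0.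
by rewrite inE mulr1 => /ltW.
Qed.

Lemma Ex_CS f g : measurable_fun setT f -> measurable_fun setT g ->
  L1 (fun w => f w ^+ 2) -> L1 (fun w => g w ^+ 2) ->
  L1 (fun w => f w * g w) /\
  Ex (fun w => f w * g w) ^+ 2 <= Ex (fun w => f w ^+ 2) * Ex (fun w => g w ^+ 2).
Proof.
move=> mf mg Lf Lg.
have Lfg : L1 (fun w => f w * g w).
  apply: (@L1_dom (fun w => f w ^+ 2 + g w ^+ 2)); first exact: measurable_funM.
    by move=> w; rewrite ler_norml; apply/andP; split; nra.
  exact: L1D.
split => //; set a := Ex _; set b := Ex (fun w => f w ^+ 2); set c := Ex _.
have b0 : 0 <= b by apply: Ex_ge0 => w; exact: sqr_ge0.
have c0 : 0 <= c by apply: Ex_ge0 => w; exact: sqr_ge0.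
have H t : 0 <= t ^+ 2 * b - 2 * t * a + c.
  have -> : t ^+ 2 * b - 2 * t * a + c = Ex (fun w => (t * f w - g w) ^+ 2).
    have -> : (fun w => (t * f w - g w) ^+ 2) =
        (fun w => t ^+ 2 * f w ^+ 2 - 2 * t * (f w * g w) + g w ^+ 2).
      by apply/funext => w; ring.
    by rewrite ExD ?ExB ?ExZ//; try apply: L1B; exact: L1Z.
  by apply: Ex_ge0 => w; exact: sqr_ge0.
have [b00|bn0] := eqVneq b 0.
  have [->|an0] := eqVneq a 0; first by rewrite expr0n/= mulr_ge0.
  (* For b = 0 the form is affine in t and takes the value -1 at this t. *)
  have := H ((c + 1) / (2 * a)); rewrite b00.
  by rewrite (_ : _ + c = -1) ?oppr_ge0 ?ler10//; field.
have b_gt0 : 0 < b by rewrite lt_def bn0.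
have := H (a / b); rewrite (_ : _ + c = (b * c - a ^+ 2) / b); last by field.
by rewrite pmulr_lge0 ?invr_gt0// subr_ge0.
Qed.

End expectation.

(** * Covariance inequalities under mixing *)

Section mixing.
Context {R : realType} {d : measure_display} {T : measurableType d}.
Variable P : probability T R.
Implicit Types (F G : set (set T)) (U V : T -> R).
Local Notation Ex := (Ex P).
Local Notation L1 := (L1 P).
Local Notation Pr := (Pr P).

(** The generated sigma-algebra is carried by the type of the domain, so that the closure lemmas for
    measurable functions apply to sub-sigma-algebras unchanged. *)
Definition gmeas F U : Prop :=
  measurable_fun setT (U : g_sigma_algebraType F -> R).

Lemma gmeas_measurable F U : F `<=` measurable -> gmeas F U -> measurable_fun setT U.
Proof.
move=> FT mU _ B mB; rewrite setTI; have := mU measurableT B mB; rewrite setTI.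
by apply: smallest_sub => //; exact: sigma_algebra_measurable.
Qed.

Lemma gmeasS F G U : F `<=` G -> gmeas F U -> gmeas G U.
Proof.
move=> FG mU _ B mB; have := mU measurableT B mB.
by apply: sub_smallest2r => //; exact: smallest_sigma_algebra.
Qed.

Definition cv U V := Ex (fun w => U w * V w) - Ex U * Ex V.

Definition mixing (a : R) F G : Prop := forall A B, <<s F >> A -> <<s G >> B ->
  `|Pr (A `&` B) - Pr A * Pr B| <= a.

(** The sum is the ceiling of [x]; this is the layer-cake formula on a mesh. *)
Lemma sum_step_bound (n : nat) (x : R) : 0 <= x <= n%:R ->
  x <= \sum_(i < n) (i%:R < x)%R%:R <= x + 1.
Proof.
elim: n => [|n IH] /andP[x0 xn].
  by rewrite big_ord0; apply/andP; split; lra.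
rewrite big_ord_recr/=; have [nx|xn'] := ltP n%:R x; last first.
  by rewrite addr0 IH// x0.
rewrite (eq_bigr (fun=> 1)) => [|i _].
  by rewrite sumr_const card_ord; rewrite -natr1 in xn; apply/andP; split; rewrite -1?natr1; lra.
by rewrite (lt_trans _ nx)// ltr_nat.
Qed.

Lemma sum2_const (n : nat) (x : R) :
  \sum_(i < n) \sum_(j < n) x = n%:R * n%:R * x.
Proof.
rewrite (eq_bigr (fun=> n%:R * x)) => [|i _]; rewrite sumr_const card_ord.
  by rewrite -[LHS]mulr_natl mulrA.
by rewrite mulr_natl.
Qed.

Section rate.
Variables (F G : set (set T)) (a : R).
Hypotheses (FT : F `<=` measurable) (GT : G `<=` measurable).
Hypothesis FG : mixing a F G.

(** A variable with values in [0, 1] is within 1/n of the mean of the indicators of its level sets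
    i/n < U. The covariance of two such means is an average of n^2 covariances of events, each at
    most [a], and the error 4/n tends to 0. *)
Lemma cv_unit U V : gmeas F U -> gmeas G V ->
  (forall w, 0 <= U w <= 1) -> (forall w, 0 <= V w <= 1) -> `|cv U V| <= a.
Proof.
move=> gU gV U01 V01; apply/ler_addgt0Pr => e e0.
have [n n0 ne] : exists2 n, (0 < n)%N & 4 / n%:R <= e.
  exists (Num.truncn (4 / e)).+1 => //.
  rewrite ler_pdivrMr// mulrC -ler_pdivrMr//; apply: ltW.
  by have /andP[] := truncn_itv (divr_ge0 (ler0n _ 4) (ltW e0)).
have nR : 0 < n%:R :> R by rewrite ltr0n.
have mU := gmeas_measurable FT gU; have mV := gmeas_measurable GT gV.
pose D (W : T -> R) (i : 'I_n) := [set w : T | i%:R < n%:R * W w].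
pose st (W : T -> R) (w : T) : R := n%:R^-1 * \sum_(i < n) \1_(D W i) w.
have gD (H : set (set T)) (HT : H `<=` measurable) (W : T -> R) : gmeas H W -> forall i, <<s H >> (D W i).
  move=> gW i.
  have -> : D W i = W @^-1` `](i%:R / n%:R), +oo[.
    apply/seteqP; split => w /=; rewrite in_itv/= andbT ltr_pdivrMr// mulrC//.
  have := gW measurableT `](i%:R / n%:R), +oo[%classic.
  by rewrite setTI; exact.
have mD (H : set (set T)) (HT : H `<=` measurable) (W : T -> R) : gmeas H W -> forall i, measurable (D W i).
  move=> gW i; have := gD _ HT _ gW i.
  by apply: smallest_sub => //; exact: sigma_algebra_measurable.
have stW (W : T -> R) : (forall w, 0 <= W w <= 1) -> forall w,
    W w <= st W w <= W w + n%:R^-1.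
  move=> W01 w; have /andP[W0 W1] := W01 w.
  have := @sum_step_bound n (n%:R * W w).
  rewrite mulr_ge0//= ler_piMr// => /(_ isT) /andP[h1 h2].
  rewrite /st; rewrite (eq_bigr (fun i : 'I_n => (i%:R < n%:R * W w)%R%:R)); last first.
    by move=> i _; rewrite indicE; congr (nat_of_bool _)%:R; apply/idP/idP; rewrite inE.
  by rewrite ler_pdivlMl// h1/= ler_pdivrMl// mulrDr mulfV ?gt_eqF.
have LD (H : set (set T)) (HT : H `<=` measurable) (W : T -> R) : gmeas H W ->
    L1 (fun w => st W w) /\ measurable_fun setT (st W).
  move=> gW; have L : L1 (fun w => st W w).
    by apply: L1Z; apply: L1_sum => i; apply: L1_indic; exact: mD gW i.
  by split => //; exact: L1_mf L.
have [LU mstU] := LD _ FT _ gU; have [LV mstV] := LD _ GT _ gV.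
have cvst : `|cv (st U) (st V)| <= a.
  have -> : cv (st U) (st V) = n%:R^-1 * n%:R^-1 *
      \sum_(i < n) \sum_(j < n) (Pr (D U i `&` D V j) - Pr (D U i) * Pr (D V j)).
    rewrite /cv.
    have -> : (fun w => st U w * st V w) = (fun w => n%:R^-1 * n%:R^-1 *
        \sum_(i < n) \sum_(j < n) \1_(D U i `&` D V j) w).
      apply/funext => w; rewrite /st mulrACA; congr (_ * _).
      rewrite mulr_suml; apply: eq_bigr => i _; rewrite mulr_sumr.
      by apply: eq_bigr => j _; rewrite indicI.
    have mUi i := mD _ FT _ gU i; have mVj j := mD _ GT _ gV j.
    have LI i j : L1 (\1_(D U i `&` D V j)) by apply: L1_indic; exact: measurableI.
    rewrite ExZ; last by apply: L1_sum => i; apply: L1_sum.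
    rewrite Ex_sum; last by move=> i; apply: L1_sum.
    have stE (H : set (set T)) (HT : H `<=` measurable) (W : T -> R) : gmeas H W ->
        Ex (st W) = n%:R^-1 * \sum_(i < n) Pr (D W i).
      move=> gW; rewrite /st ExZ; last by apply: L1_sum => i; apply: L1_indic; exact: mD gW i.
      rewrite Ex_sum; last by move=> i; apply: L1_indic; exact: mD gW i.
      by congr (_ * _); apply: eq_bigr => i _; rewrite Pr_indic//; exact: mD gW i.
    rewrite (stE _ FT _ gU) (stE _ GT _ gV) mulrACA -mulrBr; congr (_ * _).
    rewrite mulr_suml -sumrB; apply: eq_bigr => i _.
    rewrite Ex_sum// mulr_sumr -sumrB; apply: eq_bigr => j _.
    by rewrite Pr_indic//; exact: measurableI.
  rewrite normrM ger0_norm ?mulr_ge0 ?invr_ge0//.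
  rewrite -invfM ler_pdivrMl ?mulr_gt0//.
  apply: (le_trans (ler_norm_sum _ _ _)).
  apply: (@le_trans _ _ (\sum_(i < n) \sum_(j < n) a)).
    apply: ler_sum => i _; apply: (le_trans (ler_norm_sum _ _ _)).
    by apply: ler_sum => j _; apply: FG; [exact: gD gU i|exact: gD gV j].
  by rewrite sum2_const.
have bst (W : T -> R) : (forall w, 0 <= W w <= 1) -> forall w, `|W w - st W w| <= n%:R^-1.
  by move=> W01 w; have /andP[h1 h2] := stW _ W01 w; rewrite ler_norml; lra.
have st1 (W : T -> R) : (forall w, 0 <= W w <= 1) -> forall w, `|st W w| <= 1.
  move=> W01 w; have /andP[W0 W1] := W01 w; have /andP[h1 h2] := stW _ W01 w.
  rewrite ger0_norm; last by rewrite (le_trans W0).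
  rewrite /st ler_pdivrMl// mulr1 -[X in _ <= X%:R]card_ord -sumr_const.
  by apply: ler_sum => i _; rewrite indicE; case: (_ \in _); rewrite ?ler01.
have U1 w : `|U w| <= 1 by have /andP[h1 h2] := U01 w; rewrite ger0_norm.
have V1 w : `|V w| <= 1 by have /andP[h1 h2] := V01 w; rewrite ger0_norm.
have dcv : `|cv U V - cv (st U) (st V)| <= 4 / n%:R.
  have LUV := L1_bounded P mU U1; have LVV := L1_bounded P mV V1.
  have E1 : Ex (fun w => U w * V w) - Ex (fun w => st U w * st V w) =
      Ex (fun w => (U w - st U w) * V w + st U w * (V w - st V w)).
    rewrite -ExB.
    - by congr Ex; apply/funext => w; ring.
    - apply: (@L1_bounded _ _ _ P 1); first exact: measurable_funM.
      by move=> w; rewrite normrM mulr_ile1.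
    - apply: (@L1_bounded _ _ _ P 1); first exact: measurable_funM.
      by move=> w; rewrite normrM mulr_ile1 ?st1.
  have B1 : `|Ex (fun w => (U w - st U w) * V w + st U w * (V w - st V w))| <= 2 / n%:R.
    apply: Ex_bounded.
      apply: measurable_funD; apply: measurable_funM => //; exact: measurable_funB.
    move=> w; rewrite (le_trans (ler_normD _ _))// mulr_natl mulr2n.
    apply: lerD; rewrite normrM.
      by rewrite -[leRHS]mulr1 ler_pM// bst.
    by rewrite -[leRHS]mul1r ler_pM// ?st1 ?bst.
  have B2 : `|Ex U - Ex (st U)| <= n%:R^-1.
    rewrite -ExB//; apply: Ex_bounded; first exact: measurable_funB.
    by move=> w; exact: bst.
  have B3 : `|Ex V - Ex (st V)| <= n%:R^-1.
    rewrite -ExB//; apply: Ex_bounded; first exact: measurable_funB.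
    by move=> w; exact: bst.
  have B4 : `|Ex V| <= 1 by apply: Ex_bounded.
  have B5 : `|Ex (st U)| <= 1 by apply: Ex_bounded => // w; exact: st1.
  have -> : cv U V - cv (st U) (st V) =
      (Ex (fun w => U w * V w) - Ex (fun w => st U w * st V w)) -
      ((Ex U - Ex (st U)) * Ex V + Ex (st U) * (Ex V - Ex (st V))).
    by rewrite /cv; ring.
  rewrite E1 (le_trans (ler_normB _ _))//.
  rewrite (_ : 4 / n%:R = 2 / n%:R + (n%:R^-1 + n%:R^-1)); last by field; rewrite gt_eqF.
  apply: lerD => //; rewrite (le_trans (ler_normD _ _))// !normrM lerD//.
    by rewrite -[leRHS]mulr1 ler_pM.
  by rewrite -[leRHS]mul1r ler_pM.
have -> : cv U V = cv (st U) (st V) + (cv U V - cv (st U) (st V)) by ring.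
by rewrite (le_trans (ler_normD _ _))// lerD// (le_trans dcv).
Qed.

Lemma cvZD U V (x y r s : R) : L1 U -> L1 V -> L1 (fun w => U w * V w) ->
  cv (fun w => x * U w + r) (fun w => y * V w + s) = x * y * cv U V.
Proof.
move=> LU LV LUV; rewrite /cv.
have LZ (z : R) (W : T -> R) : L1 W -> L1 (fun w => z * W w) by exact: L1Z.
have -> : (fun w => (x * U w + r) * (y * V w + s)) =
    (fun w => x * y * (U w * V w) + (x * s * U w + r * y * V w) + cst (r * s) w).
  by apply/funext => w /=; ring.
have -> : (fun w => x * U w + r) = (fun w => x * U w + cst r w) by [].
have -> : (fun w => y * V w + s) = (fun w => y * V w + cst s w) by [].
have Lc c : L1 (cst c) by exact: L1_cst.
rewrite !ExD ?Ex_cst ?ExZ//; try (repeat apply: L1D => //); try exact: LZ.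
by ring.
Qed.

(** The affine maps onto [0, 1] divide the covariance by 2x and 2y, whence the factor 4. *)
Lemma cv_bounded U V (x y : R) : gmeas F U -> gmeas G V -> 0 < x -> 0 < y ->
  (forall w, `|U w| <= x) -> (forall w, `|V w| <= y) -> `|cv U V| <= 4 * x * y * a.
Proof.
move=> gU gV x0 y0 Ux Vy.
have mU := gmeas_measurable FT gU; have mV := gmeas_measurable GT gV.
have h (H : set (set T)) (W : T -> R) (z : R) : gmeas H W -> gmeas H (fun w => (2 * z)^-1 * W w + 2^-1).
  move=> gW; apply: measurable_funD; last exact: measurable_cst.
  by apply: measurable_funM => //; exact: measurable_cst.
have h01 (W : T -> R) (z : R) : 0 < z -> (forall w, `|W w| <= z) -> forall w,
    0 <= (2 * z)^-1 * W w + 2^-1 <= 1.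
  move=> z0 Wz w; have := Wz w; rewrite ler_norml => /andP[h1 h2].
  have -> : (2 * z)^-1 * W w + 2^-1 = (W w + z) / (2 * z) by field; rewrite gt_eqF.
  by apply/andP; split; [apply: divr_ge0; lra|rewrite ler_pdivrMr ?mulr_gt0//; lra].
have := cv_unit (h _ _ x gU) (h _ _ y gV) (h01 _ _ x0 Ux) (h01 _ _ y0 Vy).
rewrite cvZD; last 3 first.
- exact: (@L1_bounded _ _ _ P x).
- exact: (@L1_bounded _ _ _ P y).
- apply: (@L1_bounded _ _ _ P (x * y)); first exact: measurable_funM.
  by move=> w; rewrite normrM ler_pM.
have xy0 : 0 < 2 * x * (2 * y) by rewrite !mulr_gt0.
rewrite -invfM normrM ger0_norm ?invr_ge0 ?(ltW xy0)// ler_pdivrMl//.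
by congr (_ <= _); ring.
Qed.

(* [K] measures, in units of the truncation levels [x] and [y], how far [U] and
   [V] exceed them. *)
Lemma cv_truncated U V K (x y g : R) : gmeas F U -> gmeas G V -> 0 < x -> 0 < y ->
  L1 K -> (forall w, 0 <= K w) -> Ex K <= g ->
  (forall w, (`|U w| <= x /\ `|V w| <= y) \/
     [/\ `|U w| <= x * K w, `|V w| <= y * K w & `|U w * V w| <= x * y * K w]) ->
  [/\ L1 U, L1 V, L1 (fun w => U w * V w) &
    `|cv U V| <= x * y * (4 * a + 3 * g + g ^+ 2)].
Proof.
move=> gU gV x0 y0 LK K0 Kg H.
have mU := gmeas_measurable FT gU; have mV := gmeas_measurable GT gV.
have Lc c : L1 (cst c) by exact: L1_cst.
have LU : L1 U.
  apply: (@L1_dom _ _ _ _ (fun w => cst x w + x * K w)) => // [w|]; last first.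
    by apply: L1D => //; exact: L1Z.
  have := K0 w; have [[h _]|[h _ _]] := H w => k0; rewrite (le_trans h)//.
    by rewrite lerDl mulr_ge0// ltW.
  by rewrite lerDr ltW.
have LV : L1 V.
  apply: (@L1_dom _ _ _ _ (fun w => cst y w + y * K w)) => // [w|]; last first.
    by apply: L1D => //; exact: L1Z.
  have := K0 w; have [[_ h]|[_ h _]] := H w => k0; rewrite (le_trans h)//.
    by rewrite lerDl mulr_ge0// ltW.
  by rewrite lerDr ltW.
have LUV : L1 (fun w => U w * V w).
  apply: (@L1_dom _ _ _ _ (fun w => cst (x * y) w + x * y * K w)) => [|w|].
  - exact: measurable_funM.
  - have [[h1 h2]|[_ _ h]] := H w.
      by rewrite normrM (le_trans (ler_pM _ _ h1 h2))// lerDl ?mulr_ge0// ltW.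
    by rewrite (le_trans h)// lerDr mulr_ge0// ltW.
  - by apply: L1D => //; exact: L1Z.
split => //.
pose t (z : R) (W : T -> R) w := Num.max (- z) (Num.min z (W w)).
have gt (E : set (set T)) (W : T -> R) (z : R) : gmeas E W -> gmeas E (t z W).
  move=> gW; apply: measurable_maxr; first exact: measurable_cst.
  by apply: measurable_minr => //; exact: measurable_cst.
have tz (z : R) (W : T -> R) : 0 < z -> forall w, `|t z W w| <= z.
  by move=> z0 w; rewrite /t ler_norml le_max lexx/= ge_max ge_min lexx/= andbT; lra.
have tid (z : R) (W : T -> R) w : `|W w| <= z -> t z W w = W w.
  by rewrite ler_norml /t => /andP[h1 h2]; rewrite min_r// max_r.
(* Truncation multiplies by a factor in [0, 1]; hence truncating both variables changes their
   product by at most its own absolute value. *)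
have tS (z : R) (W : T -> R) w : 0 < z -> exists2 s, 0 <= s <= 1 & t z W w = s * W w.
  move=> z0; have [h|h] := leP `|W w| z; first by exists 1; rewrite ?ler01 ?lexx// tid// mul1r.
  have W0 : 0 < `|W w| by rewrite (lt_trans z0).
  exists (z / `|W w|).
    by rewrite divr_ge0 ?(ltW z0)//= ler_pdivrMr// mul1r ltW.
  rewrite /t; move: h W0; have [W0|W0] := leP 0 (W w).
    rewrite (ger0_norm W0) => h h0.
    by rewrite min_l ?(ltW h)// max_r ?divfK ?gt_eqF//; lra.
  rewrite (ltr0_norm W0) => h h0.
  by rewrite min_r ?max_l; [field; lra|lra|lra].
have tnorm (z : R) (W : T -> R) w : 0 < z -> `|W w - t z W w| <= `|W w|.
  move=> z0; have [s /andP[s0 s1] ->] := tS _ W w z0; rewrite -[X in `|X - _|]mul1r -mulrBl normrM.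
  by rewrite ler_piMl// ger0_norm; lra.
have := cv_bounded (gt _ _ x gU) (gt _ _ y gV) x0 y0 (tz _ _ x0) (tz _ _ y0).
move: (gmeas_measurable FT (gt _ _ x gU)) (gmeas_measurable GT (gt _ _ y gV)) (tz _ U x0) (tz _ V y0).
move: (tnorm x U) (tnorm y V) (tid x U) (tid y V) (tS x U) (tS y V).
set U' := t x U; set V' := t y V => nU nV eU eV sU sV mU' mV' bU' bV' cvb.
have LU' : L1 U' by exact: (@L1_bounded _ _ _ P x).
have LV' : L1 V' by exact: (@L1_bounded _ _ _ P y).
have LUV' : L1 (fun w => U' w * V' w).
  apply: (@L1_bounded _ _ _ P (x * y)); first exact: measurable_funM.
  by move=> w; rewrite normrM ler_pM.
have g0 : 0 <= g by rewrite (le_trans _ Kg)// Ex_ge0.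
have d1 : `|Ex U - Ex U'| <= x * g.
  rewrite -ExB// (@le_trans _ _ (Ex (fun w => x * K w)))//; last first.
    by rewrite ExZ// ler_pM2l.
  apply: Ex_norm_le; [exact: L1B|exact: L1Z|move=> w].
  have [[h _]|[h _ _]] := H w; first by rewrite eU// subrr normr0 mulr_ge0// ltW.
  by rewrite (le_trans _ h)// nU.
have d2 : `|Ex V - Ex V'| <= y * g.
  rewrite -ExB// (@le_trans _ _ (Ex (fun w => y * K w)))//; last first.
    by rewrite ExZ// ler_pM2l.
  apply: Ex_norm_le; [exact: L1B|exact: L1Z|move=> w].
  have [[_ h]|[_ h _]] := H w; first by rewrite eV// subrr normr0 mulr_ge0// ltW.
  by rewrite (le_trans _ h)// nV.
have d3 : `|Ex (fun w => U w * V w) - Ex (fun w => U' w * V' w)| <= x * y * g.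
  rewrite -ExB// (@le_trans _ _ (Ex (fun w => x * y * K w)))//; last first.
    by rewrite ExZ// ler_pM2l ?mulr_gt0.
  apply: Ex_norm_le; [exact: L1B|exact: L1Z|move=> w].
  have [[h1 h2]|[_ _ h]] := H w.
    by rewrite eU// eV// subrr normr0 !mulr_ge0// ltW.
  apply: le_trans h.
  have [r /andP[r0 r1] ->] := sU w x0; have [q /andP[q0 q1] ->] := sV w y0.
  rewrite (_ : _ - _ = (1 - r * q) * (U w * V w)); last by ring.
  rewrite normrM ler_piMl// ger0_norm ?subr_ge0 ?mulr_ile1// lerBlDr lerDl.
  exact: mulr_ge0.
have b1 : `|Ex U'| <= x by apply: Ex_bounded.
have b2 : `|Ex V| <= y + y * g.
  rewrite (_ : Ex V = Ex V' + (Ex V - Ex V')); last by ring.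
  by rewrite (le_trans (ler_normD _ _))// lerD// Ex_bounded.
rewrite (_ : cv U V = cv U' V' +
  ((Ex (fun w => U w * V w) - Ex (fun w => U' w * V' w)) -
   ((Ex U - Ex U') * Ex V + Ex U' * (Ex V - Ex V')))); last by rewrite /cv; ring.
rewrite (_ : x * y * (4 * a + 3 * g + g ^+ 2) = 4 * x * y * a +
  (x * y * g + (x * g * (y + y * g) + x * (y * g)))); last by ring.
rewrite (le_trans (ler_normD _ _))// lerD// (le_trans (ler_normB _ _))// lerD//.
by rewrite (le_trans (ler_normD _ _))// !normrM lerD// ler_pM.
Qed.

End rate.
End mixing.

(** * Powers and the series with exponent 9/8 *)

Section power.
Context {R : realType}.
Implicit Types x y g c p : R.

Lemma pow_level y g c p : 0 < p -> 0 <= y -> 0 < c -> y `^ p * c <= g ->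
  y <= c `^ (- p^-1) * g `^ (p^-1).
Proof.
move=> p0 y0 c0 h.
have g0 : 0 <= g by rewrite (le_trans _ h)// mulr_ge0 ?powR_ge0// ltW.
have pV0 : 0 <= p^-1 by rewrite invr_ge0 ltW.
rewrite -{1}[y]powRr1// -{1}(mulfV (lt0r_neq0 p0)) powRrM.
rewrite powRN mulrC ler_pdivlMr ?powR_gt0// -powRM ?powR_ge0 ?(ltW c0)//.
by apply: ge0_ler_powR; rewrite ?nnegrE ?mulr_ge0 ?powR_ge0 ?(ltW c0).
Qed.

(** Discrete form of the fact that -8 x^(-1/8) is a primitive of x^(-9/8). For the eighth roots a, b
    of consecutive integers b^8 - a^8 = 1, and the inequality becomes polynomial. *)
Lemma pow98_step (n : nat) : (n.+2%:R : R) `^ (- (9 / 8)) <=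
  8 * (n.+1%:R `^ (- (1 / 8)) - n.+2%:R `^ (- (1 / 8))).
Proof.
set a : R := n.+1%:R `^ (1 / 8); set b : R := n.+2%:R `^ (1 / 8).
have a0 : 0 < a by rewrite powR_gt0.
have b0 : 0 < b by rewrite powR_gt0.
have e8 (m : nat) : (m%:R `^ (1 / 8)) ^+ 8 = m%:R :> R.
  by rewrite -powR_mulrn ?powR_ge0// -powRrM divfK// powRr1.
have ab : b ^+ 8 - a ^+ 8 = 1 by rewrite !e8 -!natr1; ring.
have leab : a <= b.
  by rewrite /a /b; apply: ge0_ler_powR; rewrite ?nnegrE ?ler_nat//; lra.
have -> : n.+2%:R `^ (- (9 / 8)) = (b ^+ 9)^-1 :> R.
  rewrite powRN -powR_mulrn ?powR_ge0// -powRrM; congr (_ `^ _)^-1; lra.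
rewrite (powRN _ (1 / 8)) (powRN n.+2%:R (1 / 8)) -/a -/b.
have -> : a^-1 - b^-1 = (b - a) / (a * b) by field; rewrite !gt_eqF.
have H : 1 <= (b - a) * (8 * b ^+ 7).
  rewrite -[leLHS]ab.
  have -> : b ^+ 8 - a ^+ 8 = (b - a) * (b ^+ 7 + b ^+ 6 * a + b ^+ 5 * a ^+ 2 +
    b ^+ 4 * a ^+ 3 + b ^+ 3 * a ^+ 4 + b ^+ 2 * a ^+ 5 + b * a ^+ 6 + a ^+ 7) by ring.
  apply: ler_wpM2l; first by rewrite subr_ge0.
  have h (i j : nat) : (i + j = 7)%N -> b ^+ i * a ^+ j <= b ^+ 7.
    move=> <-; rewrite exprD ler_wpM2l ?exprn_ge0 ?(ltW b0)//.
    by apply: lerXn2r => //; rewrite nnegrE ltW.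
  have := h 6 1 erefl; have := h 5 2 erefl; have := h 4 3 erefl.
  have := h 3 4 erefl; have := h 2 5 erefl; have := h 1 6 erefl; have := h 0 7 erefl.
  by rewrite !expr1 expr0 mul1r; lra.
rewrite mulrA ler_pdivlMr ?mulr_gt0// ler_pdivrMl ?exprn_gt0//.
have h1 : a * b <= b * b by rewrite ler_pM2r.
apply: (le_trans h1); have -> : b ^+ 9 * (8 * (b - a)) = (b - a) * (8 * b ^+ 7) * (b * b) by ring.
by rewrite ler_peMl ?mulr_ge0 ?(ltW b0).
Qed.

(** The first term is 1 and the others telescope to at most 8. *)
Lemma sum_pow98 (n : nat) : \sum_(h < n) (h.+1%:R : R) `^ (- (9 / 8)) <= 9.
Proof.
have H m : \sum_(h < m.+1) (h.+1%:R : R) `^ (- (9 / 8)) <=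
    9 - 8 * m.+1%:R `^ (- (1 / 8)).
  elim: m => [|m IH].
    by rewrite big_ord1 !powR1; lra.
  by rewrite big_ord_recr/=; have := pow98_step m; lra.
case: n => [|n]; first by rewrite big_ord0.
by rewrite (le_trans (H n))// lerBlDr lerDl mulr_ge0 ?powR_ge0.
Qed.

Lemma le_powR_of_ge1 g q : 1 <= g -> q <= 1 -> g `^ q <= g.
Proof. by move=> g1 q1; exact: ler1_powR. Qed.

Lemma powR_le1 (g q : R) : 0 <= g -> g <= 1 -> 0 <= q -> g `^ q <= 1.
Proof.
by move=> g0 g1 q0; have := @ge0_ler_powR R q q0 g 1; rewrite !nnegrE powR1; apply.
Qed.

Lemma exponents_lt4 (q : R) : q < 4^-1 -> [/\ q + 2^-1 <= 1, q <= 1 & q + 2^-1 + q <= 1].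
Proof. by move=> h; split; lra. Qed.

End power.

(** * Covariance bounds under moment conditions *)

Section covariance_rates.
Context {R : realType} {d : measure_display} {T : measurableType d}.
Variable P : probability T R.
Implicit Types (F G : set (set T)) (U V Z S : T -> R).
Local Notation Ex := (Ex P).
Local Notation L1 := (L1 P).
Local Notation cv := (cv P).

Variables (F G : set (set T)) (c g : R).
Hypotheses (FT : F `<=` measurable) (GT : G `<=` measurable).
Hypotheses (g0 : 0 < g) (g1 : g <= 1) (FG : mixing P (c * g) F G).

(** [V] is truncated at the level s g^(-1/2), at which the mixing error and the truncated mass are
    both of order b s g^(1/2). *)
Lemma cv_bound_L2 U V (b s : R) : gmeas F U -> gmeas G V -> 0 < b -> 0 < s ->
  (forall w, `|U w| <= b) -> L1 (fun w => V w ^+ 2) -> Ex (fun w => V w ^+ 2) <= s ^+ 2 ->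
  [/\ L1 U, L1 V, L1 (fun w => U w * V w) &
   `|cv U V| <= (4 * c + 4) * b * s * g `^ 2^-1].
Proof.
move=> gU gV b0 s0 Ub LV2 EV2.
(* Normalised so that its mean is at most [g] and that it exceeds 1 exactly where [V] exceeds the
   truncation level. *)
pose K w := g / s ^+ 2 * V w ^+ 2.
have K0 w : 0 <= K w by rewrite mulr_ge0 ?sqr_ge0// divr_ge0 ?exprn_ge0// ltW.
have r0 : 0 < g `^ 2^-1 by rewrite powR_gt0.
have rr : g `^ 2^-1 * g `^ 2^-1 = g.
  by rewrite -powRD ?(gt_eqF g0) ?implybT// (_ : _ + _ = 1) ?powRr1 ?(ltW g0)//; field.
have KV w : `|V w| = s / g `^ 2^-1 * (K w) `^ 2^-1.
  have -> : K w = (g `^ 2^-1 * `|V w| / s) ^+ 2.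
    by rewrite /K !exprMn real_normK ?num_real// (expr2 (g `^ _)) rr exprVn; ring.
  rewrite -powR_mulrn; last by rewrite !mulr_ge0 ?invr_ge0 ?(ltW s0) ?(ltW r0).
  rewrite -powRrM mulfV// powRr1; last by rewrite !mulr_ge0 ?invr_ge0 ?(ltW s0) ?(ltW r0).
  by field; rewrite !gt_eqF.
have sr0 : 0 < s / g `^ 2^-1 by rewrite divr_gt0.
have [|w|||LU LV LUV] := cv_truncated (K := K) (x := b) (y := s / g `^ 2^-1) (g := g) FT GT FG gU gV b0 sr0.
- exact: L1Z.
- exact: K0.
- rewrite ExZ// mulrAC ler_pdivrMr ?exprn_gt0// ler_wpM2l// ltW//.
- move=> w; have [k1|k1] := leP (K w) 1; [left|right].
    by split => //; rewrite KV ler_piMr ?(ltW sr0)// powR_le1// invr_ge0.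
  have k2 : `|V w| <= s / g `^ 2^-1 * K w.
    by rewrite KV ler_pM2l// le_powR_of_ge1 ?(ltW k1)// invf_le1// ler1n.
  split => //; first by rewrite (le_trans (Ub w))// ler_peMr ?ltW.
  by rewrite normrM -mulrA ler_pM.
move=> h; split => //; apply: (le_trans h).
have -> : (4 * c + 4) * b * s * g `^ 2^-1 = b * (s / g `^ 2^-1) * (4 * (c * g) + 3 * g + g).
  transitivity ((4 * c + 4) * b * s * (g / g `^ 2^-1)); last first.
    by field; rewrite gt_eqF.
  by congr (_ * _); apply: (canRL (mulfK (lt0r_neq0 r0))).
by rewrite ler_pM2l ?(mulr_gt0 b0 sr0)// lerD2l expr2 ler_piMr// ltW.
Qed.

(** Both variables are truncated at g^(-1/4): the levels multiply to g^(-1/2), and the mixing rate g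
    leaves g^(1/2). *)
Lemma cv_L4 U V : gmeas F U -> gmeas G V ->
  L1 (fun w => U w ^+ 4) -> Ex (fun w => U w ^+ 4) <= 1 ->
  L1 (fun w => V w ^+ 4) -> Ex (fun w => V w ^+ 4) <= 1 ->
  [/\ L1 U, L1 V, L1 (fun w => U w * V w) &
   `|cv U V| <= (4 * c + 10) * g `^ 2^-1].
Proof.
move=> gU gV LU4 EU4 LV4 EV4.
pose K w := g * (U w ^+ 4 + V w ^+ 4).
have p4 (x : R) : 0 <= x ^+ 4 by rewrite exprn_even_ge0.
have K0 w : 0 <= K w by rewrite mulr_ge0 ?addr_ge0 ?p4// ltW.
pose x := g `^ (- 4^-1).
have x0 : 0 < x by rewrite powR_gt0.
have lev w u : u ^+ 4 * g <= K w -> `|u| <= x * (K w) `^ (4^-1).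
  move=> h; apply: pow_level => //; rewrite powR_mulrn//.
  by rewrite -normrX ger0_norm.
have lU w : `|U w| <= x * (K w) `^ (4^-1).
  by apply: lev; rewrite mulrC /K ler_pM2l// lerDl.
have lV w : `|V w| <= x * (K w) `^ (4^-1).
  by apply: lev; rewrite mulrC /K ler_pM2l// lerDr.
have [|w|||LU LV LUV] := cv_truncated (K := K) (x := x) (y := x) (g := 2 * g) FT GT FG gU gV x0 x0.
- by apply: L1Z; exact: L1D.
- exact: K0.
- by rewrite ExZ ?ExD//; [rewrite mulrC ler_pM2r//; lra|exact: L1D].
- move=> w; have [k1|k1] := leP (K w) 1; [left|right].
    have h : x * K w `^ 4^-1 <= x by rewrite ler_piMr ?(ltW x0)// powR_le1// invr_ge0.
    by split; [exact: le_trans (lU w) h|exact: le_trans (lV w) h].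
  have h : x * K w `^ 4^-1 <= x * K w.
    by rewrite ler_pM2l// le_powR_of_ge1 ?(ltW k1)// invf_le1// ler1n.
  split; [exact: le_trans (lU w) h|exact: le_trans (lV w) h|].
  rewrite normrM (le_trans (ler_pM _ _ (lU w) (lV w)))// mulrACA ler_pM2l ?mulr_gt0//.
  rewrite -powRD; last by rewrite (gt_eqF (lt_trans _ k1)) ?implybT.
  by rewrite le_powR_of_ge1 ?(ltW k1)//; lra.
move=> h; split => //; apply: (le_trans h).
have xx : x * x * g = g `^ 2^-1.
  rewrite /x -{3}[g]powRr1 ?(ltW g0)// -!powRD ?(gt_eqF g0) ?implybT//.
  by congr (_ `^ _); field.
have -> : (4 * c + 10) * g `^ 2^-1 = x * x * (4 * (c * g) + 3 * (2 * g) + 4 * g).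
  by rewrite -xx; ring.
rewrite ler_pM2l ?mulr_gt0// lerD2l (_ : (2 * g) ^+ 2 = 4 * (g * g)); last by ring.
by rewrite ler_pM2l// ler_piMr// ltW.
Qed.

(** [Z * S] is truncated at s g^(-1/J - 1/2) and [V] at g^(-1/J); what remains of g is the exponent
    1 - 1/2 - 2/J = (J - 4)/(2 J). Only a second moment of [S] is asked for, since [S] will be
    quadratic in partial sums whose fourth moment is being estimated. *)
Lemma cv_LJ Z S V (J s : R) : 4 < J -> 0 < s ->
  measurable_fun setT Z -> measurable_fun setT S ->
  gmeas F (fun w => Z w * S w) -> gmeas G V ->
  L1 (fun w => `|Z w| `^ J) -> Ex (fun w => `|Z w| `^ J) <= 1 ->
  L1 (fun w => S w ^+ 2) -> Ex (fun w => S w ^+ 2) <= s ^+ 2 ->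
  L1 (fun w => `|V w| `^ J) -> Ex (fun w => `|V w| `^ J) <= 1 ->
  [/\ L1 (fun w => Z w * S w), L1 V, L1 (fun w => Z w * S w * V w) &
   `|cv (fun w => Z w * S w) V| <= (4 * c + 18) * s * g `^ ((J - 4) / (2 * J))].
Proof.
move=> J4 s0 mZ mS gU gV LZ EZ LS ES LV EV.
have J0 : 0 < J by rewrite (lt_trans _ J4).
have JV0 : 0 < J^-1 by rewrite invr_gt0.
have JV4 : J^-1 < 4^-1 by rewrite ltf_pV2 ?posrE.
have [e1 e2 e3] : [/\ J^-1 + 2^-1 <= 1, J^-1 <= 1 & J^-1 + 2^-1 + J^-1 <= 1].
  exact: exponents_lt4.
pose K w := g * (`|Z w| `^ J + S w ^+ 2 / s ^+ 2 + `|V w| `^ J).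
have q0 w : 0 <= S w ^+ 2 / s ^+ 2 by rewrite divr_ge0 ?sqr_ge0.
have K0 w : 0 <= K w by rewrite mulr_ge0 ?addr_ge0 ?powR_ge0// ltW.
pose x := g `^ (- J^-1); pose r := g `^ (- 2^-1).
have x0 : 0 < x by rewrite powR_gt0.
have r0 : 0 < r by rewrite powR_gt0.
have lZ w : `|Z w| <= x * (K w) `^ (J^-1).
  apply: pow_level => //; rewrite mulrC /K ler_pM2l// -addrA lerDl addr_ge0// powR_ge0.
have lV w : `|V w| <= x * (K w) `^ (J^-1).
  by apply: pow_level => //; rewrite mulrC /K ler_pM2l// lerDr addr_ge0// powR_ge0.
have lS w : `|S w| <= s * r * (K w) `^ (2^-1).
  rewrite -mulrA -ler_pdivrMl// mulrC.
  apply: pow_level => //; first by rewrite divr_ge0// ltW.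
  rewrite powR_mulrn ?divr_ge0// ?(ltW s0)// expr_div_n real_normK ?num_real// mulrC /K ler_pM2l//.
  by rewrite addrAC lerDr addr_ge0// powR_ge0.
have xsr0 : 0 < x * (s * r) by rewrite !mulr_gt0.
have [|w|||L_U L_V LUV] := cv_truncated (K := K) (x := x * (s * r)) (y := x) (g := 3 * g) FT GT FG gU gV xsr0 x0.
- apply: L1Z; apply: L1D => //; apply: L1D => //.
  by under eq_fun do rewrite mulrC; exact: L1Z.
- exact: K0.
- have LS' : L1 (fun w => S w ^+ 2 / s ^+ 2) by under eq_fun do rewrite mulrC; exact: L1Z.
  rewrite ExZ ?ExD//; [|exact: L1D|by apply: L1D => //; exact: L1D].
  rewrite mulrC ler_pM2r//.
  have : Ex (fun w => S w ^+ 2 / s ^+ 2) <= 1.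
    under [X in Ex X]eq_fun do rewrite mulrC.
    by rewrite ExZ// ler_pdivrMl ?exprn_gt0// mulr1.
  by move=> ES1; rewrite [leRHS](_ : _ = 1 + 1 + 1) ?lerD//; ring.
- move=> w; have [k1|k1] := leP (K w) 1; [left|right].
    have h (p y : R) : 0 < p -> 0 < y -> y * K w `^ p <= y.
      by move=> p0 y0; rewrite ler_piMr ?(ltW y0)// powR_le1// ltW.
    split; last by rewrite (le_trans (lV w))// h.
    by rewrite normrM ler_pM//; [rewrite (le_trans (lZ w))// h|rewrite (le_trans (lS w))// h ?mulr_gt0].
  have kn0 (p : R) : (p == 0) ==> (K w != 0) by rewrite (gt_eqF (lt_trans _ k1)) ?implybT.
  have lU : `|Z w * S w| <= x * (s * r) * K w `^ (J^-1 + 2^-1).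
    by rewrite normrM (le_trans (ler_pM _ _ (lZ w) (lS w)))// mulrACA -powRD.
  split.
  - by rewrite (le_trans lU)// ler_pM2l// le_powR_of_ge1 ?(ltW k1).
  - by rewrite (le_trans (lV w))// ler_pM2l// le_powR_of_ge1 ?(ltW k1).
  - rewrite normrM (le_trans (ler_pM _ _ lU (lV w)))// mulrACA -powRD//.
    by rewrite ler_pM2l ?mulr_gt0// le_powR_of_ge1 ?(ltW k1).
move=> h; split => //; apply: (le_trans h).
have xx : x * r * x * g = g `^ ((J - 4) / (2 * J)).
  rewrite /x /r -{4}[g]powRr1 ?(ltW g0)// -!powRD ?(gt_eqF g0) ?implybT//.
  by congr (_ `^ _); field; rewrite gt_eqF.
have -> : (4 * c + 18) * s * g `^ ((J - 4) / (2 * J)) =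
    x * (s * r) * x * (4 * (c * g) + 3 * (3 * g) + 9 * g).
  by rewrite -xx; ring.
rewrite ler_pM2l ?mulr_gt0// lerD2l (_ : (3 * g) ^+ 2 = 9 * (g * g)); last by ring.
by rewrite ler_pM2l// ler_piMr// ltW.
Qed.

End covariance_rates.

(** * Moments of partial sums *)

(** The trinomial is the cofactor of x - y in x^3 - y^3; equality holds at x = y. *)
Lemma sqr_trinomial_le {R : realType} (x y : R) :
  (x ^+ 2 + x * y + y ^+ 2) ^+ 2 <= 9 / 2 * (x ^+ 4 + y ^+ 4).
Proof.
rewrite -subr_ge0 (_ : _ - _ = 5 / 2 * ((x - y) * (x + y)) ^+ 2 +
  (((x - y) * x) ^+ 2 + ((x - y) * y) ^+ 2)); last by field.
by rewrite addr_ge0// ?addr_ge0 ?sqr_ge0// mulr_ge0 ?sqr_ge0.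
Qed.

Lemma powRN_le1 {R : realType} (x q : R) : 1 <= x -> 0 <= q -> x `^ (- q) <= 1.
Proof.
by move=> x1 q0; rewrite -(powRr0 x); apply: ler_powR => //; rewrite oppr_le0.
Qed.

(** The right side grows by 2 K^2 q + K^2. With K = 2 e + 8 the first part is exactly 4 (e K q) + 8
    (2 K q), the bounds of the two middle terms, and K^2 absorbs 3 D <= 6. *)
Lemma fourth_moment_step {R : realType} (K q e A B C D : R) : 0 <= e ->
  K = 2 * e + 8 -> 0 <= q -> A <= (K * q) ^+ 2 -> B <= e * K * q ->
  C <= 2 * K * q -> D <= 2 ->
  A + 4 * B + 8 * C + 3 * D <= (K * (q + 1)) ^+ 2.
Proof.
move=> e0 KE q0 hA hB hC hD.
have K8 : 8 <= K by lra.
have Kq : 0 <= K * q by rewrite mulr_ge0//; lra.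
have -> : (K * (q + 1)) ^+ 2 = (K * q) ^+ 2 + 2 * (K * q) * K + K ^+ 2 by ring.
have V : 0 <= (K - 8) * (K + 8) by rewrite mulr_ge0//; lra.
rewrite (_ : (K - 8) * (K + 8) = K ^+ 2 - 64) in V; last by ring.
move: hA hB hC V; rewrite -[e * K * q]mulrA -[2 * K * q]mulrA.
move: (K * q) Kq (K ^+ 2) => t t0 V hA hB hC hV.
have -> : 2 * t * K = 4 * (e * t) + 16 * t by rewrite KE; ring.
by move: (e * t) hB (t ^+ 2) hA => u hB U hA; lra.
Qed.

Section fourth_moments.
Context {R : realType} {d : measure_display} {T : measurableType d}.
Variable P : probability T R.
Local Notation Ex := (Ex P).
Local Notation L1 := (L1 P).
Local Notation cv := (cv P).
Implicit Types f g h k : T -> R.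

Lemma eq_L1 f g : f =1 g -> L1 f -> L1 g.
Proof. by move=> /funext ->. Qed.

Definition L4 f : Prop := measurable_fun setT f /\ L1 (fun w => f w ^+ 4).

Lemma L4_cst (c : R) : L4 (cst c).
Proof. by split => //; exact: (L1_cst P (c ^+ 4)). Qed.

Lemma L4D f g : L4 f -> L4 g -> L4 (fun w => f w + g w).
Proof.
move=> [mf Lf] [mg Lg].
have mfg : measurable_fun setT (fun w => f w + g w) by exact: measurable_funD.
split => //; apply: (@L1_dom _ _ _ _ (fun w => 8 * (f w ^+ 4 + g w ^+ 4))).
- exact: measurable_funX.
- move=> w; rewrite ger0_norm ?exprn_even_ge0//; move: (f w) (g w) => x y.
  have h (u v : R) : (u + v) ^+ 2 <= 2 * (u ^+ 2 + v ^+ 2).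
    by have := sqr_ge0 (u - v); nra.
  have h1 := h x y; have h2 := h (x ^+ 2) (y ^+ 2).
  have h3 : ((x + y) ^+ 2) ^+ 2 <= (2 * (x ^+ 2 + y ^+ 2)) ^+ 2.
    rewrite ler_pXn2r// nnegrE ?sqr_ge0//.
    by apply: mulr_ge0 => //; apply: addr_ge0; exact: sqr_ge0.
  have -> : (x + y) ^+ 4 = ((x + y) ^+ 2) ^+ 2 by rewrite -exprM.
  have -> : x ^+ 4 = (x ^+ 2) ^+ 2 by rewrite -exprM.
  have -> : y ^+ 4 = (y ^+ 2) ^+ 2 by rewrite -exprM.
  rewrite (le_trans h3)// exprMn (_ : 8 = 2 ^+ 2 * 2); last by ring.
  by rewrite -mulrA ler_pM2l.
- by apply: L1Z; exact: L1D.
Qed.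

Lemma L4Z (c : R) f : L4 f -> L4 (fun w => c * f w).
Proof.
move=> [mf Lf]; split; first exact: measurable_funM.
by under eq_fun do rewrite exprMn; exact: L1Z.
Qed.

Lemma L4_sum I (r : seq I) (F : I -> T -> R) :
  (forall i, L4 (F i)) -> L4 (fun w => \sum_(i <- r) F i w).
Proof.
move=> LF; elim: r => [|i r IH].
  by under eq_fun do rewrite big_nil; exact: L4_cst.
by under eq_fun do rewrite big_cons; exact: L4D.
Qed.

(** By the arithmetic-geometric inequality; constant factors give the integrability of every shorter
    product. *)
Lemma L4_prod f g h k : L4 f -> L4 g -> L4 h -> L4 k ->
  L1 (fun w => f w * g w * h w * k w).
Proof.
move=> [mf Lf] [mg Lg] [mh Lh] [mk Lk].
apply: (@L1_dom _ _ _ _ (fun w => f w ^+ 4 + g w ^+ 4 + h w ^+ 4 + k w ^+ 4)).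
- by repeat apply: measurable_funM.
- move=> w; move: (f w) (g w) (h w) (k w) => x y z u.
  have q (a b : R) : `|a * b| <= (a ^+ 2 + b ^+ 2) / 2.
    have := sqr_ge0 (a - b); have := sqr_ge0 (a + b).
    by rewrite ler_norml; nra.
  rewrite -mulrA; apply: (le_trans (q _ _)).
  have q2 (a b : R) : (a * b) ^+ 2 <= (a ^+ 4 + b ^+ 4) / 2.
    rewrite ler_pdivlMr// -subr_ge0.
    by rewrite (_ : _ - _ = (a ^+ 2 - b ^+ 2) ^+ 2) ?sqr_ge0//; ring.
  have := q2 x y; have := q2 z u.
  have p4 (a : R) : 0 <= a ^+ 4 by rewrite exprn_even_ge0.
  by have := p4 x; have := p4 y; have := p4 z; have := p4 u; lra.
- by repeat apply: L1D.
Qed.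

Lemma L4_L2 f : L4 f -> L1 (fun w => f w ^+ 2).
Proof.
move=> Lf; have := L4_prod Lf Lf (L4_cst 1) (L4_cst 1).
by apply: eq_L1 => w /=; rewrite !mulr1 expr2.
Qed.

Lemma L4_L1 f : L4 f -> L1 f.
Proof.
move=> Lf; have := L4_prod Lf (L4_cst 1) (L4_cst 1) (L4_cst 1).
by apply: eq_L1 => w /=; rewrite !mulr1.
Qed.

Lemma L4_mul f g : L4 f -> L4 g -> L1 (fun w => f w * g w).
Proof.
move=> Lf Lg; have := L4_prod Lf Lg (L4_cst 1) (L4_cst 1).
by apply: eq_L1 => w /=; rewrite !mulr1.
Qed.

Lemma L4_L4 f g : L4 f -> L4 g -> L1 (fun w => (f w * g w) ^+ 2).
Proof.
move=> Lf Lg; have := L4_prod Lf Lf Lg Lg.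
by apply: eq_L1 => w /=; ring.
Qed.

Lemma LJ_L4 f (J : R) : 4 <= J -> measurable_fun setT f ->
  L1 (fun w => `|f w| `^ J) -> Ex (fun w => `|f w| `^ J) <= 1 ->
  L4 f /\ Ex (fun w => f w ^+ 4) <= 2.
Proof.
move=> J4 mf LJ EJ.
have h w : f w ^+ 4 <= cst 1 w + `|f w| `^ J.
  rewrite -[X in X <= _]ger0_norm ?exprn_even_ge0// normrX -powR_mulrn//=.
  have [f1|f1] := leP 1 `|f w|.
    by rewrite (le_trans (ler_powR f1 J4))// lerDr.
  by rewrite (@le_trans _ _ 1) ?lerDl ?powR_ge0// powR_le1// ltW.
have Ls : L1 (fun w => cst 1 w + `|f w| `^ J) by apply: L1D => //; exact: L1_cst.
have L : L1 (fun w => f w ^+ 4).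
  apply: L1_dom Ls; first exact: measurable_funX.
  by move=> w; rewrite ger0_norm ?exprn_even_ge0.
split; first by split.
rewrite (le_trans (Ex_le L Ls h))// ExD ?Ex_cst//; last exact: L1_cst.
by lra.
Qed.

Variable Gs : nat -> set (set T).
Hypothesis GsT : forall i, Gs i `<=` measurable.

Definition past (m : nat) := \bigcup_(i in [set i | (1 <= i <= m)%N]) Gs i.
Definition future (m : nat) := \bigcup_(i in [set i | (m <= i)%N]) Gs i.

Definition mixing_seq (c nu : R) : Prop := forall m k : nat, (0 < m)%N -> (0 < k)%N ->
  mixing P (c * k%:R `^ (- nu)) (past m) (future (m + k)).

Lemma past_measurable m : past m `<=` measurable.
Proof. by move=> A [i _]; exact: GsT. Qed.

Lemma future_measurable m : future m `<=` measurable.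
Proof. by move=> A [i _]; exact: GsT. Qed.

Lemma gmeas_past m i f : (0 < i <= m)%N -> gmeas (Gs i) f -> gmeas (past m) f.
Proof. by move=> im; apply: gmeasS => A GA; exists i. Qed.

Lemma gmeas_future m i f : (m <= i)%N -> gmeas (Gs i) f -> gmeas (future m) f.
Proof. by move=> im; apply: gmeasS => A GA; exists i. Qed.

Lemma gmeas_sum G I (r : seq I) (F : I -> T -> R) :
  (forall i, gmeas G (F i)) -> gmeas G (fun w => \sum_(i <- r) F i w).
Proof. by move=> mF; apply: measurable_sum => i; exact: mF. Qed.

(** The value 2 e + 8 of [fourth_moment_step] for e = 27 (4 c + 18), where 27 = 9 * 3 collects the
    sum of the series and the factor 3 in the norm of the trinomial. *)
Definition K4 (c : R) : R := 54 * (4 * c + 18) + 8.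

Lemma K4_gt0 (c : R) : 0 <= c -> 0 < K4 c.
Proof. by move=> c0; rewrite /K4; lra. Qed.

Section sums.
Variables (Z : nat -> T -> R) (c nu J : R).
Hypotheses (c0 : 0 <= c) (nu0 : 0 < nu) (J4 : 4 < J)
  (nuJ : 9 / 8 <= nu * ((J - 4) / (2 * J))) (mixZ : mixing_seq c nu).
Hypothesis gZ : forall i, (0 < i)%N -> gmeas (Gs i) (Z i).
Hypothesis Z0 : forall i, (0 < i)%N -> Ex (Z i) = 0.

Let mZ i : (0 < i)%N -> measurable_fun setT (Z i).
Proof. by move=> i0; apply: gmeas_measurable (@GsT i) _; exact: gZ. Qed.

(* Expanding [(S + Z)^4], the only dangerous term is [E (S^3 Z)]; telescoping
   [S^3] writes it as a sum of covariances between the new summand [Z] and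
   polynomials in the earlier ones, which the mixing rate makes summable. *)
Lemma fourth_moment_unit (a n : nat) :
  (forall i, (0 < i)%N -> L1 (fun w => `|Z i w| `^ J)) ->
  (forall i, (0 < i)%N -> Ex (fun w => `|Z i w| `^ J) <= 1) ->
  Ex (fun w => (\sum_(i < n) Z (a + i).+1 w) ^+ 4) <= (K4 c * n%:R) ^+ 2.
Proof.
move=> LJ EJ; pose S n w := \sum_(i < n) Z (a + i).+1 w.
rewrite -/(S n).
have J4' : 4 <= J by rewrite ltW.
have LZ i : L4 (Z i.+1) by have [] := LJ_L4 J4' (@mZ i.+1 erefl) (@LJ i.+1 erefl) (@EJ i.+1 erefl).
have EZ i : Ex (fun w => Z i.+1 w ^+ 4) <= 2.
  by have [] := LJ_L4 J4' (@mZ i.+1 erefl) (@LJ i.+1 erefl) (@EJ i.+1 erefl).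
have LS m : L4 (S m) by apply: L4_sum => i.
have LS4 m : L1 (fun w => S m w ^+ 4) by case: (LS m).
have c18 : 0 < 4 * c + 18 by rewrite ltr_wpDl// mulr_ge0.
have Kg := K4_gt0 c0; set K := K4 c in Kg *.
elim: n {-2}n (leqnn n) => [|n IH] m.
  rewrite leqn0 => /eqP ->; rewrite mulr0 expr0n/= /S.
  by under [X in Ex X]eq_fun do rewrite big_ord0 expr0n/=; rewrite Ex_cst.
rewrite leq_eqVlt => /predU1P[->|]; last by rewrite ltnS => /IH.
pose z := Z (a + n).+1; have SS w : S n.+1 w = S n w + z w by rewrite /S big_ord_recr.
pose Tj j w := S j.+1 w ^+ 2 + S j.+1 w * S j w + S j w ^+ 2.
have S3 w : S n w ^+ 3 = \sum_(j < n) Z (a + j).+1 w * Tj j w.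
  elim: n {IH z SS} => [|k IHk]; first by rewrite big_ord0 /S big_ord0 expr0n.
  rewrite big_ord_recr/= -IHk /Tj.
  have -> : S k.+1 w = S k w + Z (a + k).+1 w by rewrite /S big_ord_recr.
  by ring.
have LT j : measurable_fun setT (Tj j) /\ L1 (fun w => Tj j w ^+ 2).
  have mS i : measurable_fun setT (S i) by case: (LS i).
  have mT : measurable_fun setT (Tj j).
    apply: measurable_funD; last exact: measurable_funX.
    by apply: measurable_funD; [exact: measurable_funX|exact: measurable_funM].
  split => //; apply: (@L1_dom _ _ _ _ (fun w => 9 / 2 * (S j.+1 w ^+ 4 + S j w ^+ 4))).
  - exact: measurable_funX.
  - by move=> w; rewrite ger0_norm ?sqr_ge0//; exact: sqr_trinomial_le.
  - by apply: L1Z; apply: L1D; exact: LS4.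
have ET j : (j < n)%N -> Ex (fun w => Tj j w ^+ 2) <= (3 * K * n%:R) ^+ 2.
  move=> jn; have [mT LT2] := LT j.
  apply: (@le_trans _ _ (Ex (fun w => 9 / 2 * (S j.+1 w ^+ 4 + S j w ^+ 4)))).
    apply: Ex_le => //; first by apply: L1Z; apply: L1D; exact: LS4.
    by move=> w; exact: sqr_trinomial_le.
  have [[_ L1'] [_ L2']] := (LS j.+1, LS j).
  rewrite ExZ ?ExD//; last exact: L1D.
  have h i : (i <= n)%N -> Ex (fun w => S i w ^+ 4) <= (K * n%:R) ^+ 2.
    move=> le_in; rewrite (le_trans (IH _ le_in))//; apply: lerXn2r.
    - by rewrite nnegrE mulr_ge0// ltW.
    - by rewrite nnegrE mulr_ge0// ltW.
    - by rewrite ler_pM2l// ler_nat.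
  have := h _ jn; have := h _ (ltnW jn).
  rewrite (_ : (3 * K * n%:R) ^+ 2 = 9 * (K * n%:R) ^+ 2); last by ring.
  by move: (_ ^+ 2) (Ex _) (Ex _) => A B C h1 h2; lra.
have Lz : L4 z by exact: LZ.
have E3 : Ex (fun w => S n w ^+ 3 * z w) <= 27 * (4 * c + 18) * K * n%:R.
  have -> : (fun w => S n w ^+ 3 * z w) =
      (fun w => \sum_(j < n) Z (a + j).+1 w * Tj j w * z w).
    by apply/funext => w; rewrite S3 mulr_suml.
  have H (j : 'I_n) : L1 (fun w => Z (a + j).+1 w * Tj j w * z w) /\
      Ex (fun w => Z (a + j).+1 w * Tj j w * z w) <=
      (4 * c + 18) * (3 * K * n%:R) * (n - j)%:R `^ (- (9 / 8)).
    have jn := ltn_ord j.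
    have hj : (0 < n - j)%N by rewrite subn_gt0.
    have n0 : (0 < n)%N by rewrite (leq_ltn_trans _ jn).
    have hg0 : 0 < (n - j)%:R `^ (- nu) :> R by rewrite powR_gt0// ltr0n.
    have hg1 : (n - j)%:R `^ (- nu) <= 1 :> R.
      by rewrite powRN_le1 ?ler1n// ltW.
    have gS i : (i <= j.+1)%N -> gmeas (past (a + j).+1) (S i).
      move=> ij; apply: gmeas_sum => k; apply: (@gmeas_past _ (a + k).+1); last exact: gZ.
      by rewrite /= ltnS leq_add2l -ltnS (leq_trans (ltn_ord k)).
    have gU : gmeas (past (a + j).+1) (fun w => Z (a + j).+1 w * Tj j w).
      apply: measurable_funM.
        by apply: (@gmeas_past _ (a + j).+1) => //; [rewrite /= leqnn|exact: gZ].
      have g1 := gS _ (leqnn _); have g2 := gS _ (leqnSn _).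
      apply: measurable_funD; last exact: measurable_funX.
      by apply: measurable_funD; [exact: measurable_funX|exact: measurable_funM].
    have gV : gmeas (future ((a + j).+1 + (n - j))) z.
      by apply: (@gmeas_future _ (a + n).+1); [rewrite addSn -addnA subnKC// ltnW|exact: gZ].
    have s0 : 0 < 3 * K * n%:R by rewrite !mulr_gt0// ltr0n.
    have [mT LT2] := LT j.
    have [_ _ LL] := cv_LJ (@past_measurable _) (@future_measurable _) hg0 hg1
      (@mixZ (a + j).+1 (n - j)%N erefl hj) J4 s0 (mZ (ltn0Sn (a + j))) mT gU gV
      (LJ (a + j).+1 erefl) (EJ (a + j).+1 erefl) LT2 (ET _ jn)
      (LJ (a + n).+1 erefl) (EJ (a + n).+1 erefl).
    rewrite /cv Z0// mulr0 subr0 => h; split => //.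
    apply: (le_trans (ler_norm _)); apply: (le_trans h).
    rewrite ler_pM2l ?(mulr_gt0 c18 s0)//.
    by rewrite -powRrM ler_powR ?ler1n// mulNr lerN2.
  rewrite Ex_sum; last by move=> j; case: (H j).
  apply: (@le_trans _ _ (\sum_(j < n) (4 * c + 18) * (3 * K * n%:R) * (n - j)%:R `^ (- (9 / 8)))).
    by apply: ler_sum => j _; case: (H j).
  (* In reverse order the lags n - j run through 1, ..., n. *)
  rewrite -mulr_sumr (reindex_inj rev_ord_inj)/=.
  rewrite (eq_bigr (fun j : 'I_n => (j.+1%:R : R) `^ (- (9 / 8)))); last first.
    by move=> j _; rewrite subKn//.
  rewrite (_ : 27 * (4 * c + 18) * K * n%:R = (4 * c + 18) * (3 * K * n%:R) * 9); last by ring.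
  rewrite ler_wpM2l ?sum_pow98// !mulr_ge0 ?(ltW c18) ?(ltW Kg)//.
have E2 : Ex (fun w => S n w ^+ 2 * z w ^+ 2) <= 2 * K * n%:R.
  have [[mS _] [mz _]] := (LS n, Lz).
  have L2S : L1 (fun w => (S n w ^+ 2) ^+ 2) by under eq_fun do rewrite -exprM; case: (LS n).
  have L2z : L1 (fun w => (z w ^+ 2) ^+ 2) by under eq_fun do rewrite -exprM; case: Lz.
  have [_] := Ex_CS (measurable_funX 2 mS) (measurable_funX 2 mz) L2S L2z.
  under [X in Ex X * _]eq_fun do rewrite -exprM.
  under [X in _ * Ex X]eq_fun do rewrite -exprM.
  move=> h; have h0 : 0 <= 2 * K * n%:R by rewrite !mulr_ge0// ltW.
  rewrite -(@ler_pXn2r _ 2)// ?nnegrE ?Ex_ge0//; last by move=> w; rewrite mulr_ge0 ?sqr_ge0.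
  apply: (le_trans h); rewrite (_ : (2 * K * n%:R) ^+ 2 = (K * n%:R) ^+ 2 * 4); last by ring.
  apply: ler_pM => //; try by apply: Ex_ge0 => w; rewrite exprn_even_ge0.
    exact: IH.
  by rewrite (le_trans (EZ _))// ler_nat.
have L22 : L1 (fun w => S n w ^+ 2 * z w ^+ 2).
  by have := L4_L4 (LS n) Lz; under eq_fun do rewrite exprMn.
have L31 : L1 (fun w => S n w ^+ 3 * z w).
  have := L4_prod (LS n) (LS n) (LS n) Lz; apply: eq_L1 => w; ring.
have [[_ LSn] [_ Lz4]] := (LS n, Lz).
(* The term 4 x y^3 of (x + y)^4 is absorbed by even powers, so that E (S^3 Z) is the only odd term
   left; the two sides differ by 2 (y (x - y))^2. *)
apply: (@le_trans _ _ (Ex (fun w => S n w ^+ 4 + 4 * (S n w ^+ 3 * z w) +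
    8 * (S n w ^+ 2 * z w ^+ 2) + 3 * z w ^+ 4))).
  apply: Ex_le; first by case: (LS n.+1).
    by apply: L1D; [apply: L1D; [apply: L1D|]|] => //; exact: L1Z.
  move=> w; rewrite -/(S n.+1 w) SS; move: (S n w) (z w) => x y.
  rewrite -subr_ge0 (_ : _ - _ = 2 * (y * (x - y)) ^+ 2); last by ring.
  by rewrite mulr_ge0 ?sqr_ge0.
rewrite !ExD ?ExZ//; try by repeat (apply: L1D => //); exact: L1Z.
have h1 := IH _ (leqnn n); have h2 := EZ (a + n)%N.
rewrite -[n.+1%:R]natr1; apply: (@fourth_moment_step _ K n%:R (27 * (4 * c + 18))) => //.
- by rewrite mulr_ge0// ltW.
- by rewrite /K /K4; ring.
Qed.

Lemma LJ_scale (f : T -> R) (b : R) : 0 < b -> measurable_fun setT f ->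
  L1 (fun w => `|f w| `^ J) -> Ex (fun w => `|f w| `^ J) <= b `^ J ->
  L1 (fun w => `|b^-1 * f w| `^ J) /\ Ex (fun w => `|b^-1 * f w| `^ J) <= 1.
Proof.
move=> b0 mf Lf Ef.
have E : (fun w => `|b^-1 * f w| `^ J) = (fun w => (b `^ J)^-1 * `|f w| `^ J).
  apply/funext => w; rewrite normrM powRM//; congr (_ * _).
  rewrite ger0_norm ?invr_ge0 ?(ltW b0)// -powR_inv1 ?(ltW b0)//.
  by rewrite -powRrM mulN1r powRN.
rewrite E ExZ//; split; first exact: L1Z.
by rewrite ler_pdivrMl ?powR_gt0// mulr1.
Qed.

End sums.

Section scaled_sums.
Variables (Z : nat -> T -> R) (c nu J b : R).
Hypotheses (c0 : 0 <= c) (nu0 : 0 < nu) (J4 : 4 < J)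
  (nuJ : 9 / 8 <= nu * ((J - 4) / (2 * J))) (mixZ : mixing_seq c nu).
Hypothesis gZ : forall i, (0 < i)%N -> gmeas (Gs i) (Z i).
Hypothesis Z0 : forall i, (0 < i)%N -> Ex (Z i) = 0.
Hypotheses (b0 : 0 < b) (LJ : forall i, (0 < i)%N -> L1 (fun w => `|Z i w| `^ J))
  (EJ : forall i, (0 < i)%N -> Ex (fun w => `|Z i w| `^ J) <= b `^ J).

Let mZ i : (0 < i)%N -> measurable_fun setT (Z i).
Proof. by move=> i0; apply: gmeas_measurable (@GsT i) _; exact: gZ. Qed.

Lemma L4_of_LJ i : (0 < i)%N -> L4 (Z i) /\ Ex (fun w => Z i w ^+ 4) <= 2 * b ^+ 4.
Proof.
move=> i0; have [LJb EJb] := LJ_scale b0 (mZ i0) (LJ i0) (EJ i0).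
have [LZ EZ] := LJ_L4 (ltW J4) (measurable_funM (measurable_cst b^-1) (mZ i0)) LJb EJb.
have E : Z i = (fun w => b * (b^-1 * Z i w)) by apply/funext => w; rewrite mulrA divff ?gt_eqF// mul1r.
rewrite E; split; first exact: L4Z.
under [X in Ex X]eq_fun do rewrite exprMn.
by rewrite ExZ; [rewrite mulrC ler_pM2r ?exprn_gt0|case: LZ].
Qed.

Lemma fourth_moment (a n : nat) : L4 (fun w => \sum_(i < n) Z (a + i).+1 w) /\
  Ex (fun w => (\sum_(i < n) Z (a + i).+1 w) ^+ 4) <= (K4 c * n%:R * b ^+ 2) ^+ 2.
Proof.
have LS : L4 (fun w => \sum_(i < n) Z (a + i).+1 w).
  by apply: L4_sum => i; case: (@L4_of_LJ (a + i).+1 erefl).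
split => //; pose Zb i w := b^-1 * Z i w.
have gZb i : (0 < i)%N -> gmeas (Gs i) (Zb i).
  by move=> i0; apply: measurable_funM; [exact: measurable_cst|exact: gZ].
have Zb0 i : (0 < i)%N -> Ex (Zb i) = 0.
  move=> i0; rewrite ExZ ?Z0 ?mulr0//.
  by apply: L4_L1; case: (L4_of_LJ i0).
have h1 i (i0 : (0 < i)%N) := LJ_scale b0 (mZ i0) (LJ i0) (EJ i0).
have := fourth_moment_unit c0 nu0 J4 nuJ mixZ gZb Zb0 a n (fun i i0 => (h1 i i0).1) (fun i i0 => (h1 i i0).2).
have -> : (fun w => (\sum_(i < n) Zb (a + i).+1 w) ^+ 4) =
    (fun w => b ^- 4 * (\sum_(i < n) Z (a + i).+1 w) ^+ 4).
  by apply/funext => w; rewrite -mulr_sumr exprMn exprVn.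
rewrite ExZ; last by case: LS.
rewrite ler_pdivrMl ?exprn_gt0// => h; apply: (le_trans h).
by rewrite le_eqVlt; apply/orP; left; apply/eqP; ring.
Qed.

Lemma second_moment (a n : nat) :
  Ex (fun w => (\sum_(i < n) Z (a + i).+1 w) ^+ 2) <= K4 c * n%:R * b ^+ 2.
Proof.
have [LS ES] := fourth_moment a n; have [mS LS4] := LS.
have q0 : 0 <= K4 c * n%:R * b ^+ 2.
  by rewrite !mulr_ge0 ?sqr_ge0// ltW// K4_gt0.
rewrite -(@ler_pXn2r _ 2)// ?nnegrE ?Ex_ge0//; last by move=> w; exact: sqr_ge0.
have L2 : L1 (fun w => ((\sum_(i < n) Z (a + i).+1 w) ^+ 2) ^+ 2).
  by under eq_fun do rewrite -exprM.
have [_] := Ex_CS (measurable_funX 2 mS) (measurable_cst (1 : R)) L2 (L1_cst P (1 ^+ 2)).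
rewrite (_ : (fun w => cst 1 w ^+ 2) = cst 1); last by apply/funext => w /=; rewrite expr1n.
rewrite Ex_cst mulr1; under [X in Ex X ^+ 2]eq_fun do rewrite /= mulr1.
by under [X in _ <= Ex X]eq_fun do rewrite -exprM; move=> h; exact: (le_trans h).
Qed.

End scaled_sums.

(** [cv_L4] after division by 2b and 2b', which brings the fourth moments below 1. As nu >= 9/4, the
    square root of the mixing rate is still at most h^(-9/8). *)
Lemma lag_cov (c nu b b' : R) (U V : T -> R) (i h : nat) : 0 <= c -> 9 / 4 <= nu ->
  mixing_seq c nu -> (0 < i)%N -> (0 < h)%N ->
  gmeas (Gs i) U -> gmeas (Gs (i + h)) V -> 0 < b -> 0 < b' ->
  L4 U -> L4 V -> Ex (fun w => U w ^+ 4) <= 2 * b ^+ 4 ->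
  Ex (fun w => V w ^+ 4) <= 2 * b' ^+ 4 -> Ex V = 0 ->
  `|Ex (fun w => U w * V w)| <= 4 * (4 * c + 10) * b * b' * h%:R `^ (- (9 / 8)).
Proof.
move=> c0 nu94 mixZ i0 h0 gU gV b0 b'0 LU LV EU EV V0.
have sc (f : T -> R) (z : R) : 0 < z -> L4 f -> Ex (fun w => f w ^+ 4) <= 2 * z ^+ 4 ->
    L1 (fun w => ((2 * z)^-1 * f w) ^+ 4) /\ Ex (fun w => ((2 * z)^-1 * f w) ^+ 4) <= 1.
  move=> z0 [mf Lf] Ef; under eq_fun do rewrite exprMn.
  split; first exact: L1Z.
  rewrite ExZ// exprVn ler_pdivrMl ?exprn_gt0 ?mulr_gt0// (le_trans Ef)//.
  by rewrite mulr1 exprMn ler_pM2r ?exprn_gt0// -natrX ler_nat.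
have nu0 : 0 < nu by rewrite (lt_le_trans _ nu94).
have g0 : 0 < h%:R `^ (- nu) :> R by rewrite powR_gt0// ltr0n.
have g1 : h%:R `^ (- nu) <= 1 :> R by rewrite powRN_le1 ?ler1n// ltW.
have gc (G : set (set T)) (f : T -> R) (z : R) : gmeas G f -> gmeas G (fun w => z * f w).
  by move=> gf; apply: measurable_funM => //; exact: measurable_cst.
have gU' : gmeas (past i) U by apply: (@gmeas_past _ i) => //; rewrite i0/=.
have gV' : gmeas (future (i + h)) V by apply: (@gmeas_future _ (i + h)%N).
have [L1U E1U] := sc _ _ b0 LU EU; have [L1V E1V] := sc _ _ b'0 LV EV.
have [_ _ _] := cv_L4 (@past_measurable _) (@future_measurable _) g0 g1 (mixZ i h i0 h0)
  (gc _ _ (2 * b)^-1 gU') (gc _ _ (2 * b')^-1 gV') L1U E1U L1V E1V.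
have e0 : Ex (fun w => (2 * b')^-1 * V w) = 0 by rewrite ExZ ?V0 ?mulr0//; exact: L4_L1.
rewrite /cv e0 mulr0 subr0.
have -> : (fun w => (2 * b)^-1 * U w * ((2 * b')^-1 * V w)) =
    (fun w => (4 * b * b')^-1 * (U w * V w)).
  by apply/funext => w; field; rewrite !gt_eqF.
rewrite ExZ; last exact: L4_mul.
have bb : 0 < 4 * b * b' by rewrite !mulr_gt0.
rewrite normrM ger0_norm ?invr_ge0 ?(ltW bb)// ler_pdivrMl// => H; apply: (le_trans H).
rewrite -powRrM (_ : 4 * (4 * c + 10) * b * b' * _ = 4 * b * b' * ((4 * c + 10) * h%:R `^ (- (9 / 8)))); last by ring.
rewrite ler_pM2l// ler_wpM2l ?addr_ge0 ?mulr_ge0//.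
by rewrite ler_powR ?ler1n// mulNr lerN2 ler_pdivlMr// (le_trans _ nu94)//; lra.
Qed.

End fourth_moments.

(** * Covariance of partial sums and the long-run variance *)

Section covariance_sums.
Context {R : realType}.

(** In the eighth roots a, b of n and n + 1 this is a polynomial inequality under b^8 = a^8 + 1; it
    makes the sum of h^(-1/8) telescope. *)
Lemma pow18_step (n : nat) :
  2 * (n%:R : R) `^ (7 / 8) + n.+1%:R `^ (- (1 / 8)) <= 2 * n.+1%:R `^ (7 / 8).
Proof.
set a : R := n%:R `^ (1 / 8); set b : R := n.+1%:R `^ (1 / 8).
have a0 : 0 <= a by rewrite powR_ge0.
have b0 : 0 < b by rewrite powR_gt0.
have e8 (m : nat) : (m%:R `^ (1 / 8)) ^+ 8 = m%:R :> R.
  by rewrite -powR_mulrn ?powR_ge0// -powRrM divfK// powRr1.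
have e7 (m : nat) : m%:R `^ (7 / 8) = (m%:R `^ (1 / 8)) ^+ 7 :> R.
  by rewrite -powR_mulrn ?powR_ge0// -powRrM; congr (_ `^ _); lra.
have ab : b ^+ 8 = a ^+ 8 + 1 by rewrite !e8 -[n.+1%:R]natr1.
have leab : a <= b.
  by rewrite /a /b; apply: ge0_ler_powR; rewrite ?nnegrE ?ler_nat//; lra.
rewrite !e7 -/a -/b powRN -/b -(@ler_pM2r _ b)// mulrDl mulVf ?gt_eqF//.
have -> : 2 * b ^+ 7 * b = 2 * b ^+ 8 by ring.
rewrite ab.
have h (i j : nat) : (i + j = 7)%N -> a ^+ 7 <= a ^+ i * b ^+ j.
  move=> <-; rewrite exprD ler_wpM2l ?exprn_ge0//.
  by rewrite lerXn2r ?nnegrE// ltW.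
have H : (b - a) * (8 * a ^+ 7) <= 1.
  rewrite [leRHS](_ : _ = b ^+ 8 - a ^+ 8); last by rewrite ab; ring.
  have -> : b ^+ 8 - a ^+ 8 = (b - a) * (b ^+ 7 + a * b ^+ 6 + a ^+ 2 * b ^+ 5 +
    a ^+ 3 * b ^+ 4 + a ^+ 4 * b ^+ 3 + a ^+ 5 * b ^+ 2 + a ^+ 6 * b + a ^+ 7) by ring.
  apply: ler_wpM2l; first by rewrite subr_ge0.
  have := h 6 1 erefl; have := h 5 2 erefl; have := h 4 3 erefl.
  have := h 3 4 erefl; have := h 2 5 erefl; have := h 1 6 erefl; have := h 0 7 erefl.
  by rewrite !expr1 expr0 mul1r; lra.
move: H; rewrite (_ : (b - a) * (8 * a ^+ 7) = 8 * (a ^+ 7 * b) - 8 * a ^+ 8); last by ring.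
by rewrite -mulrA; move: (a ^+ 7 * b) (a ^+ 8) => x y; lra.
Qed.

Lemma sum_pow18 (n : nat) : \sum_(h < n) (h.+1%:R : R) `^ (- (1 / 8)) <= 2 * n%:R `^ (7 / 8).
Proof.
elim: n => [|n IH]; first by rewrite big_ord0 mulr_ge0// powR_ge0.
by rewrite big_ord_recr/= (le_trans _ (pow18_step n))// lerD2r.
Qed.

Lemma sum_pow98_tail (n m : nat) :
  \sum_(h < m) ((n.+1 + h).+1%:R : R) `^ (- (9 / 8)) <= 8 * n.+1%:R `^ (- (1 / 8)).
Proof.
have H : \sum_(h < m) ((n.+1 + h).+1%:R : R) `^ (- (9 / 8)) <=
    8 * (n.+1%:R `^ (- (1 / 8)) - (n.+1 + m)%:R `^ (- (1 / 8))).
  elim: m => [|m IH]; first by rewrite big_ord0 addn0 subrr mulr0.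
  rewrite big_ord_recr/=; have := pow98_step (R := R) (n + m).
  by rewrite addnS !addSn; move: IH; rewrite !addSn; lra.
by rewrite (le_trans H)// ler_pM2l// lerBlDr lerDl powR_ge0.
Qed.

(* The index of the sequence starts at 2, as in the long-run variance. *)
Lemma lim_sum_pow98 (r : nat -> R) (D : R) :
  (forall h, `|r h.+2| <= D * h.+1%:R `^ (- (9 / 8))) ->
  forall p, `|limn (fun m => \sum_(2 <= n < m) r n) - \sum_(h < p.+1) r h.+2| <=
    8 * D * p.+1%:R `^ (- (1 / 8)).
Proof.
move=> rD p; set s := fun m => _.
have sE m : s m.+2 = \sum_(h < m) r h.+2.
  by rewrite /s !big_add1/= big_mkord.
have D0 : 0 <= D by have := le_trans (normr_ge0 _) (rD 0%N); rewrite powR1 mulr1.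
have cs : cvgn s.
  have : cvgn (series (fun h => r h.+2)).
    apply: normed_cvg; apply: nondecreasing_is_cvgn.
      by apply: nondecreasing_series => n _ _; exact: normr_ge0.
    exists (D * 9) => _ [m _ <-].
    apply: (@le_trans _ _ (\sum_(h < m) `|r h.+2|)).
      by rewrite /normed_series_of seriesEord.
    apply: (@le_trans _ _ (\sum_(h < m) D * h.+1%:R `^ (- (9 / 8)))).
      by apply: ler_sum => i _; exact: rD.
    by rewrite -mulr_sumr ler_wpM2l// sum_pow98.
  move=> /cvgP; have -> : series (fun h => r h.+2) = (fun m => s (m + 2)%N).
    by apply/funext => m; rewrite /series/= big_mkord addn2 sE.
  move=> /cvg_ex[l sl]; apply/cvg_ex; exists l; move: sl.
  by rewrite (cvg_shiftn 2).
apply/ler_addgt0Pr => e e0.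
have /cvgrPdist_le /(_ e e0) [N _ HN] := cs.
pose M := (N + p)%N; have := HN M.+3.
rewrite /= => /(_ _); rewrite (_ : (N <= M.+3)%N) ?sE; last by rewrite /M -addnS -addn2 -!addnA leq_addr.
move=> /(_ isT) h.
have hs : \sum_(h < M.+1) r h.+2 = \sum_(h < p.+1) r h.+2 + \sum_(h < N) r (p.+1 + h).+2.
  by rewrite /M -addnS addnC big_split_ord/=.
have ht : `|\sum_(h < N) r (p.+1 + h).+2| <= 8 * D * p.+1%:R `^ (- (1 / 8)).
  apply: (le_trans (ler_norm_sum _ _ _)).
  apply: (@le_trans _ _ (\sum_(h < N) D * (p.+1 + h).+1%:R `^ (- (9 / 8)))).
    by apply: ler_sum => i _; exact: rD.
  by rewrite -mulr_sumr (_ : 8 * D * _ = D * (8 * p.+1%:R `^ (- (1 / 8))));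
    [rewrite ler_wpM2l// sum_pow98_tail|ring].
rewrite (_ : limn s - _ = (limn s - \sum_(h < M.+1) r h.+2) + \sum_(h < N) r (p.+1 + h).+2); last first.
  by rewrite hs; ring.
by rewrite (le_trans (ler_normD _ _))// addrC lerD.
Qed.

Context {d : measure_display} {T : measurableType d}.
Variable P : probability T R.
Local Notation Ex := (Ex P).

(** Appending one index to sums of length k adds the variance term and the lagged covariances in
    both orders up to lag k. This increment tends to c at the rate k^(-1/8), and summation over k
    gives n^(7/8). The two expressions for c force both one-sided series to have the same sum, so
    that doubling one amounts to adding both. *)
Lemma covariance_of_sums (A B : nat -> T -> R) (r r' : nat -> R) (D c : R) :
  (forall i, L4 P (A i.+1)) -> (forall i, L4 P (B i.+1)) ->
  (forall i h, Ex (fun w => A i.+1 w * B (i.+1 + h)%N w) = r h.+1) ->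
  (forall i h, Ex (fun w => B i.+1 w * A (i.+1 + h)%N w) = r' h.+1) ->
  (forall h, `|r h.+2| <= D * h.+1%:R `^ (- (9 / 8))) ->
  (forall h, `|r' h.+2| <= D * h.+1%:R `^ (- (9 / 8))) ->
  c = r 1%N + 2 * limn (fun m => \sum_(2 <= n < m) r n) ->
  c = r' 1%N + 2 * limn (fun m => \sum_(2 <= n < m) r' n) ->
  forall a n, `|Ex (fun w => (\sum_(i < n) A (a + i).+1 w) * (\sum_(i < n) B (a + i).+1 w)) - n%:R * c|
    <= 100 * D * n%:R `^ (7 / 8).
Proof.
move=> LA LB rE rE' rD rD' cE cE' a n.
set lr := limn _ in cE; set lr' := limn _ in cE'.
have D0 : 0 <= D by have := le_trans (normr_ge0 _) (rD 0%N); rewrite powR1 mulr1.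
have r1 : r 1%N = r' 1%N.
  have := rE 0%N 0%N; have := rE' 0%N 0%N; rewrite !addn0 => <- <-.
  by congr Ex; apply/funext => w; rewrite mulrC.
have lrr : lr = lr' by move: cE; rewrite cE' r1; lra.
(* At k = 0, where the power has base 0, a constant takes its place. *)
have tl k : `|c - (r 1%N + \sum_(h < k) (r h.+2 + r' h.+2))| <= 16 * D * (if k is j.+1 then k%:R `^ (- (1 / 8)) else 2).
  rewrite cE (_ : _ - _ = (lr - \sum_(h < k) r h.+2) + (lr' - \sum_(h < k) r' h.+2)); last first.
    by rewrite -lrr big_split/=; ring.
  rewrite (le_trans (ler_normD _ _))//.
  case: k => [|k]; last first.
    have := lim_sum_pow98 rD k; have := lim_sum_pow98 rD' k.
    by rewrite -/lr -/lr'; move: (_ `^ _) => x; lra.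
  rewrite !big_ord0 !subr0.
  have := lim_sum_pow98 rD 0; have := lim_sum_pow98 rD' 0.
  rewrite -/lr -/lr' !big_ord1 !powR1.
  have := rD 0%N; have := rD' 0%N; rewrite !powR1.
  have := ler_normD (lr - r 2%N) (r 2%N); have := ler_normD (lr' - r' 2%N) (r' 2%N).
  by rewrite !subrK; lra.
pose SA n w := \sum_(i < n) A (a + i).+1 w; pose SB n w := \sum_(i < n) B (a + i).+1 w.
have LSA k : L4 P (SA k) by apply: L4_sum.
have LSB k : L4 P (SB k) by apply: L4_sum.
have step k : Ex (fun w => SA k.+1 w * SB k.+1 w) =
    Ex (fun w => SA k w * SB k w) + (r 1%N + \sum_(h < k) (r h.+2 + r' h.+2)).
  have -> : (fun w => SA k.+1 w * SB k.+1 w) = (fun w => SA k w * SB k w +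
      (A (a + k).+1 w * B (a + k).+1 w + \sum_(j < k)
       (A (a + j).+1 w * B (a + k).+1 w + B (a + j).+1 w * A (a + k).+1 w))).
    apply/funext => w; rewrite /SA /SB !big_ord_recr/= big_split/= -!mulr_suml; ring.
  have Lj i j : L1 P (fun w => A i.+1 w * B j.+1 w) by exact: L4_mul.
  have Lj' i j : L1 P (fun w => B i.+1 w * A j.+1 w) by exact: L4_mul.
  have Ls : L1 P (fun w => \sum_(j < k) (A (a + j).+1 w * B (a + k).+1 w + B (a + j).+1 w * A (a + k).+1 w)).
    by apply: L1_sum => j; exact: L1D.
  rewrite ExD; [|exact: L4_mul|exact: L1D].
  rewrite ExD//; congr (_ + (_ + _)).
    by have := rE (a + k)%N 0%N; rewrite addn0.
  rewrite Ex_sum; last by move=> j; exact: L1D.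
  rewrite (reindex_inj rev_ord_inj)/=; apply: eq_bigr => j _.
  rewrite ExD//.
  have e : ((a + (k - j.+1)).+1 + j.+1 = (a + k).+1)%N by rewrite addSn -addnA subnK.
  by have := rE (a + (k - j.+1))%N j.+1; have := rE' (a + (k - j.+1))%N j.+1; rewrite e => -> ->.
have D0n k : 0 <= D * k%:R `^ (7 / 8) by rewrite mulr_ge0 ?powR_ge0.
have H k : `|Ex (fun w => SA k w * SB k w) - k%:R * c| <=
    \sum_(j < k) 16 * D * (if nat_of_ord j is _.+1 then (j%:R : R) `^ (- (1 / 8)) else 2).
  elim: k => [|k IH].
    rewrite big_ord0 mul0r subr0 /SA.
    by under [X in Ex X]eq_fun do rewrite big_ord0 mul0r; rewrite Ex_cst normr0.
  rewrite step big_ord_recr/= -[k.+1%:R]natr1.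
  rewrite (_ : _ - _ = (Ex (fun w => SA k w * SB k w) - k%:R * c) -
    (c - (r 1%N + \sum_(h < k) (r h.+2 + r' h.+2)))); last by ring.
  by rewrite (le_trans (ler_normB _ _))// lerD.
apply: (le_trans (H n)); case: n => [|n]; first by rewrite big_ord0 -mulrA mulr_ge0.
rewrite big_ord_recl/= -mulr_sumr.
have h1 : \sum_(i < n) ((bump 0 i)%:R : R) `^ (- (1 / 8)) <= 2 * n.+1%:R `^ (7 / 8).
  apply: (le_trans (sum_pow18 n)); rewrite ler_pM2l//.
  by apply: ge0_ler_powR; rewrite ?nnegrE ?ler_nat.
have h2 : 1 <= n.+1%:R `^ (7 / 8) :> R.
  by rewrite -[leLHS](powRr0 (n.+1%:R : R)) ler_powR// ler1n.
have h3 : 16 * D * (\sum_(i < n) ((bump 0 i)%:R : R) `^ (- (1 / 8))) <= 16 * D * (2 * n.+1%:R `^ (7 / 8)).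
  by rewrite ler_wpM2l// mulr_ge0.
have h4 : D * 1 <= D * n.+1%:R `^ (7 / 8) by rewrite ler_wpM2l.
by move: h3 h4; rewrite -!mulrA (mulrCA D 2); move: (D * (_ `^ _)) (D * \sum_(_ < _) _) => x y; lra.
Qed.

End covariance_sums.

(** * Smooth approximation of indicators *)

Section jets.
Context {R : realType}.
Implicit Types (x y t h L M : R) (a b : nat -> R -> R).

(* [a 0], [a 1], [a 2] behave like a function and its first two derivatives, the
   second one being Lipschitz. *)
Record jet L a : Prop := {
  jet_bound : forall j x, (j <= 2)%N -> `|a j x| <= L ;
  jet_lip : forall j x t, (j <= 2)%N -> `|a j (x + t) - a j x| <= L * `|t| ;
  jet_taylor2 : forall j x t, (j <= 1)%N ->
    `|a j (x + t) - a j x - t * a j.+1 x| <= L * `|t| ^+ 2 ;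
  jet_taylor3 : forall x t,
    `|a 0%N (x + t) - a 0%N x - t * a 1%N x - t ^+ 2 / 2 * a 2%N x| <= L * `|t| ^+ 3 }.

Lemma jet_const L c : 0 <= L -> `|c| <= L -> jet L (fun j _ => if j == 0%N then c else 0).
Proof.
move=> L0 cL; split => [[|j] x _|[|j] x t _|[|j] x t _|x t] //=;
  rewrite ?normr0 ?mulr0 ?subrr ?subr0 ?normr0 ?mulr_ge0 ?exprn_ge0//.
Qed.

Lemma jetB L L' a b : jet L a -> jet L' b -> jet (L + L') (fun j x => a j x - b j x).
Proof.
move=> [A0 A1 A2 A3] [B0 B1 B2 B3]; split.
- by move=> j x j2; rewrite (le_trans (ler_normB _ _))// lerD ?A0 ?B0.
- move=> j x t j2; rewrite (_ : _ - _ = (a j (x + t) - a j x) - (b j (x + t) - b j x)); last by ring.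
  by rewrite mulrDl (le_trans (ler_normB _ _))// lerD ?A1 ?B1.
- move=> j x t j2; rewrite (_ : _ - _ = (a j (x + t) - a j x - t * a j.+1 x) -
    (b j (x + t) - b j x - t * b j.+1 x)); last by ring.
  by rewrite mulrDl (le_trans (ler_normB _ _))// lerD ?A2 ?B2.
- move=> x t; rewrite (_ : _ - _ = (a 0%N (x + t) - a 0%N x - t * a 1%N x - t ^+ 2 / 2 * a 2%N x) -
    (b 0%N (x + t) - b 0%N x - t * b 1%N x - t ^+ 2 / 2 * b 2%N x)); last by ring.
  by rewrite mulrDl (le_trans (ler_normB _ _))// lerD ?A3 ?B3.
Qed.

(** Each order of differentiation costs 1/h and at most three orders occur; as h <= 1, the factor
    h^(-3) covers them all. *)
Lemma jet_affine L a h M : 0 <= L -> 0 < h -> h <= 1 -> jet L a ->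
  jet (L / h ^+ 3) (fun j x => a j (x / h + M) / h ^+ j).
Proof.
move=> L0 h0 h1 [A0 A1 A2 A3].
have hj j x : (j <= 3)%N -> 0 <= x -> x / h ^+ j <= x / h ^+ 3.
  move=> j3 x0; rewrite ler_wpM2l// lef_pV2 ?posrE ?exprn_gt0//.
  by rewrite ler_wiXn2l// ltW.
have hV j x : `|x / h ^+ j| = `|x| / h ^+ j.
  by rewrite normrM normfV [`|h ^+ j|]ger0_norm// exprn_ge0// ltW.
have sh x t : (x + t) / h + M = (x / h + M) + t / h by rewrite mulrDl addrAC.
have nt t : `|t / h| = `|t| / h by rewrite -{1}[h]expr1 hV expr1.
split.
- move=> j x j2; rewrite hV (le_trans _ (hj j L _ _))//; last by rewrite (leq_trans j2).
  by rewrite ler_wpM2r ?A0// invr_ge0 exprn_ge0// ltW.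
- move=> j x t j2; rewrite sh -mulrBl hV.
  apply: (@le_trans _ _ (L * `|t| / h ^+ j.+1)).
    rewrite ler_pdivrMr ?exprn_gt0// (le_trans (A1 _ _ _ j2))// nt.
    rewrite le_eqVlt; apply/orP; left; apply/eqP; rewrite !exprS; field.
    by rewrite expf_neq0 lt0r_neq0.
  by rewrite [leRHS]mulrAC hj// mulr_ge0.
- move=> j x t j1; rewrite sh.
  rewrite (_ : _ - _ = (a j (x / h + M + t / h) - a j (x / h + M) - t / h * a j.+1 (x / h + M)) / h ^+ j); last first.
    by rewrite exprS; field; rewrite expf_neq0 lt0r_neq0.
  rewrite hV; apply: (@le_trans _ _ (L * `|t| ^+ 2 / h ^+ j.+2)).
    rewrite ler_pdivrMr ?exprn_gt0// (le_trans (A2 _ _ _ j1))// nt.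
    rewrite le_eqVlt; apply/orP; left; apply/eqP; rewrite !exprS; field.
    by rewrite expf_neq0 lt0r_neq0.
  by rewrite [leRHS]mulrAC hj// mulr_ge0// exprn_ge0.
- move=> x t; rewrite sh.
  rewrite (_ : _ - _ = a 0%N (x / h + M + t / h) - a 0%N (x / h + M) - t / h * a 1%N (x / h + M) -
    (t / h) ^+ 2 / 2 * a 2%N (x / h + M)); last by field; rewrite gt_eqF.
  by rewrite (le_trans (A3 _ _))// nt expr_div_n mulrA mulrAC.
Qed.

(** The positive part; its powers are the truncated powers of which B-splines are combinations. *)
Definition pp x : R := Num.max 0 x.

Lemma pp_taylor1 x t : `|pp (x + t) - pp x| <= `|t|.
Proof.
rewrite /pp; case: (leP 0 (x + t)) => h1; case: (leP 0 x) => h2.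
- by rewrite addrAC subrr add0r.
- by rewrite subr0 (ger0_norm h1) ger0_norm; lra.
- by rewrite sub0r normrN (ger0_norm h2) ltr0_norm; lra.
- by rewrite subrr normr0.
Qed.

Lemma pp_taylor2 x t : `|pp (x + t) ^+ 2 - pp x ^+ 2 - t * (2 * pp x)| <= `|t| ^+ 2.
Proof.
rewrite /pp real_normK ?num_real//; case: (leP 0 (x + t)) => h1; case: (leP 0 x) => h2; rewrite ler_norml.
- by rewrite (_ : _ - _ = t ^+ 2); [have := sqr_ge0 t; lra|ring].
- rewrite expr0n/= !mulr0 !subr0; apply/andP; split; first by have := sqr_ge0 t; have := sqr_ge0 (x + t); lra.
  by rewrite ler_pXn2r ?nnegrE//; lra.
- rewrite expr0n/= sub0r (_ : - _ - _ = t ^+ 2 - (x + t) ^+ 2); last by ring.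
  have h3 : (x + t) ^+ 2 <= t ^+ 2.
    rewrite -subr_ge0 (_ : _ - _ = x * (- (x + t) + - t)); last by ring.
    by rewrite mulr_ge0//; lra.
  by have := sqr_ge0 (x + t); lra.
- by rewrite expr0n/= !mulr0 !subr0; have := sqr_ge0 t; lra.
Qed.

(** The truncated cube keeps the remainder of the cube, |t|^3, even if the kink at 0 lies between x
    and x + t. *)
Lemma pp_taylor3 x t :
  `|pp (x + t) ^+ 3 - pp x ^+ 3 - t * (3 * pp x ^+ 2) - t ^+ 2 * (3 * pp x)| <= `|t| ^+ 3.
Proof.
rewrite /pp; case: (leP 0 (x + t)) => h1; case: (leP 0 x) => h2; rewrite ?expr0n/=.
- by rewrite (_ : _ - _ = t ^+ 3); [rewrite normrX|ring].
- rewrite !mulr0 !subr0 (ger0_norm (exprn_ge0 _ h1)) (@ger0_norm _ t); last by lra.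
  by rewrite ler_pXn2r ?nnegrE//; lra.
- rewrite (_ : _ - _ = t ^+ 3 - (x + t) ^+ 3); last by ring.
  have h3 : 0 <= - (x + t) by lra.
  have h4 : (- (x + t)) ^+ 3 <= (- t) ^+ 3 by rewrite ler_pXn2r ?nnegrE//; lra.
  have h5 : 0 <= (- (x + t)) ^+ 3 by rewrite exprn_ge0.
  move: h4 h5; rewrite (_ : (- (x + t)) ^+ 3 = - (x + t) ^+ 3); last by ring.
  rewrite (_ : (- t) ^+ 3 = - t ^+ 3); last by ring.
  move=> h4 h5; rewrite (@ler0_norm _ t); last by lra.
  rewrite (_ : (- t) ^+ 3 = - t ^+ 3); last by ring.
  by rewrite ler_norml; lra.
- by rewrite !mulr0 !subr0 normr0 exprn_ge0.
Qed.

(* The cumulative quadratic B-spline and its derivatives: a C^{2,1} step from 0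
   (left of 0) to 1 (right of 3). *)
Definition step (j : nat) x : R :=
  match j with
  | 0 => (pp x ^+ 3 - 3 * pp (x - 1) ^+ 3 + 3 * pp (x - 2) ^+ 3 - pp (x - 3) ^+ 3) / 6
  | 1 => (pp x ^+ 2 - 3 * pp (x - 1) ^+ 2 + 3 * pp (x - 2) ^+ 2 - pp (x - 3) ^+ 2) / 2
  | _ => pp x - 3 * pp (x - 1) + 3 * pp (x - 2) - pp (x - 3)
  end.

Lemma ppE x : (0 <= x -> pp x = x) * (x <= 0 -> pp x = 0).
Proof. by rewrite /pp; split=> h; [rewrite max_r|rewrite max_l]. Qed.

Lemma step_le0 j x : x <= 0 -> step j x = 0.
Proof.
move=> x0; have h : [/\ pp x = 0, pp (x - 1) = 0, pp (x - 2) = 0 & pp (x - 3) = 0].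
  by split; apply: (ppE _).2; lra.
by case: h => h1 h2 h3 h4; case: j => [|[|j]]; rewrite /step h1 h2 h3 h4; lra.
Qed.

Lemma step_ge3 x : 3 <= x -> step 0 x = 1 /\ forall j, step j.+1 x = 0.
Proof.
move=> x0; have h : [/\ pp x = x, pp (x - 1) = x - 1, pp (x - 2) = x - 2 & pp (x - 3) = x - 3].
  by split; apply: (ppE _).1; lra.
by case: h => h1 h2 h3 h4; split=> [|[|j]]; rewrite /step h1 h2 h3 h4; field.
Qed.

Lemma step_mid x : 0 <= x <= 3 ->
  [/\ 0 <= step 0 x <= 1, 0 <= step 1 x <= 1 & -3 <= step 2 x <= 3].
Proof.
move=> /andP[x0 x3].
have p0 : pp x = x by apply: (ppE _).1.
have p3 : pp (x - 3) = 0 by apply: (ppE _).2; lra.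
have [h1|h1] := leP x 1; [|have [h2|h2] := leP x 2].
- have p1 : pp (x - 1) = 0 by apply: (ppE _).2; lra.
  have p2 : pp (x - 2) = 0 by apply: (ppE _).2; lra.
  have h3 : 0 <= x ^+ 2 <= 1 by rewrite sqr_ge0 expr_le1.
  have h4 : 0 <= x ^+ 3 <= 1 by rewrite exprn_ge0// expr_le1.
  by rewrite /step p0 p1 p2 p3 !expr0n/=; split; lra.
- have p1 : pp (x - 1) = x - 1 by apply: (ppE _).1; lra.
  have p2 : pp (x - 2) = 0 by apply: (ppE _).2; lra.
  rewrite /step p0 p1 p2 p3 !expr0n/=.
  have e : x = 1 + (x - 1) by ring.
  move: e; have : 0 <= x - 1 <= 1 by lra.
  move: (x - 1) => y /andP[y0 y1] ->.
  have h3 : 0 <= y ^+ 2 <= 1 by rewrite sqr_ge0 expr_le1.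
  have h4 : 0 <= y ^+ 3 <= 1 by rewrite exprn_ge0// expr_le1.
  have h5 : y ^+ 3 <= y ^+ 2 by rewrite ler_wiXn2l.
  have h6 : y ^+ 2 <= y by rewrite -[leRHS]expr1 ler_wiXn2l.
  have e3 : (1 + y) ^+ 3 = 1 + 3 * y + 3 * y ^+ 2 + y ^+ 3 by ring.
  have e2 : (1 + y) ^+ 2 = 1 + 2 * y + y ^+ 2 by ring.
  have h7 : 0 <= (2 * y - 1) ^+ 2 by rewrite sqr_ge0.
  rewrite (_ : (2 * y - 1) ^+ 2 = 4 * y ^+ 2 - 4 * y + 1) in h7; last by ring.
  have h8 : 0 <= (1 - y) ^+ 2 * (1 + 2 * y) by rewrite mulr_ge0 ?sqr_ge0//; lra.
  rewrite (_ : _ * _ = 1 - 3 * y ^+ 2 + 2 * y ^+ 3) in h8; last by ring.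
  by rewrite e3 e2; split; lra.
- have p1 : pp (x - 1) = x - 1 by apply: (ppE _).1; lra.
  have p2 : pp (x - 2) = x - 2 by apply: (ppE _).1; lra.
  rewrite /step p0 p1 p2 p3 !expr0n/=.
  have e : x = 3 - (3 - x) by ring.
  move: e; have : 0 <= 3 - x <= 1 by lra.
  move: (3 - x) => y /andP[y0 y1] ->.
  have h3 : 0 <= y ^+ 2 <= 1 by rewrite sqr_ge0 expr_le1.
  have h4 : 0 <= y ^+ 3 <= 1 by rewrite exprn_ge0// expr_le1.
  have -> : ((3 - y) ^+ 3 - 3 * (3 - y - 1) ^+ 3 + 3 * (3 - y - 2) ^+ 3 - 0) / 6 = 1 - y ^+ 3 / 6 by field.
  have -> : ((3 - y) ^+ 2 - 3 * (3 - y - 1) ^+ 2 + 3 * (3 - y - 2) ^+ 2 - 0) / 2 = y ^+ 2 / 2 by field.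
  by split; lra.
Qed.

Lemma step_bounds x : [/\ 0 <= step 0 x <= 1, 0 <= step 1 x <= 1 & -3 <= step 2 x <= 3].
Proof.
have [x0|x0] := leP x 0; first by rewrite !step_le0//; split; lra.
have [x3|x3] := leP 3 x; last by apply: step_mid; lra.
by have [-> h] := step_ge3 x3; rewrite !h; split; lra.
Qed.

(** The coefficients 1, 3, 3, 1 add up to 8, so the remainders of the truncated powers give 8, 8/2
    and 8/6 at the three orders. The estimates of lower order follow from these for |t| <= 1 and
    from the boundedness of the entries for |t| > 1. *)
Lemma step_jet : jet 8 step.
Proof.
have b x := step_bounds x.
have T3 x t : `|step 0 (x + t) - step 0 x - t * step 1 x - t ^+ 2 / 2 * step 2 x| <= 2 * `|t| ^+ 3.
  have := pp_taylor3 x t; have := pp_taylor3 (x - 1) t.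
  have := pp_taylor3 (x - 2) t; have := pp_taylor3 (x - 3) t.
  rewrite /step ![x - _ + t]addrAC.
  set p0 := pp (x + t); set p1 := pp (x + t - 1); set p2 := pp (x + t - 2); set p3 := pp (x + t - 3).
  set q0 := pp x; set q1 := pp (x - 1); set q2 := pp (x - 2); set q3 := pp (x - 3).
  set A := p3 ^+ 3 - _ - _ - _; set B := p2 ^+ 3 - _ - _ - _; set C := p1 ^+ 3 - _ - _ - _; set D := p0 ^+ 3 - _ - _ - _.
  rewrite (_ : _ - _ = (D - 3 * C + 3 * B - A) / 6); last by rewrite /A /B /C /D; field.
  by move: (`|t| ^+ 3) => u; rewrite !ler_norml; move: A B C D => A B C D; lra.
have T2 x t : `|step 1 (x + t) - step 1 x - t * step 2 x| <= 4 * `|t| ^+ 2.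
  have := pp_taylor2 x t; have := pp_taylor2 (x - 1) t.
  have := pp_taylor2 (x - 2) t; have := pp_taylor2 (x - 3) t.
  rewrite /step ![x - _ + t]addrAC.
  set p0 := pp (x + t); set p1 := pp (x + t - 1); set p2 := pp (x + t - 2); set p3 := pp (x + t - 3).
  set q0 := pp x; set q1 := pp (x - 1); set q2 := pp (x - 2); set q3 := pp (x - 3).
  set A := p3 ^+ 2 - _ - _; set B := p2 ^+ 2 - _ - _; set C := p1 ^+ 2 - _ - _; set D := p0 ^+ 2 - _ - _.
  rewrite (_ : _ - _ = (D - 3 * C + 3 * B - A) / 2); last by rewrite /A /B /C /D; field.
  by move: (`|t| ^+ 2) => u; rewrite !ler_norml; move: A B C D => A B C D; lra.
have T1 x t : `|step 2 (x + t) - step 2 x| <= 8 * `|t|.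
  have := pp_taylor1 x t; have := pp_taylor1 (x - 1) t.
  have := pp_taylor1 (x - 2) t; have := pp_taylor1 (x - 3) t.
  by rewrite /step ![x - _ + t]addrAC; move: (`|t|) => u; rewrite !ler_norml; lra.
have t0 t : 0 <= `|t| by [].
have small t : `|t| <= 1 -> `|t| ^+ 3 <= `|t| ^+ 2 /\ `|t| ^+ 2 <= `|t|.
  by move=> t1; split; [rewrite ler_wiXn2l|rewrite -[leRHS]expr1 ler_wiXn2l].
have large t : 1 <= `|t| -> `|t| <= `|t| ^+ 2 by move=> t1; rewrite -[leLHS]expr1 ler_weXn2l.
have tt t (c : R) : -3 <= c <= 3 -> - (3 * `|t|) <= t * c <= 3 * `|t|.
  move=> /andP[c1 c2]; rewrite -ler_norml normrM mulrC ler_wpM2r// ler_norml; lra.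
have tt2 t (c : R) : -3 <= c <= 3 -> - (3 / 2 * `|t| ^+ 2) <= t ^+ 2 / 2 * c <= 3 / 2 * `|t| ^+ 2.
  move=> /andP[c1 c2]; rewrite -ler_norml real_normK ?num_real//.
  rewrite normrM (@ger0_norm _ (t ^+ 2 / 2)) ?divr_ge0 ?sqr_ge0//.
  rewrite (_ : 3 / 2 * t ^+ 2 = t ^+ 2 / 2 * 3); last by field.
  by rewrite ler_wpM2l ?divr_ge0 ?sqr_ge0// ler_norml c1 c2.
have S2 x t : `|step 0 (x + t) - step 0 x - t * step 1 x| <= 8 * `|t| ^+ 2.
  have [b1 b2 b3] := b x; have [b4 _ _] := b (x + t).
  have b2' : -3 <= step 1 x <= 3 by lra.
  have := T3 x t; have := tt2 t _ b3; have := tt t _ b2'; have := t0 t.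
  move: (t * step 1 x) (t ^+ 2 / 2 * step 2 x) => u v.
  have [/small[h1 h2]|/ltW h] := leP `|t| 1.
    move: h1 h2; move: (`|t| ^+ 3) (`|t| ^+ 2) => c e h1 h2 h3 h4 h5.
    by rewrite !ler_norml; lra.
  have := large _ h; move: (`|t| ^+ 3) (`|t| ^+ 2) => c e h1 h2 h3 h4 h5.
  by rewrite ler_norml; lra.
split.
- move=> [|[|[|j]]] x //= _; have [b1 b2 b3] := b x; rewrite ler_norml; move: b1 b2 b3; rewrite /step; lra.
- move=> [|[|[|j]]] x t //= _.
  + have [b1 b2 b3] := b x; have [b4 _ _] := b (x + t).
    have b2' : -3 <= step 1 x <= 3 by lra.
    have := T3 x t; have := tt t _ b2'; have := tt2 t _ b3; have := t0 t.
    rewrite -/(step 0 (x + t)) -/(step 0 x).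
    move: (t * step 1 x) (t ^+ 2 / 2 * step 2 x) => u v.
    have [/small[h1 h2]|/ltW h] := leP `|t| 1.
      by move: h1 h2; move: (`|t| ^+ 3) (`|t| ^+ 2) => c e h1 h2 h3 h4 h5; rewrite !ler_norml; lra.
    by move=> *; rewrite ler_norml; lra.
  + have [b1 b2 b3] := b x; have [_ b4 _] := b (x + t).
    have := T2 x t; have := tt t _ b3; have := t0 t.
    rewrite -/(step 1 (x + t)) -/(step 1 x).
    move: (t * step 2 x) => u.
    have [/small[h1 h2]|/ltW h] := leP `|t| 1.
      by move: h1 h2; move: (`|t| ^+ 3) (`|t| ^+ 2) => c e h1 h2 h3 h4; rewrite !ler_norml; lra.
    by move=> *; rewrite ler_norml; lra.
  + exact: T1.
- move=> [|[|j]] x t //= _; first exact: S2.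
  by rewrite (le_trans (T2 _ _))// ler_wpM2r ?exprn_ge0//; lra.
- by move=> x t; rewrite (le_trans (T3 _ _))// ler_wpM2r ?exprn_ge0//; lra.
Qed.

(** It makes the differences of consecutive translates nonnegative, as a partition of unity
    requires. *)
Lemma step_mono x : step 0 (x - 1) <= step 0 x.
Proof.
have [b1 _ _] := step_bounds x; have [b2 _ _] := step_bounds (x - 1).
have [h0|h0] := leP x 1; first by rewrite (step_le0 0 (x := x - 1)); lra.
have [h3|h3] := leP 3 x; first by rewrite (step_ge3 h3).1; lra.
have p0 : pp x = x by apply: (ppE _).1; lra.
have p1 : pp (x - 1) = x - 1 by apply: (ppE _).1; lra.
have p3 : pp (x - 3) = 0 by apply: (ppE _).2; lra.
have p4 : pp (x - 1 - 2) = 0 by apply: (ppE _).2; lra.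
have p5 : pp (x - 1 - 3) = 0 by apply: (ppE _).2; lra.
have [h2|h2] := leP x 2.
  have p2 : pp (x - 2) = 0 by apply: (ppE _).2; lra.
  have p6 : pp (x - 1 - 1) = 0 by apply: (ppE _).2; lra.
  rewrite /step p0 p1 p2 p3 p4 p5 p6 !expr0n/=.
  have : 0 <= (2 - x) * (x - 1) by rewrite mulr_ge0; lra.
  have e : x = 1 + (x - 1) by ring.
  move: e; have : 0 < x - 1 <= 1 by lra.
  move: (x - 1) => y /andP[y0 y1] -> _.
  have h6 : y ^+ 3 <= y by rewrite -[leRHS]expr1 ler_wiXn2l// ltW.
  have h7 : 0 <= y ^+ 2 by rewrite sqr_ge0.
  have e3 : (1 + y) ^+ 3 = 1 + 3 * y + 3 * y ^+ 2 + y ^+ 3 by ring.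
  by rewrite e3; lra.
have p2 : pp (x - 2) = x - 2 by apply: (ppE _).1; lra.
have p6 : pp (x - 1 - 1) = x - 1 - 1 by apply: (ppE _).1; lra.
rewrite /step p0 p1 p2 p3 p4 p5 p6 !expr0n/=.
have e : x = 2 + (x - 2) by ring.
move: e; have : 0 < x - 2 <= 1 by lra.
move: (x - 2) => y /andP[y0 y1] ->.
have h6 : y ^+ 3 <= 1 by rewrite expr_le1// ltW.
have h7 : y ^+ 2 <= 1 by rewrite expr_le1// ltW.
have h8 : 0 <= y ^+ 3 by rewrite exprn_ge0// ltW.
have h9 : y ^+ 2 <= y by rewrite -[leRHS]expr1 ler_wiXn2l// ltW.
rewrite -subr_ge0 (_ : _ - _ = (4 - 6 * y ^+ 2 + 3 * y ^+ 3) / 6); last by field.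
by rewrite divr_ge0//; have : 3 * (y ^+ 2 - y ^+ 3) <= 1; [nra|lra].
Qed.

End jets.
Arguments step : simpl never.

Section smoothing.
Context {R : realType} {Q : finType}.
Implicit Types (x y : Q -> R) (f psi : (Q -> R) -> R).

Definition n1 y : R := \sum_i `|y i|.

Definition fadd x y : Q -> R := fun i => x i + y i.

(** Stated by composition over all measurable spaces: no sigma-algebra on [Q -> R] has to be chosen,
    and the property serves under both probabilities and under sub-sigma-algebras. *)
Definition preserves_measurability psi : Prop :=
  forall (d : measure_display) (T : measurableType d) (S : T -> Q -> R),
    (forall i, measurable_fun setT (fun w => S w i)) ->
    measurable_fun setT (fun w => psi (S w)).

(** [g] and [H] play the roles of gradient and Hessian, but only bounds and expansions are recorded.
    The remainder is in the l1 norm, for which moving the coordinates one at a time loses no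
    constant. *)
Record smooth (L : R) f (g : Q -> (Q -> R) -> R) (H : Q -> Q -> (Q -> R) -> R) : Prop := {
  sm_f : forall x, `|f x| <= L ;
  sm_g : forall i x, `|g i x| <= L ;
  sm_H : forall i j x, `|H i j x| <= L ;
  sm_lip : forall x y, `|f (fadd x y) - f x| <= L * n1 y ;
  sm_taylor : forall x y, `|f (fadd x y) - f x - \sum_i g i x * y i -
    2^-1 * \sum_i \sum_j H i j x * (y i * y j)| <= L * n1 y ^+ 3 ;
  sm_mf : preserves_measurability f ;
  sm_mg : forall i, preserves_measurability (g i) ;
  sm_mH : forall i j, preserves_measurability (H i j) }.

(** * From expansions in each coordinate to a joint expansion *)

Section telescoping.
Variables (L : R) (F : (Q -> nat) -> (Q -> R) -> R).
Hypothesis L0 : 0 <= L.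

Definition addc x (i : Q) (t : R) : Q -> R := fun l => if l == i then x l + t else x l.
Definition ei (i : Q) : Q -> nat := fun l => (l == i).
(** A multi-index of derivatives; on the diagonal its value is 2, the pure second derivative. *)
Definition eij (i j : Q) : Q -> nat := fun l => ((l == i) + (l == j))%N.

Hypothesis Flip0 : forall x i t, `|F (fun=> 0%N) (addc x i t) - F (fun=> 0%N) x| <= L * `|t|.
Hypothesis Flip2 : forall j k x i t, `|F (eij j k) (addc x i t) - F (eij j k) x| <= L * `|t|.
Hypothesis Ftaylor2 : forall j x i t,
  `|F (ei j) (addc x i t) - F (ei j) x - t * F (eij j i) x| <= L * `|t| ^+ 2.
Hypothesis Ftaylor3 : forall x i t,
  `|F (fun=> 0%N) (addc x i t) - F (fun=> 0%N) x - t * F (ei i) x -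
    t ^+ 2 / 2 * F (eij i i) x| <= L * `|t| ^+ 3.

Let part (s : seq Q) x y : Q -> R := fun l => if l \in s then x l + y l else x l.
Let ns (s : seq Q) y : R := \sum_(i <- s) `|y i|.

Let part_cons i s x y : i \notin s -> part (i :: s) x y = addc (part s x y) i (y i).
Proof.
move=> nis; apply/funext => l; rewrite /part /addc inE.
by case: eqP => [->|_] //=; rewrite (negPf nis).
Qed.

Let ns_ge0 s y : 0 <= ns s y. Proof. exact: sumr_ge0. Qed.

Let ns_cons i s y : ns (i :: s) y = `|y i| + ns s y.
Proof. by rewrite /ns big_cons. Qed.

Let lip_part (G : (Q -> R) -> R) : (forall x i t, `|G (addc x i t) - G x| <= L * `|t|) ->
  forall s x y, uniq s -> `|G (part s x y) - G x| <= L * ns s y.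
Proof.
move=> HG; elim=> [|i s IH] x y /=.
  by move=> _; rewrite /part /ns big_nil mulr0 subrr normr0.
move=> /andP[nis us]; rewrite part_cons// ns_cons mulrDr.
rewrite (_ : _ - _ = (G (addc (part s x y) i (y i)) - G (part s x y)) +
  (G (part s x y) - G x)); last by ring.
by rewrite (le_trans (ler_normD _ _))// lerD ?HG ?IH.
Qed.

Let taylor2_part j s x y : uniq s ->
  `|F (ei j) (part s x y) - F (ei j) x - \sum_(i <- s) y i * F (eij j i) x| <= L * ns s y ^+ 2.
Proof.
elim: s => [|i s IH] /=.
  by move=> _; rewrite /part /ns !big_nil expr0n/= mulr0 subrr subr0 normr0.
move=> /andP[nis us]; rewrite part_cons// ns_cons big_cons.
set z := part s x y.
rewrite (_ : _ - _ = (F (ei j) (addc z i (y i)) - F (ei j) z - y i * F (eij j i) z) +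
  y i * (F (eij j i) z - F (eij j i) x) +
  (F (ei j) z - F (ei j) x - \sum_(i0 <- s) y i0 * F (eij j i0) x)); last by ring.
have h1 := Ftaylor2 j z i (y i).
have h2 : `|y i * (F (eij j i) z - F (eij j i) x)| <= `|y i| * (L * ns s y).
  by rewrite normrM ler_wpM2l// lip_part.
have h3 := IH us.
rewrite (le_trans (ler_normD _ _))// (le_trans (lerD (ler_normD _ _) (lexx _)))//.
rewrite (le_trans (lerD (lerD h1 h2) h3))//.
rewrite (_ : L * (`|y i| + ns s y) ^+ 2 = L * `|y i| ^+ 2 + `|y i| * (L * ns s y) + L * ns s y ^+ 2 +
  `|y i| * (L * ns s y)); last by ring.
by rewrite lerDl !mulr_ge0.
Qed.

Let eijC i j : eij i j = eij j i.
Proof. by apply/funext => l; rewrite /eij addnC. Qed.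

(** Induction on the coordinates already moved. The expansion in the next coordinate is taken at the
    moved point, and the estimates of lower order bring its coefficients back to x; the errors are
    monomials of L (|y i| + rest)^3. *)
Let taylor3_part s x y : uniq s ->
  `|F (fun=> 0%N) (part s x y) - F (fun=> 0%N) x - \sum_(i <- s) F (ei i) x * y i -
    2^-1 * \sum_(i <- s) \sum_(j <- s) F (eij i j) x * (y i * y j)| <= L * ns s y ^+ 3.
Proof.
elim: s => [|i s IH] /=.
  by move=> _; rewrite /part /ns !big_nil expr0n/= !mulr0 subrr !subr0 normr0.
move=> /andP[nis us]; rewrite part_cons// ns_cons !big_cons.
have -> : \sum_(j <- s) \sum_(j0 <- i :: s) F (eij j j0) x * (y j * y j0) =
    \sum_(j <- s) F (eij i j) x * (y i * y j) +
    \sum_(j <- s) \sum_(j0 <- s) F (eij j j0) x * (y j * y j0).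
  rewrite -big_split/=; apply: eq_bigr => j _.
  by rewrite big_cons eijC [y j * y i]mulrC.
set z := part s x y; set f := F (fun=> 0%N).
set q := \sum_(j <- s) \sum_(j0 <- s) _.
have -> : \sum_(j <- s) F (eij i j) x * (y i * y j) = y i * \sum_(j <- s) y j * F (eij i j) x.
  by rewrite mulr_sumr; apply: eq_bigr => j _; ring.
set q2 := \sum_(j <- s) y j * F (eij i j) x; set q1 := \sum_(j <- s) F (ei j) x * y j.
rewrite (_ : _ - _ = (f (addc z i (y i)) - f z - y i * F (ei i) z - y i ^+ 2 / 2 * F (eij i i) z) +
  y i * (F (ei i) z - F (ei i) x - q2) + y i ^+ 2 / 2 * (F (eij i i) z - F (eij i i) x) +
  (f z - f x - q1 - 2^-1 * q)); last by field.
have h1 := Ftaylor3 z i (y i).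
have h2 : `|y i * (F (ei i) z - F (ei i) x - q2)| <= `|y i| * (L * ns s y ^+ 2).
  by rewrite normrM ler_wpM2l// taylor2_part.
have h3 : `|y i ^+ 2 / 2 * (F (eij i i) z - F (eij i i) x)| <= `|y i| ^+ 2 * (L * ns s y).
  rewrite normrM ler_pM// ?lip_part// normrM normrX (@ger0_norm _ 2^-1)//.
  by rewrite ler_piMr ?exprn_ge0// invf_le1// ler1n.
have h4 := IH us.
rewrite (le_trans (ler_normD _ _))// (le_trans (lerD (ler_normD _ _) (lexx _)))//.
rewrite (le_trans (lerD (lerD (ler_normD _ _) (lexx _)) (lexx _)))//.
rewrite (le_trans (lerD (lerD (lerD h1 h2) h3) h4))//.
rewrite (_ : L * (`|y i| + ns s y) ^+ 3 = L * `|y i| ^+ 3 + `|y i| * (L * ns s y ^+ 2) +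
  `|y i| ^+ 2 * (L * ns s y) + L * ns s y ^+ 3 +
  (2 * (`|y i| * (L * ns s y ^+ 2)) + 2 * (`|y i| ^+ 2 * (L * ns s y)))); last by ring.
by rewrite lerDl addr_ge0// mulr_ge0// mulr_ge0 ?exprn_ge0// mulr_ge0 ?exprn_ge0.
Qed.

Lemma smooth_of_partial : (forall x, `|F (fun=> 0%N) x| <= L) ->
  (forall i x, `|F (ei i) x| <= L) -> (forall i j x, `|F (eij i j) x| <= L) ->
  (forall n, preserves_measurability (F n)) ->
  smooth L (F (fun=> 0%N)) (fun i => F (ei i)) (fun i j => F (eij i j)).
Proof.
move=> F0 F1 F2 mF.
have pe x y : part (index_enum Q) x y = fadd x y.
  by apply/funext => l; rewrite /part mem_index_enum.
have u := index_enum_uniq Q.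
split => // x y.
- by rewrite -pe; exact: lip_part.
- by rewrite -pe; exact: taylor3_part.
Qed.

End telescoping.

(** * Tensor products of splines *)

Section partition_of_unity.
Variables (h c : R) (m : nat).
Hypotheses (h0 : 0 < h) (h1 : h <= 1).

(** Level 0 is the constant 1 and the levels above [m] vanish: the bumps then add up to 1 on the
    whole line, at the price of a first and a last one that are unbounded. *)
Definition stepk (k j : nat) (t : R) : R :=
  if k == 0%N then (if j == 0%N then 1 else 0) else
  if (m < k)%N then 0 else step j (t / h + (c - k%:R)) / h ^+ j.

Definition bumpk (k j : nat) (t : R) : R := stepk k j t - stepk k.+1 j t.

Let h3 : 8 <= 8 / h ^+ 3.
Proof. by rewrite ler_pdivlMr ?exprn_gt0// ler_piMr// expr_le1// ltW. Qed.

Lemma bumpk_jet k : jet (16 / h ^+ 3) (bumpk k).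
Proof.
have js k' : jet (8 / h ^+ 3) (stepk k').
  rewrite /stepk; case: k' => [|k'] /=.
    apply: jet_const; first by rewrite (le_trans _ h3).
    by rewrite normr1 (le_trans _ h3)// ler1n.
  case: (m < k'.+1)%N; last exact: jet_affine step_jet.
  have := @jet_const R (8 / h ^+ 3) 0; rewrite normr0.
  have -> : (fun j (_ : R) => if j == 0%N then 0 else 0) = (fun _ _ => 0 : R).
    by apply/funext => j; apply/funext => t; case: (j == 0%N).
  by apply; rewrite (le_trans _ h3).
rewrite (_ : 16 / h ^+ 3 = 8 / h ^+ 3 + 8 / h ^+ 3); first exact: jetB.
by rewrite -mulrDl; congr (_ / _); ring.
Qed.

Lemma bumpk_ge0 k t : 0 <= bumpk k 0 t.
Proof.
rewrite /bumpk /stepk subr_ge0/= ?expr0 ?divr1.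
have b (u : R) := step_bounds u.
case: k => [|k] /=; first by case: ifP => _ //; have [/andP[]] := b (t / h + (c - 1)).
case: (ltnP m k.+1) => [mk|km]; first by rewrite (leq_trans mk).
case: ifP => _; first by have [/andP[]] := b (t / h + (c - k.+1%:R)).
by rewrite -[k.+2%:R]natr1 opprD !addrA; exact: step_mono.
Qed.

Lemma sum_bumpk t : \sum_(k < m.+1) bumpk k 0 t = 1.
Proof.
rewrite -(big_mkord xpredT (fun k => bumpk k 0 t)) /bumpk.
under eq_bigr do rewrite -opprB.
by rewrite sumrN telescope_sumr// /stepk/= ltnSn sub0r opprK.
Qed.

(** The range is restricted because of the two unbounded bumps: inside [0, m + 4] they too live on
    an interval of length 4. *)
Lemma bumpk_supp (k : 'I_m.+1) t : 0 <= t / h + c <= m.+4%:R -> bumpk k 0 t != 0 ->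
  k%:R <= t / h + c <= k%:R + 4.
Proof.
set y := t / h + c => /andP[y0 ym] b0; apply/andP; split.
  rewrite leNgt; apply/negP => yk; move/eqP: b0; apply.
  have k0 : (0 < k)%N by rewrite -(ltr0n R) (le_lt_trans y0).
  rewrite /bumpk /stepk/= gtn_eqF//= ltnNge -ltnS ltn_ord/= ?expr0 ?divr1.
  rewrite step_le0; last by rewrite addrA -/y subr_le0 ltW.
  case: ifP => _; rewrite ?subr0// step_le0 ?subr0//.
  by rewrite addrA -/y -[k.+1%:R]natr1; move: yk; lra.
rewrite leNgt; apply/negP => yk; move/eqP: b0; apply.
have km : (k < m)%N.
  have : (k%:R + 4 < m.+4%:R :> R) by rewrite (lt_le_trans yk).
  by rewrite -natrD ltr_nat addnC !addSn !ltnS.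
rewrite /bumpk /stepk/= ltnNge (ltnW km)/= ltnNge km/= ?expr0 ?divr1.
have e1 : 3 <= t / h + (c - k.+1%:R).
  by rewrite addrA -/y -[k.+1%:R]natr1; move: yk; lra.
rewrite (step_ge3 e1).1.
case: eqP => [_|_]; first by rewrite subrr.
rewrite (step_ge3 _).1 ?subrr// addrA -/y; move: yk; lra.
Qed.

Variable g : {ffun Q -> 'I_m.+1} -> R.
Hypothesis g1 : forall k, `|g k| <= 1.

(** [n] is the order of differentiation in each coordinate, [g] the value attached to each cell of
    the product grid. *)
Definition spl (n : Q -> nat) x : R :=
  \sum_(k : {ffun Q -> 'I_m.+1}) g k * \prod_l bumpk (k l) (n l) (x l).

Let spli (n : Q -> nat) x (i : Q) (v : 'I_m.+1 -> R) : R :=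
  \sum_(k : {ffun Q -> 'I_m.+1}) g k * (v (k i) * \prod_(l | l != i) bumpk (k l) (n l) (x l)).

Let splE n x i : spl n x = spli n x i (fun k => bumpk k (n i) (x i)).
Proof. by apply: eq_bigr => k _; rewrite (bigD1 i). Qed.

Let spl_addc n x i t : spl n (addc x i t) = spli n x i (fun k => bumpk k (n i) (x i + t)).
Proof.
apply: eq_bigr => k _; rewrite (bigD1 i)//= /addc eqxx; congr (_ * (_ * _)).
by apply: eq_bigr => l /negPf ->.
Qed.

Let spl_incr n n' x i : n' i = (n i).+1 -> (forall l, l != i -> n' l = n l) ->
  spl n' x = spli n x i (fun k => bumpk k (n i).+1 (x i)).
Proof.
move=> ni nl; apply: eq_bigr => k _; rewrite (bigD1 i)//= ni; congr (_ * (_ * _)).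
by apply: eq_bigr => l li; rewrite nl.
Qed.

Let Lam : R := m.+1%:R * (16 / h ^+ 3).

Let Lam1 : 1 <= Lam.
Proof.
have h3' : 16 <= 16 / h ^+ 3 :> R.
  by rewrite ler_pdivlMr ?exprn_gt0// ler_piMr// expr_le1// ltW.
by rewrite mulr_ege1 ?ler1n// (le_trans _ h3')// ler1n.
Qed.

Let Lam0 : 0 <= Lam. Proof. exact: le_trans Lam1. Qed.

Let sum_bump j t : (j <= 2)%N -> \sum_(k < m.+1) `|bumpk k j t| <= Lam ^+ j.
Proof.
move=> j2; case: j j2 => [|j] j2.
  rewrite expr0 -(sum_bumpk t) le_eqVlt; apply/orP; left; apply/eqP.
  by apply: eq_bigr => k _; rewrite ger0_norm// bumpk_ge0.
apply: (@le_trans _ _ Lam); last by rewrite exprS ler_peMr// exprn_ege1.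
apply: (@le_trans _ _ (\sum_(k < m.+1) (16 / h ^+ 3))).
  by apply: ler_sum => k _; apply: (jet_bound (bumpk_jet k)).
by rewrite sumr_const card_ord -[leLHS]mulr_natl.
Qed.

(** The sum over all (m + 1)^|Q| cells factorises into sums over one coordinate. In a coordinate
    that is not differentiated this sum is 1, by the partition of unity; only [i] and at most two
    orders of differentiation cost a factor. Hence the constant does not depend on the number of
    variables. *)
Let spli_bound n x i v b : (forall l, (n l <= 2)%N) -> (\sum_l n l <= 2)%N -> 0 <= b ->
  (forall k, `|v k| <= b) -> `|spli n x i v| <= m.+1%:R * b * Lam ^+ 2.
Proof.
move=> n2 sn b0 vb.
pose w l (k : 'I_m.+1) := if l == i then `|v k| else `|bumpk k (n l) (x l)|.
apply: (@le_trans _ _ (\prod_l \sum_k w l k)).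
  rewrite bigA_distr_bigA/= (le_trans (ler_norm_sum _ _ _))//; apply: ler_sum => k _.
  rewrite normrM [leRHS](bigD1 i)//= {1}/w eqxx.
  have -> : \prod_(l | l != i) w l (k l) = \prod_(l | l != i) `|bumpk (k l) (n l) (x l)|.
    by apply: eq_bigr => l /negPf li; rewrite /w li.
  by rewrite normrM normr_prod ler_piMl// mulr_ge0// prodr_ge0.
rewrite (bigD1 i)//=; apply: ler_pM.
- by apply: sumr_ge0 => k _; rewrite /w; case: ifP.
- by apply: prodr_ge0 => l _; apply: sumr_ge0 => k _; rewrite /w; case: ifP.
- rewrite (eq_bigr (fun k => `|v k|)); last by move=> k _; rewrite /w eqxx.
  apply: (@le_trans _ _ (\sum_(k < m.+1) b)); first exact: ler_sum.
  by rewrite sumr_const card_ord -[leLHS]mulr_natl.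
- apply: (@le_trans _ _ (\prod_(l | l != i) Lam ^+ n l)).
    apply: ler_prod => l /negPf li; apply/andP; split.
      by apply: sumr_ge0 => k _; rewrite /w li.
    by rewrite (eq_bigr (fun k : 'I_m.+1 => `|bumpk k (n l) (x l)|)) ?sum_bump// => k _; rewrite /w li.
  rewrite prodrXr ler_weXn2l//; apply: leq_trans sn.
  by rewrite [leqRHS](bigD1 i)//= leq_addl.
Qed.

Let spliB n x i v v' : spli n x i v - spli n x i v' = spli n x i (fun k => v k - v' k).
Proof. by rewrite -sumrB; apply: eq_bigr => k _; ring. Qed.

Let spliZ n x i t v : t * spli n x i v = spli n x i (fun k => t * v k).
Proof. by rewrite mulr_sumr; apply: eq_bigr => k _; ring. Qed.

Let sum_ei i : (\sum_l ei i l = 1)%N.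
Proof.
rewrite (bigD1 i)//= {1}/ei eqxx big1 ?addn0// => l /negPf li.
by rewrite /ei li.
Qed.

Let sum_eij i j : (\sum_l eij i j l = 2)%N.
Proof. by rewrite big_split/= (sum_ei i) (sum_ei j). Qed.

Let n_le2 (n : Q -> nat) : (\sum_l n l <= 2)%N -> forall l, (n l <= 2)%N.
Proof. by move=> s l; apply: leq_trans s; rewrite (bigD1 l)//= leq_addr. Qed.

Let L3 b : m.+1%:R * (16 / h ^+ 3 * b) * Lam ^+ 2 = Lam ^+ 3 * b.
Proof. by rewrite /Lam; ring. Qed.

Let b0 : 0 <= 16 / h ^+ 3. Proof. by rewrite divr_ge0// exprn_ge0// ltW. Qed.

Lemma spl_smooth : smooth ((m.+1%:R * (16 / h ^+ 3)) ^+ 3) (spl (fun=> 0%N))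
  (fun i => spl (ei i)) (fun i j => spl (eij i j)).
Proof.
have J k := bumpk_jet k.
have s0 : (\sum_(l : Q) 0 <= 2)%N by rewrite big1.
have s1 i : (\sum_l ei i l <= 2)%N by rewrite sum_ei.
have s2 i j : (\sum_l eij i j l <= 2)%N by rewrite sum_eij.
have lip n x i t : (\sum_l n l <= 2)%N -> `|spl n (addc x i t) - spl n x| <= Lam ^+ 3 * `|t|.
  move=> sn; rewrite spl_addc (splE n x i) spliB -L3; apply: spli_bound => //.
  - exact: n_le2.
  - by rewrite mulr_ge0.
  - by move=> k; apply: (jet_lip (J k)); exact: n_le2.
have bnd n x : (\sum_l n l <= 2)%N -> `|spl n x| <= Lam ^+ 3.
  move=> sn; apply: (@le_trans _ _ (Lam ^+ (\sum_l n l))); last first.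
    by rewrite ler_weXn2l// (leq_trans sn).
  rewrite -prodrXr; apply: (@le_trans _ _ (\prod_l \sum_(k < m.+1) `|bumpk k (n l) (x l)|)).
    rewrite bigA_distr_bigA/= (le_trans (ler_norm_sum _ _ _))//; apply: ler_sum => k _.
    by rewrite normrM normr_prod ler_piMl// prodr_ge0.
  apply: ler_prod => l _; rewrite sumr_ge0//= sum_bump//; exact: n_le2.
apply: smooth_of_partial.
- by rewrite exprn_ge0.
- by move=> x i t; exact: lip.
- by move=> j k x i t; exact: lip.
- move=> j x i t; rewrite spl_addc (splE (ei j) x i) (@spl_incr (ei j) (eij j i) x i).
  + rewrite spliZ !spliB -/Lam -L3; apply: spli_bound => //.
    * exact: n_le2.
    * by rewrite mulr_ge0// exprn_ge0.
    * by move=> k; apply: (jet_taylor2 (J k)); rewrite /ei; case: (_ == _).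
  + by rewrite /eij /ei eqxx addn1.
  + by move=> l /negPf li; rewrite /eij /ei li addn0.
- move=> x i t; rewrite spl_addc (splE (fun=> 0%N) x i) (@spl_incr (fun=> 0%N) (ei i) x i).
  + have -> : spl (eij i i) x = spli (fun=> 0%N) x i (fun k => bumpk k 2 (x i)).
      apply: eq_bigr => k _; rewrite (bigD1 i)//= {1}/eij eqxx; congr (_ * (_ * _)).
      by apply: eq_bigr => l /negPf li; rewrite /eij li.
    rewrite !spliZ !spliB -/Lam -L3; apply: spli_bound => //.
    * by rewrite mulr_ge0// exprn_ge0.
    * by move=> k; exact: (jet_taylor3 (J k)).
  + by rewrite /ei eqxx.
  + by move=> l /negPf li; rewrite /ei li.
- by move=> x; exact: bnd.
- by move=> i x; exact: bnd.
- by move=> i j x; exact: bnd.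
- move=> n d T S mS; apply: measurable_sum => k; apply: measurable_funM; first exact: measurable_cst.
  apply: measurable_prod => l _ /=.
  have mp (f : T -> R) : measurable_fun setT f -> measurable_fun setT (fun w => pp (f w)).
    by move=> mf; apply: measurable_maxr => //; exact: measurable_cst.
  have mst j (f : T -> R) : measurable_fun setT f -> measurable_fun setT (fun w => step j (f w)).
    move=> mf; have mpb (b : R) : measurable_fun setT (fun w => pp (f w - b)).
      by apply: mp; apply: measurable_funB => //; exact: measurable_cst.
    have mc (b : R) : measurable_fun setT (fun _ : T => b) by exact: measurable_cst.
    have mpf := mp _ mf.
    by case: j => [|[|j]]; rewrite /step; repeat (first [exact: mpb|exact: mpf|exact: mc|
      apply: measurable_funB|apply: measurable_funD|apply: measurable_funM|apply: measurable_funX]).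
  have mk j k' (f : T -> R) : measurable_fun setT f -> measurable_fun setT (fun w => stepk k' j (f w)).
    move=> mf; rewrite /stepk; case: (k' == 0%N); first by case: (j == 0%N).
    case: (m < k')%N => //; apply: measurable_funM => //; apply: mst.
    by apply: measurable_funD => //; exact: measurable_funM.
  by apply: measurable_funB; exact: mk.
Qed.

End partition_of_unity.

(** A cell gets the value 1 when its support contains a point of [B]. So f is 1 on [B] and positive
    only within four meshes of it, and f is measurable however irregular [B] is. The condition on
    [m] lets the grid cover [-M, M]. *)
Lemma smooth_indicator (B : set (Q -> R)) (h M : R) (m : nat) :
  0 < h -> h <= 1 -> 0 <= M -> 2 * M <= h * m.+4%:R ->
  exists f g H, [/\ smooth ((m.+1%:R * (16 / h ^+ 3)) ^+ 3) f g H,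
    forall x, 0 <= f x <= 1,
    forall x, B x -> (forall i, `|x i| <= M) -> f x = 1 &
    forall x, (forall i, `|x i| <= M) -> 0 < f x ->
      exists2 b, B b & forall i, `|x i - b i| <= 4 * h].
Proof.
move=> h0 h1 M0 Mm; pose c := M / h.
pose near (k : {ffun Q -> 'I_m.+1}) x := forall i, (k i)%:R <= x i / h + c <= (k i)%:R + 4.
pose g (k : {ffun Q -> 'I_m.+1}) : R := if `[< exists2 b, B b & near k b >] then 1 else 0.
have g01 k : 0 <= g k <= 1 by rewrite /g; case: ifP; rewrite ?lexx ?ler01.
have g1 k : `|g k| <= 1 by have /andP[g0 ?] := g01 k; rewrite ger0_norm.
have S := spl_smooth c h0 h1 g1.
have b0 k t : 0 <= bumpk h c m k 0 t by exact: bumpk_ge0.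
have p0 k x : 0 <= \prod_l bumpk h c m (k l : 'I_m.+1) 0 (x l) by exact: prodr_ge0.
have s1 x : \sum_(k : {ffun Q -> 'I_m.+1}) \prod_l bumpk h c m (k l) 0 (x l) = 1.
  rewrite -(bigA_distr_bigA (fun l (k : 'I_m.+1) => bumpk h c m k 0 (x l))).
  by rewrite big1// => l _; exact: sum_bumpk.
have nr x (k : {ffun Q -> 'I_m.+1}) : (forall i, `|x i| <= M) -> \prod_l bumpk h c m (k l) 0 (x l) != 0 -> near k x.
  move=> xM /prodf_neq0 pk i; apply: (@bumpk_supp h c m) => //; last exact: pk.
  rewrite /c -mulrDl divr_ge0 ?(ltW h0)//=; last by have := xM i; rewrite ler_norml; lra.
  by rewrite ler_pdivrMr// mulrC (le_trans _ Mm)//; have := xM i; rewrite ler_norml; lra.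
exists (spl h c g (fun=> 0%N)), (fun i => spl h c g (ei i)), (fun i j => spl h c g (eij i j)).
split => //.
- move=> x; rewrite /spl; apply/andP; split.
    by apply: sumr_ge0 => k _; rewrite mulr_ge0//; case/andP: (g01 k).
  rewrite -[leRHS](s1 x); apply: ler_sum => k _.
  by rewrite ler_piMl//; case/andP: (g01 k).
- move=> x Bx xM; rewrite -[RHS](s1 x); apply: eq_bigr => k _.
  have [->|pk] := eqVneq (\prod_l bumpk h c m (k l) 0 (x l)) 0; first by rewrite mulr0.
  rewrite /g asboolT ?mul1r//; exists x => //; exact: nr.
- move=> x xM fx.
  have [k] : exists k : {ffun Q -> 'I_m.+1}, g k * \prod_l bumpk h c m (k l) 0 (x l) != 0.
    apply/not_existsP => H; move: fx; rewrite /spl big1 ?ltxx// => k _.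
    by have /negP := H k; rewrite negbK => /eqP.
  rewrite mulf_eq0 negb_or => /andP[gk /(nr _ _ xM) kx].
  move: gk; rewrite /g; case: ifP => [/asboolP[b Bb kb] _|]; last by rewrite eqxx.
  exists b => // i; have := kx i; have := kb i.
  rewrite (_ : x i - b i = (x i / h + c - (b i / h + c)) * h); last by field; rewrite gt_eqF.
  rewrite normrM (ger0_norm (ltW h0)) ler_pM2r// ler_norml.
  by move: (x i / h + c) (b i / h + c) => u v; lra.
Qed.

End smoothing.

(** * Lindeberg's method *)

Section lindeberg.
Context {R : realType} {Q : finType}.
Context {d : measure_display} {T : measurableType d} (P : probability T R).
Context {d' : measure_display} {T' : measurableType d'} (P' : probability T' R).
Implicit Types (x y : Q -> R) (psi f : (Q -> R) -> R).

Definition mvec {d0 : measure_display} {T0 : measurableType d0} (S : T0 -> Q -> R) : Prop :=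
  forall i, measurable_fun setT (fun w => S w i).

Lemma mvec_fadd {d0 : measure_display} {T0 : measurableType d0} (S S' : T0 -> Q -> R) :
  mvec S -> mvec S' -> mvec (fun w => fadd (S w) (S' w)).
Proof. by move=> mS mS' i; exact: measurable_funD. Qed.

Lemma measurable_n1 {d0 : measure_display} {T0 : measurableType d0} (S : T0 -> Q -> R) :
  mvec S -> measurable_fun setT (fun w => n1 (S w)).
Proof. by move=> mS; apply: measurable_sum => i; apply: measurableT_comp => //; exact: mS. Qed.

Lemma n1_ge0 y : 0 <= n1 y.
Proof. exact: sumr_ge0. Qed.

Section averaging.
Variable G : T' -> Q -> R.
Hypothesis mG : mvec G.

Definition avg psi x : R := Ex P' (fun w => psi (fadd x (G w))).

Lemma avg_L1 L psi x : preserves_measurability psi -> (forall y, `|psi y| <= L) ->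
  L1 P' (fun w => psi (fadd x (G w))).
Proof.
move=> mpsi psiL; apply: (@L1_bounded _ _ _ _ L) => //; apply: mpsi => i.
by apply: measurable_funD => //; exact: measurable_cst.
Qed.

Lemma avg_bound L psi x : preserves_measurability psi -> (forall y, `|psi y| <= L) ->
  `|avg psi x| <= L.
Proof.
move=> mpsi psiL; apply: Ex_bounded => //; apply: mpsi => i.
by apply: measurable_funD => //; exact: measurable_cst.
Qed.

Lemma avg_measurable L psi : preserves_measurability psi -> (forall y, `|psi y| <= L) ->
  preserves_measurability (avg psi).
Proof.
move=> mpsi psiL d0 T0 S mS.
(* Shifted by [L] to be nonnegative, for Tonelli's theorem. *)
pose F (w : T0 * T') : \bar R := (psi (fadd (S w.1) (G w.2)) + L)%:E.
have mF : measurable_fun setT F.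
  apply/measurable_EFinP; apply: measurable_funD; last exact: measurable_cst.
  apply: mpsi => i; apply: measurable_funD.
    exact: (measurableT_comp (mS i) measurable_fst).
  exact: (measurableT_comp (mG i) measurable_snd).
have F0 w : (0 <= F w)%E.
  by rewrite lee_fin; have := psiL (fadd (S w.1) (G w.2)); rewrite ler_norml; lra.
have -> : (fun w => avg psi (S w)) = (fun w => fine (\int[P']_v F (w, v))%E - L).
  apply/funext => w; rewrite /F /= /avg.
  have -> : fine (\int[P']_v (psi (fadd (S w) (G v)) + L)%:E)%E =
      Ex P' (fun v => psi (fadd (S w) (G v)) + cst L v) by [].
  rewrite ExD ?Ex_cst ?addrK//; [exact: avg_L1|exact: L1_cst].
apply: measurable_funB; last exact: measurable_cst.
have mI := measurable_fun_fubini_tonelli_F (m2 := P') F mF F0.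
exact: (measurableT_comp (@fine_measurable _ setT measurableT) mI).
Qed.

Lemma avgE (L : R) (I : finType) (a : I -> (Q -> R) -> R) (b : I -> R) x :
  (forall i, preserves_measurability (a i)) -> (forall i y, `|a i y| <= L) ->
  Ex P' (fun w => \sum_i a i (fadd x (G w)) * b i) = \sum_i avg (a i) x * b i.
Proof.
move=> ma aL; have La i := @avg_L1 L (a i) x (ma i) (aL i).
rewrite Ex_sum; last by move=> i; under eq_fun do rewrite mulrC; exact: L1Z.
apply: eq_bigr => i _; under [X in Ex _ X]eq_fun do rewrite mulrC.
by rewrite ExZ// mulrC.
Qed.

(** Every clause of [smooth] is uniform in the base point, so it survives averaging over translates
    with the same constant. *)
Lemma smooth_avg L f g H : smooth L f g H ->
  smooth L (avg f) (fun i => avg (g i)) (fun i j => avg (H i j)).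
Proof.
move=> [fL gL HL lip tay mf mg mH].
have L_f x := @avg_L1 L f x mf fL.
have sw x y w : fadd (fadd x y) (G w) = fadd (fadd x (G w)) y.
  by apply/funext => i; rewrite /fadd addrAC.
split.
- by move=> x; exact: avg_bound.
- by move=> i x; exact: avg_bound.
- by move=> i j x; exact: avg_bound.
- move=> x y; rewrite /avg -ExB//; apply: Ex_bounded; first by apply: L1_mf; exact: L1B.
  by move=> w; rewrite sw.
- move=> x y.
  have Lg : L1 P' (fun w => \sum_i g i (fadd x (G w)) * y i).
    by apply: L1_sum => i; under eq_fun do rewrite mulrC; apply: L1Z; exact: (@avg_L1 L).
  have LH : L1 P' (fun w => \sum_i \sum_j H i j (fadd x (G w)) * (y i * y j)).
    apply: L1_sum => i; apply: L1_sum => j; under eq_fun do rewrite mulrC.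
    by apply: L1Z; exact: (@avg_L1 L).
  have LHi i : L1 P' (fun w => \sum_j H i j (fadd x (G w)) * (y i * y j)).
    apply: L1_sum => j; under eq_fun do rewrite mulrC.
    by apply: L1Z; exact: (@avg_L1 L).
  rewrite -(@avgE L _ g)//.
  have -> : \sum_i \sum_j avg (H i j) x * (y i * y j) =
      Ex P' (fun w => \sum_i \sum_j H i j (fadd x (G w)) * (y i * y j)).
    rewrite Ex_sum//; apply: eq_bigr => i _.
    by rewrite (@avgE L _ (H i) (fun j => y i * y j)).
  rewrite -ExZ// /avg -!ExB//; try (repeat apply: L1B => //; exact: L1Z).
  apply: Ex_bounded.
    by apply: (@L1_mf _ _ _ P'); repeat apply: L1B => //; exact: L1Z.
  by move=> w; rewrite sw.
- exact: avg_measurable.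
- by move=> i; exact: avg_measurable.
- by move=> i j; exact: avg_measurable.
Qed.

End averaging.

(* [G] lives on another probability space: [f] is averaged over it, and the
   class of smooth functions is stable under this averaging. *)
Lemma lindeberg_step (L d1 d2 e1 e3 : R) f g H (S D Y : T -> Q -> R) (G : T' -> Q -> R)
    (s : Q -> Q -> R) : smooth L f g H -> 0 <= L ->
  mvec S -> mvec D -> mvec Y -> mvec G ->
  L1 P (fun w => n1 (D w)) -> Ex P (fun w => n1 (D w)) <= e1 ->
  L1 P (fun w => n1 (Y w) ^+ 3) -> Ex P (fun w => n1 (Y w) ^+ 3) <= e3 ->
  L1 P' (fun w => n1 (G w) ^+ 3) -> Ex P' (fun w => n1 (G w) ^+ 3) <= e3 ->
  (forall i, L1 P (fun w => Y w i)) -> (forall i j, L1 P (fun w => Y w i * Y w j)) ->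
  (forall i, L1 P' (fun w => G w i)) -> (forall i j, L1 P' (fun w => G w i * G w j)) ->
  (forall i, Ex P' (fun w => G w i) = 0) ->
  (forall i j, Ex P' (fun w => G w i * G w j) = s i j) ->
  (forall psi, preserves_measurability psi -> (forall x, `|psi x| <= L) ->
    forall i, `|Ex P (fun w => psi (S w) * Y w i)| <= d1) ->
  (forall psi, preserves_measurability psi -> (forall x, `|psi x| <= L) ->
    forall i j, `|Ex P (fun w => psi (S w) * (Y w i * Y w j)) -
                  Ex P (fun w => psi (S w)) * s i j| <= d2) ->
  `|Ex P (fun w => f (fadd (S w) (fadd (D w) (Y w)))) - Ex P (fun w => avg G f (S w))| <=
    L * e1 + #|Q|%:R * d1 + #|Q|%:R ^+ 2 * d2 + 2 * L * e3.
Proof.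
move=> sf L0 mS mD mY mG LD ED LY EY LG EG LY1 LY2 LG1 LG2 EG0 EGs H1 H2.
have [fL gL HL lip tay mf mg mH] := sf.
have Lb psi (S' : T -> Q -> R) : preserves_measurability psi -> (forall x, `|psi x| <= L) -> mvec S' ->
    L1 P (fun w => psi (S' w)).
  by move=> mpsi pL mS'; apply: (@L1_bounded _ _ _ _ L) => //; exact: mpsi.
have mSY := mvec_fadd mS mY.
have mSDY := mvec_fadd mS (mvec_fadd mD mY).
have LfSY := Lb _ _ mf fL mSY; have LfSDY := Lb _ _ mf fL mSDY; have LfS := Lb _ _ mf fL mS.
have A1 : `|Ex P (fun w => f (fadd (S w) (fadd (D w) (Y w)))) - Ex P (fun w => f (fadd (S w) (Y w)))| <= L * e1.
  rewrite -ExB//; apply: (@le_trans _ _ (Ex P (fun w => L * n1 (D w)))); last by rewrite ExZ// ler_wpM2l.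
  apply: Ex_norm_le; [exact: L1B|exact: L1Z|move=> w].
  have -> : fadd (S w) (fadd (D w) (Y w)) = fadd (fadd (S w) (Y w)) (D w).
    by apply/funext => i; rewrite /fadd addrA addrAC.
  exact: lip.
have dom psi (Z : T -> R) : preserves_measurability psi -> (forall x, `|psi x| <= L) ->
    L1 P Z -> L1 P (fun w => psi (S w) * Z w).
  move=> mpsi pL LZ; apply: (@L1_dom _ _ _ _ (fun w => L * `|Z w|)).
  - by apply: measurable_funM; [exact: mpsi|exact: L1_mf LZ].
  - by move=> w; rewrite normrM ler_wpM2r.
  - by apply: L1Z; exact: L1_norm.
pose lin w := \sum_i g i (S w) * Y w i.
pose qua w := \sum_i \sum_j H i j (S w) * (Y w i * Y w j).
pose quas w := \sum_i \sum_j H i j (S w) * s i j.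
have Llin : L1 P lin by apply: L1_sum => i; exact: dom.
have Lquai i : L1 P (fun w => \sum_j H i j (S w) * (Y w i * Y w j)).
  by apply: L1_sum => j; apply: (dom (H i j) (fun w => Y w i * Y w j)).
have Lqua : L1 P qua by apply: L1_sum => i.
have LHs i j : L1 P (fun w => H i j (S w) * s i j).
  by under eq_fun do rewrite mulrC; apply: L1Z; exact: Lb.
have Lquasi i : L1 P (fun w => \sum_j H i j (S w) * s i j) by apply: L1_sum => j.
have Lquas : L1 P quas by apply: L1_sum => i.
have A2 : `|Ex P (fun w => f (fadd (S w) (Y w))) - Ex P (fun w => f (S w)) - Ex P lin - 2^-1 * Ex P qua| <= L * e3.
  rewrite -[2^-1 * _]ExZ// -!ExB//; try (repeat apply: L1B => //; exact: L1Z).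
  apply: (@le_trans _ _ (Ex P (fun w => L * n1 (Y w) ^+ 3))); last by rewrite ExZ// ler_wpM2l.
  apply: Ex_norm_le; [|exact: L1Z|by move=> w; exact: tay].
  by repeat apply: L1B => //; exact: L1Z.
have Lavg := Lb _ _ (avg_measurable mG mf fL) (fun x => avg_bound mG x mf fL) mS.
(* Averaging over [G] removes the linear term and turns the quadratic one into the sum against
   [s]. *)
have A3 : `|Ex P (fun w => avg G f (S w)) - Ex P (fun w => f (S w)) - 2^-1 * Ex P quas| <= L * e3.
  rewrite -[2^-1 * _]ExZ// -!ExB//; try (repeat apply: L1B => //; exact: L1Z).
  apply: Ex_bounded; first by apply: (@L1_mf _ _ _ P); repeat apply: L1B => //; exact: L1Z.
  move=> w; have LfG := avg_L1 mG (S w) mf fL.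
  have LgG : L1 P' (fun w' => \sum_i g i (S w) * G w' i).
    by apply: L1_sum => i; exact: L1Z.
  have LHG i : L1 P' (fun w' => \sum_j H i j (S w) * (G w' i * G w' j)).
    by apply: L1_sum => j; exact: L1Z.
  have LHG' : L1 P' (fun w' => \sum_i \sum_j H i j (S w) * (G w' i * G w' j)) by apply: L1_sum.
  have e1' : Ex P' (fun w' => \sum_i g i (S w) * G w' i) = 0.
    rewrite Ex_sum; last by move=> i; exact: L1Z.
    by rewrite big1// => i _; rewrite ExZ// EG0 mulr0.
  have e2' : quas w = Ex P' (fun w' => \sum_i \sum_j H i j (S w) * (G w' i * G w' j)).
    rewrite Ex_sum//; apply: eq_bigr => i _.
    rewrite Ex_sum; last by move=> j; exact: L1Z.
    by apply: eq_bigr => j _; rewrite ExZ// EGs.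
  rewrite e2' /avg -[X in _ - X - _](Ex_cst P') -ExZ//.
  rewrite -[X in X - _]subr0 -[X in _ - X - _]addr0 -{2}e1' opprD addrA.
  rewrite subr0 -!ExB//; try (repeat apply: L1B => //; try exact: L1_cst; exact: L1Z).
  apply: (@le_trans _ _ (Ex P' (fun w => L * n1 (G w) ^+ 3))); last by rewrite ExZ// ler_wpM2l.
  apply: Ex_norm_le; [|exact: L1Z|by move=> w'; exact: tay].
  by repeat apply: L1B => //; try exact: L1_cst; exact: L1Z.
have A4 : `|Ex P lin| <= #|Q|%:R * d1.
  rewrite Ex_sum; last by move=> i; exact: dom.
  rewrite (le_trans (ler_norm_sum _ _ _))//.
  apply: (@le_trans _ _ (\sum_(i : Q) d1)); first by apply: ler_sum => i _; exact: H1.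
  by rewrite sumr_const -[leLHS]mulr_natl.
have A5 : `|Ex P qua - Ex P quas| <= #|Q|%:R ^+ 2 * d2.
  rewrite !Ex_sum// -sumrB (le_trans (ler_norm_sum _ _ _))//.
  apply: (@le_trans _ _ (\sum_(i : Q) (#|Q|%:R * d2))); last first.
    by rewrite sumr_const -[leLHS]mulr_natl mulrA.
  apply: ler_sum => i _; rewrite !Ex_sum//; last first.
    by move=> j; apply: (dom (H i j) (fun w => Y w i * Y w j)).
  rewrite -sumrB (le_trans (ler_norm_sum _ _ _))//.
  apply: (@le_trans _ _ (\sum_(j : Q) d2)); last by rewrite sumr_const -[leLHS]mulr_natl.
  apply: ler_sum => j _; have := H2 _ (mH i j) (HL i j) i j.
  under [X in _ -> `|_ - Ex P X| <= _]eq_fun do rewrite mulrC.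
  by rewrite ExZ ?(mulrC (s i j))//; exact: Lb.
have d20 : 0 <= #|Q|%:R ^+ 2 * d2 by exact: le_trans A5.
move: A1 A2 A3 A4 A5; move: (Ex P _) (Ex P _) (Ex P _) (Ex P _) (Ex P lin) (Ex P qua) (Ex P quas).
move=> a b a' c l q qs; rewrite -(mulrA 2 L e3) !ler_norml; move: (L * e1) (L * e3) (_ * d1) (_ * d2) d20 => *.
lra.
Qed.

(** At 0 this is the expectation of [f] at a sum of independent copies of the [G j], obtained
    without a product space; the last variable is averaged out first. *)
Fixpoint avgs (G : nat -> T' -> Q -> R) n f : (Q -> R) -> R :=
  match n with 0%N => f | n.+1 => avgs G n (avg (G n) f) end.

(** The last block is replaced first: the function tested against block j then depends on earlier
    blocks of the first process only, the later ones having been averaged out without loss of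
    smoothness. *)
Lemma lindeberg (L d1 d2 e1 e3 : R) n f g H (D Y : nat -> T -> Q -> R) (G : nat -> T' -> Q -> R)
    (s : nat -> Q -> Q -> R) : smooth L f g H -> 0 <= L ->
  let S j w := fun i => \sum_(k < j) (D k w i + Y k w i) in
  (forall j, (j < n)%N -> [/\ mvec (D j), mvec (Y j) & mvec (G j)]) ->
  (forall j, (j < n)%N -> L1 P (fun w => n1 (D j w)) /\ Ex P (fun w => n1 (D j w)) <= e1) ->
  (forall j, (j < n)%N -> L1 P (fun w => n1 (Y j w) ^+ 3) /\ Ex P (fun w => n1 (Y j w) ^+ 3) <= e3) ->
  (forall j, (j < n)%N -> L1 P' (fun w => n1 (G j w) ^+ 3) /\ Ex P' (fun w => n1 (G j w) ^+ 3) <= e3) ->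
  (forall j, (j < n)%N -> (forall i, L1 P (fun w => Y j w i)) /\
     (forall i i', L1 P (fun w => Y j w i * Y j w i'))) ->
  (forall j, (j < n)%N -> forall i, L1 P' (fun w => G j w i) /\ Ex P' (fun w => G j w i) = 0) ->
  (forall j, (j < n)%N -> forall i i', L1 P' (fun w => G j w i * G j w i') /\
     Ex P' (fun w => G j w i * G j w i') = s j i i') ->
  (forall j, (j < n)%N -> forall psi, preserves_measurability psi -> (forall x, `|psi x| <= L) ->
    forall i, `|Ex P (fun w => psi (S j w) * Y j w i)| <= d1) ->
  (forall j, (j < n)%N -> forall psi, preserves_measurability psi -> (forall x, `|psi x| <= L) ->
    forall i i', `|Ex P (fun w => psi (S j w) * (Y j w i * Y j w i')) -
                  Ex P (fun w => psi (S j w)) * s j i i'| <= d2) ->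
  `|Ex P (fun w => f (S n w)) - avgs G n f (fun=> 0)| <=
    n%:R * (L * e1 + #|Q|%:R * d1 + #|Q|%:R ^+ 2 * d2 + 2 * L * e3).
Proof.
move=> + L0 S; elim: n f g H => [|n IH] f g H sf hm hD hY hG hYi hGi hGij h1 h2.
  rewrite mul0r /=; have -> : (fun w => f (S 0%N w)) = cst (f (fun=> 0)).
    by apply/funext => w; congr f; apply/funext => i; rewrite /S big_ord0.
  by rewrite Ex_cst subrr normr0.
have nn : (n < n.+1)%N by [].
have lt j : (j < n)%N -> (j < n.+1)%N by move=> jn; exact: leq_trans jn (leqnSn n).
have [mDn mYn mGn] := hm _ nn.
have mS j : (j <= n.+1)%N -> mvec (S j).
  move=> jn i; apply: measurable_sum => k; have [mD mY _] := hm _ (leq_trans (ltn_ord k) jn).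
  by apply: measurable_funD; [exact: mD|exact: mY].
have IHn := IH _ _ _ (smooth_avg mGn sf) (fun j jn => hm j (lt _ jn)) (fun j jn => hD j (lt _ jn))
  (fun j jn => hY j (lt _ jn)) (fun j jn => hG j (lt _ jn)) (fun j jn => hYi j (lt _ jn))
  (fun j jn => hGi j (lt _ jn)) (fun j jn => hGij j (lt _ jn))
  (fun j jn => h1 j (lt _ jn)) (fun j jn => h2 j (lt _ jn)).
have [LDn EDn] := hD _ nn; have [LYn EYn] := hY _ nn; have [LGn EGn] := hG _ nn.
have [LY1 LY2] := hYi _ nn.
have step := lindeberg_step sf L0 (mS n (leqnSn n)) mDn mYn mGn LDn EDn LYn EYn LGn EGn LY1 LY2
  (fun i => (hGi _ nn i).1) (fun i i' => (hGij _ nn i i').1)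
  (fun i => (hGi _ nn i).2) (fun i i' => (hGij _ nn i i').2) (h1 _ nn) (h2 _ nn).
have -> : (fun w => f (S n.+1 w)) = (fun w => f (fadd (S n w) (fadd (D n w) (Y n w)))).
  by apply/funext => w; congr f; apply/funext => i; rewrite /S big_ord_recr.
rewrite /= -[n.+1%:R]natr1 mulrDl mul1r.
rewrite -[X in `|X - _|](subrK (Ex P (fun w => avg (G n) f (S n w)))) -addrA.
by rewrite (le_trans (ler_normD _ _))// [leRHS]addrC lerD.
Qed.

End lindeberg.

(** * Discretization and the Prokhorov distance *)

Section borel_measurability.
Context {R : realType} {T : normedModType R}.

Lemma open_enlargement (A : set T) (chi : R) : open (enlargement A chi).
Proof.
have -> : enlargement A chi = \bigcup_(a in A) ball a chi.
  by apply/seteqP; split => x [a Aa axchi]; exists a.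
by apply: bigcup_open => a _; exact: ball_open.
Qed.

Context {d : measure_display} {Omega : measurableType d}.

Lemma measurable_borel (Y : Omega -> T) :
  (forall O : set T, open O -> measurable (Y @^-1` O)) ->
  measurable_fun setT (Y : Omega -> borel T).
Proof.
move=> mY; apply: (@measurability _ _ Omega (borel T) setT Y (@open T)) => //.
by move=> _ [U oU <-]; rewrite setTI; exact: mY.
Qed.

Lemma measurable_borel_open (Y : Omega -> T) (O : set T) :
  measurable_fun setT (Y : Omega -> borel T) -> open O -> measurable (Y @^-1` O).
Proof.
move=> mY oO; rewrite -[X in measurable X]setTI; apply: mY => //.
exact: sub_sigma_algebra.
Qed.

End borel_measurability.

(** * From smooth test functions to the Prokhorov distance *)

Section prokhorov_bound.
Context {R : realType} {Tp : Type} {D : set Tp} {V : normedModType R}.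
Local Notation E := (Linf D V).

Lemma prokhorov_le (mu nu : set (borel E) -> \bar R) (chi : R) : 0 < chi ->
  (forall A : set (borel E), measurable A ->
    (mu A <= nu (enlargement A chi) + chi%:E)%E /\
    (nu A <= mu (enlargement A chi) + chi%:E)%E) ->
  prokhorov mu nu <= chi.
Proof.
move=> chi0 H; apply: ge_inf; last by split.
by exists 0 => c [/ltW].
Qed.

Context {Q : finType}.
Variable rec : (Q -> R) -> Tp -> V.
Hypothesis rec_lip : forall x x' (a : R), 0 <= a -> (forall i, `|x i - x' i| <= a) ->
  forall p, `|rec x p - rec x' p| <= a.

(** [rec] rebuilds a path from its grid values; [M] confines these values to the range covered by
    the splines. *)
Record discretized {d} {T : measurableType d} (P : probability T R) (Y : T -> E)
    (X : T -> Q -> R) (M e : R) : Prop := {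
  dis_Y : measurable_fun setT (Y : T -> borel E) ;
  dis_X : mvec X ;
  dis_bad : exists2 N, measurable N /\ Pr P N <= e &
    forall w, ~ N w -> (forall p, D p -> `|Y w p - rec (X w) p| <= e) /\
      forall i, `|X w i| <= M }.

Context {d1 : measure_display} {T1 : measurableType d1} {P1 : probability T1 R}.
Context {d2 : measure_display} {T2 : measurableType d2} {P2 : probability T2 R}.

(** Let f be the smoothed indicator of the grid vectors whose reconstruction is e-close to A. Then
    P1 (Y1 in A) <= e + E f(X1) <= 2e + E f(X2) <= 3e + P2 (Y2 in the enlargement). *)
Lemma prokhorov_half (Y1 : T1 -> E) (X1 : T1 -> Q -> R) (Y2 : T2 -> E) (X2 : T2 -> Q -> R)
    (M e : R) (m : nat) : 0 < e -> e <= 1 -> 0 <= M -> 2 * M <= e * m.+4%:R ->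
  discretized P1 Y1 X1 M e -> discretized P2 Y2 X2 M e ->
  (forall f g H, smooth ((m.+1%:R * (16 / e ^+ 3)) ^+ 3) f g H ->
    `|Ex P1 (fun w => f (X1 w)) - Ex P2 (fun w => f (X2 w))| <= e) ->
  forall A : set (borel E), measurable A ->
    (pushforward P1 (Y1 : T1 -> borel E) A <=
     pushforward P2 (Y2 : T2 -> borel E) (enlargement A (7 * e)) + (7 * e)%:E)%E.
Proof.
move=> e0 e1 M0 Mm [mY1 mX1 [N1 [mN1 PN1] HN1]] [mY2 mX2 [N2 [mN2 PN2] HN2]] cmp A mA.
pose B : set (Q -> R) := [set x | exists2 a : E, A a & forall p, D p -> `|a p - rec x p| <= e].
have [f [g [H [sf f01 fB fpos]]]] := @smooth_indicator R Q B e M m e0 e1 M0 Mm.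
have cf := cmp _ _ _ sf.
have mA1 : measurable (Y1 @^-1` A) by rewrite -[X in measurable X]setTI; exact: mY1.
have mA2 : measurable (Y2 @^-1` enlargement A (7 * e)).
  by apply: measurable_borel_open => //; exact: open_enlargement.
have Lf d (T : measurableType d) (P : probability T R) (X : T -> Q -> R) : mvec X -> L1 P (fun w => f (X w)).
  move=> mX; apply: (@L1_bounded _ _ _ _ 1); first exact: (sm_mf sf).
  by move=> w; have /andP[h1 h2] := f01 (X w); rewrite ger0_norm.
have h1 : Pr P1 (Y1 @^-1` A) <= Pr P1 N1 + Ex P1 (fun w => f (X1 w)).
  rewrite -!Pr_indic// -ExD; [|exact: L1_indic|exact: Lf].
  apply: Ex_le; first exact: L1_indic.
    by apply: L1D; [exact: L1_indic|exact: Lf].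
  move=> w; have /andP[f0 _] := f01 (X1 w).
  have [N1w|N1w] := pselect (N1 w).
    by rewrite !indicE (mem_set N1w); case: (_ \in _); rewrite /=; lra.
  have [Aw|Aw] := pselect ((Y1 @^-1` A) w); last by rewrite !indicE (memNset Aw) addr_ge0.
  have [h hM] := HN1 _ N1w.
  by rewrite !indicE (mem_set Aw) (memNset N1w) fB ?add0r//; exists (Y1 w).
have h2 : Ex P2 (fun w => f (X2 w)) <= Pr P2 N2 + Pr P2 (Y2 @^-1` enlargement A (7 * e)).
  rewrite -!Pr_indic// -ExD; [|exact: L1_indic|exact: L1_indic].
  apply: Ex_le; [exact: Lf|by apply: L1D; exact: L1_indic|].
  move=> w; have /andP[f0 f1] := f01 (X2 w).
  have [N2w|N2w] := pselect (N2 w).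
    by rewrite !indicE (mem_set N2w) (le_trans f1)// lerDl.
  have [h hM] := HN2 _ N2w.
  have [fw|fw] := leP (f (X2 w)) 0; first by rewrite (le_trans fw)// addr_ge0// indicE.
  have [b [a Aa ab] Xb] := fpos _ hM fw.
  rewrite !indicE (memNset N2w) add0r mem_set//=; exists a => //.
  (* Two reconstructions at e each and four meshes of the spline make 6e; the ball is open, whence
     7e. *)
  rewrite -ball_normE/=; apply: (@le_lt_trans _ _ (6 * e)); last by rewrite ltr_pM2r// ltr_nat.
  apply: supnorm_le => [|p Dp]; first by rewrite mulr_ge0// ltW.
  have -> : (a - Y2 w) p = (a p - rec b p) + (rec b p - rec (X2 w) p) + (rec (X2 w) p - Y2 w p).
    change (a p - Y2 w p = (a p - rec b p) + (rec b p - rec (X2 w) p) + (rec (X2 w) p - Y2 w p)).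
    by rewrite !addrA !subrK.
  rewrite (_ : 6 * e = e + 4 * e + e); last by ring.
  rewrite (le_trans (ler_normD _ _))// lerD//.
    rewrite (le_trans (ler_normD _ _))// lerD//; first exact: ab.
    apply: rec_lip => //; first by rewrite mulr_ge0// ltW.
    by move=> i; rewrite distrC; exact: Xb.
  by rewrite distrC; exact: h.
rewrite /pushforward -PrE// -[P2 _]PrE// -EFinD lee_fin.
by move: cf; rewrite ler_norml => /andP[c1 c2]; move: h1 h2 c1 c2 PN1 PN2; lra.
Qed.

End prokhorov_bound.

Lemma prokhorov_rv_le {R : realType} {Tp : Type} {D : set Tp} {V : normedModType R}
    {Q : finType} (rec : (Q -> R) -> Tp -> V)
    {d1 : measure_display} {T1 : measurableType d1} (P1 : probability T1 R)
    {d2 : measure_display} {T2 : measurableType d2} (P2 : probability T2 R)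
    (Y1 : T1 -> Linf D V) (X1 : T1 -> Q -> R) (Y2 : T2 -> Linf D V) (X2 : T2 -> Q -> R)
    (M e : R) (m : nat) :
  (forall x x' (a : R), 0 <= a -> (forall i, `|x i - x' i| <= a) ->
    forall p, `|rec x p - rec x' p| <= a) ->
  0 < e -> e <= 1 -> 0 <= M -> 2 * M <= e * m.+4%:R ->
  discretized rec P1 Y1 X1 M e -> discretized rec P2 Y2 X2 M e ->
  (forall f g H, smooth ((m.+1%:R * (16 / e ^+ 3)) ^+ 3) f g H ->
    `|Ex P1 (fun w => f (X1 w)) - Ex P2 (fun w => f (X2 w))| <= e) ->
  prokhorov_rv P1 Y1 P2 Y2 <= 7 * e.
Proof.
move=> recl e0 e1 M0 Mm D1 D2 cmp; apply: prokhorov_le; first by rewrite mulr_gt0.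
move=> A mA; split; first exact: (prokhorov_half recl e0 e1 M0 Mm D1 D2 cmp).
apply: (prokhorov_half recl e0 e1 M0 Mm D2 D1) => // f g H sf.
by rewrite distrC; exact: cmp sf.
Qed.

(** * Chaining *)

Section small_events.
Context {R : realType} {d : measure_display} {T : measurableType d}.
Variable P : probability T R.
Implicit Types (A B : set T) (c e : R).

(** A bound on the outer measure, as events about suprema over all times and points need not be
    measurable. *)
Definition small A c : Prop :=
  exists N, [/\ measurable N, Pr P N <= c & A `<=` N].

Lemma small_sub A B c c' : A `<=` B -> c <= c' -> small B c -> small A c'.
Proof.
move=> AB cc [N [mN PN BN]]; exists N; split => //; first exact: le_trans cc.
exact: subset_trans BN.
Qed.

Lemma small_meas A c : measurable A -> Pr P A <= c -> small A c.
Proof. by move=> mA PA; exists A; split. Qed.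

Lemma small0 c : 0 <= c -> small set0 c.
Proof. by move=> c0; exists set0; split => //; rewrite /Pr measure0. Qed.

Lemma smallU A B c c' : small A c -> small B c' -> small (A `|` B) (c + c').
Proof.
move=> [N [mN PN AN]] [M [mM PM BM]]; exists (N `|` M); split.
- exact: measurableU.
- by rewrite (le_trans (PrU _ mN mM))// lerD.
- by move=> w [/AN|/BM]; [left|right].
Qed.

Lemma small_sum (A : nat -> set T) (c : nat -> R) n :
  (forall i, (i < n)%N -> small (A i) (c i)) ->
  small [set w | exists2 i, (i < n)%N & A i w] (\sum_(i < n) c i).
Proof.
elim: n => [|n IH] H.
  by rewrite big_ord0; apply: small_sub (small0 (lexx 0)) => // w [].
rewrite big_ord_recr/=; apply: small_sub (smallU (IH _) (H n _)) => //.
  move=> w [i]; rewrite ltnS leq_eqVlt => /predU1P[->|ilt] Aw; first by right.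
  by left; exists i.
by move=> i ilt; apply: H; exact: leq_trans ilt (leqnSn n).
Qed.

Lemma small_bigU (I : finType) (A : I -> set T) (c : I -> R) :
  (forall i, small (A i) (c i)) -> small [set w | exists i, A i w] (\sum_i c i).
Proof.
move=> H; pose N i := projT1 (cid (H i)).
have NP i : [/\ measurable (N i), Pr P (N i) <= c i & A i `<=` N i].
  exact: (projT2 (cid (H i))).
exists [set w | exists i, N i w]; split.
- have -> : [set w | exists i, N i w] = \bigcup_i N i.
    by apply/seteqP; split => w [i]; [exists i|exists i].
  by apply: fin_bigcup_measurable => // i _; case: (NP i).
- by apply: Pr_bigU => i; case: (NP i).
- by move=> w [i Aw]; exists i; case: (NP i) => _ _; apply.
Qed.

Lemma small_nested (A : nat -> set T) c : (forall n, A n `<=` A n.+1) ->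
  (forall n, small (A n) c) -> small (\bigcup_n A n) c.
Proof.
move=> ndA H; pose N i := projT1 (cid (H i)).
have NP i : [/\ measurable (N i), Pr P (N i) <= c & A i `<=` N i].
  exact: (projT2 (cid (H i))).
(* The measurable covers need not increase; these intersections do, they still contain [A n], and
   they are no larger. *)
pose M n := \bigcap_(k in [set k | (n <= k)%N]) N k.
have mM n : measurable (M n) by apply: bigcap_measurable => [|k _]; [exists n => /=|case: (NP k)].
have AA n k : (n <= k)%N -> A n `<=` A k.
  by elim: k => [|k IH]; [rewrite leqn0 => /eqP ->|rewrite leq_eqVlt => /predU1P[->//|/IH h]; exact: subset_trans (ndA k)].
exists (\bigcup_n M n); split.
- exact: bigcupT_measurable.
- apply: Pr_bigcup => // n.
    by move=> w Mw k /= nk; apply: Mw; exact: leq_trans nk.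
  have [mN PN _] := NP n; rewrite (le_trans _ PN)// (Pr_le P (mM n) mN)// => w Mw; exact: (Mw n (leqnn n)).
- move=> w [n _ An]; exists n => // k nk; have [_ _] := NP k; apply.
  exact: AA nk _ An.
Qed.

Lemma small_series (A : nat -> set T) (c : nat -> R) C :
  (forall i, small (A i) (c i)) -> (forall n, \sum_(i < n) c i <= C) ->
  small (\bigcup_n A n) C.
Proof.
move=> H cC.
have -> : \bigcup_n A n = \bigcup_n [set w | exists2 i, (i < n)%N & A i w].
  apply/seteqP; split => w [n _].
    by move=> Aw; exists n.+1 => //; exists n.
  by move=> [i _ Aw]; exists i.
apply: small_nested => n.
  by move=> w [i ilt Aw]; exists i => //; exact: leq_trans ilt (leqnSn n).
by apply: (small_sub _ (cC n) (small_sum (fun i _ => H i))).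
Qed.

(** The share of the allowed oscillation given to dyadic level r. The shares add up to at most 1 and
    decay slowly enough for 2^r events of probability 4^(-r) / wt^4 to be summable over r. *)
Definition wt (r : nat) : R := 10^-1 * (9 / 10) ^+ r.

Lemma wt_gt0 r : 0 < wt r.
Proof. by rewrite mulr_gt0// exprn_gt0//; lra. Qed.

Lemma sum_wt n : \sum_(r < n) wt r <= 1.
Proof.
have -> : \sum_(r < n) wt r = 1 - (9 / 10) ^+ n.
  elim: n => [|n IH]; first by rewrite big_ord0 expr0 subrr.
  by rewrite big_ord_recr/= IH /wt exprS; lra.
by rewrite lerBlDr lerDl exprn_ge0//; lra.
Qed.

(** 10^4 comes from the factor 1/10 in [wt], and 5 is the sum of the powers of 4/5. *)
Definition Kch : R := 10 ^+ 4 * 5.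

Lemma Kch_gt0 : 0 < Kch.
Proof. by rewrite mulr_gt0// exprn_gt0. Qed.

Lemma small_dyadic (Bad : nat -> nat -> set T) (b : R) : 0 <= b ->
  (forall r i, (i < 2 ^ r)%N -> small (Bad r i) (b * 4^-1 ^+ r / wt r ^+ 4)) ->
  small [set w | exists r i, (i < 2 ^ r)%N /\ Bad r i w] (Kch * b).
Proof.
move=> b0 H.
pose A r := [set w | exists2 i, (i < 2 ^ r)%N & Bad r i w].
have -> : [set w | exists r i, (i < 2 ^ r)%N /\ Bad r i w] = \bigcup_r A r.
  apply/seteqP; split => w.
    by move=> [r [i [ir Bw]]]; exists r => //; exists i.
  by move=> [r _ [i ir Bw]]; exists r, i.
(* Ratio of the level bounds: 2^r events of size 4^(-r) leave 2^(-r), and the weights multiply by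
   (10/9)^(4 r). *)
have q1 : 2^-1 * (10 / 9) ^+ 4 <= 4 / 5 :> R.
  have h : (10 / 9) ^+ 2 <= 5 / 4 :> R by rewrite expr2; lra.
  have h2 : ((10 / 9) ^+ 2) ^+ 2 <= (5 / 4) ^+ 2 :> R.
    by rewrite ler_pXn2r ?nnegrE ?sqr_ge0//; lra.
  rewrite (_ : (10 / 9) ^+ 4 = ((10 / 9) ^+ 2) ^+ 2); last by rewrite -exprM.
  by move: h2; rewrite [X in _ <= X -> _]expr2; lra.
have e r : (2 ^ r)%:R * (b * 4^-1 ^+ r / wt r ^+ 4) <= 10 ^+ 4 * b * (4 / 5) ^+ r.
  have -> : (2 ^ r)%:R * (b * 4^-1 ^+ r / wt r ^+ 4) =
      10 ^+ 4 * b * (2^-1 * (10 / 9) ^+ 4) ^+ r.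
    rewrite /wt natrX (_ : 4^-1 = 2^-1 * 2^-1 :> R); last by field.
    have -> : (10^-1 * (9 / 10) ^+ r) ^+ 4 = 10^-1 ^+ 4 * ((9 / 10) ^+ 4) ^+ r :> R.
      by rewrite exprMn -!exprM mulnC.
    rewrite (_ : (10 / 9) ^+ 4 = ((9 / 10) ^+ 4)^-1); last by rewrite -exprVn invf_div.
    have : (9 / 10) ^+ 4 != 0 :> R by rewrite expf_neq0// mulf_neq0// invr_eq0 pnatr_eq0.
    move: ((9 / 10) ^+ 4) => x x0; rewrite !exprMn !exprVn; field.
    by rewrite !expf_neq0.
  by rewrite ler_wpM2l ?mulr_ge0 ?exprn_ge0// lerXn2r ?nnegrE ?mulr_ge0 ?exprn_ge0.
apply: (@small_series _ (fun r => 10 ^+ 4 * b * (4 / 5) ^+ r)).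
  move=> r; have := small_sum (H r); rewrite sumr_const card_ord -[_ *+ _]mulr_natl.
  exact: small_sub (e r).
move=> n; rewrite -mulr_sumr /Kch.
have h : \sum_(r < n) (4 / 5) ^+ r <= 5 :> R.
  have -> : \sum_(r < n) (4 / 5) ^+ r = 5 * (1 - (4 / 5) ^+ n) :> R.
    elim: n => [|n IH]; first by rewrite big_ord0 expr0 subrr mulr0.
    by rewrite big_ord_recr/= IH exprS; lra.
  have : 0 <= (4 / 5) ^+ n :> R by rewrite exprn_ge0//; lra.
  by lra.
rewrite (_ : 10 ^+ 4 * 5 * b = 10 ^+ 4 * b * 5); last by rewrite mulrAC.
by rewrite ler_wpM2l// mulr_ge0// exprn_ge0.
Qed.

End small_events.

(** * Dyadic chaining, discrete and continuous *)

Section chaining.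
Context {R : realType}.
Local Notation wt := (@wt R).

(** A point of level r + 1 either occurs already at level r, when its index is even, or is the right
    neighbour of such a point; halving the index thus costs at most one weight per level. *)
Lemma dyadic_path (F : nat -> nat -> R) (e : R) (a : nat) : 0 <= e ->
  (forall r i, (r < a)%N -> (i < 2 ^ r)%N -> F r.+1 i.*2 = F r i) ->
  (forall r i, (r < a)%N -> (i < 2 ^ r)%N -> `|F r.+1 i.*2.+1 - F r.+1 i.*2| <= e * wt r) ->
  forall i, (i < 2 ^ a)%N -> `|F a i - F 0%N 0%N| <= e.
Proof.
move=> e0 cF sF.
have H r : (r <= a)%N -> forall i, (i < 2 ^ r)%N -> `|F r i - F 0%N 0%N| <= e * \sum_(s < r) wt s.
  elim: r => [|r IH] ra i ir.
    move: ir; rewrite expn0 ltnS leqn0 => /eqP ->.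
    by rewrite subrr normr0 big_ord0 mulr0.
  have ir' : (i./2 < 2 ^ r)%N by rewrite ltn_half_double -mul2n -expnS.
  have IHr := IH (ltnW ra) _ ir'; rewrite big_ord_recr/= mulrDr.
  rewrite -[i]odd_double_half; case: (odd i); rewrite ?add1n ?add0n.
    rewrite (_ : _ - _ = (F r i./2 - F 0%N 0%N) + (F r.+1 (i./2).*2.+1 - F r.+1 (i./2).*2)); last first.
      by rewrite cF//; ring.
    by rewrite (le_trans (ler_normD _ _))// lerD// sF.
  by rewrite cF// (le_trans IHr)// lerDl mulr_ge0// ltW// wt_gt0.
move=> i ia; rewrite (le_trans (H a (leqnn a) i ia))//.
by rewrite ler_piMr// sum_wt.
Qed.

Lemma inv_pow2_sqr (r : nat) : ((2 ^ r.+1)%:R^-1) ^+ 2 <= 4^-1 ^+ r :> R.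
Proof.
rewrite natrX -exprVn -exprM mulnC exprM (_ : 2^-1 ^+ 2 = 4^-1 :> R); last by field.
by rewrite exprS ler_piMl ?exprn_ge0 ?invr_ge0// invf_le1// ler1n.
Qed.

Definition cont_on (a b : R) (f : R -> R) : Prop :=
  forall u e, a <= u <= b -> 0 < e ->
    exists2 dl, 0 < dl & forall v, a <= v <= b -> `|u - v| < dl -> `|f u - f v| < e.

(** The index stays strictly below 2^r, as in the chaining lemmas, so that t = 1 is approached from
    the left. *)
Lemma dyadic_approx (t : R) (dl : R) : 0 <= t <= 1 -> 0 < dl ->
  exists r i, (i < 2 ^ r)%N /\ `|t - i%:R / (2 ^ r)%:R| < dl.
Proof.
move=> /andP[t0 t1] dl0.
pose r := (Num.truncn dl^-1).+1.
have r1 : dl^-1 < r%:R by exact: truncnS_gt.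
have q0 : 0 < (2 ^ r)%:R :> R by rewrite ltr0n expn_gt0.
have q1 : (2 ^ r)%:R^-1 < dl.
  rewrite -[dl]invrK ltf_pV2 ?posrE ?invr_gt0// (lt_trans r1)// ltr_nat.
  exact: ltn_expl.
have [t1'|t1'] := ltP t 1; last first.
  have -> : t = 1 by apply/eqP; rewrite eq_le t1 t1'.
  exists r, (2 ^ r).-1; have q2 : (0 < 2 ^ r)%N by rewrite expn_gt0.
  rewrite prednK//; split => //.
  rewrite -subn1 natrB// mulrBl mulfV ?gt_eqF// mul1r opprB addrCA subrr addr0.
  by rewrite ger0_norm// invr_ge0 ltW.
exists r, (Num.truncn (t * (2 ^ r)%:R)).
have tq : 0 <= t * (2 ^ r)%:R by rewrite mulr_ge0.
have /andP[h1 h2] := truncn_itv tq.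
split.
  rewrite -(ltr_nat R) (le_lt_trans h1)// -[ltRHS]mul1r ltr_pM2r//.
rewrite ger0_norm; last by rewrite subr_ge0 ler_pdivrMr.
rewrite ltrBlDr (@lt_trans _ _ ((Num.truncn (t * (2 ^ r)%:R)).+1%:R / (2 ^ r)%:R))//.
  by rewrite ltr_pdivlMr.
by rewrite -[X in X%:R / _]addn1 natrD mulrDl addrC ltrD2r mul1r.
Qed.

Context {d : measure_display} {T : measurableType d}.
Variable P : probability T R.

(** The exponent 2 > 1 of the fourth-moment bound makes the union bound over the dyadic increments
    converge; consequently the result does not depend on [a]. *)
Lemma discrete_chaining (a : nat) (S : nat -> T -> R) (B e : R) : 0 <= B -> 0 < e ->
  (forall i j, (i <= j <= 2 ^ a)%N -> L4 P (fun w => S j w - S i w) /\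
    Ex P (fun w => (S j w - S i w) ^+ 4) <= B * ((j - i)%:R / (2 ^ a)%:R) ^+ 2) ->
  small P [set w | exists2 j, (j < 2 ^ a)%N & e < `|S j w - S 0%N w|] (@Kch R * (B / e ^+ 4)).
Proof.
move=> B0 e0 HS.
pose F w r i := S (i * 2 ^ (a - r))%N w.
pose Bad r i := if (r < a)%N then [set w | e * wt r < `|F w r.+1 i.*2.+1 - F w r.+1 i.*2|] else set0.
have b0 : 0 <= B / e ^+ 4 by rewrite divr_ge0// exprn_ge0// ltW.
have H r i : (i < 2 ^ r)%N -> small P (Bad r i) (B / e ^+ 4 * 4^-1 ^+ r / wt r ^+ 4).
  move=> ir; rewrite /Bad; case: ifP => ra; last first.
    by apply: small0; rewrite !mulr_ge0 ?exprn_ge0 ?invr_ge0 ?exprn_ge0// ltW// wt_gt0.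
  pose i1 := (i.*2 * 2 ^ (a - r.+1))%N; pose i2 := (i.*2.+1 * 2 ^ (a - r.+1))%N.
  have e12 : (i2 - i1 = 2 ^ (a - r.+1))%N by rewrite -mulnBl subSnn mul1n.
  have i12 : (i1 <= i2 <= 2 ^ a)%N.
    rewrite leq_mul2r leqnSn orbT/= /i2 -[in X in (_ <= X)%N](subnK ra) expnD.
    by rewrite [X in (_ <= X)%N]mulnC leq_mul2r expnS mul2n ltn_double ir orbT.
  have [LS ES] := HS _ _ i12; have [mS LS4] := LS.
  have ew : 0 < e * wt r by rewrite mulr_gt0// wt_gt0.
  have p4 w : 0 <= (S i2 w - S i1 w) ^+ 4 by rewrite exprn_even_ge0.
  have := Pr_markov (exprn_gt0 4 ew) p4 LS4.
  set N := [set w | _]; move=> PN.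
  have mN : measurable N.
    rewrite /N (_ : [set w | _] = (fun w => (S i2 w - S i1 w) ^+ 4) @^-1` `](e * wt r) ^+ 4, +oo[).
      by rewrite -[X in measurable X]setTI; apply: (L1_mf LS4).
    by apply/seteqP; split => w /=; rewrite in_itv/= andbT.
  exists N; split => //.
    rewrite (le_trans PN)// ler_pdivrMr ?exprn_gt0// (le_trans ES)// e12.
    rewrite (exprMn 4 e).
    have -> : B / e ^+ 4 * 4^-1 ^+ r / wt r ^+ 4 * (e ^+ 4 * wt r ^+ 4) = B * 4^-1 ^+ r.
      by field; rewrite !lt0r_neq0// wt_gt0.
    rewrite ler_wpM2l//.
    have -> : (2 ^ (a - r.+1))%:R / (2 ^ a)%:R = (2 ^ r.+1)%:R^-1 :> R.
      rewrite -{2}(subnK ra) expnD natrM; field.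
      by rewrite !pnatr_eq0 !expn_eq0.
    exact: inv_pow2_sqr.
  move=> w /= h; rewrite /N/= -[ltRHS]ger0_norm// normrX ltr_pXn2r// nnegrE ltW//.
have := small_dyadic b0 H; apply: small_sub => // w [j ja ejw].
apply: contrapT => nb; move: ejw; apply/negP; rewrite -leNgt.
have := @dyadic_path (F w) e a (ltW e0); rewrite /F subn0 mul0n => h.
have := h _ _ j ja; rewrite subnn expn0 muln1; apply.
  move=> r i ra ir; congr (S _ w).
  by rewrite -[in RHS](subnSK ra) expnS mulnA muln2.
move=> r i ra ir; rewrite leNgt; apply/negP => h'; apply: nb; exists r, i; split => //.
by rewrite /Bad ra.
Qed.

(** The parameter [l] sits inside the bad events, so that the oscillation in u is controlled for all
    l at once; later l is the time. Only increments between neighbouring dyadic points are tested,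
    and continuity covers the other points. *)
Lemma dyadic_chaining (Lam : Type) (Z : Lam -> R -> T -> R) (u0 h B e : R) :
  0 < h -> 0 <= B -> 0 < e ->
  (forall l w, cont_on u0 (u0 + h) (fun u => Z l u w)) ->
  (forall (r i : nat) (e' : R), (i < 2 ^ r)%N -> 0 < e' ->
    small P [set w | exists l, e' < `|Z l (u0 + h * (i.+1%:R / (2 ^ r)%:R)) w -
        Z l (u0 + h * (i%:R / (2 ^ r)%:R)) w|] (B * ((2 ^ r)%:R^-1) ^+ 2 / e' ^+ 4)) ->
  small P [set w | exists l u, u0 <= u <= u0 + h /\ e < `|Z l u w - Z l u0 w|]
    (@Kch R * (B / e ^+ 4)).
Proof.
move=> h0 B0 e0 cZ HZ.
pose pt r i : R := u0 + h * (i%:R / (2 ^ r)%:R).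
have q0 r : 0 < (2 ^ r)%:R :> R by rewrite ltr0n expn_gt0.
have ptI r i : (i <= 2 ^ r)%N -> u0 <= pt r i <= u0 + h.
  move=> ir; rewrite lerDl lerD2l mulr_ge0 ?divr_ge0 ?(ltW h0)//=.
  by rewrite ler_piMr ?(ltW h0)// ler_pdivrMr// mul1r ler_nat.
pose Bad r i := [set w | exists l, e * wt r < `|Z l (pt r.+1 i.*2.+1) w - Z l (pt r.+1 i.*2) w|].
have b0 : 0 <= B / e ^+ 4 by rewrite divr_ge0// exprn_ge0// ltW.
have H r i : (i < 2 ^ r)%N -> small P (Bad r i) (B / e ^+ 4 * 4^-1 ^+ r / wt r ^+ 4).
  move=> ir; have ew : 0 < e * wt r by rewrite mulr_gt0// wt_gt0.
  have i1 : (i.*2.+1 <= 2 ^ r.+1)%N by rewrite expnS mul2n ltn_double.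
  apply: small_sub (HZ _ _ _ i1 ew) => //.
  rewrite (exprMn 4 e).
  have -> : B / e ^+ 4 * 4^-1 ^+ r / wt r ^+ 4 = B * 4^-1 ^+ r / (e ^+ 4 * wt r ^+ 4).
    by field; rewrite !lt0r_neq0// wt_gt0.
  rewrite ler_wpM2r ?invr_ge0 ?mulr_ge0 ?exprn_ge0 ?(ltW e0) ?(ltW (wt_gt0 r))//.
  by rewrite ler_wpM2l// inv_pow2_sqr.
have := small_dyadic b0 H; apply: small_sub => // w [l [u [uI euw]]].
apply: contrapT => nb.
have dy r i : (i < 2 ^ r)%N -> `|Z l (pt r i) w - Z l u0 w| <= e.
  have := @dyadic_path (fun r i => Z l (pt r i) w) e r (ltW e0).
  have -> : pt 0%N 0%N = u0 by rewrite /pt mul0r mulr0 addr0.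
  apply.
    move=> s j sr js; congr (Z l _ w); rewrite /pt -muln2 expnS natrM natrM; congr (_ + h * _).
    by field; rewrite gt_eqF.
  move=> s j sr js; rewrite leNgt; apply/negP => h'; apply: nb; exists s, j; split => //.
  by exists l.
have ep : 0 < `|Z l u w - Z l u0 w| - e by rewrite subr_gt0.
have [dl dl0 Hdl] := cZ l w u _ uI ep.
have tI : 0 <= (u - u0) / h <= 1.
  by case/andP: uI => h1 h2; rewrite divr_ge0 ?subr_ge0 ?(ltW h0)//= ler_pdivrMr// mul1r lerBlDr addrC.
have [r [i [ir ti]]] := dyadic_approx tI (divr_gt0 dl0 h0).
have := Hdl (pt r i) (ptI _ _ (ltnW ir)).
have -> : u - pt r i = h * ((u - u0) / h - i%:R / (2 ^ r)%:R).
  by rewrite /pt; field; rewrite !gt_eqF.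
rewrite normrM (ger0_norm (ltW h0)) -ltr_pdivlMl// [h^-1 * dl]mulrC => /(_ ti).
have := ler_normD (Z l u w - Z l (pt r i) w) (Z l (pt r i) w - Z l u0 w).
rewrite addrA subrK; have := dy _ _ ir; lra.
Qed.

Lemma continuous_chaining (Lam : Type) (Z : Lam -> R -> T -> R) (u0 h B e : R) :
  0 < h -> 0 <= B -> 0 < e ->
  (forall l w, cont_on u0 (u0 + h) (fun u => Z l u w)) ->
  (forall u v e' : R, u0 <= u <= u0 + h -> u0 <= v <= u0 + h -> 0 < e' ->
    small P [set w | exists l, e' < `|Z l u w - Z l v w|] (B * (`|u - v| / h) ^+ 2 / e' ^+ 4)) ->
  small P [set w | exists l u, u0 <= u <= u0 + h /\ e < `|Z l u w - Z l u0 w|]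
    (@Kch R * (B / e ^+ 4)).
Proof.
move=> h0 B0 e0 cZ HZ; apply: dyadic_chaining => // r i e' ir e'0.
have q0 : 0 < (2 ^ r)%:R :> R by rewrite ltr0n expn_gt0.
have ptI j : (j <= 2 ^ r)%N -> u0 <= u0 + h * (j%:R / (2 ^ r)%:R) <= u0 + h.
  move=> jr; rewrite lerDl lerD2l mulr_ge0 ?divr_ge0 ?(ltW h0)//=.
  by rewrite ler_piMr ?(ltW h0)// ler_pdivrMr// mul1r ler_nat.
apply: small_sub (HZ _ _ _ (ptI _ ir) (ptI _ (ltnW ir)) e'0) => //.
rewrite opprD addrACA subrr add0r -mulrBr -mulrBl -natrB// subSnn mul1r.
have -> : `|h / (2 ^ r)%:R| / h = (2 ^ r)%:R^-1 :> R.
  by rewrite ger0_norm ?divr_ge0 ?(ltW h0)// mulrC mulrA mulVf ?gt_eqF// mul1r.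
exact: lexx.
Qed.

End chaining.

(** * Separability and measurability *)

Section uniform_continuity.
Context {R : realType} {V : normedModType R}.
Implicit Types (a b e : R) (f : R -> V).

Definition cont_in a b f : Prop :=
  forall u e, a <= u <= b -> 0 < e ->
    exists2 dl, 0 < dl & forall v, a <= v <= b -> `|u - v| < dl -> `|f u - f v| < e.

Lemma cont_in_within (I : set R) a b f : (forall u, a <= u <= b -> I u) ->
  {within I, continuous f} -> cont_in a b f.
Proof.
move=> abI /subspace_continuousP cf u e uab e0.
have /cvgrPdist_lt/(_ e e0) := cf u (abI u uab).
rewrite /prop_near1 /within/= => /nbhs_ballP[dl /= dl0 H]; exists dl => // v vab uv.
by apply: H => //; exact: abI.
Qed.

(** Heine-Cantor: offending pairs at distance below 1/(n + 1) would cluster at a point where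
    continuity fails. *)
Lemma heine a b f : cont_in a b f -> forall e, 0 < e ->
  exists2 dl, 0 < dl & forall u v, a <= u <= b -> a <= v <= b -> `|u - v| < dl -> `|f u - f v| <= e.
Proof.
move=> cf e e0; apply: contrapT => H.
have bad (n : nat) : {uv : R * R | [/\ a <= uv.1 <= b, a <= uv.2 <= b, `|uv.1 - uv.2| < n.+1%:R^-1 & e < `|f uv.1 - f uv.2|]}.
  apply: cid; apply: contrapT => nb; apply: H; exists n.+1%:R^-1; first by rewrite invr_gt0.
  move=> u v uab vab uv; rewrite leNgt; apply/negP => ne; apply: nb.
  by exists (u, v).
pose un n := (projT1 (bad n)).1; pose vn n := (projT1 (bad n)).2.
have unP n : [/\ a <= un n <= b, a <= vn n <= b, `|un n - vn n| < n.+1%:R^-1 & e < `|f (un n) - f (vn n)|].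
  exact: (projT2 (bad n)).
have uI : (un @ \oo) `[a, b]%classic.
  by exists 0%N => // n _ /=; rewrite in_itv/=; case: (unP n).
have [x [xab clx]] : `[a, b]%classic `&` cluster (un @ \oo) !=set0 by exact: segment_compact.
have xab' : a <= x <= b by move: xab; rewrite /= in_itv.
have [dl dl0 Hdl] := cf x (e / 2) xab' (divr_gt0 e0 (ltr0n _ 2)).
have [N NP] : exists N : nat, N.+1%:R^-1 < dl / 2.
  exists (Num.truncn (2 / dl)); rewrite -[dl / 2]invf_div ltf_pV2 ?posrE ?divr_gt0//.
  exact: truncnS_gt.
have tail : (un @ \oo) [set un n | n in [set n | (N <= n)%N]].
  by exists N => // n /= Nn; exists n.
have nx : nbhs x (ball x (dl / 2)) by apply: nbhsx_ballx; rewrite divr_gt0.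
have [y [[n /= Nn <-] xy]] := clx _ _ tail nx.
have [u1 v1 uv ne] := unP n.
have xu : `|x - un n| < dl / 2 by move: xy; rewrite -ball_normE.
have uv' : `|un n - vn n| < dl / 2.
  rewrite (lt_trans uv)// (le_lt_trans _ NP)// lef_pV2 ?posrE// ler_nat ltnS//.
have h1 := Hdl _ u1 (lt_trans xu _); have h2 := Hdl _ v1.
have xv : `|x - vn n| < dl.
  by rewrite (le_lt_trans (ler_distD (un n) _ _))// [ltRHS]splitr ltrD.
have {}h1 : `|f x - f (un n)| < e / 2 by apply: h1; rewrite ltr_pdivrMr// ltr_pMr// ltr1n.
have {}h2 := h2 xv.
move: ne; apply/negP; rewrite -leNgt.
rewrite (_ : f (un n) - f (vn n) = (f x - f (vn n)) - (f x - f (un n))); last first.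
  by rewrite opprB [RHS]addrC addrA subrK.
by rewrite (le_trans (ler_normB _ _))// [leRHS]splitr lerD// ltW.
Qed.

Definition grid a b (n i : nat) : R := a + (b - a) * (i%:R / n.+1%:R).

(** For a = b the division by 0 gives 0, which is the right cell. *)
Definition cell a b (n : nat) (u : R) : nat := Num.truncn ((u - a) / (b - a) * n.+1%:R).

Lemma grid_cell a b n u : a <= u <= b ->
  [/\ (cell a b n u <= n.+1)%N, a <= grid a b n (cell a b n u) <= u &
    u - grid a b n (cell a b n u) <= (b - a) / n.+1%:R].
Proof.
move=> /andP[au ub]; rewrite /grid /cell.
have [ab|ab] := eqVneq a b.
  have -> : u = a by apply/eqP; rewrite eq_le au ab ub.
  by rewrite -ab subrr !mul0r truncn0 ?mul0r addr0 subrr lexx.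
have ba : 0 < b - a by rewrite subr_gt0 lt_def eq_sym ab (le_trans au).
set t := (u - a) / (b - a).
have t0 : 0 <= t by rewrite divr_ge0 ?(ltW ba)// subr_ge0.
have t1 : t <= 1 by rewrite ler_pdivrMr// mul1r lerD2r.
have uE : u = a + (b - a) * t by rewrite /t mulrC divfK ?gt_eqF// addrC subrK.
have tn : 0 <= t * n.+1%:R by rewrite mulr_ge0.
have /andP[h1 h2] := truncn_itv tn.
split.
- by rewrite -(ler_nat R) (le_trans h1)// ler_piMl.
- rewrite lerDl mulr_ge0 ?(ltW ba)//= [leRHS]uE lerD2l ler_pM2l//.
  by rewrite ler_pdivrMr.
- rewrite [X in X - _]uE opprD addrACA subrr add0r -mulrBr ler_pM2l//.
  rewrite lerBlDr -[X in X + _]mul1r -mulrDl ler_pdivlMr//.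
  by rewrite (le_trans (ltW h2))// -[leLHS]natr1 addrC.
Qed.

Lemma heine_grid a b f : cont_in a b f -> forall e, 0 < e -> exists n,
  forall u, a <= u <= b -> `|f u - f (grid a b n (cell a b n u))| <= e.
Proof.
move=> cf e e0; have [dl dl0 H] := heine cf e0.
exists (Num.truncn ((b - a) / dl)) => u uab.
set n := Num.truncn _; have [h1 /andP[h2 h3] h4] := grid_cell n uab.
apply: H => //.
  by case/andP: uab => _ ub; rewrite h2 (le_trans h3).
rewrite ger0_norm ?subr_ge0// (le_lt_trans h4)// ltr_pdivrMr// mulrC -ltr_pdivrMr//.
exact: truncnS_gt.
Qed.

Lemma cont_in_bounded a b f : cont_in a b f -> exists K, forall u, a <= u <= b -> `|f u| <= K.
Proof.
move=> cf; have [n H] := heine_grid cf ltr01.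
exists (1 + \sum_(i < n.+2) `|f (grid a b n i)|) => u uab.
have [h1 _ _] := grid_cell n uab.
rewrite -[f u](subrK (f (grid a b n (cell a b n u)))) (le_trans (ler_normD _ _))// lerD ?H//.
by rewrite (bigD1 (Ordinal (h1 : (_ < n.+2)%N)))//= lerDl sumr_ge0.
Qed.

(** Separability, as countable covers by sets of small diameter without chosen centres. *)
Definition coverable : Prop := forall e, 0 < e -> exists U : nat -> set V,
  (forall x, exists n, U n x) /\ forall n x y, U n x -> U n y -> `|x - y| <= e.

(** A function is coded by a mesh on which it oscillates by at most e/3 and by the codes of its
    values there; there are countably many such codes. *)
Lemma cont_cover a b : coverable -> forall e, 0 < e -> exists U : nat -> set (R -> V),
  (forall f, cont_in a b f -> exists n, U n f) /\
  forall n f g, U n f -> U n g -> forall u, a <= u <= b -> `|f u - g u| <= e.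
Proof.
move=> covV e e0; have e3 : 0 < e / 3 by rewrite divr_gt0.
have [U [Ucov Ud]] := covV _ e3.
pose C (c : nat * seq nat) : set (R -> V) := [set f |
  (forall i, (i <= c.1.+1)%N -> U (nth 0%N c.2 i) (f (grid a b c.1 i))) /\
  forall u, a <= u <= b -> `|f u - f (grid a b c.1 (cell a b c.1 u))| <= e / 3].
exists (fun n => if unpickle n is Some c then C c else set0); split.
  move=> f cf; have [n H] := heine_grid cf e3.
  pose s := [seq projT1 (cid (Ucov (f (grid a b n i)))) | i <- iota 0 n.+2].
  exists (pickle (n, s)); rewrite pickleK; split => //= i ilt.
  rewrite (nth_map 0%N) ?size_iota// nth_iota// add0n.
  exact: (projT2 (cid (Ucov (f (grid a b n i))))).
move=> n f g; case: (unpickle n) => [c|]// [f1 f2] [g1 g2] u uab.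
have [h1 _ _] := grid_cell c.1 uab.
set t := grid a b c.1 (cell a b c.1 u).
rewrite (_ : f u - g u = (f u - f t) + (f t - g t) - (g u - g t)); last first.
  by rewrite opprB !addrA !subrK.
rewrite (_ : e = e / 3 + e / 3 + e / 3); last by field.
rewrite (le_trans (ler_normB _ _))// lerD ?g2// (le_trans (ler_normD _ _))// lerD ?f2//.
exact: Ud (f1 _ h1) (g1 _ h1).
Qed.

End uniform_continuity.
Arguments coverable {R} V.

Section row_vectors.
Context {R : realType} {k : nat}.

Lemma rV_coord_le (x : 'rV[R]_k) i : `|x ord0 i| <= `|x|.
Proof.
by rewrite [leRHS]mx_normrE; exact: (le_bigmax _ (fun ij => `|x ij.1 ij.2|) (ord0, i)).
Qed.

Lemma rV_norm_le (x : 'rV[R]_k) (c : R) : 0 <= c -> (forall i, `|x ord0 i| <= c) -> `|x| <= c.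
Proof.
move=> c0 xc; rewrite [leLHS]mx_normrE; apply: bigmax_le => //= -[i j] _ /=.
by rewrite (ord1 i).
Qed.

Lemma rV_coverable : coverable 'rV[R]_k.
Proof.
move=> e e0.
pose C (c : {ffun 'I_k -> int}) : set 'rV[R]_k := [set x | forall i, c i = Num.floor (x ord0 i / e)].
exists (fun n => if unpickle n is Some c then C c else set0); split.
  move=> x; exists (pickle [ffun i => Num.floor (x ord0 i / e)]).
  by rewrite pickleK => i; rewrite ffunE.
move=> n x y; case: (unpickle n) => [c|]// xc yc; apply: rV_norm_le; first exact: ltW.
move=> i; rewrite !mxE.
have /andP[a1 a2] := floor_itv (x ord0 i / e); have /andP[b1 b2] := floor_itv (y ord0 i / e).
rewrite -xc in a1 a2; rewrite -yc in b1 b2.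
rewrite -[x ord0 i](divfK (lt0r_neq0 e0)) -[y ord0 i](divfK (lt0r_neq0 e0)) -mulrBl normrM.
rewrite (ger0_norm (ltW e0)) ler_piMl ?(ltW e0)//.
move: a1 a2 b1 b2; rewrite intrD; move: ((c i)%:~R : R) (x ord0 i / e) (y ord0 i / e) => z u v.
by rewrite ler_norml; lra.
Qed.

End row_vectors.

Section C0_facts.
Context {R : realType} {I : set R} {V : normedModType R}.
Implicit Types f g : C0 I V.

Lemma Linf_ub {Tp : Type} {D : set Tp} (F : Linf D V) t : `|F t| <= `|F|.
Proof.
have [Dt|nDt] := pselect (D t).
  by apply: supnorm_ub => //; exact: Linf_bounded.
by rewrite Linf_out// normr0.
Qed.

Lemma C0_ub f u : `|f u| <= `|f|.
Proof. exact: Linf_ub. Qed.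

Lemma C0_subE f g u : (f - g) u = f u - g u.
Proof. by []. Qed.

Lemma C0_norm_le f (c : R) : 0 <= c -> (forall u, I u -> `|f u| <= c) -> `|f| <= c.
Proof. by move=> c0 fc; apply: supnorm_le. Qed.

Lemma C0_cont_in a b f : (forall u, a <= u <= b -> I u) -> cont_in a b (fun u => f u).
Proof.
move=> abI; apply: cont_in_within abI _.
by case: f => f /=; rewrite inE => -[].
Qed.

Lemma C0_tail f (e : R) : 0 < e -> exists n : nat, forall u, n%:R < `|u| -> `|f u| <= e.
Proof.
move=> e0; case: f => f /=; rewrite inE => -[_ /cvgrPdist_lt /(_ e e0)].
move=> [y [yr H]]; exists (Num.truncn (Num.max y 0)).+1 => u nu.
have yn : y < (Num.truncn (Num.max y 0)).+1%:R.
  by rewrite (le_lt_trans _ (truncnS_gt _))// le_max lexx.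
have := H _ yn; rewrite sub0r normrN ger0_norm ?supnorm_ge0// => h.
rewrite (le_trans _ (ltW h))//; apply: supnorm_ub => //; exact: Linf_bounded_on.
Qed.

(** On the line the code also contains a radius beyond which the function is at most e/2. *)
Lemma C0_coverable : domain I -> coverable V -> coverable (C0 I V).
Proof.
move=> domI covV e e0; case: domI => [IT|[a [b [ab IE]]]].
  pose e2 := e / 2; have e20 : 0 < e2 by rewrite divr_gt0.
  pose U n := projT1 (cid (@cont_cover R V (- n%:R) n%:R covV e e0)).
  have UP n : (forall p : R -> V, cont_in (- n%:R) n%:R p -> exists m, U n m p) /\
    forall m (p q : R -> V), U n m p -> U n m q -> forall u, - n%:R <= u <= n%:R -> `|p u - q u| <= e.
    exact: (projT2 (cid (@cont_cover R V (- n%:R) n%:R covV e e0))).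
  pose C (c : nat * nat) : set (C0 I V) := [set f | U c.1 c.2 (fun u => f u) /\
    forall u, c.1%:R < `|u| -> `|f u| <= e2].
  exists (fun n => if unpickle n is Some c then C c else set0); split.
    move=> f; have [n Hn] := C0_tail f e20.
    have [|m Um] := (UP n).1 (fun u => f u); first by apply: C0_cont_in => u _; rewrite IT.
    by exists (pickle (n, m)); rewrite pickleK.
  move=> n f g; case: (unpickle n) => [[m l]|]// [f1 f2] [g1 g2].
  apply: C0_norm_le; first exact: ltW.
  move=> u _; rewrite C0_subE; have [um|um] := leP `|u| m%:R.
    by apply: (UP m).2 f1 g1 _ _; rewrite -ler_norml.
  by rewrite (le_trans (ler_normB _ _))// [leRHS]splitr lerD ?f2 ?g2.
have [U [U1 U2]] := @cont_cover R V a b covV e e0.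
have abI u : a <= u <= b -> I u by rewrite IE /= in_itv.
exists (fun n => [set f : C0 I V | U n (fun u => f u)]); split.
  by move=> f; apply: U1; exact: C0_cont_in.
move=> n f g f1 g1; apply: C0_norm_le; first exact: ltW.
move=> u Iu; have uab : a <= u <= b by have := Iu; rewrite IE /= in_itv.
by rewrite C0_subE; exact: U2 f1 g1 _ uab.
Qed.

End C0_facts.

Section measurability.
Context {R : realType} {d : measure_display} {Omega : measurableType d}.

(** Algebraic operations on Borel maps into a normed space need separability to stay measurable.
    Here the preimage of an open set is a countable union: for each precision j and each piece n of
    the cover, take a point of the piece, if there is one, whose measurable neighbourhood in terms
    of [Z] is sent into the open set. *)
Lemma measurable_of_cover {M T : normedModType R} (Z : nat -> Omega -> M) (Y : Omega -> T) :
  (forall l, measurable_fun setT (Z l : Omega -> borel M)) ->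
  (forall e : R, 0 < e -> exists U : nat -> set Omega, (forall w, exists n, U n w) /\
    forall n w w', U n w -> U n w' -> forall l, `|Z l w - Z l w'| <= e) ->
  (forall e : R, 0 < e -> exists2 e', 0 < e' & forall w w',
     (forall l, `|Z l w - Z l w'| <= e') -> `|Y w - Y w'| <= e) ->
  measurable_fun setT (Y : Omega -> borel T).
Proof.
move=> mZ covZ YZ; apply: measurable_borel => O oO.
have jpos (j : nat) : 0 < j.+1%:R^-1 :> R by rewrite invr_gt0.
pose de j := projT1 (cid2 (YZ j.+1%:R^-1 (jpos j))).
have [de0 deP] : (forall j, 0 < de j) /\ forall j w w',
    (forall l, `|Z l w - Z l w'| <= de j) -> `|Y w - Y w'| <= j.+1%:R^-1.
  by split => j; case: (projT2 (cid2 (YZ j.+1%:R^-1 (jpos j)))).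
have hpos j : 0 < de j / 2 by rewrite divr_gt0.
pose U j := projT1 (cid (covZ _ (hpos j))).
have UP j : (forall w, exists n, U j n w) /\
    forall n w w', U j n w -> U j n w' -> forall l, `|Z l w - Z l w'| <= de j / 2.
  exact: (projT2 (cid (covZ _ (hpos j)))).
pose C j w0 : set Omega := [set w | forall l, `|Z l w - Z l w0| <= de j / 2].
have mC j w0 : measurable (C j w0).
  have -> : C j w0 = \bigcap_l (Z l @^-1` (~` [set x | de j / 2 < `|x - Z l w0|])).
    apply/seteqP; split => w /= H l; first by move=> _ /=; apply/negP; rewrite -leNgt; exact: H.
    by rewrite leNgt; apply/negP; exact: H l I.
  apply: bigcapT_measurable => l; rewrite preimage_setC; apply: measurableC.
  suff oS : open [set x : M | de j / 2 < `|x - Z l w0|] by exact: (measurable_borel_open (mZ l) oS).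
  have -> : [set x : M | de j / 2 < `|x - Z l w0|] = (fun x => `|x - Z l w0|) @^-1` [set r | de j / 2 < r] by [].
  apply: open_comp; last exact: open_gt.
  move=> x _; apply: cvg_norm; apply: cvgB; [exact: cvg_id|exact: cvg_cst].
pose B j n : set Omega := if pselect (exists w0, U j n w0 /\ forall w, C j w0 w -> O (Y w)) is left ex
  then C j (projT1 (cid ex)) else set0.
have -> : Y @^-1` O = \bigcup_j \bigcup_n B j n.
  apply/seteqP; split => w /=; last first.
    move=> [j _ [n _]]; rewrite /B; case: pselect => // ex.
    by case: (projT2 (cid ex)) => _ + Yw; exact.
  move=> Ow; have : nbhs (Y w) O by exact: open_nbhs_nbhs.
  move=> /nbhs_ballP[r /= r0 rO].
  have [j jr] : exists j : nat, j.+1%:R^-1 < r.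
    exists (Num.truncn r^-1); rewrite -[ltRHS]invrK ltf_pV2 ?posrE ?invr_gt0//.
    exact: truncnS_gt.
  have [n Un] := (UP j).1 w; exists j => //; exists n => //.
  rewrite /B; case: pselect => [ex|nex].
    by case: (projT2 (cid ex)) => Un0 _ l; exact: (UP j).2 Un Un0 l.
  exfalso; apply: nex; exists w; split => // w' Cw'; apply: rO.
  rewrite -ball_normE/= distrC (le_lt_trans _ jr)//; apply: deP => l.
  by rewrite (le_trans (Cw' l))// ler_pdivrMr// ler_peMr ?(ltW (de0 j))// ler1n.
apply: bigcupT_measurable => j; apply: bigcupT_measurable => n.
by rewrite /B; case: pselect.
Qed.

Lemma lip1_continuous {M : normedModType R} (phi : M -> R) :
  (forall x y, `|phi x - phi y| <= `|x - y|) -> continuous phi.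
Proof.
move=> H x; apply/cvgrPdist_lt => e e0; apply/nbhs_ballP; exists e => // y.
by rewrite -ball_normE/=; exact: le_lt_trans.
Qed.

Lemma C0_coord_measurable {I : set R} {k : nat} (X : Omega -> C0 I 'rV[R]_k) (u : R) (i : 'I_k) :
  measurable_fun setT (X : Omega -> borel (C0 I 'rV[R]_k)) ->
  measurable_fun setT (fun w => X w u ord0 i).
Proof.
move=> mX; apply: (measurability _ (RGenOpens.measurableE R)).

move=> _ [U [p [q ->]] <-]; rewrite setTI.
have oU : open `]p, q[%classic by exact: interval_open.
set U' := `]p, q[%classic in oU *.
have -> : (fun w => X w u ord0 i) @^-1` U' = X @^-1` ((fun f : C0 I 'rV[R]_k => f u ord0 i) @^-1` U') by [].
apply: measurable_borel_open => //; apply: open_comp => //.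
move=> f _; apply: lip1_continuous => {}f g; rewrite (le_trans _ (C0_ub (f - g) u))//.
by rewrite C0_subE; have := rV_coord_le (f u - g u) i; rewrite !mxE.
Qed.

End measurability.

(** * Moments of order J *)

Section expectation_bounds.
Context {R : realType} {d : measure_display} {T : measurableType d}.
Variable P : probability T R.
Local Notation Ex := (Ex P).
Local Notation L1 := (L1 P).

(* The integral of a nonnegative function is a lower integral, so that it is
   monotone without any measurability of the larger function. *)
Lemma expectation_mono (f g : T -> R) : (forall w, 0 <= f w) -> (forall w, f w <= g w) ->
  ('E_P[f] <= 'E_P[g])%E.
Proof.
move=> f0 fg; rewrite unlock !ge0_integralTE => [|w|w]; last 2 first.
- by rewrite lee_fin (le_trans (f0 w)).
- by rewrite lee_fin.
apply: le_ereal_sup => _ [h hf <-]; exists h => // x.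
by rewrite (le_trans (hf x))// lee_fin.
Qed.

Lemma L1_expectation_le (f g : T -> R) (c : R) : measurable_fun setT f ->
  (forall w, 0 <= f w) -> (forall w, f w <= g w) -> ('E_P[g] <= c%:E)%E ->
  L1 f /\ Ex f <= c.
Proof.
move=> mf f0 fg gc; apply: L1_expectation => //.
exact: le_trans (expectation_mono f0 fg) gc.
Qed.

Variable J : R.
Hypothesis J1 : 1 <= J.

Let J0 : 0 < J. Proof. exact: lt_le_trans J1. Qed.

Definition LJ (f : T -> R) (b : R) : Prop := [/\ measurable_fun setT f,
  L1 (fun w => `|f w| `^ J) & Ex (fun w => `|f w| `^ J) <= b `^ J].

Lemma powR_add_le (x y : R) : 0 <= x -> 0 <= y -> (x + y) `^ J <= 2 `^ J * (x `^ J + y `^ J).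
Proof.
move=> x0 y0.
have h (u v : R) : 0 <= u -> u <= v -> (u + v) `^ J <= 2 `^ J * (u `^ J + v `^ J).
  move=> u0 uv; have v0 := le_trans u0 uv.
  apply: (@le_trans _ _ ((2 * v) `^ J)).
    apply: ge0_ler_powR; rewrite ?nnegrE ?addr_ge0 ?mulr_ge0// ?(ltW J0)//.
    by rewrite mulr_natl mulr2n lerD2r.
  by rewrite powRM// ler_wpM2l ?powR_ge0// lerDr powR_ge0.
have [xy|/ltW yx] := leP x y; first exact: h.
by rewrite addrC [X in _ * X]addrC; exact: h.
Qed.

(** Minkowski's inequality up to a factor 4, from the pointwise bound [powR_add_le]. *)
Lemma LJ_D f g (b b' : R) : 0 <= b -> 0 <= b' -> LJ f b -> LJ g b' -> LJ (fun w => f w + g w) (4 * (b + b')).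
Proof.
move=> b0 b'0 [mf Lf Ef] [mg Lg Eg].
have mfg : measurable_fun setT (fun w => f w + g w) by exact: measurable_funD.
have mpow (h : T -> R) : measurable_fun setT h -> measurable_fun setT (fun w => `|h w| `^ J).
  by move=> mh; apply: (measurableT_comp (measurable_powR J)); exact: measurableT_comp.
have le w : `|f w + g w| `^ J <= 2 `^ J * (`|f w| `^ J + `|g w| `^ J).
  rewrite (le_trans _ (powR_add_le _ _))//; apply: ge0_ler_powR; rewrite ?nnegrE ?addr_ge0// ?(ltW J0)//.
  exact: ler_normD.
have LR : L1 (fun w => 2 `^ J * (`|f w| `^ J + `|g w| `^ J)) by apply: L1Z; exact: L1D.
have L : L1 (fun w => `|f w + g w| `^ J).
  apply: L1_dom LR; first exact: mpow.
  by move=> w; rewrite ger0_norm// powR_ge0.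
split => //; apply: (le_trans (Ex_le L LR le)).
rewrite ExZ ?ExD//; last exact: L1D.
have h1 : b `^ J <= (b + b') `^ J.
  by apply: ge0_ler_powR; rewrite ?nnegrE ?addr_ge0// ?(ltW J0)// lerDl.
have h2 : b' `^ J <= (b + b') `^ J.
  by apply: ge0_ler_powR; rewrite ?nnegrE ?addr_ge0// ?(ltW J0)// lerDr.
rewrite (_ : 4 = 2 * 2 :> R); last by rewrite -natrM.
rewrite -mulrA powRM ?mulr_ge0 ?addr_ge0// ler_wpM2l ?powR_ge0// powRM ?addr_ge0//.
have h3 : 2 <= 2 `^ J :> R by rewrite -{1}[2](powRr1 (ler0n R 2)) ler_powR// ler1n.
apply: (@le_trans _ _ (2 * (b + b') `^ J)); last by rewrite ler_wpM2r ?powR_ge0.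
by rewrite mulr_natl mulr2n (le_trans (lerD Ef Eg))// lerD.
Qed.

Lemma LJ_le f (b b' : R) : 0 <= b -> b <= b' -> LJ f b -> LJ f b'.
Proof.
move=> b0 bb [mf Lf Ef]; split => //; rewrite (le_trans Ef)//.
by apply: ge0_ler_powR; rewrite ?nnegrE ?(ltW J0)// (le_trans b0).
Qed.

(** Jensen's inequality up to a factor 2, from |f| <= b + b (|f|/b)^J. *)
Lemma LJ_L1 f (b : R) : 0 < b -> LJ f b -> L1 f /\ `|Ex f| <= 2 * b.
Proof.
move=> b0 [mf Lf Ef].
have le w : `|f w| <= cst b w + b * (b `^ J)^-1 * `|f w| `^ J.
  have e : `|f w| = b * (`|f w| / b) by rewrite mulrC divfK// gt_eqF.
  have -> : b * (b `^ J)^-1 * `|f w| `^ J = b * (`|f w| / b) `^ J.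
    by rewrite powRM ?invr_ge0 ?(ltW b0)// -[b^-1]powR_inv1 ?(ltW b0)// -powRrM mulN1r powRN; ring.
  have x0 : 0 <= `|f w| / b by rewrite divr_ge0// ltW.
  rewrite {1}e /= -[X in X + _]mulr1 -mulrDr ler_pM2l//.
  have [x1|x1] := leP (`|f w| / b) 1; first by rewrite (le_trans x1)// lerDl powR_ge0.
  by rewrite (le_trans (le1r_powR (ltW x1) J1))// lerDr.
have LR : L1 (fun w => cst b w + b * (b `^ J)^-1 * `|f w| `^ J).
  by apply: L1D; [exact: L1_cst|exact: L1Z].
have L : L1 f by apply: L1_dom LR.
split => //; rewrite (le_trans (Ex_norm_le L LR le))// ExD ?ExZ ?Ex_cst//; [|exact: L1_cst|exact: L1Z].
rewrite mulr_natl mulr2n lerD2l -mulrA ler_piMr ?(ltW b0)//.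
by rewrite mulrC ler_pdivrMr ?powR_gt0// mul1r.
Qed.

Lemma LJ_centered f b : 0 < b -> LJ f b -> LJ (fun w => f w - Ex f) (12 * b).
Proof.
move=> b0 Lf; have [_ mf] := LJ_L1 b0 Lf.
have Lc : LJ (cst (- Ex f)) (2 * b).
  split; [exact: measurable_cst|exact: (L1_cst P (`|- Ex f| `^ J))|].
  rewrite (Ex_cst P (`|- Ex f| `^ J)) normrN.
  by apply: ge0_ler_powR; rewrite ?nnegrE ?mulr_ge0 ?(ltW b0) ?(ltW J0).
have := LJ_D (ltW b0) (mulr_ge0 (ler0n _ 2) (ltW b0)) Lf Lc.
by rewrite (_ : 4 * (b + 2 * b) = 12 * b)//; ring.
Qed.

(** [g] stands for norms in function space, of which measurability is not known; that of the
    coordinate [f] suffices. *)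
Lemma LJ_of_expectation (f g : T -> R) (c s : R) : 0 < s -> 0 <= c -> measurable_fun setT f ->
  (forall w, `|f w| / s <= g w) -> ('E_P[fun w => (g w `^ J)%R] <= c%:E)%E ->
  LJ f (s * c `^ J^-1).
Proof.
move=> s0 c0 mf fg Eg.
have mpow : measurable_fun setT (fun w => (`|f w| / s) `^ J).
  apply: (measurableT_comp (measurable_powR J)).
  by apply: measurable_funM; [exact: measurableT_comp|exact: measurable_cst].
have [L E] : L1 (fun w => (`|f w| / s) `^ J) /\ Ex (fun w => (`|f w| / s) `^ J) <= c.
  apply: L1_expectation_le Eg => // [w|w]; first exact: powR_ge0.
  have h : 0 <= `|f w| / s by rewrite divr_ge0// ltW.
  by apply: ge0_ler_powR; rewrite ?nnegrE ?(ltW J0)// (le_trans h).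
have e : (fun w => `|f w| `^ J) = (fun w => s `^ J * (`|f w| / s) `^ J).
  apply/funext => w; rewrite -powRM ?divr_ge0 ?(ltW s0)//.
  by rewrite mulrC divfK// gt_eqF.
rewrite /LJ e; split => //; first exact: L1Z.
rewrite ExZ// powRM ?powR_ge0 ?(ltW s0)// -[(c `^ _) `^ _]powRrM mulVf ?gt_eqF// powRr1//.
by rewrite ler_wpM2l ?powR_ge0.
Qed.

End expectation_bounds.

Section mixing_transfer.
Context {R : realType} {d : measure_display} {T : measurableType d}.
Variable P : probability T R.

(** Index 0, at which nothing is assumed about [Y], generates nothing. *)
Lemma mixing_of_alpha {dT} {E : measurableType dT} (Y : nat -> T -> E) (c nu : R) :
  (forall n, (0 < n)%N -> measurable_fun setT (Y n)) ->
  (forall n, (0 < n)%N -> (alpha_coef P Y n <= (c * n%:R `^ (- nu))%:E)%E) ->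
  mixing_seq P (fun i => if i == 0%N then set0 else preimage_set_system setT (Y i) measurable) c nu.
Proof.
move=> mY aY m k m0 k0 A B sA sB.
pose G i := if i == 0%N then set0 else preimage_set_system setT (Y i) measurable.
have GT (D : set nat) C : <<s \bigcup_(i in D) G i >> C -> measurable C.
  apply: smallest_sub; first exact: sigma_algebra_measurable.
  move=> S [i _]; rewrite /G; case: i => [|i]//= [B' mB' <-].
  by rewrite setTI; have := mY i.+1 erefl measurableT B' mB'; rewrite setTI.
have mA : measurable A := GT _ _ sA; have mB : measurable B := GT _ _ sB.
have eq (D : set nat) : ~ D 0%N -> \bigcup_(i in D) G i =
    \bigcup_(i in D) preimage_set_system setT (Y i) measurable.
  move=> D0; apply/seteqP; split => S [i Di]; rewrite /G => GS; exists i => //.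
    by case: eqP GS.
  by case: eqP => // i0; move: Di; rewrite i0.
rewrite -lee_fin; apply: le_trans (aY k k0); apply: ereal_sup_ubound.
exists m, A, B; split => //.
- by move: sA; rewrite /past (eq [set i | (1 <= i <= m)%N]).
- by move: sB; rewrite /future (eq [set i | (m + k <= i)%N])//= leqn0 addn_eq0 (gtn_eqF m0).
- by rewrite -!PrE//; exact: measurableI.
Qed.

Lemma gmeas_preimage {dT} {E : measurableType dT} (Y : T -> E) (phi : E -> R) :
  measurable_fun setT phi -> gmeas (preimage_set_system setT Y measurable) (fun w => phi (Y w)).
Proof.
move=> mphi _ B mB; rewrite setTI; apply: sub_sigma_algebra.
exists (phi @^-1` B); last by rewrite setTI.
by have := mphi measurableT B mB; rewrite setTI.
Qed.

End mixing_transfer.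

(** * The triangular array of sparse estimators *)

Section arrays.
Context {R : realType} {dO : measure_display} {Omega : measurableType dO}.
Variable P : probability Omega R.
Context {d : nat}.
Local Notation Ex := (Ex P).

Definition centered {I : set R} (Y : nat -> Omega -> C0 I 'rV[R]_d) (i : nat) (u : R) (k : 'I_d)
  (w : Omega) : R := Y i w u ord0 k - Ex (fun w => Y i w u ord0 k).

(** The interface between the assumptions and the limit theorem. [eta] is the relative error of the
    sparse approximation; the squares on the right of the fourth-moment bounds are what chaining
    needs. *)
Record array (Gs : nat -> set (set Omega)) (I : set R) (z : nat -> R -> 'I_d -> Omega -> R)
    (c : 'I_d -> 'I_d -> R -> R -> R) (C1 nu B eta : R) : Prop := {
  ar_sub : forall i, Gs i `<=` measurable ;
  ar_mix : mixing_seq P Gs C1 nu ;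
  ar_gmeas : forall i u k, (0 < i)%N -> I u -> gmeas (Gs i) (z i u k) ;
  ar_mean : forall i u k, (0 < i)%N -> I u -> Ex (z i u k) = 0 ;
  ar_L4 : forall a n u k, I u -> L4 P (fun w => \sum_(i < n) z (a + i).+1 u k w) /\
    Ex (fun w => (\sum_(i < n) z (a + i).+1 u k w) ^+ 4) <= (B * n%:R) ^+ 2 ;
  ar_diff : forall a n u v k, I u -> I v -> `|u - v| <= 1 ->
    Ex (fun w => (\sum_(i < n) (z (a + i).+1 u k w - z (a + i).+1 v k w)) ^+ 4) <=
      (B * n%:R * `|u - v|) ^+ 2 ;
  ar_cov : forall a n u v k l, I u -> I v ->
    `|Ex (fun w => (\sum_(i < n) z (a + i).+1 u k w) * (\sum_(i < n) z (a + i).+1 v l w)) -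
      n%:R * c k l u v| <= B * (n%:R `^ (7 / 8) + n%:R * eta) }.

End arrays.

Lemma Kz_ineq {R : realType} (x y : R) : 0 < x -> 0 < y -> 12 * x <= 48 * (x + y) /\ 12 * y <= 48 * (x + y).
Proof. by move=> *; split; lra. Qed.

(** The hypothesis gives nu (J - 4) > 3 (J - 4) + 9 = 3 J - 3, and this is at least (9/8) 2 J when J
    >= 4. *)
Lemma moment_exponent {R : realType} (J nu : R) : 4 < J -> 3 + 9 / (J - 4) < nu ->
  9 / 8 <= nu * ((J - 4) / (2 * J)) /\ 3 < nu.
Proof.
move=> J4 h; have J40 : 0 < J - 4 by rewrite subr_gt0.
have J0 : 0 < 2 * J by rewrite mulr_gt0// (lt_trans _ J4).
have h3 : 3 < nu by rewrite (le_lt_trans _ h)// lerDl divr_ge0// ltW.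
split=> //; rewrite mulrA ler_pdivlMr//.
have : (3 + 9 / (J - 4)) * (J - 4) <= nu * (J - 4) by rewrite ler_pM2r// ltW.
rewrite mulrDl divfK ?gt_eqF// => h1; rewrite (le_trans _ h1)//; lra.
Qed.

(** Divide by n and let it grow along eighth powers, for which n^(7/8) is an integer power. *)
Lemma le_of_sublinear {R : realType} (x a b : R) : 0 <= b ->
  (forall n : nat, (0 < n)%N -> n%:R * x <= n%:R * a + b * n%:R `^ (7 / 8)) -> x <= a.
Proof.
move=> b0 h; rewrite leNgt; apply/negP => ax; have xa : 0 < x - a by rewrite subr_gt0.
have [m bm] : exists m : nat, b / (x - a) < m.+1%:R.
  by exists (Num.truncn (b / (x - a))); rewrite truncnS_gt// divr_ge0// ltW.
have := h (m.+1 ^ 8)%N; rewrite expn_gt0 => /(_ erefl).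
have m0 : 0 <= m.+1%:R :> R by [].
have -> : ((m.+1 ^ 8)%:R : R) `^ (7 / 8) = m.+1%:R ^+ 7.
  rewrite natrX -!powR_mulrn// -powRrM; congr (_ `^ _); by field.
rewrite natrX exprS -lerBlDl -mulrBr -mulrA mulrC mulrAC -[leRHS]mulrC.
move=> h1; have : m.+1%:R * (x - a) <= b by move: h1; rewrite -mulrA ler_pM2l ?exprn_gt0.
apply/negP; rewrite -ltNge.
by rewrite -ltr_pdivrMr.
Qed.

Lemma lrv_arith {R : realType} (uu uv vu vv cuu cuv cvu cvv n D B : R) :
  - D <= vv - n * cvv -> vu - n * cvu <= D -> uv - n * cuv <= D -> - D <= uu - n * cuu ->
  uu - uv - vu + vv <= n * B -> n * (cuu - cuv - cvu + cvv) <= n * B + 4 * D.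
Proof. by rewrite mulrDr !mulrBr => *; lra. Qed.

Lemma lrv_decay_arith {R : realType} (r l s p t D e : R) : s <= p * t -> r <= t ->
  l - s <= 8 * D * e -> r + 2 * l <= (2 * p + 1) * t + 16 * D * e.
Proof. by move=> *; lra. Qed.

Lemma array_arith {R : realType} (K D x y : R) : 0 <= K -> 0 <= D -> 0 <= x -> 0 <= y ->
  2 * K * y + 100 * D * x <= (3 * K + 100 * D) * (x + y).
Proof.
move=> K0 D0 x0 y0.
have := mulr_ge0 K0 x0; have := mulr_ge0 K0 y0; have := mulr_ge0 D0 y0; lra.
Qed.

Lemma error_triangle {R : realType} (a m b e x y z : R) : `|a - m| <= x -> `|b| <= y -> `|e| <= z ->
  `|a + b + e - m| <= x + y + z.
Proof.
move=> h1 h2 h3; rewrite (_ : _ - m = a - m + b + e); last by ring.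
by rewrite (le_trans (ler_normD _ _))// lerD// (le_trans (ler_normD _ _))// lerD.
Qed.

(** * Moments and covariances of the sparse estimators *)

Section model.
Context {R : realType} {dO : measure_display} {Omega : measurableType dO}.
Variable P : probability Omega R.
Context {d : nat} {I1 : set R}.
Variables (X : nat -> Omega -> C0 I1 'rV[R]_d) (S : nat -> pmetricType R).
Variable delta : nat -> forall M : nat, Omega -> S M.
Variable A : forall (M : nat) (I : set R), C0 I1 'rV[R]_d * S M -> C0 I 'rV[R]_d.
Variables (I2 : nat -> set R) (MN : nat -> nat).
Variables (C1 C2 C3 J nu xi gamma : R).
Hypotheses (hC1 : 0 < C1) (hC2 : 0 < C2) (hC3 : 0 < C3)
  (hJ : 4 < J) (hxi : 2^-1 < xi) (hnu : 0 < nu) (hJnu : 3 + 9 / (J - 4) < nu)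
  (hgamma : 0 < gamma).
Hypothesis se : sparse_estimators X delta A I2 MN.
Hypothesis aA : assumptionA P X delta A I2 MN C1 C2 C3 J nu xi gamma.
Variable N : nat.
Hypothesis N0 : (0 < N)%N.
Local Notation Ex := (Ex P).
Local Notation I := (I2 N).
Local Notation M := (MN N).
Local Notation Sp := (sparse X delta A (MN N) (I2 N)).
Local Notation zX := (centered P X).
Local Notation zS := (centered P Sp).
Local Notation c := (long_run_variance P X).
Local Notation eta := (N%:R `^ (- (gamma / J))).

Definition Gjoint (i : nat) : set (set Omega) :=
  if i == 0%N then set0 else preimage_set_system setT (joint X delta M i) measurable.

Let J1 : 1 <= J. Proof. by rewrite ltW// (lt_trans _ hJ)// ltr1n. Qed.
Let J0 : 0 < J. Proof. exact: lt_le_trans J1. Qed.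
Let M0 : (0 < M)%N. Proof. exact: se_MN_gt0 se _ N0. Qed.
Let I12 : I `<=` I1. Proof. exact: (se_domain2 se N0).2. Qed.

Lemma joint_measurable i : (0 < i)%N -> measurable_fun setT (joint X delta M i).
Proof.
move=> i0; apply/measurable_fun_pairP; split.
  exact: se_measurable_X se _ i0.
exact: se_measurable_delta se _ _ i0 M0.
Qed.

Lemma Gjoint_sub i : Gjoint i `<=` measurable.
Proof.
move=> B; rewrite /Gjoint; case: i => [|i]//= [B' mB' <-].
by have := @joint_measurable i.+1 erefl measurableT B' mB'.
Qed.

Lemma joint_mixing : mixing_seq P Gjoint C1 nu.
Proof.
apply: mixing_of_alpha; first exact: joint_measurable.
by move=> n n0; exact: A_mixing_rate aA _ _ M0 n0.
Qed.

Lemma gmeas_X i u k : (0 < i)%N -> gmeas (Gjoint i) (fun w => X i w u ord0 k).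
Proof.
move=> i0; rewrite /Gjoint gtn_eqF//.
apply: (@gmeas_preimage _ _ _ _ _ _ (fun q : borel (C0 I1 'rV[R]_d) * borel (S M) => q.1 u ord0 k)).
by apply: (@C0_coord_measurable _ _ _ _ _ (fun q : borel (C0 I1 'rV[R]_d) * borel (S M) => q.1));
  exact: measurable_fst.
Qed.

Lemma gmeas_sparse i u k : (0 < i)%N -> gmeas (Gjoint i) (fun w => Sp i w u ord0 k).
Proof.
move=> i0; rewrite /Gjoint gtn_eqF//.
apply: (@gmeas_preimage _ _ _ _ _ _
  (fun q : borel (C0 I1 'rV[R]_d) * borel (S M) => @A M I q u ord0 k)).
apply: (@C0_coord_measurable _ _ _ _ _ (fun q : borel (C0 I1 'rV[R]_d) * borel (S M) => @A M I q)).
exact: se_measurable_A se _ _ M0 N0.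
Qed.

Lemma gmeas_centered {I' : set R} (Y : nat -> Omega -> C0 I' 'rV[R]_d) i u k :
  gmeas (Gjoint i) (fun w => Y i w u ord0 k) -> gmeas (Gjoint i) (centered P Y i u k).
Proof. by move=> mY; apply: measurable_funB => //; exact: measurable_cst. Qed.

Let mX i u k : (0 < i)%N -> measurable_fun setT (fun w => X i w u ord0 k).
Proof. by move=> i0; apply: gmeas_measurable (gmeas_X u k i0); exact: Gjoint_sub. Qed.

Let mS i u k : (0 < i)%N -> measurable_fun setT (fun w => Sp i w u ord0 k).
Proof. by move=> i0; apply: gmeas_measurable (gmeas_sparse u k i0); exact: Gjoint_sub. Qed.

(** A common constant for centred coordinates, increments and errors: 4 from [LJ_D] times 12 from
    [LJ_centered]. *)
Definition Kz : R := 48 * (C2 `^ J^-1 + C3 `^ J^-1).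

Lemma Kz_gt0 : 0 < Kz.
Proof. by rewrite mulr_gt0// addr_gt0// powR_gt0. Qed.

Let c1 := C2 `^ J^-1.
Let c2 := C3 `^ J^-1.
Let c10 : 0 < c1. Proof. exact: powR_gt0. Qed.
Let c20 : 0 < c2. Proof. exact: powR_gt0. Qed.
Let eta0 : 0 < eta. Proof. by rewrite powR_gt0// ltr0n. Qed.
Let eta1 : eta <= 1.
Proof. by rewrite powRN_le1 ?ler1n ?divr_ge0 ?(ltW hgamma) ?(ltW J0). Qed.
Let swap (a b x y : R) : a - b - (x - y) = a - x - (b - y). Proof. by ring. Qed.

Let coordB {I' : set R} (f : C0 I' 'rV[R]_d) {I'' : set R} (g : C0 I'' 'rV[R]_d) u v k :
  `|f u ord0 k - g v ord0 k| <= `|f u - g v|.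
Proof. by have := rV_coord_le (f u - g v) k; rewrite !mxE. Qed.

Lemma LJ_X i u k : (0 < i)%N -> LJ P J (fun w => X i w u ord0 k) c1.
Proof.
move=> i0; rewrite -[c1]mul1r.
apply: (@LJ_of_expectation _ _ _ P J J1 _ (fun w => `|X i w|)) => //; [exact: ltW|exact: mX| |].
  by move=> w; rewrite divr1 (le_trans (rV_coord_le _ _))// C0_ub.
exact: A_moment aA _ i0.
Qed.

Lemma LJ_Xdiff i u v k : (0 < i)%N -> I u -> I v -> u != v ->
  LJ P J (fun w => X i w u ord0 k - X i w v ord0 k) (`|u - v| `^ xi * c1).
Proof.
move=> i0 Iu Iv uv.
have uv0 : 0 < `|u - v| `^ xi by rewrite powR_gt0// normr_gt0 subr_eq0.
apply: (@LJ_of_expectation _ _ _ P J J1 _ (fun w => `|X i w u - X i w v| / `|u - v| `^ xi)) => //.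
- exact: ltW.
- by apply: measurable_funB; exact: mX.
- by move=> w; rewrite ler_pM2r ?invr_gt0// coordB.
- exact: (A_hoelder aA i0 (I12 Iu) (I12 Iv) uv).
Qed.

Lemma LJ_Sdiff i u v k : (0 < i)%N -> I u -> I v -> u != v ->
  LJ P J (fun w => Sp i w u ord0 k - Sp i w v ord0 k) (`|u - v| `^ xi * c2).
Proof.
move=> i0 Iu Iv uv.
have uv0 : 0 < `|u - v| `^ xi by rewrite powR_gt0// normr_gt0 subr_eq0.
apply: (@LJ_of_expectation _ _ _ P J J1 _ (fun w => `|Sp i w u - Sp i w v| / `|u - v| `^ xi)) => //.
- exact: ltW.
- by apply: measurable_funB; exact: mS.
- by move=> w; rewrite ler_pM2r ?invr_gt0// coordB.
- exact: (A_sparse_hoelder aA i0 N0 Iu Iv uv).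
Qed.

Lemma LJ_error i u k : (0 < i)%N -> I u ->
  LJ P J (fun w => Sp i w u ord0 k - X i w u ord0 k) (c2 * eta).
Proof.
move=> i0 Iu.
have -> : c2 * eta = 1 * (C3 * N%:R `^ (- gamma)) `^ J^-1.
  by rewrite mul1r powRM ?powR_ge0 ?(ltW hC3)// -[(_ `^ (- gamma)) `^ _]powRrM mulNr.
apply: (@LJ_of_expectation _ _ _ P J J1 _
    (fun w => supnorm I (fun u => X i w u - Sp i w u))) => //.
- by rewrite mulr_ge0 ?powR_ge0 ?(ltW hC3).
- by apply: measurable_funB; [exact: mS|exact: mX].
- move=> w; rewrite divr1 distrC (le_trans (coordB _ _ _ _ _))//.
  apply: (@supnorm_ub _ _ _ I (fun u => X i w u - Sp i w u) u) => //.
  have [a fa] := Linf_bounded_on (C0_fun (X i w)) I; have [b gb] := Linf_bounded_on (C0_fun (Sp i w)) I.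
  by exists (a + b) => t It; rewrite (le_trans (ler_normB _ _))// lerD ?fa ?gb.
- exact: (A_sparse_error aA i0 N0).
Qed.

Lemma LJ_S i u k : (0 < i)%N -> I u -> LJ P J (fun w => Sp i w u ord0 k) (4 * (c1 + c2)).
Proof.
move=> i0 Iu.
have := LJ_D J1 (ltW c10) (mulr_ge0 (ltW c20) (ltW eta0)) (LJ_X u k i0) (LJ_error k i0 Iu).
rewrite (_ : (fun w => _) = (fun w => Sp i w u ord0 k)); last first.
  by apply/funext => w; rewrite addrC subrK.
apply: (LJ_le J1) => //; first by rewrite mulr_ge0// addr_ge0 ?mulr_ge0 ?(ltW c10) ?(ltW c20) ?(ltW eta0).
by rewrite ler_pM2l// lerD2l ler_piMr// ltW.
Qed.

Let LJ_L1' f b : 0 < b -> LJ P J f b -> L1 P f.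
Proof. by move=> b0 /(LJ_L1 J1 b0)[]. Qed.

Let L1X i u k : (0 < i)%N -> L1 P (fun w => X i w u ord0 k).
Proof. by move=> i0; apply: LJ_L1' (LJ_X u k i0). Qed.

Let L1S i u k : (0 < i)%N -> I u -> L1 P (fun w => Sp i w u ord0 k).
Proof. by move=> i0 Iu; apply: LJ_L1' (LJ_S k i0 Iu); rewrite mulr_gt0// addr_gt0. Qed.

Let K0 := Kz_gt0.

Lemma LJ_zX i u k : (0 < i)%N -> LJ P J (zX i u k) Kz.
Proof.
move=> i0; apply: (LJ_le J1) (LJ_centered J1 c10 (LJ_X u k i0)) => //; first by rewrite mulr_ge0 ?(ltW c10).
exact: (Kz_ineq c10 c20).1.
Qed.

Lemma LJ_zS i u k : (0 < i)%N -> I u -> LJ P J (zS i u k) Kz.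
Proof.
move=> i0 Iu; have := LJ_centered J1 _ (LJ_S k i0 Iu).
rewrite mulr_gt0 ?addr_gt0// => /(_ erefl).
by rewrite (_ : 12 * (4 * (c1 + c2)) = Kz)// /Kz -/c1 -/c2; ring.
Qed.

Lemma LJ_zXdiff i u v k : (0 < i)%N -> I u -> I v -> u != v ->
  LJ P J (fun w => zX i u k w - zX i v k w) (Kz * `|u - v| `^ xi).
Proof.
move=> i0 Iu Iv uv.
have uv0 : 0 < `|u - v| `^ xi by rewrite powR_gt0// normr_gt0 subr_eq0.
have uc : 0 < `|u - v| `^ xi * c1 by rewrite mulr_gt0.
have := LJ_centered J1 uc (LJ_Xdiff k i0 Iu Iv uv).
rewrite (_ : (fun w => _) = (fun w => zX i u k w - zX i v k w)); last first.
  apply/funext => w; rewrite (ExB (L1X u k i0) (L1X v k i0)); exact: swap.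
apply: (LJ_le J1) => //; first by rewrite mulr_ge0// ltW.
rewrite mulrA mulrAC ler_pM2r//; exact: (Kz_ineq c10 c20).1.
Qed.

Lemma LJ_zSdiff i u v k : (0 < i)%N -> I u -> I v -> u != v ->
  LJ P J (fun w => zS i u k w - zS i v k w) (Kz * `|u - v| `^ xi).
Proof.
move=> i0 Iu Iv uv.
have uv0 : 0 < `|u - v| `^ xi by rewrite powR_gt0// normr_gt0 subr_eq0.
have uc : 0 < `|u - v| `^ xi * c2 by rewrite mulr_gt0.
have := LJ_centered J1 uc (LJ_Sdiff k i0 Iu Iv uv).
rewrite (_ : (fun w => _) = (fun w => zS i u k w - zS i v k w)); last first.
  apply/funext => w; rewrite (ExB (L1S k i0 Iu) (L1S k i0 Iv)); exact: swap.
apply: (LJ_le J1) => //; first by rewrite mulr_ge0// ltW.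
rewrite mulrA mulrAC ler_pM2r//; exact: (Kz_ineq c10 c20).2.
Qed.

Lemma LJ_zerror i u k : (0 < i)%N -> I u ->
  LJ P J (fun w => zS i u k w - zX i u k w) (Kz * eta).
Proof.
move=> i0 Iu; have ec : 0 < c2 * eta by rewrite mulr_gt0.
have := LJ_centered J1 ec (LJ_error k i0 Iu).
rewrite (_ : (fun w => _) = (fun w => zS i u k w - zX i u k w)); last first.
  apply/funext => w; rewrite (ExB (L1S k i0 Iu) (L1X u k i0)); exact: swap.
apply: (LJ_le J1) => //; first by rewrite mulr_ge0// ltW.
rewrite mulrA ler_pM2r//; exact: (Kz_ineq c10 c20).2.
Qed.

Definition Dz : R := 4 * (4 * C1 + 10) * Kz * Kz.
Definition Bz : R := 3 * (K4 C1 * Kz ^+ 2) + 100 * Dz.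

Let K40 : 0 < K4 C1. Proof. exact: K4_gt0 (ltW hC1). Qed.
Let Dz0 : 0 < Dz. Proof. by rewrite /Dz !mulr_gt0 ?Kz_gt0// addr_gt0 ?mulr_gt0. Qed.
Let KK0 : 0 < K4 C1 * Kz ^+ 2. Proof. by rewrite mulr_gt0// exprn_gt0. Qed.

Lemma Bz_gt0 : 0 < Bz.
Proof. by apply: addr_gt0; apply: mulr_gt0. Qed.

Let KB : K4 C1 * Kz ^+ 2 <= Bz.
Proof.
by rewrite /Bz -[leLHS]addr0 lerD//; [rewrite -[leLHS]mul1r ler_pM2r// ler1n|rewrite mulr_ge0// ltW].
Qed.

Let nuJ := (moment_exponent hJ hJnu).1.
Let nu3 := (moment_exponent hJ hJnu).2.
Let nu94 : 9 / 4 <= nu.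
Proof. by rewrite (le_trans _ (ltW nu3))// ler_pdivrMr// -natrM ler_nat. Qed.

Definition nice (Z : nat -> Omega -> R) (b : R) : Prop := forall i, (0 < i)%N ->
  [/\ gmeas (Gjoint i) (Z i), Ex (Z i) = 0 & LJ P J (Z i) b].

Lemma nice_moments Z b : 0 < b -> nice Z b -> forall a n,
  [/\ forall i, (0 < i)%N -> L4 P (Z i) /\ Ex (fun w => Z i w ^+ 4) <= 2 * b ^+ 4,
     L4 P (fun w => \sum_(i < n) Z (a + i).+1 w),
   Ex (fun w => (\sum_(i < n) Z (a + i).+1 w) ^+ 4) <= (K4 C1 * n%:R * b ^+ 2) ^+ 2 &
   Ex (fun w => (\sum_(i < n) Z (a + i).+1 w) ^+ 2) <= K4 C1 * n%:R * b ^+ 2].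
Proof.
move=> b0 nZ a n.
have gZ i : (0 < i)%N -> gmeas (Gjoint i) (Z i) by case/nZ.
have Z0 i : (0 < i)%N -> Ex (Z i) = 0 by case/nZ.
have LZ i : (0 < i)%N -> L1 P (fun w => `|Z i w| `^ J) by move=> /nZ[_ _ []].
have EZ i : (0 < i)%N -> Ex (fun w => `|Z i w| `^ J) <= b `^ J by move=> /nZ[_ _ []].
have [h1 h2] := fourth_moment Gjoint_sub (ltW hC1) hnu hJ nuJ joint_mixing gZ Z0 b0 LZ EZ a n.
split => // [i i0|]; first exact: (L4_of_LJ Gjoint_sub hJ gZ b0 LZ EZ i0).
exact: (second_moment Gjoint_sub (ltW hC1) hnu hJ nuJ joint_mixing gZ Z0 b0 LZ EZ a n).
Qed.

Lemma Ex_centered {I' : set R} (Y : nat -> Omega -> C0 I' 'rV[R]_d) i u k :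
  L1 P (fun w => Y i w u ord0 k) -> Ex (centered P Y i u k) = 0.
Proof.
move=> LY; rewrite (ExB LY (L1_cst P _)) (Ex_cst P _); exact: subrr.
Qed.

Lemma nice_B Z Z' b b' b'' : 0 < b -> nice Z b -> 0 < b' -> nice Z' b' ->
  (forall i, (0 < i)%N -> LJ P J (fun w => Z i w - Z' i w) b'') -> nice (fun i w => Z i w - Z' i w) b''.
Proof.
move=> b0 nZ b'0 nZ' L i i0; have [gZ Z0 LZ] := nZ i i0; have [gZ' Z'0 LZ'] := nZ' i i0.
split; [exact: measurable_funB|by rewrite ExB ?Z0 ?Z'0 ?subrr//; [exact: LJ_L1' LZ|exact: LJ_L1' LZ']|exact: L].
Qed.

Lemma nice_X u k : nice (fun i => zX i u k) Kz.
Proof.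
by move=> i i0; split; [apply: gmeas_centered; exact: gmeas_X|apply: Ex_centered; exact: L1X|exact: LJ_zX].
Qed.

Lemma nice_S u k : I u -> nice (fun i => zS i u k) Kz.
Proof.
by move=> Iu i i0; split; [apply: gmeas_centered; exact: gmeas_sparse|apply: Ex_centered; exact: L1S|exact: LJ_zS].
Qed.

Lemma nice_Xdiff u v k : I u -> I v -> u != v ->
  nice (fun i w => zX i u k w - zX i v k w) (Kz * `|u - v| `^ xi).
Proof.
by move=> Iu Iv uv; apply: (nice_B K0 (nice_X u k) K0 (nice_X v k)) => i i0; exact: LJ_zXdiff.
Qed.

Lemma nice_Sdiff u v k : I u -> I v -> u != v ->
  nice (fun i w => zS i u k w - zS i v k w) (Kz * `|u - v| `^ xi).
Proof.
by move=> Iu Iv uv; apply: (nice_B K0 (nice_S k Iu) K0 (nice_S k Iv)) => i i0; exact: LJ_zSdiff.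
Qed.

Lemma nice_error u k : I u -> nice (fun i w => zS i u k w - zX i u k w) (Kz * eta).
Proof.
by move=> Iu; apply: (nice_B K0 (nice_S k Iu) K0 (nice_X u k)) => i i0; exact: LJ_zerror.
Qed.

(** Here xi > 1/2 gives second moments linear in the distance, hence fourth moments quadratic in it,
    as chaining requires. *)
Let sqr_hoelder (u v : R) : `|u - v| <= 1 -> u != v -> (Kz * `|u - v| `^ xi) ^+ 2 <= Kz ^+ 2 * `|u - v|.
Proof.
move=> uv1 uv; rewrite exprMn ler_pM2l ?exprn_gt0// -powR_mulrn ?powR_ge0// -powRrM.
have uv0 : 0 < `|u - v| by rewrite normr_gt0 subr_eq0.
rewrite ge1r_powR// ?uv1 ?andbT ?(ltW uv0)//.
by rewrite -ler_pdivrMr// mul1r ltW.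
Qed.

(** Not automatic for the one-sided series; it will come from the Brownian motion, through
    [bm_sym]. *)
Hypothesis csym : forall k l u v, I u -> I v -> c k l u v = c l k v u.

Let rX (k l : 'I_d) (u v : R) (n : nat) : R := fine (cov P (X 1%N) (X n) k l u v).

Let rXE k l u v i h : I u -> I v ->
  Ex (fun w => zX i.+1 u k w * zX (i.+1 + h)%N v l w) = rX k l u v h.+1.
Proof.
move=> Iu Iv; rewrite /rX -[h.+1]add1n.
rewrite -((A_stationary aA).2 i.+1 1%N h k l u v erefl erefl (I12 Iu) (I12 Iv)).
by rewrite /cov unlock unlock.
Qed.

Let L4X i u k : L4 P (zX i.+1 u k).
Proof. by have [h _ _ _] := nice_moments K0 (nice_X u k) 0 0; have [] := h i.+1 erefl. Qed.

Let rX_bound k l u v h : I u -> I v -> `|rX k l u v h.+2| <= Dz * h.+1%:R `^ (- (9 / 8)).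
Proof.
move=> Iu Iv; rewrite -(rXE k l 0%N h.+1 Iu Iv).
have [LU _ _ _] := nice_moments K0 (nice_X u k) 0 0.
have [LV _ _ _] := nice_moments K0 (nice_X v l) 0 0.
have [L1u E1u] := LU 1%N erefl; have [L1v E1v] := LV (1 + h.+1)%N erefl.
have [gu _ _] := nice_X u k (erefl : (0 < 1)%N).
have [gv v0 _] := nice_X v l (erefl : (0 < 1 + h.+1)%N).
exact: (lag_cov Gjoint_sub (ltW hC1) nu94 joint_mixing (isT : (0 < 1)%N) (isT : (0 < h.+1)%N) gu gv K0 K0 L1u L1v E1u E1v v0).
Qed.

Lemma covariance_X a n u v k l : I u -> I v ->
  `|Ex (fun w => (\sum_(i < n) zX (a + i).+1 u k w) * (\sum_(i < n) zX (a + i).+1 v l w)) -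
    n%:R * c k l u v| <= 100 * Dz * n%:R `^ (7 / 8).
Proof.
move=> Iu Iv; apply: (@covariance_of_sums _ _ _ P (fun i => zX i u k) (fun i => zX i v l)
  (rX k l u v) (rX l k v u)).
- by move=> i; exact: L4X.
- by move=> i; exact: L4X.
- by move=> i h; exact: rXE.
- by move=> i h; exact: rXE.
- by move=> h; exact: rX_bound.
- by move=> h; exact: rX_bound.
- by [].
- by rewrite csym.
Qed.

Lemma variance_X n u k : I u ->
  Ex (fun w => (\sum_(i < n) zX (0 + i).+1 u k w) ^+ 2) <= n%:R * (K4 C1 * Kz ^+ 2).
Proof.
move=> Iu; have [_ _ _] := nice_moments K0 (nice_X u k) 0 n.
by rewrite (mulrC (K4 C1)) -mulrA.
Qed.

Let L4sX n u k : L4 P (fun w => \sum_(i < n) zX (0 + i).+1 u k w).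
Proof. by have [_ + _ _] := nice_moments K0 (nice_X u k) 0 n. Qed.

(** The long-run variance is the limit of the variances of the sums divided by n, which are
    nonnegative and bounded by the second-moment estimate. *)
Lemma lrv_bound k u : I u -> 0 <= c k k u u <= Bz.
Proof.
move=> Iu; have D0 : 0 <= 100 * Dz by rewrite mulr_ge0// ltW.
have h n := covariance_X 0 n k k Iu Iu.
apply/andP; split.
  rewrite -oppr_le0; apply: (le_of_sublinear D0) => n n0; rewrite mulr0 add0r mulrN.
  have := h n; rewrite ler_norml => /andP[_]; apply: le_trans.
  by rewrite lerDr; apply: Ex_ge0 => w; rewrite -expr2 sqr_ge0.
apply: le_trans KB; apply: (le_of_sublinear D0) => n n0.
have := h n; rewrite ler_norml => /andP[+ _]; rewrite lerNl opprB lerBlDl => /le_trans; apply.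
by rewrite lerD2r; exact: variance_X.
Qed.

(** The left side is the limiting variance of the sums of increments from v to u. *)
Lemma lrv_diff k u v : I u -> I v -> `|u - v| <= 1 ->
  c k k u u - c k k u v - c k k v u + c k k v v <= Bz * `|u - v|.
Proof.
move=> Iu Iv uv1; have [->|uv] := eqVneq u v.
  by rewrite (subrr v) normr0 mulr0 subrr sub0r addrC subrr.
have D0 : 0 <= 4 * (100 * Dz) by rewrite mulr_ge0// mulr_ge0// ltW.
apply: (@le_trans _ _ (K4 C1 * (Kz ^+ 2 * `|u - v|))); last by rewrite mulrA ler_wpM2r.
apply: (le_of_sublinear D0) => n n0.
have uvx : 0 < Kz * `|u - v| `^ xi by rewrite mulr_gt0// powR_gt0// normr_gt0 subr_eq0.
have [_ _ _] := nice_moments uvx (nice_Xdiff k Iu Iv uv) 0 n.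
pose U w := \sum_(i < n) zX (0 + i).+1 u k w; pose V w := \sum_(i < n) zX (0 + i).+1 v k w.
have -> : (fun w => (\sum_(i < n) (zX (0 + i).+1 u k w - zX (0 + i).+1 v k w)) ^+ 2) =
    (fun w => U w * U w - U w * V w - V w * U w + V w * V w).
  by apply/funext => w; rewrite sumrB -/(U w) -/(V w); ring.
have LU := L4sX n u k; have LV := L4sX n v k.
have e1 := L4_mul LU LU; have e2 := L4_mul LU LV; have e3 := L4_mul LV LU; have e4 := L4_mul LV LV.
rewrite ExD ?ExB//; try by repeat apply: L1B.
have := covariance_X 0 n k k Iu Iu; have := covariance_X 0 n k k Iu Iv.
have := covariance_X 0 n k k Iv Iu; have := covariance_X 0 n k k Iv Iv.
rewrite -/U -/V !ler_norml => /andP[h1 _] /andP[_ h2] /andP[_ h3] /andP[h4 _] h5.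
have h6 : K4 C1 * n%:R * (Kz * `|u - v| `^ xi) ^+ 2 <= n%:R * (K4 C1 * (Kz ^+ 2 * `|u - v|)).
  by rewrite (mulrC (K4 C1)) -mulrA ler_wpM2l// ler_pM2l// sqr_hoelder.
by rewrite -(mulrA 4); exact: lrv_arith h1 h2 h3 h4 (le_trans h5 h6).
Qed.

(* Cauchy-Schwarz bounds the lags up to [p] by [tau], mixing the other ones. *)
Lemma lrv_decay k u (tau : R) (p : nat) : I u -> 0 <= tau ->
  (forall i, (0 < i)%N -> Ex (fun w => zX i u k w ^+ 2) <= tau) ->
  c k k u u <= (2 * p.+1%:R + 1) * tau + 16 * Dz * p.+1%:R `^ (- (1 / 8)).
Proof.
move=> Iu t0 ht.
have rt h : `|rX k k u u h.+1| <= tau.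
  rewrite -(rXE k k 0%N h Iu Iu).
  have [hL _ _ _] := nice_moments K0 (nice_X u k) 0 0.
  have [l1 _] := hL 1%N erefl; have [l2 _] := hL (1 + h)%N erefl.
  have [_ cs] := Ex_CS l1.1 l2.1 (L4_L2 l1) (L4_L2 l2).
  rewrite -(@ler_pXn2r _ 2%N) ?nnegrE// real_normK ?num_real// (le_trans cs)//.
  by rewrite expr2 ler_pM ?ht// Ex_ge0// => w; exact: sqr_ge0.
have /= := lim_sum_pow98 (fun h => rX_bound k k h Iu Iu) p; set l := limn _ => hl.
have -> : c k k u u = rX k k u u 1 + 2 * l by [].
have hs : \sum_(h < p.+1) rX k k u u h.+2 <= p.+1%:R * tau.
  apply: (@le_trans _ _ (\sum_(h < p.+1) tau)).
    by apply: ler_sum => h _; exact: le_trans (ler_norm _) (rt h.+1).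
  by rewrite sumr_const card_ord mulr_natl.
have h1 := le_trans (ler_norm _) (rt 0%N); have := le_trans (ler_norm _) hl.
exact: lrv_decay_arith.
Qed.

(** The covariance of the sums is known for [X]; passing to the sparse estimators one factor at a
    time costs n * eta each, by Cauchy-Schwarz. *)
Lemma array_model : array P Gjoint I zS c C1 nu Bz eta.
Proof.
split; [exact: Gjoint_sub|exact: joint_mixing| | | | |].
- by move=> i u k i0 Iu; have [] := nice_S k Iu i0.
- by move=> i u k i0 Iu; have [] := nice_S k Iu i0.
- move=> a n u k Iu; have [_ h1 h2 _] := nice_moments K0 (nice_S k Iu) a n.
  split => //; rewrite (le_trans h2)// ler_pXn2r ?nnegrE//; last 2 first.
  + by rewrite mulr_ge0 ?sqr_ge0// mulr_ge0// ltW.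
  + by rewrite mulr_ge0// ltW// Bz_gt0.
  by rewrite mulrAC ler_wpM2r.
- move=> a n u v k Iu Iv uv1; have [->|uv] := eqVneq u v.
    rewrite (_ : (fun w => _) = cst 0) ?Ex_cst ?sqr_ge0//.
    by apply/funext => w; rewrite big1 ?expr0n// => i _; rewrite subrr.
  have uvx : 0 < Kz * `|u - v| `^ xi by rewrite mulr_gt0// powR_gt0// normr_gt0 subr_eq0.
  have [_ _ h _] := nice_moments uvx (nice_Sdiff k Iu Iv uv) a n.
  rewrite (le_trans h)// ler_pXn2r ?nnegrE//; last 2 first.
  + by rewrite mulr_ge0 ?sqr_ge0// mulr_ge0// ltW.
  + by rewrite mulr_ge0// mulr_ge0// ltW// Bz_gt0.
  rewrite (mulrAC (K4 C1)) (mulrAC Bz) ler_wpM2r//.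
  apply: (@le_trans _ _ (K4 C1 * (Kz ^+ 2 * `|u - v|))); first by rewrite ler_pM2l// sqr_hoelder.
  by rewrite mulrA ler_wpM2r.
- move=> a n u v k l Iu Iv.
  pose U w := \sum_(i < n) zX (a + i).+1 u k w; pose V w := \sum_(i < n) zX (a + i).+1 v l w.
  pose U' w := \sum_(i < n) zS (a + i).+1 u k w; pose V' w := \sum_(i < n) zS (a + i).+1 v l w.
  have [_ LU _ EU] := nice_moments K0 (nice_X u k) a n.
  have [_ LV' _ EV'] := nice_moments K0 (nice_S l Iv) a n.
  have [_ LU' _ _] := nice_moments K0 (nice_S k Iu) a n.
  have [_ LV _ _] := nice_moments K0 (nice_X v l) a n.
  have Ke : 0 < Kz * eta by rewrite mulr_gt0.
  have [_ LdU _ EdU] := nice_moments Ke (nice_error k Iu) a n.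
  have [_ LdV _ EdV] := nice_moments Ke (nice_error l Iv) a n.
  pose dU w := \sum_(i < n) (zS (a + i).+1 u k w - zX (a + i).+1 u k w).
  pose dV w := \sum_(i < n) (zS (a + i).+1 v l w - zX (a + i).+1 v l w).
  have eq : (fun w => U' w * V' w) = (fun w => U w * V w + dU w * V' w + U w * dV w).
    have eU w : dU w = U' w - U w by rewrite /dU sumrB.
    have eV w : dV w = V' w - V w by rewrite /dV sumrB.
    by apply/funext => w; rewrite eU eV; move: (U w) (V w) (U' w) (V' w) => *; ring.
  have cs (f g : Omega -> R) (x y : R) : 0 < x -> 0 < y -> L4 P f -> L4 P g ->
      Ex (fun w => f w ^+ 2) <= K4 C1 * n%:R * x ^+ 2 -> Ex (fun w => g w ^+ 2) <= K4 C1 * n%:R * y ^+ 2 ->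
      `|Ex (fun w => f w * g w)| <= n%:R * (K4 C1 * x * y).
    move=> x0 y0 Lf Lg Ef Eg; have [_ h] := Ex_CS Lf.1 Lg.1 (L4_L2 Lf) (L4_L2 Lg).
    rewrite -(@ler_pXn2r _ 2%N) ?nnegrE// ?real_normK ?num_real//; last first.
      by rewrite mulr_ge0// !mulr_ge0// ltW.
    rewrite (le_trans h)// (_ : _ ^+ 2 = (K4 C1 * n%:R * x ^+ 2) * (K4 C1 * n%:R * y ^+ 2)); last by ring.
    by rewrite ler_pM// Ex_ge0// => w; exact: sqr_ge0.
  have h1 := cs dU V' _ _ Ke K0 LdU LV' EdU EV'.
  have h2 := cs U dV _ _ K0 Ke LU LdV EU EdV.
  have h3 := covariance_X a n k l Iu Iv; rewrite -/U -/V in h3.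
  have m1 := L4_mul LdU LV'; have m2 := L4_mul LU LdV; have m3 := L4_mul LU LV.
  rewrite -/U' -/V' eq ExD//; last exact: L1D.
  rewrite ExD//.
  have n0 : 0 <= n%:R `^ (7 / 8) :> R by exact: powR_ge0.
  have ne0 : 0 <= n%:R * eta by rewrite mulr_ge0// ltW.
  have KB' : 2 * (K4 C1 * Kz ^+ 2) * (n%:R * eta) + 100 * Dz * n%:R `^ (7 / 8) <= Bz * (n%:R `^ (7 / 8) + n%:R * eta).
    exact: array_arith (ltW KK0) (ltW Dz0) n0 ne0.
  apply: le_trans KB'; apply: (le_trans (error_triangle h3 h1 h2)).
  rewrite le_eqVlt; apply/orP; left; apply/eqP; ring.
Qed.

End model.

(** * Brownian motion *)

Section normal_moments.
Context {R : realType}.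
Local Notation mu := (@lebesgue_measure R).

Lemma normal_integral (m s : R) (f : R -> R) : (forall x, 0 <= f x) ->
  measurable_fun setT f ->
  (\int[normal_prob m s]_x (f x)%:E = \int[mu]_x (f x * normal_pdf m s x)%:E)%E.
Proof.
move=> f0 mf; have dom := normal_prob_dominates m s.
rewrite -(Radon_Nikodym_SigmaFinite.change_of_variables dom)//=; last exact/measurable_EFinP.
have rnint := Radon_Nikodym_SigmaFinite.f_integrable dom.
have mRN := measurable_int mu rnint.
have mpdf : measurable_fun setT (fun x => (normal_pdf m s x)%:E).
  by apply/measurable_EFinP; exact: measurable_normal_pdf.
apply: ae_eq_integral => //.
- by apply: emeasurable_funM => //; exact/measurable_EFinP.
- by apply/measurable_EFinP; apply: measurable_funM => //; exact: measurable_normal_pdf.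
- rewrite (_ : (fun x => (f x * normal_pdf m s x)%:E) = (fun x => (f x)%:E * (normal_pdf m s x)%:E)%E); last first.
    by apply/funext => x; rewrite EFinM.
  apply: ae_eqe_mul2l; apply: integral_ae_eq => // E _ mE.
  by rewrite -Radon_Nikodym_SigmaFinite.f_integral.
Qed.

Lemma pow4_add_le (x y : R) : (x + y) ^+ 4 <= 8 * (x ^+ 4 + y ^+ 4).
Proof.
have := sqr_ge0 (x ^+ 2 - y ^+ 2); have := sqr_ge0 (x - y).
have := sqr_ge0 (x * (x - y)); have := sqr_ge0 (y * (x - y)); have := sqr_ge0 (x ^+ 2 - y ^+ 2); nra.
Qed.

Lemma pow4_le_expR (y : R) : y ^+ 4 <= 29 * expR (3 / 8 * y ^+ 2).
Proof.
set x := 3 / 8 * y ^+ 2.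
have x0 : 0 <= x by rewrite mulr_ge0// sqr_ge0.
have h : (x / 2) ^+ 2 <= expR x.
  have {2}-> : x = x / 2 + x / 2 by lra.
  rewrite expRD -expr2 ler_pXn2r ?nnegrE ?divr_ge0 ?expR_ge0//.
  by rewrite (le_trans _ (expR_ge1Dx _))// lerDr.
have -> : y ^+ 4 = 256 / 9 * (x / 2) ^+ 2 by rewrite /x; field.
have := expR_ge0 x; lra.
Qed.

(** Doubling the standard deviation absorbs the fourth power, so that the moment reduces to the
    total mass of another normal density; a constant larger than the exact 3 is harmless. *)
Lemma normal_pdf_pow4 (m s x : R) : s != 0 ->
  (x - m) ^+ 4 * normal_pdf m s x <= 58 * s ^+ 4 * normal_pdf m (2 * s) x.
Proof.
move=> s0; rewrite !normal_pdfE ?mulf_neq0// /normal_fun.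
have -> : normal_peak (2 * s) = normal_peak s / 2.
  rewrite /normal_peak exprMn -mulrA -mulrnAr sqrtrM ?sqr_ge0// sqrtr_sqr ger0_norm//.
  by rewrite invfM mulrC.
set y := (x - m) / s.
have e1 : - (x - m) ^+ 2 / (s ^+ 2 *+ 2) = - (y ^+ 2 / 2).
  by rewrite /y -mulr_natr; field.
have e2 : - (x - m) ^+ 2 / ((2 * s) ^+ 2 *+ 2) = - (y ^+ 2 / 2) + 3 / 8 * y ^+ 2.
  by rewrite /y -mulr_natr; field.
have e3 : x - m = y * s by rewrite /y divfK.
rewrite e1 e2 e3 expRD exprMn.
have h : y ^+ 4 <= 29 * expR (3 / 8 * y ^+ 2) by exact: pow4_le_expR.
have q0 : 0 <= s ^+ 4 * normal_peak s * expR (- (y ^+ 2 / 2)).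
  by rewrite mulr_ge0 ?expR_ge0// mulr_ge0 ?normal_peak_ge0// -[4%N]/(2 * 2)%N exprM sqr_ge0.
have := ler_wpM2l q0 h.
set a := s ^+ 4; set b := normal_peak s; set c := expR _; set e := expR _; set z := y ^+ 4.
move=> h'; rewrite (_ : z * a * (b * c) = a * b * c * z); last by ring.
by rewrite (le_trans h')// le_eqVlt; apply/orP; left; apply/eqP; field.
Qed.

Lemma normal_fourth (m s : R) : s != 0 ->
  (\int[normal_prob m s]_x ((x - m) ^+ 4)%:E <= (58 * s ^+ 4)%:E)%E.
Proof.
move=> s0; have e4 (z : R) : 0 <= z ^+ 4 by rewrite -[4%N]/(2 * 2)%N exprM sqr_ge0.
have mp : measurable_fun setT (fun x : R => (x - m) ^+ 4).
  by apply: measurable_funX; exact: measurable_funB.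
rewrite normal_integral//.
apply: (@le_trans _ _ (\int[mu]_x (58 * s ^+ 4 * normal_pdf m (2 * s) x)%:E)%E).
  apply: ge0_le_integral => //.
  - by move=> x _; rewrite lee_fin mulr_ge0// normal_pdf_ge0.
  - by apply/measurable_EFinP; apply: measurable_funM => //; exact: measurable_normal_pdf.
  - by apply/measurable_EFinP; apply: measurable_funM => //; exact: measurable_normal_pdf.
  - by move=> x _; rewrite lee_fin normal_pdf_pow4.
under eq_integral do rewrite EFinM.
have c0 : 0 <= 58 * s ^+ 4 by rewrite mulr_ge0.
rewrite ge0_integralZl//.
- by rewrite integral_normal_pdf mule1.
- by apply/measurable_EFinP; exact: measurable_normal_pdf.
- by move=> x _; rewrite lee_fin normal_pdf_ge0.
Qed.

(** The density is at most 1/|s| and the interval has length |s|/2. *)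
Lemma normal_near0 (m s : R) : s != 0 ->
  (normal_prob m s [set x : R | (`|x| <= `|s| / 4)%R] <= (2^-1)%:E)%E.
Proof.
move=> s0; have s1 : 0 < `|s| by rewrite normr_gt0.
have -> : [set x : R | `|x| <= `|s| / 4] = `[- (`|s| / 4), `|s| / 4]%classic.
  by apply/seteqP; split => x /=; rewrite in_itv/= ler_norml.
pose A : set R := `[- (`|s| / 4), `|s| / 4]%classic.
have h : (\int[mu]_(x in A) (normal_pdf m s x)%:E <= \int[mu]_(x in A) (cst (`|s|^-1)%:E x))%E.
  apply: ge0_le_integral => //.
  - exact: measurable_itv.
  - by move=> x _; rewrite lee_fin normal_pdf_ge0.
  - by apply/measurable_EFinP; apply: measurable_funTS; exact: measurable_normal_pdf.
  - move=> x _; rewrite lee_fin (le_trans (normal_pdf_ub m x s0))// /normal_peak.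
    have s2 : 0 < s ^+ 2 by rewrite exprn_even_gt0.
    rewrite lef_pV2 ?posrE//; last by rewrite sqrtr_gt0 pmulrn_lgt0// mulr_gt0// pi_gt0.
    rewrite -[leLHS]sqrtr_sqr ler_wsqrtr// -mulrnAr ler_peMr ?sqr_ge0// mulr2n.
    by rewrite (le_trans (_ : 1 <= 2)) ?ler1n// (le_trans (@pi_ge2 R))// lerDl pi_ge0.
apply: le_trans h _.
rewrite integral_cst//=; last exact: measurable_itv.
rewrite /A lebesgue_measure_itv/=.
rewrite lte_fin ifT; last by rewrite gtrN// divr_gt0.
rewrite -EFinB -EFinM lee_fin opprK (_ : `|s|^-1 * _ = 2^-1)//.
by field; rewrite gt_eqF.
Qed.

Context {d : measure_display} {T : measurableType d}.
Variable P : probability T R.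
Local Notation Ex := (Ex P).
Local Notation L1 := (L1 P).

Definition Kn : R := 8 * ((2 + 60 * 32) ^+ 2 + 58 * 32 ^+ 2).

Lemma normal_arith (V m2 s2 F : R) : 0 <= m2 -> 0 <= s2 -> s2 <= 32 * V -> m2 <= 2 * V + 60 * s2 ->
  F <= 8 * (m2 ^+ 2 + 58 * s2 ^+ 2) -> F <= Kn * V ^+ 2.
Proof.
move=> m0 s0 sV mV FV.
have h1 : m2 ^+ 2 <= (2 + 60 * 32) ^+ 2 * V ^+ 2.
  rewrite -exprMn ler_pXn2r ?nnegrE//; first lra.
  by rewrite (le_trans m0)// (le_trans mV)//; lra.
have h2 : s2 ^+ 2 <= 32 ^+ 2 * V ^+ 2.
  by rewrite -exprMn ler_pXn2r ?nnegrE// (le_trans s0).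
rewrite (le_trans FV)// /Kn -mulrA ler_wpM2l// [leRHS]mulrDl -mulrA lerD// ler_wpM2l//.
Qed.

(** The parameters m and s are not given as moments of [Z]. Anticoncentration, [normal_near0],
    yields E Z^2 >= s^2/32; this bounds s and then m by the second moment, and the fourth moment
    follows. The Dirac case s = 0 is treated apart. *)
Lemma normal_moments (Z : T -> R) : measurable_fun setT Z -> normally_distributed P Z ->
  L4 P Z /\ Ex (fun w => Z w ^+ 4) <= Kn * Ex (fun w => Z w ^+ 2) ^+ 2.
Proof.
move=> mZ [m [s hms]].
pose X : {RV P >-> R} := mfun_Sub (mem_set mZ).
have e4 (z : R) : 0 <= z ^+ 4 by rewrite -[4%N]/(2 * 2)%N exprM sqr_ge0.
have mp : measurable_fun setT (fun x : R => (x - m) ^+ 4).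
  by apply: measurable_funX; exact: measurable_funB.
have mW : measurable_fun setT (fun w => (Z w - m) ^+ 4).
  by apply: (measurableT_comp mp mZ).
have push : ('E_P[fun w => ((Z w - m) ^+ 4)%R] = \int[pushforward P Z]_x ((x - m) ^+ 4)%:E)%E.
  rewrite unlock ge0_integral_pushforward//; first exact/measurable_EFinP.
  by move=> x _; rewrite lee_fin.
have mZ' : measurable_fun setT (Z : T -> measurableTypeR R) by exact: mZ.
have pushE : ('E_P[fun w => ((Z w - m) ^+ 4)%R] =
    \int[pushforward P (Z : T -> measurableTypeR R)]_x ((x - m) ^+ 4)%:E)%E.
  rewrite unlock (ge0_integral_pushforward mZ')//; first exact/measurable_EFinP.
  by move=> x _; rewrite lee_fin.
have [L E4] : L1 (fun w => (Z w - m) ^+ 4) /\ Ex (fun w => (Z w - m) ^+ 4) <= 58 * s ^+ 4.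
  apply: L1_expectation => //.
  have [s0|s0] := eqVneq s 0.
    rewrite push (@eq_measure_integral _ _ _ setT (dirac m)); last first.
      by move=> A mA _; have := hms A mA; rewrite s0 eqxx.
    rewrite integral_dirac//; last exact/measurable_EFinP.
    by rewrite diracE mem_set// mul1e subrr expr0n lee_fin mulr_ge0.
  apply: le_trans (normal_fourth m s0); rewrite pushE le_eqVlt; apply/orP; left; apply/eqP.
  by apply: eq_measure_integral => A mA _; have := hms A mA; rewrite (negbTE s0).
have L4W : L4 P (fun w => Z w - m) by split => //; exact: measurable_funB.
have L4Z : L4 P Z.
  have -> : Z = (fun w => Z w - m + m) by apply/funext => w; rewrite subrK.
  by apply: L4D => //; exact: L4_cst.
split => //.
have L2Z := L4_L2 L4Z; have L2W := L4_L2 L4W.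
set V := Ex (fun w => Z w ^+ 2).
have EW : Ex (fun w => (Z w - m) ^+ 2) <= 30 * s ^+ 2.
  have [s0|s0] := eqVneq s 0.
    have := E4; rewrite s0 !expr0n !mulr0 => h.
    have m2W : measurable_fun setT (fun w => (Z w - m) ^+ 2) by exact: L1_mf L2W.
    have e w : ((Z w - m) ^+ 2) ^+ 2 = (Z w - m) ^+ 4 by rewrite -exprM.
    have L22 : L1 (fun w => ((Z w - m) ^+ 2) ^+ 2) by apply: eq_L1 L => w; rewrite e.
    have [_] := Ex_CS m2W (@measurable_cst _ _ T R setT 1) L22 (L1_cst P (1 ^+ 2)).
    rewrite (_ : (fun w => _ * cst 1 w) = (fun w => (Z w - m) ^+ 2)); last by apply/funext => w; rewrite mulr1.
    rewrite (Ex_cst P (1 ^+ 2)) expr1n mulr1 (eq_fun e) => h2.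
    have := le_trans h2 h; rewrite le_eqVlt ltNge sqr_ge0 orbF sqrf_eq0 => /eqP ->; exact: lexx.
  have s2 : 0 < s ^+ 2 by rewrite exprn_even_gt0.
  have h w : (Z w - m) ^+ 2 <= s ^+ 2 / 2 + (s ^+ 2)^-1 / 2 * (Z w - m) ^+ 4.
    set x := (Z w - m) ^+ 2; have -> : (Z w - m) ^+ 4 = x ^+ 2 by rewrite -exprM.
    rewrite -(ler_pM2l s2) (_ : s ^+ 2 * (_ + _) = (s ^+ 2) ^+ 2 / 2 + x ^+ 2 / 2); last by field.
    by have := sqr_ge0 (s ^+ 2 - x); rewrite sqrrB; lra.
  have LR : L1 (fun w => s ^+ 2 / 2 + (s ^+ 2)^-1 / 2 * (Z w - m) ^+ 4).
    by apply: L1D; [exact: (L1_cst P)|exact: L1Z].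
  apply: (le_trans (Ex_le L2W LR h)); rewrite (ExD (L1_cst P (s ^+ 2 / 2)) (L1Z _ L)) (Ex_cst P (s ^+ 2 / 2)) (ExZ _ L).
  have : (s ^+ 2)^-1 / 2 * Ex (fun w => (Z w - m) ^+ 4) <= (s ^+ 2)^-1 / 2 * (58 * s ^+ 4).
    by rewrite ler_wpM2l// divr_ge0// invr_ge0 ltW.
  rewrite (_ : (s ^+ 2)^-1 / 2 * (58 * s ^+ 4) = 29 * s ^+ 2); last by field.
  lra.
have m2 : m ^+ 2 <= 2 * V + 60 * s ^+ 2.
  have h w : cst (m ^+ 2) w <= 2 * Z w ^+ 2 + 2 * (Z w - m) ^+ 2.
    by have := sqr_ge0 (2 * Z w - m); rewrite /= !sqrrB; lra.
  have LR : L1 (fun w => 2 * Z w ^+ 2 + 2 * (Z w - m) ^+ 2) by apply: L1D; exact: L1Z.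
  have := Ex_le (L1_cst P _) LR h; rewrite (Ex_cst P) ExD ?ExZ//; try exact: L1Z.
  by rewrite -/V; lra.
have s2V : s ^+ 2 <= 32 * V.
  have [s0|s0] := eqVneq s 0.
    by rewrite s0 expr0n mulr_ge0// Ex_ge0// => w; exact: sqr_ge0.
  pose A := [set w | `|Z w| <= `|s| / 4].
  have mB : measurable [set x : R | `|x| <= `|s| / 4].
    by rewrite -[X in measurable X]setTI; apply: measurable_fun_le => //; exact: measurable_normr.
  have mA : measurable A by have := mZ measurableT _ mB; rewrite setTI.
  have PA : Pr P A <= 2^-1.
    rewrite -lee_fin PrE//; have := hms _ mB; rewrite (negbTE s0) /pushforward => ->.
    exact: normal_near0.
  have h w : (s ^+ 2 / 16) * (1 - \1_A w) <= Z w ^+ 2.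
    rewrite indicE; have [|/negP] := boolP (w \in A).
      by rewrite subrr mulr0 sqr_ge0.
    rewrite inE /= => /negP; rewrite -ltNge => hw; rewrite subr0 mulr1.
    rewrite -[leRHS]real_normK ?num_real// (_ : s ^+ 2 / 16 = (`|s| / 4) ^+ 2); last first.
      by rewrite exprMn real_normK ?num_real//; field.
    by rewrite ler_pXn2r ?nnegrE ?divr_ge0// ltW.
  have Li := L1_indic P mA; have L1i : L1 (fun w => 1 - \1_A w) by exact: (L1B (L1_cst P 1) Li).
  have := Ex_le (L1Z _ L1i) L2Z h; rewrite ExZ// (ExB (L1_cst P 1) Li) (Ex_cst P) Pr_indic// -/V.
  move=> h1; have s2 : 0 <= s ^+ 2 / 16 by rewrite divr_ge0// sqr_ge0.
  have : s ^+ 2 / 16 * 2^-1 <= s ^+ 2 / 16 * (1 - Pr P A) by rewrite ler_wpM2l//; lra.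
  lra.
apply: (normal_arith (sqr_ge0 m) (sqr_ge0 s) s2V m2).
have h w : Z w ^+ 4 <= 8 * ((Z w - m) ^+ 4 + cst (m ^+ 4) w).
  have -> : Z w = (Z w - m) + m by rewrite subrK.
  rewrite addrK /=; exact: pow4_add_le.
have LR : L1 (fun w => 8 * ((Z w - m) ^+ 4 + cst (m ^+ 4) w)).
  by apply: L1Z; apply: L1D => //; exact: L1_cst.
apply: (le_trans (Ex_le L4Z.2 LR h)); rewrite ExZ ?ExD ?(Ex_cst P) -?exprM//; last 2 first.
- exact: L1_cst.
- by apply: L1D => //; exact: L1_cst.
by rewrite ler_pM2l// addrC lerD2l.
Qed.

End normal_moments.

(** * Independence as mixing with coefficient 0 *)

Section independence.
Context {R : realType} {d : measure_display} {T : measurableType d}.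
Variable P : probability T R.
Local Notation Ex := (Ex P).

Lemma Ex_of_law {dE} {E : measurableType dE} (Y1 Y2 : T -> E) (phi : E -> R) :
  measurable_fun setT Y1 -> measurable_fun setT Y2 -> measurable_fun setT phi ->
  (forall B, measurable B -> pushforward P Y1 B = pushforward P Y2 B) ->
  L1 P (fun w => phi (Y1 w)) -> L1 P (fun w => phi (Y2 w)) ->
  Ex (fun w => phi (Y1 w)) = Ex (fun w => phi (Y2 w)).
Proof.
move=> m1 m2 mphi law L1' L2'; congr fine.
have mphi' : measurable_fun setT (EFin \o phi) by exact/measurable_EFinP.
have := integral_pushforward m1 mphi' (L1' : P.-integrable (Y1 @^-1` setT) _) measurableT.
have := integral_pushforward m2 mphi' (L2' : P.-integrable (Y2 @^-1` setT) _) measurableT.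
rewrite !preimage_setT /= => <- <-.
by apply: eq_measure_integral => B mB _; exact: law.
Qed.

(** For fixed B, the trace of P on B and the multiple P(B) of P are measures that agree on the
    pi-system, hence on the sigma-algebra that it generates. *)
Lemma mixing_pi_system (F G : set (set T)) (Pi : set (set T)) :
  Pi `<=` measurable -> setI_closed Pi -> F `<=` Pi -> <<s G >> `<=` measurable ->
  (forall A B, Pi A -> <<s G >> B -> P (A `&` B) = (P A * P B)%E) -> mixing P 0 F G.
Proof.
move=> PiT PiI FPi GT ind A B sA sB.
have mB := GT _ sB.
have sPi : <<s Pi >> A by apply: sub_smallest2r sA => //; exact: smallest_sigma_algebra.
have mA : measurable A.
  by move: sPi; apply: smallest_sub => //; exact: sigma_algebra_measurable.
have B0 : 0 <= Pr P B by exact: Pr_ge0.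
have -> : Pr P (A `&` B) = Pr P A * Pr P B.
  have H : [set X | Pi X /\ X `<=` setT] = Pi by apply/seteqP; split => [X []|X].
  suff : P (A `&` B) = (P A * P B)%E.
    by move=> e; apply: EFin_inj; rewrite EFinM !PrE//; exact: measurableI.
  have := @g_sigma_algebra_measure_unique_trace _ _ _ Pi setT measurableT.
  rewrite H => /(_ R PiT PiI (mrestr P mB) (mscale (NngNum B0) P)).
  have e1 X : Pi X -> P (X `&` B) = ((Pr P B)%:E * P X)%E by move=> PiX; rewrite ind// muleC PrE.
  have e2 : P (setT `&` B) = ((Pr P B)%:E * P setT)%E by rewrite setTI probability_setT mule1 PrE.
  have e3 : (P (setT `&` B) < +oo)%E by rewrite setTI -PrE// ltry.
  move=> h; rewrite muleC -[X in (X * _)%E]PrE//.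
  by apply: (h e2 e1 e3).
by rewrite subrr normr0.
Qed.

(** The coefficient 0 is 0 * g for every g in (0, 1]; letting g tend to 0 in [cv_L4] annihilates the
    covariance. *)
Lemma indep_Ex (F G : set (set T)) (U V : T -> R) : F `<=` measurable -> G `<=` measurable ->
  mixing P 0 F G -> gmeas F U -> gmeas G V -> L4 P U -> L4 P V ->
  Ex (fun w => U w * V w) = Ex U * Ex V.
Proof.
move=> FT GT FG gU gV LU LV.
have norm4 (f : T -> R) : L4 P f -> exists2 a : R, 0 < a &
    L1 P (fun w => (a * f w) ^+ 4) /\ Ex (fun w => (a * f w) ^+ 4) <= 1.
  move=> Lf; have E0 : 0 <= Ex (fun w => f w ^+ 4).
    by apply: Ex_ge0 => w; rewrite -[4%N]/(2 * 2)%N exprM sqr_ge0.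
  set e := Ex _ in E0; have e1 : 0 < 1 + e by rewrite ltr_wpDr.
  exists (1 + e)^-1; first by rewrite invr_gt0.
  have eq : (fun w => ((1 + e)^-1 * f w) ^+ 4) = (fun w => ((1 + e)^-1) ^+ 4 * f w ^+ 4).
    by apply/funext => w; rewrite exprMn.
  rewrite eq; split; first by apply: L1Z; exact: Lf.2.
  rewrite ExZ; last exact: Lf.2.
  rewrite -/e exprVn mulrC ler_pdivrMr ?exprn_gt0// mul1r.
  rewrite (@le_trans _ _ (1 + e))// ?lerDr// exprS ler_peMr ?(ltW e1)//.
  by rewrite exprn_ege1// lerDl.
have [a a0 [La Ea]] := norm4 U LU; have [b b0 [Lb Eb]] := norm4 V LV.
have gaU : gmeas F (fun w => a * U w) by apply: measurable_funM => //; exact: measurable_cst.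
have gbV : gmeas G (fun w => b * V w) by apply: measurable_funM => //; exact: measurable_cst.
have h (g : R) : 0 < g -> g <= 1 -> `|cv P (fun w => a * U w) (fun w => b * V w)| <= 10 * g `^ 2^-1.
  move=> g0 g1; have FG' : mixing P (0 * g) F G by rewrite mul0r.
  have [_ _ _] := cv_L4 FT GT g0 g1 FG' gaU gbV La Ea Lb Eb.
  by rewrite mulr0 add0r.
have z : cv P (fun w => a * U w) (fun w => b * V w) = 0.
  apply/eqP; rewrite -normr_le0 leNgt; apply/negP; set x := `|_| => x0.
  have [x1|x1] := leP 1 (x / 20).
    have := h 1 ltr01 (lexx 1); rewrite powR1 mulr1 -/x leNgt; apply/negP; rewrite negbK; lra.
  have y0 : 0 < x / 20 by rewrite divr_gt0.
  (* For this g the bound 10 g^(1/2) is x/2. *)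
  have := h ((x / 20) ^+ 2); rewrite exprn_gt0// => /(_ erefl).
  rewrite -powR_mulrn ?(ltW y0)// -powRrM mulfV ?powRr1 ?(ltW y0)// powR_mulrn ?(ltW y0)//.
  rewrite expr_le1 ?(ltW y0)// ?(ltW x1)// => /(_ erefl); rewrite -/x; lra.
move: z; rewrite /cv.
have -> : (fun w => a * U w * (b * V w)) = (fun w => a * b * (U w * V w)).
  by apply/funext => w; ring.
rewrite !ExZ; [|exact: L4_L1|exact: L4_L1|exact: L4_mul].
move/eqP; rewrite (_ : _ - _ = a * b * (Ex (fun w => U w * V w) - Ex U * Ex V)); last by ring.
by rewrite !mulf_eq0 (gt_eqF a0) (gt_eqF b0)/= subr_eq0 => /eqP.
Qed.

End independence.

(** * Increments of the Brownian motion *)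

Section brownian_facts.
Context {R : realType} {dO : measure_display} {Omega : measurableType dO}.
Variable P : probability Omega R.
Context {d : nat} {I : set R}.
Variables (W : R -> Omega -> C0 I 'rV[R]_d) (c : 'I_d -> 'I_d -> R -> R -> R).
Hypotheses (dI : domain I) (hW : brownian_motion P c W).
Local Notation Ex := (Ex P).

Lemma cover_pair {M : normedModType R} (A B : Omega -> M) : coverable M -> forall e : R, 0 < e ->
  exists U : nat -> set Omega, (forall w, exists n, U n w) /\
    forall n w w', U n w -> U n w' -> `|A w - A w'| <= e /\ `|B w - B w'| <= e.
Proof.
move=> cM e e0; have [U [U1 U2]] := cM e e0.
exists (fun n => if choice.unpickle n is Some (i, j) then [set w | U i (A w) /\ U j (B w)] else set0).
split=> [w|n w w'].
  have [i Ui] := U1 (A w); have [j Uj] := U1 (B w).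
  by exists (choice.pickle (i, j)); rewrite choice.pickleK.
case: (choice.unpickle n) => [[i j]|//] [h1 h2] [h3 h4].
by split; [exact: U2 h1 h3|exact: U2 h2 h4].
Qed.

Lemma increment_measurable (s t : R) : 0 <= s <= 1 -> 0 <= t <= 1 ->
  measurable_fun setT (increment W s t).
Proof.
move=> hs ht; apply: (@measurable_of_cover _ _ _ _ _ (fun l => if l == 0%N then W s else W t)).
- by move=> l; case: (l == 0%N); [exact: bm_measurable hW _ hs|exact: bm_measurable hW _ ht].
- move=> e e0; have [U [U1 U2]] := cover_pair (W s) (W t) (C0_coverable dI rV_coverable) e0.
  exists U; split => // n w w' h h' l; have [h1 h2] := U2 n w w' h h'.
  by case: (l == 0%N).
- move=> e e0; exists (e / 2); first by rewrite divr_gt0.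
  move=> w w' h; rewrite /increment (_ : _ - _ - _ = (W t w - W t w') - (W s w - W s w')); last first.
    by rewrite !opprD !opprK addrACA.
  rewrite (le_trans (ler_normB _ _))// (_ : e = e / 2 + e / 2); last by rewrite -splitr.
  by apply: lerD; [exact: (h 1%N)|exact: (h 0%N)].
Qed.

Definition incr (s t u : R) (k : 'I_d) (w : Omega) : R := W t w u ord0 k - W s w u ord0 k.

Lemma incrE s t u k w : incr s t u k w = increment W s t w u ord0 k.
Proof. by rewrite /increment C0_subE !mxE. Qed.

Definition Gincr (t : nat -> R) (j : nat) : set (set Omega) :=
  preimage_set_system setT (increment W (t j) (t j.+1)) measurable.
Definition Fincr (t : nat -> R) (j : nat) : set (set Omega) :=
  \bigcup_(i in `I_j) Gincr t i.

Definition times (t : nat -> R) (n : nat) : Prop :=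
  (forall i, (i <= n)%N -> 0 <= t i <= 1) /\ (forall i, (i < n)%N -> t i <= t i.+1).

Lemma Gincr_sub t n j : times t n -> (j < n)%N -> Gincr t j `<=` measurable.
Proof.
move=> [t01 _] jn _ [B mB <-].
exact: (increment_measurable (t01 j (ltnW jn)) (t01 j.+1 jn)).
Qed.

Lemma Fincr_sub t n j : times t n -> (j <= n)%N -> Fincr t j `<=` measurable.
Proof.
by move=> ht jn A [i /= ij]; apply: (Gincr_sub ht); exact: leq_trans jn.
Qed.

Lemma gmeas_Gincr t j u k : gmeas (Gincr t j) (incr (t j) (t j.+1) u k).
Proof.
rewrite (_ : incr _ _ _ _ = fun w => increment W (t j) (t j.+1) w u ord0 k); last first.
  by apply/funext => w; rewrite incrE.
apply: (@gmeas_preimage _ _ _ _ _ (increment W (t j) (t j.+1)) (fun f => f u ord0 k)).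
by apply: (@C0_coord_measurable _ _ _ _ _ (fun f : borel (C0 I 'rV[R]_d) => f)); exact: measurable_id.
Qed.

Lemma gmeas_Fincr t j i u k : (i < j)%N -> gmeas (Fincr t j) (incr (t i) (t i.+1) u k).
Proof.
by move=> ij; apply: (@gmeasS _ _ _ (Gincr t i)); [move=> A GA; exists i|exact: gmeas_Gincr].
Qed.

(** The pi-system consists of the intersections of one event for each earlier increment, to which
    [bm_independent] applies directly. *)
Lemma mixing_incr t n j : times t n -> (j < n)%N -> mixing P 0 (Fincr t j) (Gincr t j).
Proof.
move=> ht jn; have [t01 tm] := ht.
pose inc i := increment W (t i) (t i.+1).
have minc i : (i < n)%N -> forall B, measurable B -> measurable (inc i @^-1` B).
  move=> i_n B mB; rewrite -[X in measurable X]setTI.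
  exact: (increment_measurable (t01 i (ltnW i_n)) (t01 i.+1 i_n)).
pose Pi := [set A : set Omega | exists2 B : nat -> set (borel (C0 I 'rV[R]_d)),
  (forall i, measurable (B i)) & A = \bigcap_(i in `I_j) (inc i @^-1` B i)].
have sG B : <<s Gincr t j >> B -> exists2 C, measurable C & B = inc j @^-1` C.
  have /smallest_sub h := sigma_algebra_preimage setT (inc j) (sigma_algebra_measurable (borel (C0 I 'rV[R]_d))).
  by move=> /(h _ (@subset_refl _ _))[C mC <-]; exists C => //; rewrite setTI.
have mPi A : Pi A -> measurable A.
  move=> [B mB ->].
  have -> : \bigcap_(i in `I_j) (inc i @^-1` B i) =
      \bigcap_i (if (i < j)%N then inc i @^-1` B i else setT).
    apply/seteqP; split => w /= h i; first by move=> _; case: ifP => // ij; exact: h.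
    by move=> /= ij; have := h i Logic.I; rewrite ij.
  apply: bigcapT_measurable => i; case: ifP => // ij; apply: minc => //.
  exact: ltn_trans jn.
apply: (@mixing_pi_system _ _ _ P _ _ Pi) => //.
- move=> A A' [B mB ->] [B' mB' ->]; exists (fun i => B i `&` B' i).
    by move=> i; exact: measurableI.
  by rewrite -bigcapI; apply: eq_bigcapr => i _; rewrite preimage_setI.
- move=> A [i /= ij [C mC <-]]; exists (fun i' => if i' == i then C else setT).
    by move=> i'; case: eqP => // _; exact: measurableT.
  apply/seteqP; split => w /= h.
    by move=> i' _ /=; case: eqP => // ->; exact: h.2.
  by split => //; have := h i ij; rewrite /= eqxx.
- by move=> B /sG[C mC ->]; exact: minc.
- move=> A B [B1 mB1 ->] /sG[C mC ->].
  pose B2 i := if i == j then C else B1 i.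
  have mB2 i : measurable (B2 i) by rewrite /B2; case: eqP.
  have hb m : (m <= n)%N -> (forall i, (i <= m)%N -> 0 <= t i <= 1) /\ (forall i, (i < m)%N -> t i <= t i.+1).
    by move=> mn; split => i im; [apply: t01; exact: leq_trans mn|apply: tm; exact: leq_trans mn].
  have [h1 h2] := hb j (ltnW jn); have [h3 h4] := hb j.+1 jn.
  have e1 := bm_independent hW h1 h2 mB1.
  have := bm_independent hW h3 h4 mB2; rewrite big_ord_recr/= {3}/B2 eqxx.
  under eq_bigr => i _ do rewrite /B2 (ltn_eqF (ltn_ord i)).
  rewrite -e1 => <-; congr (P _); apply/seteqP; split => w /= h.
    move=> i /=; rewrite /B2 ltnS leq_eqVlt; case: eqP => [->|_ /= ij]; [by move=> _; exact: h.2|exact: h.1].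
  split; last by have := h j (ltnSn j); rewrite /B2/= eqxx.
  by move=> i /= ij; have := h i (ltnW ij : (i < j.+1)%N); rewrite /B2 /= (ltn_eqF ij).
Qed.

Lemma incr_measurable (s t u : R) k : 0 <= s <= 1 -> 0 <= t <= 1 ->
  measurable_fun setT (incr s t u k).
Proof.
by move=> hs ht; apply: measurable_funB; apply: C0_coord_measurable;
  [exact: bm_measurable hW _ ht|exact: bm_measurable hW _ hs].
Qed.

Lemma incr_moments (s t u : R) k : 0 <= s <= t -> t <= 1 -> I u ->
  L4 P (incr s t u k) /\
  Ex (fun w => incr s t u k w ^+ 4) <= Kn * Ex (fun w => incr s t u k w ^+ 2) ^+ 2.
Proof.
move=> /andP[s0 st] t1 Iu; apply: normal_moments.
  by apply: incr_measurable; rewrite ?s0 ?t1 ?(le_trans st)// (le_trans s0).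
have := bm_normal hW (m := 1%N) (fun=> 1) (fun=> k) (u := fun=> u) (s := s) (t := t).
rewrite s0 st t1 => /(_ erefl erefl (fun=> Iu)); congr normally_distributed.
by apply/funext => w; rewrite big_ord1 mul1r incrE.
Qed.

Lemma incr_diff_moments (s t u v : R) k : 0 <= s <= t -> t <= 1 -> I u -> I v ->
  Ex (fun w => (incr s t u k w - incr s t v k w) ^+ 4) <=
    Kn * Ex (fun w => (incr s t u k w - incr s t v k w) ^+ 2) ^+ 2.
Proof.
move=> /andP[s0 st] t1 Iu Iv; apply: (normal_moments _ _).2.
  by apply: measurable_funB; apply: incr_measurable; rewrite ?s0 ?t1 ?(le_trans st)// (le_trans s0).
have := bm_normal hW (m := 2%N) (fun i => if i == ord0 then 1 else -1) (fun=> k)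
  (u := fun i => if i == ord0 then u else v) (s := s) (t := t).
rewrite s0 st t1 => /(_ erefl erefl).
have Iuv (i : 'I_2) : I (if i == ord0 then u else v) by case: (i == ord0).
move=> /(_ Iuv); congr normally_distributed.
by apply/funext => w; rewrite big_ord_recl big_ord1/= mul1r mulN1r !incrE.
Qed.

Lemma W1_mean0 u k : I u -> Ex (fun w => W 1 w u ord0 k) = 0.
Proof.
move=> Iu; have := congr1 (fun f : 'rV[R]_d => f ord0 k) (bm_mean hW Iu); rewrite !mxE unlock.
by [].
Qed.

Section rational_times.
Variable q : nat.
Hypothesis q0 : (0 < q)%N.

Definition tq (i : nat) : R := i%:R / q%:R.

Let qR : 0 < q%:R :> R. Proof. by rewrite ltr0n. Qed.

Lemma tq_le i j : (i <= j)%N -> tq i <= tq j.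
Proof. by move=> ij; rewrite ler_pM2r ?invr_gt0// ler_nat. Qed.

Lemma tq0 : tq 0 = 0. Proof. by rewrite /tq mul0r. Qed.

Lemma tqq : tq q = 1. Proof. by rewrite /tq divff ?gt_eqF. Qed.

Lemma tq01 i : (i <= q)%N -> 0 <= tq i <= 1.
Proof. by move=> iq; rewrite -tq0 -tqq !tq_le. Qed.

Lemma tq_times : times tq q.
Proof. by split => i iq; [exact: tq01|exact: tq_le]. Qed.

Lemma tq_L4 i j u k : (i <= j <= q)%N -> I u -> L4 P (incr (tq i) (tq j) u k).
Proof.
move=> /andP[ij jq] Iu; apply: (incr_moments k _ _ Iu).1; last by case/andP: (tq01 jq).
by rewrite tq_le// andbT; case/andP: (tq01 (leq_trans ij jq)).
Qed.

Lemma incr_law i (phi : borel (C0 I 'rV[R]_d) -> R) : (i < q)%N -> measurable_fun setT phi ->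
  (forall j, (j < q)%N -> L1 P (fun w => phi (increment W (tq j) (tq j.+1) w))) ->
  Ex (fun w => phi (increment W (tq i) (tq i.+1) w)) = Ex (fun w => phi (increment W (tq 0) (tq 1) w)).
Proof.
move=> iq mphi Lphi; apply: Ex_of_law => //.
- by apply: increment_measurable; exact: tq01 (ltnW iq) || exact: tq01.
- by apply: increment_measurable; exact: tq01.
- move=> B mB; have := @bm_stationary _ _ _ _ _ _ _ _ hW (tq 0) (tq 1) (tq i) B.
  rewrite tq0 lexx /= add0r; have -> : tq 1 + tq i = tq i.+1 by rewrite /tq -mulrDl -natrD add1n.
  apply => //; [by case/andP: (tq01 q0)|by case/andP: (tq01 (ltnW iq))|by case/andP: (tq01 iq)].
- exact: Lphi.
- exact: Lphi.
Qed.

Lemma incr_sum a p u k w : incr (tq a) (tq (a + p)) u k w =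
  \sum_(i < p) incr (tq (a + i)) (tq (a + i).+1) u k w.
Proof.
elim: p => [|p IH]; first by rewrite addn0 big_ord0 /incr subrr.
by rewrite big_ord_recr/= -IH addnS /incr [in RHS]addrC addrA subrK.
Qed.

Let mcoord u k : measurable_fun setT (fun f : borel (C0 I 'rV[R]_d) => f u ord0 k).
Proof. by apply: (@C0_coord_measurable _ _ _ _ _ (fun f : borel (C0 I 'rV[R]_d) => f)); exact: measurable_id. Qed.

(** Only the mean of [W 1] is prescribed. It is the sum of q increments with equal means, by
    stationarity, so each of them is centred. *)
Lemma incr_mean0 a p u k : (a + p <= q)%N -> I u -> Ex (incr (tq a) (tq (a + p)) u k) = 0.
Proof.
have step i : (i < q)%N -> I u -> Ex (incr (tq i) (tq i.+1) u k) = Ex (incr (tq 0) (tq 1) u k).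
  move=> iq Iu; have := @incr_law i (fun f => f u ord0 k) iq (mcoord u k).
  rewrite (_ : (fun w => increment W (tq i) (tq i.+1) w u ord0 k) = incr (tq i) (tq i.+1) u k); last first.
    by apply/funext => w; rewrite incrE.
  rewrite (_ : (fun w => increment W (tq 0) (tq 1) w u ord0 k) = incr (tq 0) (tq 1) u k); last first.
    by apply/funext => w; rewrite incrE.
  apply=> j jq; apply: (eq_L1 (f := incr (tq j) (tq j.+1) u k)); first by move=> w; rewrite incrE.
  by apply: L4_L1; apply: tq_L4; rewrite ?leqnSn.
have tot a' p' : (a' + p' <= q)%N -> I u ->
    Ex (incr (tq a') (tq (a' + p')) u k) = p'%:R * Ex (incr (tq 0) (tq 1) u k).
  move=> apq Iu; elim: p' apq => [|p' IH] apq.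
    by rewrite addn0 mul0r (_ : incr _ _ _ _ = cst 0) ?(Ex_cst P)//; apply/funext => w; rewrite /incr subrr.
  have h : (a' + p' < q)%N by rewrite -addnS.
  have -> : incr (tq a') (tq (a' + p'.+1)) u k =
      (fun w => incr (tq a') (tq (a' + p')) u k w + incr (tq (a' + p')) (tq (a' + p').+1) u k w).
    by apply/funext => w; rewrite incr_sum big_ord_recr/= -incr_sum.
  rewrite ExD; first by rewrite (IH (ltnW h)) (step _ h Iu) -[in RHS]addn1 natrD mulrDl mul1r.
  - by apply: L4_L1; apply: tq_L4 => //; rewrite leq_addr ltnW.
  - by apply: L4_L1; apply: tq_L4 => //; rewrite leqnSn.
move=> apq Iu; rewrite tot//; have := tot 0%N q (leqnn q) Iu.
rewrite add0n tq0 tqq (_ : incr 0 1 u k = fun w => W 1 w u ord0 k); last first.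
  by apply/funext => w; rewrite /incr (bm_start hW) [X in _ - X](_ : _ = 0) ?subr0// mxE.
rewrite (W1_mean0 k Iu); move/eqP; rewrite eq_sym mulf_eq0 gt_eqF//= => /eqP ->.
by rewrite mulr0.
Qed.

(** As for the mean: the q increments of length 1/q have equal covariances, which add up by
    independence to that of [W 1]. *)
Lemma incr_cov a p u v k l : (a + p <= q)%N -> I u -> I v ->
  Ex (fun w => incr (tq a) (tq (a + p)) u k w * incr (tq a) (tq (a + p)) v l w) =
    p%:R / q%:R * c k l u v.
Proof.
move=> apq Iu Iv.
pose r := Ex (fun w => incr (tq 0) (tq 1) u k w * incr (tq 0) (tq 1) v l w).
have step i : (i < q)%N -> Ex (fun w => incr (tq i) (tq i.+1) u k w * incr (tq i) (tq i.+1) v l w) = r.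
  move=> iq; have e j : (fun w => increment W (tq j) (tq j.+1) w u ord0 k * increment W (tq j) (tq j.+1) w v ord0 l) =
      (fun w => incr (tq j) (tq j.+1) u k w * incr (tq j) (tq j.+1) v l w).
    by apply/funext => w; rewrite !incrE.
  have := @incr_law i (fun f => f u ord0 k * f v ord0 l) iq (measurable_funM (mcoord u k) (mcoord v l)).
  rewrite !e; apply => j jq; rewrite e; apply: L4_mul; apply: tq_L4 => //; by rewrite leqnSn.
have tot a' p' : (a' + p' <= q)%N ->
    Ex (fun w => incr (tq a') (tq (a' + p')) u k w * incr (tq a') (tq (a' + p')) v l w) = p'%:R * r.
  elim: p' => [|p' IH] h'.
    rewrite addn0 mul0r (_ : (fun w => _) = cst 0) ?(Ex_cst P)//.
    by apply/funext => w; rewrite /incr subrr mul0r.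
  have h : (a' + p' < q)%N by rewrite -addnS.
  have L x m : I x -> L4 P (incr (tq a') (tq (a' + p')) x m).
    by move=> Ix; apply: tq_L4 => //; rewrite leq_addr ltnW.
  have L' x m : I x -> L4 P (incr (tq (a' + p')) (tq (a' + p').+1) x m).
    by move=> Ix; apply: tq_L4 => //; rewrite leqnSn.
  have z x y m m' : I x -> I y -> Ex (fun w => incr (tq a') (tq (a' + p')) x m w *
      incr (tq (a' + p')) (tq (a' + p').+1) y m' w) = 0.
    move=> Ix Iy; rewrite (indep_Ex (Fincr_sub tq_times (ltnW h)) (Gincr_sub tq_times h) (mixing_incr tq_times h)).
    - by rewrite -[X in incr _ (tq X) y]addn1 (incr_mean0 _ _ Iy) ?mulr0// addn1.
    - rewrite (_ : incr _ _ _ _ = fun w => \sum_(i < p') incr (tq (a' + i)) (tq (a' + i).+1) x m w); last first.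
        by apply/funext => w; exact: incr_sum.
      by apply: gmeas_sum => i; apply: gmeas_Fincr; rewrite ltn_add2l.
    - exact: gmeas_Gincr.
    - exact: L.
    - exact: L'.
  rewrite (_ : (fun w => _) = (fun w => incr (tq a') (tq (a' + p')) u k w * incr (tq a') (tq (a' + p')) v l w +
     incr (tq a') (tq (a' + p')) u k w * incr (tq (a' + p')) (tq (a' + p').+1) v l w +
     incr (tq a') (tq (a' + p')) v l w * incr (tq (a' + p')) (tq (a' + p').+1) u k w +
     incr (tq (a' + p')) (tq (a' + p').+1) u k w * incr (tq (a' + p')) (tq (a' + p').+1) v l w)); last first.
    apply/funext => w; rewrite !incr_sum !big_ord_recr/= -!incr_sum; ring.
  have l1 := L4_mul (L _ k Iu) (L _ l Iv); have l2 := L4_mul (L _ k Iu) (L' _ l Iv).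
  have l3 := L4_mul (L _ l Iv) (L' _ k Iu); have l4 := L4_mul (L' _ k Iu) (L' _ l Iv).
  rewrite ExD//; last by apply: L1D => //; exact: L1D.
  rewrite ExD//; last exact: L1D.
  rewrite ExD// !z// !addr0 IH ?(ltnW h)// step// -[p'.+1]addn1 natrD mulrDl mul1r//.
rewrite tot//; have := tot 0%N q (leqnn q).
rewrite add0n tq0 tqq.
have e x m : incr 0 1 x m = fun w => W 1 w x ord0 m.
  by apply/funext => w; rewrite /incr (bm_start hW) [X in _ - X](_ : _ = 0) ?subr0// mxE.
have := bm_covariance hW k l Iu Iv; rewrite /cov unlock unlock => /(congr1 fine) /= ec.
have {}ec : Ex (fun w => (W 1 w u ord0 k - Ex (fun w => W 1 w u ord0 k)) *
    (W 1 w v ord0 l - Ex (fun w => W 1 w v ord0 l))) = c k l u v by exact: ec.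
rewrite !W1_mean0// in ec.
rewrite !e => eq; rewrite -mulrA; congr (_ * _).
have -> : c k l u v = q%:R * r.
  by rewrite -eq -ec; congr Ex; apply/funext => w; rewrite !subr0.
by rewrite mulrA mulVf ?mul1r// gt_eqF.
Qed.

End rational_times.

End brownian_facts.

(** * Tightness *)

Lemma sqr_ratio {R : realType} (b h z : R) : h != 0 -> b * h ^+ 2 * (z / h) ^+ 2 = b * z ^+ 2.
Proof. by move=> h0; field. Qed.

Section tightness.
Context {R : realType} {dO : measure_display} {Omega : measurableType dO}.
Variable P : probability Omega R.
Context {d : nat} {I : set R}.
Local Notation Ex := (Ex P).

(** What discretisation needs, shared by the partial sums and the Brownian motion. Time windows are
    half-open because the partial sums jump at multiples of 1/N. *)
Record tight (N : nat) (Z : R -> R -> 'I_d -> Omega -> R) (b : R) : Prop := {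
  ti_cont : forall t k w x y, 0 <= t <= 1 -> (forall u, x <= u <= y -> I u) ->
    cont_on x y (fun u => Z t u k w) ;
  ti_space : forall u v k e, I u -> I v -> `|u - v| <= 1 -> 0 < e ->
    small P [set w | exists2 t, 0 <= t <= 1 & e < `|Z t u k w - Z t v k w|]
      (b * `|u - v| ^+ 2 / e ^+ 4) ;
  ti_time : forall u k (j a : nat) e, I u -> (j <= N)%N -> 0 < e ->
    small P [set w | exists2 t, 0 <= t <= 1 /\ j%:R <= t * N%:R < (j + 2 ^ a)%:R &
        e < `|Z t u k w - Z (j%:R / N%:R) u k w|]
      (b * ((2 ^ a)%:R / N%:R) ^+ 2 / e ^+ 4) ;
  ti_moment : forall (j : nat) u k, (j <= N)%N -> I u ->
    L4 P (Z (j%:R / N%:R) u k) /\ Ex (fun w => Z (j%:R / N%:R) u k w ^+ 4) <= b }.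

Lemma small_bigU_cst (J : finType) (A : J -> set Omega) (c : R) :
  (forall i, small P (A i) c) -> small P [set w | exists i, A i w] (#|J|%:R * c).
Proof.
by move=> h; have := small_bigU h; rewrite sumr_const -[_ *+ _]mulr_natl.
Qed.

Lemma small_markov4 (f : Omega -> R) (b M : R) : 0 < M -> L4 P f ->
  Ex (fun w => f w ^+ 4) <= b -> small P [set w | M < `|f w|] (b / M ^+ 4).
Proof.
move=> M0 [mf Lf] Ef; have p4 w : 0 <= f w ^+ 4 by rewrite exprn_even_ge0.
have h := Pr_markov (exprn_gt0 4 M0) p4 Lf.
exists [set w | M ^+ 4 < f w ^+ 4]; split.
- rewrite (_ : [set w | _] = (fun w => f w ^+ 4) @^-1` `]M ^+ 4, +oo[).
    by rewrite -[X in measurable X]setTI; apply: (L1_mf Lf).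
  by apply/seteqP; split => w /=; rewrite in_itv/= andbT.
- by rewrite (le_trans h)// ler_pM2r// invr_gt0 exprn_gt0.
- by move=> w /= h'; rewrite -[ltRHS]ger0_norm// normrX ltr_pXn2r// nnegrE ltW.
Qed.

Section discretization.
Variables (N : nat) (Z : R -> R -> 'I_d -> Omega -> R) (b : R).
Hypotheses (N0 : (0 < N)%N) (b0 : 0 <= b) (tZ : tight N Z b).
Variables (x y : R) (n K a : nat).
Hypotheses (xy : x <= y) (Ixy : forall u, x <= u <= y -> I u).
Hypothesis NK : (N < K * 2 ^ a)%N.
Hypothesis xyn : (y - x) / n.+1%:R <= 1.

Let m := (2 ^ a)%N.
Let m0 : (0 < m)%N. Proof. by rewrite expn_gt0. Qed.
Let K0 : (0 < K)%N. Proof. by move: NK; case: K. Qed.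

Definition tcell (t : R) : nat := (Num.truncn (t * N%:R) %/ m)%N.

Lemma tcell_lt t : 0 <= t <= 1 -> (tcell t < K)%N.
Proof.
move=> /andP[t0 t1]; rewrite ltn_divLR// (leq_ltn_trans _ NK)//.
rewrite -(@ler_nat R) (@le_trans _ _ (t * N%:R))//; last by rewrite ler_piMl.
by rewrite truncn_le mulr_ge0.
Qed.

Lemma tcell_itv (t : R) : 0 <= t -> (tcell t * m)%:R <= t * N%:R < (tcell t * m + m)%:R.
Proof.
move=> t0; have tN : 0 <= t * N%:R by rewrite mulr_ge0.
have /andP[h1 h2] := truncn_itv tN; apply/andP; split.
  by rewrite (le_trans _ h1)// ler_nat leq_divM.
rewrite (lt_le_trans h2)// ler_nat -mulSnr ltn_ceil//.
Qed.

(** Piecewise constant in time and space, zero off the core; in the first branch the defaults of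
    [insubd] and [inord] are not reached. *)
Definition rec (z : 'I_K * 'I_n.+2 * 'I_d -> R) (p : R * R) : 'rV[R]_d :=
  \row_k (if pselect (0 <= p.1 <= 1 /\ x <= p.2 <= y) is left _ then
    z (insubd (Ordinal K0) (tcell p.1), inord (cell x y n p.2), k) else 0).

Lemma rec_lip (z z' : 'I_K * 'I_n.+2 * 'I_d -> R) (e : R) : 0 <= e ->
  (forall i, `|z i - z' i| <= e) -> forall p, `|rec z p - rec z' p| <= e.
Proof.
move=> e0 h p; apply: rV_norm_le => // i; rewrite !mxE.
by case: pselect => _ //; rewrite subrr normr0.
Qed.

(** A time cell that starts beyond N is met by no t <= 1, and its variable is set to 0. *)
Definition gridval (w : Omega) (i : 'I_K * 'I_n.+2 * 'I_d) : R :=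
  if (i.1.1 * m <= N)%N then Z ((i.1.1 * m)%:R / N%:R) (grid x y n i.1.2) i.2 w else 0.

Lemma grid_in (g : 'I_n.+2) : I (grid x y n g).
Proof.
apply: Ixy; rewrite /grid lerDl mulr_ge0 ?subr_ge0 ?divr_ge0//= -lerBrDl.
by rewrite ler_piMr ?subr_ge0// ler_pdivrMr// mul1r ler_nat -ltnS.
Qed.

Lemma gridval_mvec : mvec gridval.
Proof.
move=> i; rewrite /gridval; case: (boolP (i.1.1 * m <= N)%N) => h; last exact: measurable_cst.
by have [[]] := ti_moment tZ i.2 h (grid_in i.1.2).
Qed.

Let cellP u : x <= u <= y -> [/\ (cell x y n u <= n.+1)%N, x <= grid x y n (cell x y n u) <= u &
    u - grid x y n (cell x y n u) <= (y - x) / n.+1%:R].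
Proof. exact: grid_cell. Qed.

Lemma space_small (g : 'I_n.+2) k (e : R) : 0 < e ->
  small P [set w | exists t u, [/\ 0 <= t <= 1, x <= u <= y, cell x y n u = g &
      e < `|Z t u k w - Z t (grid x y n g) k w|]]
    (@Kch R * (b * ((y - x) / n.+1%:R) ^+ 2 / e ^+ 4)).
Proof.
move=> e0; set h := (y - x) / n.+1%:R.
have Kb : 0 <= @Kch R * (b * h ^+ 2 / e ^+ 4).
  have K0' := ltW (@Kch_gt0 R); apply: mulr_ge0 => //; apply: divr_ge0; last by rewrite exprn_ge0// ltW.
  by rewrite mulr_ge0// sqr_ge0.
have nogap u t w : u = grid x y n g -> ~ e < `|Z t u k w - Z t (grid x y n g) k w|.
  by move=> ->; rewrite subrr normr0 ltNge (ltW e0).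
(* The last grid point is [y], the only point of its cell. *)
have [gn|gn] := ltnP g n.+1; last first.
  apply: small_sub (small0 P Kb) => // w [t [u [_ ui ug]]]; apply: nogap.
  have [_ /andP[_ gu] _] := cellP ui; have /andP[_ uy] := ui.
  have gE : nat_of_ord g = n.+1 by apply/eqP; rewrite eqn_leq gn -ltnS ltn_ord.
  have gy : grid x y n g = y by rewrite gE /grid divff ?gt_eqF// mulr1 addrC subrK.
  by apply/eqP; rewrite eq_le -{2}ug gu gy uy.
have [xy'|yx] := ltP x y; last first.
  apply: small_sub (small0 P Kb) => // w [t [u [_ ui ug]]]; apply: nogap.
  have [_ /andP[xg gu] _] := cellP ui; have /andP[_ uy] := ui.
  by apply/eqP; rewrite eq_le -ug gu andbT (le_trans uy)// (le_trans yx).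
have h0 : 0 < h by rewrite divr_gt0// subr_gt0.
have cI u : grid x y n g <= u <= grid x y n g + h -> I u.
  move=> /andP[u1 u2]; apply: Ixy; rewrite (le_trans _ u1) ?(le_trans u2)//.
    have -> : grid x y n g + h = x + (y - x) * (g.+1%:R / n.+1%:R).
      by rewrite /grid /h -[g.+1%:R]natr1; ring.
    by rewrite -lerBrDl ler_piMr ?subr_ge0// ler_pdivrMr// mul1r ler_nat.
  by rewrite /grid lerDl mulr_ge0 ?subr_ge0// divr_ge0.
have B0 : 0 <= b * h ^+ 2 by rewrite mulr_ge0// sqr_ge0.
have := @continuous_chaining R _ _ P {t : R | 0 <= t <= 1} (fun t u w => Z (sval t) u k w) (grid x y n g) h (b * h ^+ 2) e h0 B0 e0.
move=> H; apply: small_sub (H _ _) => //.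
- move=> w [t [u [t01 ui ug eZ]]]; exists (exist _ t t01), u; split => //=.
  have [_ h1 h2] := cellP ui; rewrite -ug; case/andP: h1 => _ -> /=.
  by rewrite -lerBlDl.
- by move=> [t t01] w /=; apply: (ti_cont tZ).
- move=> u v e' ui vi e'0; have uvh : `|u - v| <= h.
    by rewrite ler_norml; move: ui vi => /andP[u1 u2] /andP[v1 v2]; lra.
  apply: small_sub (ti_space tZ k (cI u ui) (cI v vi) (le_trans uvh xyn) e'0).
    by move=> w [[t t01] /= h']; exists t.
  by rewrite (sqr_ratio b `|u - v| (lt0r_neq0 h0)) lexx.
Qed.

Lemma time_small (i : 'I_K * 'I_n.+2 * 'I_d) (e : R) : 0 < e ->
  small P [set w | exists t, [/\ 0 <= t <= 1, tcell t = i.1.1 &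
      e < `|Z t (grid x y n i.1.2) i.2 w - gridval w i|]] (b * (m%:R / N%:R) ^+ 2 / e ^+ 4).
Proof.
move=> e0; have [jN|Nj] := leqP (i.1.1 * m) N; last first.
  have c0 : 0 <= b * (m%:R / N%:R) ^+ 2 / e ^+ 4.
    by apply: divr_ge0; rewrite ?exprn_ge0 ?(ltW e0)// mulr_ge0 ?sqr_ge0.
  apply: (small_sub _ (lexx _) (small0 P c0)) => w [t [t01 ti _]].
  have [t0 t1] := andP t01; have := tcell_itv t0; rewrite ti => /andP[h _].
  have : (i.1.1 * m)%:R <= N%:R :> R by rewrite (le_trans h)// ler_piMl.
  by rewrite ler_nat leqNgt Nj.
apply: small_sub (ti_time tZ i.2 a (grid_in i.1.2) jN e0) => // w [t [t01 ti]].
rewrite /gridval jN => h; exists t => //; split => //.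
by have [t0 _] := andP t01; have := tcell_itv t0; rewrite ti natrD.
Qed.

Lemma moment_small (i : 'I_K * 'I_n.+2 * 'I_d) (M : R) : 0 < M ->
  small P [set w | M < `|gridval w i|] (b / M ^+ 4).
Proof.
move=> M0; rewrite /gridval; have [jN|Nj] := boolP (i.1.1 * m <= N)%N; last first.
  have c0 : 0 <= b / M ^+ 4 by rewrite divr_ge0// exprn_ge0// ltW.
  apply: (small_sub _ (lexx _) (small0 P c0)) => w /=.
  by rewrite normr0 ltNge (ltW M0).
by have [h1 h2] := ti_moment tZ i.2 jN (grid_in i.1.2); exact: small_markov4.
Qed.

Lemma discretized_of_tight (Y : Omega -> Linf (`[0, 1]%classic `*` I) 'rV[R]_d) (tau e M : R) :
  0 < e -> 0 < M -> measurable_fun setT (Y : Omega -> borel (Linf (`[0, 1]%classic `*` I) 'rV[R]_d)) ->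
  (forall w t u k, 0 <= t <= 1 -> I u -> Y w (t, u) ord0 k = Z t u k w) ->
  small P [set w | exists t u k, [/\ 0 <= t <= 1, I u, ~ (x <= u <= y) & e < `|Z t u k w|]] tau ->
  (n.+2 * d)%:R * (@Kch R * (b * ((y - x) / n.+1%:R) ^+ 2 / (e / 2) ^+ 4)) +
  (K * n.+2 * d)%:R * (b * (m%:R / N%:R) ^+ 2 / (e / 2) ^+ 4) +
  (K * n.+2 * d)%:R * (b / M ^+ 4) + tau <= e ->
  discretized rec P Y gridval M e.
Proof.
move=> e0 M0 mY YZ stau he; have e20 : 0 < e / 2 by rewrite divr_gt0.
split => //; first exact: gridval_mvec.
have s1 := small_bigU_cst (fun i : 'I_n.+2 * 'I_d => space_small i.1 i.2 e20).
have s2 := small_bigU_cst (fun i : 'I_K * 'I_n.+2 * 'I_d => time_small i e20).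
have s3 := small_bigU_cst (fun i : 'I_K * 'I_n.+2 * 'I_d => moment_small i M0).
rewrite card_prod !card_ord in s1; rewrite !card_prod !card_ord in s2; rewrite !card_prod !card_ord in s3.
have [B [mB PB sB]] := smallU (smallU (smallU s1 s2) s3) stau.
exists B; first by split => //; exact: le_trans PB he.
move=> w nB; have nb : ~ ([set w | exists t u k, [/\ 0 <= t <= 1, I u, ~ (x <= u <= y) & e < `|Z t u k w|]] w).
  by move=> h; apply: nB; apply: sB; right.
have n3 i : `|gridval w i| <= M.
  by rewrite leNgt; apply/negP => h; apply: nB; apply: sB; left; right; exists i.
split => // -[t u] [/= t01 Iu]; rewrite in_itv/= in t01.
apply: rV_norm_le; first exact: ltW.
move=> k; rewrite !mxE YZ//=.
case: pselect => [[_ ui]|nui]; last first.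
  rewrite subr0 leNgt; apply/negP => h; apply: nb; exists t, u, k; split => // ui.
  by apply: nui.
have [cn cg _] := cellP ui; set g := inord _.
have gE : cell x y n u = g by rewrite /g inordK.
have kE : nat_of_ord (insubd (Ordinal K0) (tcell t)) = tcell t by rewrite val_insubd tcell_lt.
set kap := insubd _ _ in kE *.
have n1' : `|Z t u k w - Z t (grid x y n g) k w| <= e / 2.
  rewrite leNgt; apply/negP => h; apply: nB; apply: sB; left; left; left.
  by exists (g, k), t, u.
have n2' : `|Z t (grid x y n g) k w - gridval w (kap, g, k)| <= e / 2.
  rewrite leNgt; apply/negP => h; apply: nB; apply: sB; left; left; right.
  by exists (kap, g, k), t; split => //=.
rewrite -(subrKA (Z t (grid x y n g) k w)) (le_trans (ler_normD _ _))// (_ : e = e / 2 + e / 2) ?lerD//.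
exact: splitr.
Qed.

End discretization.
End tightness.

Lemma minn_step (x y m q : nat) : (minn (x + (m + y)) q - minn (x + y) q <= m)%N.
Proof. lia. Qed.

Lemma slack4 {R : realType} (K x r e : R) : 0 <= K -> 0 <= e ->
  K * (x ^+ 2 * r ^+ 2 / e) <= K * (x ^+ 2 * 4) * r ^+ 2 / e.
Proof.
move=> K0 e0; rewrite (_ : K * (x ^+ 2 * 4) * r ^+ 2 / e = K * (x ^+ 2 * r ^+ 2 / e) * 4); last by ring.
by rewrite ler_peMr ?ler1n// mulr_ge0// divr_ge0// mulr_ge0 ?sqr_ge0.
Qed.

Lemma min1_lip {R : realType} (u v : R) : `|Num.min u 1 - Num.min v 1| <= `|u - v|.
Proof.
wlog uv : u v / u <= v.
  by move=> H; have [/H//|/ltW/H] := leP u v; rewrite distrC [leRHS]distrC.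
rewrite [leRHS]ler0_norm ?subr_le0// ler0_norm ?subr_le0.
  by case: (leP u 1) => u1; case: (leP v 1) => v1; lra.
by case: (leP u 1) => u1; case: (leP v 1) => v1; lra.
Qed.

(** * Chaining in time for continuous paths *)

Section path_chaining.
Context {R : realType} {dO : measure_display} {Omega : measurableType dO}.
Variable P : probability Omega R.
Local Notation Ex := (Ex P).

(** Dyadic subdivision of a window starting at j/N meets only rational times, at which moments are
    available. The window may reach beyond 1, so the path is frozen there by [Num.min t 1]. *)
Lemma rational_time_chaining (V : R -> Omega -> R) (b : R) (N m j : nat) (e : R) :
  (0 < N)%N -> (0 < m)%N -> (j <= N)%N -> 0 <= b -> 0 < e ->
  (forall w, cont_on 0 1 (fun t => V t w)) ->
  (forall q i l, (0 < q)%N -> (i <= l <= q)%N -> L4 P (fun w => V (l%:R / q%:R) w - V (i%:R / q%:R) w) /\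
    Ex (fun w => (V (l%:R / q%:R) w - V (i%:R / q%:R) w) ^+ 4) <= (b * ((l - i)%:R / q%:R)) ^+ 2) ->
  small P [set w | exists2 t, 0 <= t <= 1 /\ j%:R <= t * N%:R < (j + m)%:R &
        e < `|V t w - V (j%:R / N%:R) w|] (@Kch R * (b ^+ 2 * (m%:R / N%:R) ^+ 2 / e ^+ 4)).
Proof.
move=> N0 m0 jN b0 e0 cV HV.
have NR : 0 < N%:R :> R by rewrite ltr0n.
have mR : 0 < m%:R :> R by rewrite ltr0n.
pose Z (_ : unit) (t : R) w := V (Num.min t 1) w.
have u01 : 0 <= (j%:R / N%:R : R) <= 1.
  by apply/andP; split; [rewrite divr_ge0|rewrite ler_pdivrMr// mul1r ler_nat].
have h0 : 0 < m%:R / N%:R :> R by rewrite divr_gt0.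
have B0 : 0 <= b ^+ 2 * (m%:R / N%:R) ^+ 2 by rewrite mulr_ge0 ?sqr_ge0.
have := @dyadic_chaining R _ _ P unit Z (j%:R / N%:R) (m%:R / N%:R) _ e h0 B0 e0.
move=> H; apply: small_sub (H _ _) => //.
- move=> w [t [t01 /andP[t1 t2]] et]; exists tt, t; split.
    rewrite ler_pdivrMr// t1 -mulrDl -natrD ler_pdivlMr// ltW//.
  by rewrite /Z !min_l//; [case/andP: u01|case/andP: t01].
- move=> [] w u e' ui e'0; rewrite /Z.
  have [u0 u1] := andP ui; have j0 : 0 <= j%:R / N%:R :> R by rewrite divr_ge0.
  have i01 (t : R) : j%:R / N%:R <= t -> 0 <= Num.min t 1 <= 1.
    by move=> jt; rewrite le_min ge_min lexx orbT ler01 (le_trans j0 jt).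
  have [dl dl0 h] := cV w (Num.min u 1) e' (i01 u u0) e'0; exists dl => // v /andP[v0 _] uv.
  apply: h; first exact: i01.
  by apply: le_lt_trans uv; exact: min1_lip.
- move=> r i e' ir e'0; pose q := (N * 2 ^ r)%N.
  have q0 : (0 < q)%N by rewrite muln_gt0 N0 expn_gt0.
  have rR : 0 < (2 ^ r)%:R :> R by rewrite ltr0n expn_gt0.
  pose pt l := (j * 2 ^ r + m * l)%N.
  have ptE l : Num.min (j%:R / N%:R + m%:R / N%:R * (l%:R / (2 ^ r)%:R)) 1 = (minn (pt l) q)%:R / q%:R :> R.
    have -> : j%:R / N%:R + m%:R / N%:R * (l%:R / (2 ^ r)%:R) = (pt l)%:R / q%:R :> R.
      by rewrite /pt /q natrD !natrM; field; rewrite !gt_eqF.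
    have qR : 0 < q%:R :> R by rewrite ltr0n.
    rewrite /Order.min ltr_pdivrMr// mul1r ltr_nat /minn.
    by case: ltnP => // _; rewrite divff// gt_eqF.
  set i1 := minn (pt i) q; set i2 := minn (pt i.+1) q.
  have i12 : (i1 <= i2 <= q)%N.
    rewrite /i2 geq_minr andbT /i1 leq_min geq_minr andbT geq_min /pt.
    by rewrite leq_add2l leq_mul2l leqnSn orbT.
  have [L E] := HV q i1 i2 q0 i12.
  apply: small_sub (small_markov4 e'0 L E); first by move=> w [[]]; rewrite /Z !ptE.
  rewrite ler_pM2r ?invr_gt0 ?exprn_gt0// !exprMn -mulrA ler_wpM2l ?sqr_ge0//.
  rewrite -!exprMn ler_pXn2r ?nnegrE//.
  rewrite (_ : m%:R / N%:R / (2 ^ r)%:R = m%:R / q%:R); last by rewrite /q natrM; field; rewrite !gt_eqF.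
  rewrite ler_pM2r ?invr_gt0 ?ltr0n// ler_nat /i1 /i2 /pt mulnS.
  exact: minn_step.
Qed.

End path_chaining.

Section brownian_tight.
Context {R : realType} {dO : measure_display} {Omega : measurableType dO}.
Variable P : probability Omega R.
Context {d : nat} {I : set R}.
Variables (W : R -> Omega -> C0 I 'rV[R]_d) (c : 'I_d -> 'I_d -> R -> R -> R).
Hypotheses (dI : domain I) (hW : brownian_motion P c W).
Local Notation Ex := (Ex P).

(** c is an actual covariance, by [incr_cov]; this is the symmetry that the one-sided series lacks a
    priori. *)
Lemma bm_sym k l u v : I u -> I v -> c k l u v = c l k v u.
Proof.
move=> Iu Iv; have := incr_cov dI hW (erefl : (0 < 1)%N) l k (leqnn (0 + 1)) Iv Iu.
have := incr_cov dI hW (erefl : (0 < 1)%N) k l (leqnn (0 + 1)) Iu Iv.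
rewrite divr1 !mul1r => <- <-; congr Ex; apply/funext => w; exact: mulrC.
Qed.

(** Its square dominates [Kn], so that fourth moments are bounded by squares. *)
Definition Kw : R := 8 * (2 + 60 * 32 + 58 * 32).

Lemma Kn_le : @Kn R <= Kw ^+ 2.
Proof.
rewrite /Kn /Kw; set x : R := 2 + 60 * 32; set y : R := 32.
have x0 : 0 <= x by rewrite addr_ge0// mulr_ge0.
have y0 : 0 <= y by [].
have := mulr_ge0 x0 y0; have := sqr_ge0 x; have := sqr_ge0 y.
rewrite exprMn sqrrD; lra.
Qed.

Lemma Kw_gt0 : 0 < Kw.
Proof. by rewrite mulr_gt0// !addr_gt0// mulr_gt0. Qed.

Lemma bm_diag k u : I u -> 0 <= c k k u u.
Proof.
move=> Iu; have := incr_cov dI hW (erefl : (0 < 1)%N) k k (leqnn (0 + 1)) Iu Iu.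
by rewrite divr1 mul1r => <-; apply: Ex_ge0 => w; rewrite -expr2 sqr_ge0.
Qed.

Let fourth_le (x y b r : R) : x <= @Kn R * y ^+ 2 -> 0 <= y -> y <= r * b -> x <= (Kw * b * r) ^+ 2.
Proof.
move=> h y0 yb; rewrite (le_trans h)// (_ : Kw * b * r = Kw * (r * b)); last by ring.
rewrite exprMn ler_pM ?sqr_ge0//; last by rewrite ler_pXn2r ?nnegrE// (le_trans y0).
  by rewrite mulr_ge0// addr_ge0 ?mulr_ge0 ?sqr_ge0.
exact: Kn_le.
Qed.

Lemma bm_fourth q i j u k (b : R) : (0 < q)%N -> (i <= j <= q)%N -> I u -> c k k u u <= b ->
  L4 P (incr W (tq q i) (tq q j) u k) /\
  Ex (fun w => incr W (tq q i) (tq q j) u k w ^+ 4) <= (Kw * b * ((j - i)%:R / q%:R)) ^+ 2.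
Proof.
move=> q0 ijq Iu cb; have [ij jq] := andP ijq.
have i01 := tq01 q0 (leq_trans ij jq) : 0 <= (tq q i : R) <= 1.
have j01 := tq01 q0 jq : 0 <= (tq q j : R) <= 1.
have ij01 : 0 <= (tq q i : R) <= tq q j by rewrite tq_le// andbT; case/andP: i01.
have [L E] := incr_moments hW k ij01 (proj2 (andP j01)) Iu; split => //.
apply: fourth_le E _ _ => //; first by apply: Ex_ge0 => w; exact: sqr_ge0.
have ipq : (i + (j - i) <= q)%N by rewrite subnKC.
have := incr_cov dI hW q0 k k ipq Iu Iu; rewrite subnKC// => h.
rewrite (_ : (fun w => _) = (fun w => incr W (tq q i) (tq q j) u k w * incr W (tq q i) (tq q j) u k w)); last first.
  by apply/funext => w; exact: expr2.
by rewrite h ler_wpM2l// divr_ge0.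
Qed.

Lemma bm_fourth_diff q i j u v k (b : R) : (0 < q)%N -> (i <= j <= q)%N -> I u -> I v ->
  c k k u u - c k k u v - c k k v u + c k k v v <= b ->
  L4 P (fun w => incr W (tq q i) (tq q j) u k w - incr W (tq q i) (tq q j) v k w) /\
  Ex (fun w => (incr W (tq q i) (tq q j) u k w - incr W (tq q i) (tq q j) v k w) ^+ 4) <=
    (Kw * b * ((j - i)%:R / q%:R)) ^+ 2.
Proof.
move=> q0 ijq Iu Iv cb; have [ij jq] := andP ijq.
have i01 := tq01 q0 (leq_trans ij jq) : 0 <= (tq q i : R) <= 1.
have j01 := tq01 q0 jq : 0 <= (tq q j : R) <= 1.
have ij01 : 0 <= (tq q i : R) <= tq q j by rewrite tq_le// andbT; case/andP: i01.
have [Lu _] := incr_moments hW k ij01 (proj2 (andP j01)) Iu.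
have [Lv _] := incr_moments hW k ij01 (proj2 (andP j01)) Iv.
split.
  have -> : (fun w => incr W (tq q i) (tq q j) u k w - incr W (tq q i) (tq q j) v k w) =
      (fun w => incr W (tq q i) (tq q j) u k w + (-1) * incr W (tq q i) (tq q j) v k w).
    by apply/funext => w; rewrite mulN1r.
  by apply: L4D => //; exact: L4Z.
have E := incr_diff_moments hW k ij01 (proj2 (andP j01)) Iu Iv.
apply: fourth_le E _ _ => //; first by apply: Ex_ge0 => w; exact: sqr_ge0.
have ipq : (i + (j - i) <= q)%N by rewrite subnKC.
have huu := incr_cov dI hW q0 k k ipq Iu Iu; have huv := incr_cov dI hW q0 k k ipq Iu Iv.
have hvu := incr_cov dI hW q0 k k ipq Iv Iu; have hvv := incr_cov dI hW q0 k k ipq Iv Iv.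
rewrite subnKC// in huu huv hvu hvv.
pose U := incr W (tq q i) (tq q j) u k; pose V := incr W (tq q i) (tq q j) v k.
have -> : (fun w => (U w - V w) ^+ 2) = (fun w => U w * U w - U w * V w - V w * U w + V w * V w).
  by apply/funext => w; ring.
rewrite ExD; [|by apply: L1B; [apply: L1B|]; exact: L4_mul|exact: L4_mul].
rewrite ExB; [|by apply: L1B; exact: L4_mul|exact: L4_mul].
rewrite ExB; [|exact: L4_mul|exact: L4_mul].
rewrite huu huv hvu hvv -!mulrBr -mulrDr ler_wpM2l// divr_ge0//.
Qed.

Lemma bm_time_cont w u k : cont_on 0 1 (fun t => W t w u ord0 k).
Proof.
move=> t e t01 e0; have := @cont_in_within _ _ `[0, 1]%classic 0 1 (fun x => W x w) _ (bm_continuous hW (w := w)).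
move=> /(_ _ t e t01 e0)[|dl dl0 h]; first by move=> x; rewrite /= in_itv.
exists dl => // v v01 tv; apply: le_lt_trans (h v v01 tv).
have := rV_coord_le (W t w u - W v w u) k; rewrite !mxE => /le_trans; apply.
by rewrite -C0_subE C0_ub.
Qed.

Variable B : R.
Hypothesis B0 : 0 < B.
Hypothesis cB : forall k u, I u -> c k k u u <= B.
Hypothesis cD : forall k u v, I u -> I v -> `|u - v| <= 1 ->
  c k k u u - c k k u v - c k k v u + c k k v v <= B * `|u - v|.

Let incr_L u k q i l w : incr W (tq q i) (tq q l) u k w = W (l%:R / q%:R) w u ord0 k - W (i%:R / q%:R) w u ord0 k.
Proof. by []. Qed.

Lemma bm_small_time u k (b e : R) (N m j : nat) : (0 < N)%N -> (0 < m)%N -> (j <= N)%N -> 0 < e ->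
  I u -> c k k u u <= b ->
  small P [set w | exists2 t, 0 <= t <= 1 /\ j%:R <= t * N%:R < (j + m)%:R &
        e < `|W t w u ord0 k - W (j%:R / N%:R) w u ord0 k|]
    (@Kch R * ((Kw * b) ^+ 2 * (m%:R / N%:R) ^+ 2 / e ^+ 4)).
Proof.
move=> N0 m0 jN e0 Iu cb; have b0 : 0 <= b := le_trans (bm_diag k Iu) cb.
apply: (@rational_time_chaining _ _ _ P (fun t w => W t w u ord0 k)) => //.
- by rewrite mulr_ge0// ltW// Kw_gt0.
- by move=> w; exact: bm_time_cont.
- by move=> q i l q0 ilq; exact: bm_fourth.
Qed.

(** One window of length 2, since a half-open one of length 1 would miss t = 1; this is the factor
    4. *)
Lemma bm_small u k (b e : R) : 0 < e -> I u -> c k k u u <= b ->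
  small P [set w | exists2 t, 0 <= t <= 1 & e < `|W t w u ord0 k|]
    (@Kch R * ((Kw * b) ^+ 2 * 4 / e ^+ 4)).
Proof.
move=> e0 Iu cb; have := bm_small_time (erefl : (0 < 1)%N) (erefl : (0 < 2)%N) (leq0n 1) e0 Iu cb.
rewrite (_ : (2%:R / 1%:R) ^+ 2 = 4 :> R); last by rewrite divr1 expr2 -natrM.
apply: small_sub => // w [t t01 h]; exists t; first split => //.
  by rewrite mulr1 add0n; case/andP: t01 => -> t1; rewrite (le_lt_trans t1)// ltr1n.
by rewrite mul0r (bm_start hW) [X in _ - X](_ : _ = 0) ?subr0// mxE.
Qed.

(** For the space clause, time chaining is applied to the difference of the motions at u and v,
    whose variance at time 1 is at most B |u - v|. *)
Lemma bm_tight N : (0 < N)%N ->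
  tight (I := I) P N (fun t u k w => W t w u ord0 k) (@Kch R * ((Kw * B) ^+ 2 * 4)).
Proof.
move=> N0; have KB : 0 < Kw * B by rewrite mulr_gt0// Kw_gt0.
have K0 := @Kch_gt0 R.
split.
- move=> t k w x y t01 Ixy u e ui e0.
  have [dl dl0 h] := C0_cont_in (W t w) Ixy ui e0; exists dl => // v vi uv.
  apply: le_lt_trans (h v vi uv).
  by have := rV_coord_le (W t w u - W t w v) k; rewrite !mxE.
- move=> u v k e Iu Iv uv e0.
  have := @rational_time_chaining _ _ _ P (fun t w => W t w u ord0 k - W t w v ord0 k)
    (Kw * (B * `|u - v|)) 1 2 0 e.
  rewrite (_ : (2%:R / 1%:R) ^+ 2 = 4 :> R); last by rewrite divr1 expr2 -natrM.
  move=> H; apply: small_sub (H _ _ _ _ e0 _ _) => //.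
  + move=> w [t t01 h]; exists t; first split => //.
      by rewrite mulr1 add0n; case/andP: t01 => -> t1; rewrite (le_lt_trans t1)// ltr1n.
    rewrite mul0r (bm_start hW) (_ : (0 : C0 I 'rV[R]_d) u ord0 k = 0) ?mxE//.
    by rewrite subrr subr0.
  + rewrite le_eqVlt; apply/orP; left; apply/eqP; ring.
  + by rewrite mulr_ge0 ?(ltW Kw_gt0)// mulr_ge0// ltW.
  + move=> w t s t01 s0; have [d1 d10 h1] := bm_time_cont w u k t01 (divr_gt0 s0 (ltr0n R 2)).
    have [d2 d20 h2] := bm_time_cont w v k t01 (divr_gt0 s0 (ltr0n R 2)).
    exists (Num.min d1 d2); first by rewrite lt_min d10 d20.
    move=> t' t'01; rewrite lt_min => /andP[/(h1 _ t'01) l1 /(h2 _ t'01) l2].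
    move: l1 l2; set x1 := W t w u _ _; set x2 := W t' w u _ _; set x3 := W t w v _ _; set x4 := W t' w v _ _.
    move=> l1 l2; rewrite (_ : _ - _ = (x1 - x2) - (x3 - x4)); last by ring.
    by rewrite (le_lt_trans (ler_normB _ _))// (splitr s) ltrD.
  + move=> q i l q0 ilq; have [L E] := bm_fourth_diff (k := k) q0 ilq Iu Iv (cD k Iu Iv uv).
    have e' w : W (l%:R / q%:R) w u ord0 k - W (l%:R / q%:R) w v ord0 k -
        (W (i%:R / q%:R) w u ord0 k - W (i%:R / q%:R) w v ord0 k) =
        incr W (tq q i) (tq q l) u k w - incr W (tq q i) (tq q l) v k w.
      by rewrite !incr_L; ring.
    by rewrite (eq_fun e') (eq_fun (fun w => congr1 (fun x => x ^+ 4) (e' w))).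
- move=> u k j a e Iu jN e0; have a0 : (0 < 2 ^ a)%N by rewrite expn_gt0.
  apply: small_sub (bm_small_time N0 a0 jN e0 Iu (cB k Iu)) => //.
  by apply: slack4; rewrite ?ltW// exprn_gt0.
- move=> j u k jN Iu; have [L E] := bm_fourth N0 (jN : (0 <= j <= N)%N) Iu (cB k Iu).
  have e w : incr W (tq N 0) (tq N j) u k w = W (j%:R / N%:R) w u ord0 k.
    by rewrite /incr tq0 (bm_start hW) [X in _ - X](_ : _ = 0) ?subr0// mxE.
  have ef : incr W (tq N 0) (tq N j) u k = (fun w => W (j%:R / N%:R) w u ord0 k) by exact/funext.
  rewrite ef in L E; split => //; apply: (le_trans E); rewrite subn0 exprMn.
  apply: (@le_trans _ _ ((Kw * B) ^+ 2 * 1)).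
    rewrite ler_wpM2l ?sqr_ge0// expr_le1 ?divr_ge0//.
    by rewrite ler_pdivrMr ?ltr0n// mul1r ler_nat.
  rewrite mulrCA ler_wpM2l ?sqr_ge0// (@le_trans _ _ (@Kch R))// ?ler_peMr ?ler1n ?(ltW K0)//.
  by rewrite /Kch -[leLHS]mulr1 ler_pM// ?ler1n// exprn_ege1// ler1n.
Qed.

End brownian_tight.

Lemma slack_eq {R : realType} (K b x e : R) : K * ((b * x) ^+ 2 * 4 / e) = K * (b ^+ 2 * 4) * x ^+ 2 / e.
Proof. ring. Qed.

(** * Tightness of the partial sums *)

Section partial_sums.
Context {R : realType} {dO : measure_display} {Omega : measurableType dO}.
Variable P : probability Omega R.
Context {d : nat} {I : set R}.
Variables (Gs : nat -> set (set Omega)) (z : nat -> R -> 'I_d -> Omega -> R).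
Variables (c : 'I_d -> 'I_d -> R -> R -> R) (C1 nu B eta : R).
Hypotheses (B0 : 0 < B) (az : array P Gs I z c C1 nu B eta).
Hypothesis cz : forall i k w x y, (forall u, x <= u <= y -> I u) ->
  cont_on x y (fun u => z i.+1 u k w).
Local Notation Ex := (Ex P).

Definition psum (N : nat) (t u : R) (k : 'I_d) (w : Omega) : R :=
  (Num.sqrt N%:R)^-1 * \sum_(i < Num.truncn (t * N%:R)) z i.+1 u k w.

Lemma cont_on_sum (J : Type) (r : seq J) (f : J -> R -> R) (x y : R) :
  (forall j, cont_on x y (f j)) -> cont_on x y (fun u => \sum_(j <- r) f j u).
Proof.
move=> cf u e ui; elim: r e => [|j r IH] e e0.
  by exists 1 => // v _ _; rewrite !big_nil subrr normr0.
have e20 : 0 < e / 2 by rewrite divr_gt0.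
have [d1 d10 h1] := cf j u _ ui e20; have [d2 d20 h2] := IH _ e20.
exists (Num.min d1 d2); first by rewrite lt_min d10 d20.
move=> v vi; rewrite lt_min => /andP[/(h1 _ vi) l1 /(h2 _ vi) l2].
rewrite !big_cons opprD addrACA (le_lt_trans (ler_normD _ _))// (splitr e) ltrD//.
Qed.

Lemma cont_on_scale (a : R) (f : R -> R) (x y : R) : cont_on x y f -> cont_on x y (fun u => a * f u).
Proof.
move=> cf u e ui e0; have a0 : 0 < `|a| + 1 by rewrite ltr_wpDl.
have [dl dl0 h] := cf u _ ui (divr_gt0 e0 a0); exists dl => // v vi uv.
have := h v vi uv; rewrite ltr_pdivlMr// => h'; rewrite -mulrBr normrM mulrC.
by rewrite (le_lt_trans _ h')// ler_wpM2l// lerDl.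
Qed.

Lemma sum_split (f : nat -> R) (i j : nat) : (i <= j)%N ->
  \sum_(l < j) f l.+1 - \sum_(l < i) f l.+1 = \sum_(l < j - i) f (i + l).+1.
Proof.
move=> ij; have [p ->] : exists p, j = (i + p)%N by exists (j - i)%N; rewrite subnKC.
rewrite addKn; elim: p => [|p IH].
  by rewrite addn0 subrr big_ord0.
by rewrite addnS !big_ord_recr/= -IH addrAC.
Qed.

Lemma truncn_grid (N j : nat) : (0 < N)%N -> Num.truncn ((j%:R / N%:R : R) * N%:R) = j.
Proof. by move=> N0; rewrite divfK ?natrK// pnatr_eq0 -lt0n. Qed.

Lemma sqrtN4 (N : nat) (x : R) : (0 < N)%N -> ((Num.sqrt N%:R)^-1 * x) ^+ 4 = (N%:R^-1) ^+ 2 * x ^+ 4.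
Proof.
move=> N0; rewrite exprMn; congr (_ * _).
have h : Num.sqrt N%:R ^+ 2 = N%:R :> R by rewrite sqr_sqrtr.
by rewrite -[in RHS]h -exprVn -exprM.
Qed.

(** Discrete chaining over 2^a indices. For the space clause N < 2^a <= 2 N, and the square of the
    ratio 2^a / N is the factor 4. *)
Lemma psum_tight N : (0 < N)%N -> tight (I := I) P N (psum N) (@Kch R * (B ^+ 2 * 4)).
Proof.
move=> N0; have NR : 0 < N%:R :> R by rewrite ltr0n.
have K0 := @Kch_gt0 R.
split.
- by move=> t k w x y t01 Ixy; apply: cont_on_scale; apply: cont_on_sum => i; exact: cz.
- move=> u v k e Iu Iv uv e0; pose a := (trunc_log 2 N).+1.
  have Na : (N < 2 ^ a)%N by exact: trunc_log_ltn.
  have aN : (2 ^ a <= 2 * N)%N by rewrite expnS leq_mul2l trunc_logP.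
  have aR : 0 < (2 ^ a)%:R :> R by rewrite ltr0n expn_gt0.
  pose S n w := (Num.sqrt N%:R)^-1 * \sum_(i < n) (z i.+1 u k w - z i.+1 v k w).
  have BB : 0 <= (B * `|u - v|) ^+ 2 * 4 by rewrite mulr_ge0// sqr_ge0.
  have SE i j w : (i <= j)%N -> S j w - S i w =
      (Num.sqrt N%:R)^-1 * \sum_(l < j - i) (z (i + l).+1 u k w - z (i + l).+1 v k w).
    by move=> ij; rewrite /S -mulrBr (sum_split (fun l => z l u k w - z l v k w) ij).
  have := @discrete_chaining _ _ _ P a S _ e BB e0.
  move=> H; apply: small_sub (H _) => //.
  + move=> w [t t01]; rewrite /psum -mulrBr -sumrB => h.
    exists (Num.truncn (t * N%:R)); last by rewrite /S big_ord0 mulr0 subr0.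
    rewrite (leq_ltn_trans _ Na)// -(@ler_nat R) (@le_trans _ _ (t * N%:R))//.
      by rewrite truncn_le mulr_ge0//; case/andP: t01.
    by rewrite ler_piMl//; case/andP: t01.
  + by rewrite slack_eq.
  + move=> i j /andP[ij ja]; have -> : (fun w => S j w - S i w) =
        (fun w => (Num.sqrt N%:R)^-1 * \sum_(l < j - i) (z (i + l).+1 u k w - z (i + l).+1 v k w)).
      by apply/funext => w; exact: SE.
    have [Lu _] := ar_L4 az i (j - i) k Iu; have [Lv _] := ar_L4 az i (j - i) k Iv.
    have L : L4 P (fun w => \sum_(l < j - i) (z (i + l).+1 u k w - z (i + l).+1 v k w)).
      have -> : (fun w => \sum_(l < j - i) (z (i + l).+1 u k w - z (i + l).+1 v k w)) =
        (fun w => \sum_(l < j - i) z (i + l).+1 u k w + (-1) * \sum_(l < j - i) z (i + l).+1 v k w).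
        by apply/funext => w; rewrite sumrB mulN1r.
      by apply: L4D => //; exact: L4Z.
    split; first exact: L4Z.
    rewrite (_ : (fun w => _) = (fun w => (N%:R^-1) ^+ 2 * (\sum_(l < j - i) (z (i + l).+1 u k w - z (i + l).+1 v k w)) ^+ 4)); last first.
      by apply/funext => w; rewrite SE// sqrtN4.
    rewrite ExZ; last exact: L.2.
    apply: (@le_trans _ _ ((N%:R^-1) ^+ 2 * (B * (j - i)%:R * `|u - v|) ^+ 2)).
      by rewrite ler_wpM2l ?sqr_ge0//; exact: (ar_diff az).
    rewrite (_ : (N%:R^-1) ^+ 2 * _ = (B * `|u - v|) ^+ 2 * (((2 ^ a)%:R / N%:R) ^+ 2 * ((j - i)%:R / (2 ^ a)%:R) ^+ 2)); last first.
      by rewrite expr_div_n; field; rewrite !gt_eqF.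
    rewrite -mulrA ler_wpM2l ?sqr_ge0// ler_wpM2r ?sqr_ge0// (_ : 4 = 2 ^+ 2 :> R); last by rewrite expr2 -natrM.
    by rewrite ler_pXn2r ?nnegrE ?divr_ge0// ler_pdivrMr// -natrM ler_nat.
- move=> u k j a e Iu jN e0; have aR : 0 < (2 ^ a)%:R :> R by rewrite ltr0n expn_gt0.
  pose S n w := (Num.sqrt N%:R)^-1 * \sum_(i < n) z (j + i).+1 u k w.
  have BB : 0 <= B ^+ 2 * ((2 ^ a)%:R / N%:R) ^+ 2 by rewrite mulr_ge0 ?sqr_ge0.
  have := @discrete_chaining _ _ _ P a S _ e BB e0.
  move=> H; apply: small_sub (H _) => //.
  + move=> w [t [t01 /andP[t1 t2]]]; rewrite /psum truncn_grid// -mulrBr.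
    have tN : 0 <= t * N%:R by rewrite mulr_ge0//; case/andP: t01.
    have jt : (j <= Num.truncn (t * N%:R))%N by rewrite truncn_ge_nat.
    rewrite (sum_split (fun l => z l u k w) jt) => h.
    exists (Num.truncn (t * N%:R) - j)%N; last by rewrite /S big_ord0 mulr0 subr0.
    rewrite ltn_subLR// -(@ltr_nat R) (le_lt_trans _ t2)//.
    by rewrite truncn_le.
  + by apply: slack4; rewrite ?ltW// exprn_gt0.
  + move=> i l /andP[il la]; have SE w : S l w - S i w =
        (Num.sqrt N%:R)^-1 * \sum_(h < l - i) z (j + i + h).+1 u k w.
      rewrite /S -mulrBr; congr (_ * _).
      rewrite (eq_bigr (fun h : 'I_l => z (j + h.+1)%N u k w)); last by move=> h _; rewrite addnS.
      rewrite (eq_bigr (fun h : 'I_i => z (j + h.+1)%N u k w)); last by move=> h _; rewrite addnS.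
      rewrite (sum_split (fun h => z (j + h)%N u k w) il).
      by apply: eq_bigr => h _; rewrite addnS addnA.
    have -> : (fun w => S l w - S i w) =
        (fun w => (Num.sqrt N%:R)^-1 * \sum_(h < l - i) z (j + i + h).+1 u k w) by exact/funext.
    have [L E] := ar_L4 az (j + i) (l - i) k Iu; split; first exact: L4Z.
    rewrite (_ : (fun w => _) = (fun w => (N%:R^-1) ^+ 2 * (\sum_(h < l - i) z (j + i + h).+1 u k w) ^+ 4)); last first.
      by apply/funext => w; rewrite SE sqrtN4.
    rewrite ExZ; last exact: L.2.
    rewrite (@le_trans _ _ ((N%:R^-1) ^+ 2 * (B * (l - i)%:R) ^+ 2))//; first by rewrite ler_wpM2l ?sqr_ge0.
    rewrite le_eqVlt; apply/orP; left; apply/eqP.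
    by rewrite !expr_div_n; field; rewrite !gt_eqF.
- move=> j u k jN Iu; have [L E] := ar_L4 az 0 j k Iu.
  rewrite /psum truncn_grid//; split; first exact: L4Z.
  rewrite (_ : (fun w => _) = (fun w => (N%:R^-1) ^+ 2 * (\sum_(h < j) z (0 + h).+1 u k w) ^+ 4)); last first.
    by apply/funext => w; rewrite sqrtN4.
  rewrite ExZ; last exact: L.2.
  rewrite (@le_trans _ _ ((N%:R^-1) ^+ 2 * (B * j%:R) ^+ 2))//; first by rewrite ler_wpM2l ?sqr_ge0.
  apply: (@le_trans _ _ (B ^+ 2 * 1)).
    rewrite -exprMn mulrCA exprMn ler_wpM2l ?sqr_ge0// expr_le1 ?mulr_ge0 ?invr_ge0//.
    by rewrite mulrC ler_pdivrMr// mul1r ler_nat.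
  rewrite mulrCA ler_wpM2l ?sqr_ge0// (@le_trans _ _ (@Kch R))// ?ler_peMr ?ler1n ?(ltW K0)//.
  by rewrite /Kch -[leLHS]mulr1 ler_pM// ?ler1n// exprn_ege1// ler1n.
Qed.

End partial_sums.

(** * Comparison of block sums *)

Section block_lindeberg.
Context {R : realType} {Q : finType}.
Context {d : measure_display} {T : measurableType d} (P : probability T R).
Context {d' : measure_display} {T' : measurableType d'} (P' : probability T' R).

Lemma amgm3 (x y z : R) : 0 <= x -> 0 <= y -> 0 <= z -> 3 * (x * y * z) <= x ^+ 3 + y ^+ 3 + z ^+ 3.
Proof.
move=> x0 y0 z0; have s0 : 0 <= x + y + z by rewrite !addr_ge0.
have := mulr_ge0 s0 (sqr_ge0 (x - y)); have := mulr_ge0 s0 (sqr_ge0 (y - z)).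
have := mulr_ge0 s0 (sqr_ge0 (x - z)); nra.
Qed.

(** The power mean inequality, by expanding the cube and applying [amgm3] to each product. *)
Lemma n1_cube (y : Q -> R) : n1 y ^+ 3 <= #|Q|%:R ^+ 2 * \sum_i `|y i| ^+ 3.
Proof.
set q : R := #|Q|%:R; set S := \sum_i `|y i| ^+ 3.
have -> : n1 y ^+ 3 = \sum_i \sum_j \sum_k `|y i| * `|y j| * `|y k|.
  rewrite /n1; set s := \sum_i `|y i|.
  have ss : s * s = \sum_j \sum_k `|y j| * `|y k|.
    by rewrite {1}/s mulr_suml; apply: eq_bigr => j _; rewrite mulr_sumr.
  rewrite exprS expr2 {1}/s mulr_suml; apply: eq_bigr => i _.
  rewrite ss mulr_sumr; apply: eq_bigr => j _; rewrite mulr_sumr.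
  by apply: eq_bigr => k _; rewrite mulrA.
have c (x : R) : \sum_(i : Q) x = q * x by rewrite sumr_const -[_ *+ _]mulr_natl.
apply: (@le_trans _ _ (\sum_i \sum_j \sum_k (3^-1 * (`|y i| ^+ 3 + `|y j| ^+ 3 + `|y k| ^+ 3)))).
  apply: ler_sum => i _; apply: ler_sum => j _; apply: ler_sum => k _.
  have := amgm3 (normr_ge0 (y i)) (normr_ge0 (y j)) (normr_ge0 (y k)); lra.
have e i j : \sum_k (3^-1 * (`|y i| ^+ 3 + `|y j| ^+ 3 + `|y k| ^+ 3)) =
    3^-1 * (q * (`|y i| ^+ 3 + `|y j| ^+ 3) + S).
  by rewrite -mulr_sumr big_split/= c.
under eq_bigr => i _ do under eq_bigr => j _ do rewrite e.
have e2 i : \sum_j 3^-1 * (q * (`|y i| ^+ 3 + `|y j| ^+ 3) + S) = 3^-1 * (q ^+ 2 * `|y i| ^+ 3 + 2 * q * S).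
  rewrite -mulr_sumr big_split/= c -mulr_sumr big_split/= c -/S; congr (_ * _); ring.
under eq_bigr => i _ do rewrite e2.
rewrite -mulr_sumr big_split/= c -mulr_sumr -/S le_eqVlt; apply/orP; left; apply/eqP; by field.
Qed.

Lemma Ex_sqr_le {d0 : measure_display} {T0 : measurableType d0} (P0 : probability T0 R) (f : T0 -> R) (b : R) :
  0 <= b -> L4 P0 f -> Ex P0 (fun w => f w ^+ 4) <= b ^+ 4 -> Ex P0 (fun w => f w ^+ 2) <= b ^+ 2.
Proof.
move=> b0 Lf Ef; have m2 : measurable_fun setT (fun w => f w ^+ 2) by exact: L1_mf (L4_L2 Lf).
have e w : (f w ^+ 2) ^+ 2 = f w ^+ 4 by rewrite -exprM.
have L22 : L1 P0 (fun w => (f w ^+ 2) ^+ 2) by apply: eq_L1 Lf.2 => w; rewrite e.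
have [_] := Ex_CS m2 (@measurable_cst _ _ T0 R setT 1) L22 (L1_cst P0 (1 ^+ 2)).
rewrite (_ : (fun w => _ * cst 1 w) = (fun w => f w ^+ 2)); last by apply/funext => w; rewrite mulr1.
rewrite (Ex_cst P0 (1 ^+ 2)) expr1n mulr1 (eq_fun e) => h2.
rewrite -(@ler_pXn2r _ 2%N) ?nnegrE ?sqr_ge0//; last by apply: Ex_ge0 => w; exact: sqr_ge0.
by rewrite (le_trans h2)// (le_trans Ef)// -exprM.
Qed.

Lemma Ex_norm_sqr {d0 : measure_display} {T0 : measurableType d0} (P0 : probability T0 R) (f : T0 -> R) (b : R) :
  0 <= b -> L4 P0 f -> Ex P0 (fun w => f w ^+ 2) <= b ^+ 2 -> Ex P0 (fun w => `|f w|) <= b.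
Proof.
move=> b0 Lf Ef; have mf : measurable_fun setT (fun w => `|f w|) by apply: measurableT_comp => //; exact: Lf.1.
have e w : `|f w| ^+ 2 = f w ^+ 2 by rewrite real_normK// num_real.
have L22 : L1 P0 (fun w => `|f w| ^+ 2) by apply: eq_L1 (L4_L2 Lf) => w; rewrite e.
have [_] := Ex_CS mf (@measurable_cst _ _ T0 R setT 1) L22 (L1_cst P0 (1 ^+ 2)).
rewrite (_ : (fun w => _ * cst 1 w) = (fun w => `|f w|)); last by apply/funext => w; rewrite mulr1.
rewrite (Ex_cst P0 (1 ^+ 2)) expr1n mulr1 (eq_fun e) => h2.
rewrite -(@ler_pXn2r _ 2%N) ?nnegrE//; first exact: le_trans h2 Ef.
exact: Ex_ge0.
Qed.

(** The third absolute moments lie between the second and the fourth: |y|^3 <= (b y^2 + y^4 / b) /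
    2. *)
Lemma Ex_n1_cube {d0 : measure_display} {T0 : measurableType d0} (P0 : probability T0 R) (Y : T0 -> Q -> R) (b : R) :
  0 < b -> (forall i, L4 P0 (fun w => Y w i)) -> (forall i, Ex P0 (fun w => Y w i ^+ 4) <= b ^+ 4) ->
  L1 P0 (fun w => n1 (Y w) ^+ 3) /\ Ex P0 (fun w => n1 (Y w) ^+ 3) <= (#|Q|%:R * b) ^+ 3.
Proof.
move=> b0 LY EY.
have cube (y : R) : `|y| ^+ 3 <= b / 2 * y ^+ 2 + b^-1 / 2 * y ^+ 4.
  rewrite -(ler_pM2l b0) (_ : b * (_ + _) = (b ^+ 2 * y ^+ 2 + y ^+ 4) / 2); last by field; rewrite gt_eqF.
  have -> : y ^+ 2 = `|y| ^+ 2 by rewrite real_normK ?num_real.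
  have -> : y ^+ 4 = `|y| ^+ 4 by rewrite -normrX ger0_norm// exprn_even_ge0.
  have := mulr_ge0 (sqr_ge0 `|y|) (sqr_ge0 (b - `|y|)); nra.
have my i : measurable_fun setT (fun w => `|Y w i| ^+ 3).
  by apply: measurable_funX; apply: measurableT_comp => //; exact: (LY i).1.
have LR i : L1 P0 (fun w => b / 2 * Y w i ^+ 2 + b^-1 / 2 * Y w i ^+ 4).
  by apply: L1D; apply: L1Z; [exact: L4_L2|exact: (LY i).2].
have L3 i : L1 P0 (fun w => `|Y w i| ^+ 3).
  by apply: L1_dom (LR i) => // w; rewrite ger0_norm ?exprn_ge0.
have E3 i : Ex P0 (fun w => `|Y w i| ^+ 3) <= b ^+ 3.
  apply: (le_trans (Ex_le (L3 i) (LR i) (fun w => cube (Y w i)))).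
  rewrite ExD ?ExZ//; [|exact: (LY i).2|exact: L4_L2|apply: L1Z; exact: L4_L2|apply: L1Z; exact: (LY i).2].
  have h2 := Ex_sqr_le (ltW b0) (LY i) (EY i).
  have : b / 2 * Ex P0 (fun w => Y w i ^+ 2) <= b / 2 * b ^+ 2 by rewrite ler_wpM2l// divr_ge0// ltW.
  have : b^-1 / 2 * Ex P0 (fun w => Y w i ^+ 4) <= b^-1 / 2 * b ^+ 4.
    by rewrite ler_wpM2l// divr_ge0// invr_ge0 ltW.
  have -> : b^-1 / 2 * b ^+ 4 = b ^+ 3 / 2 by field; rewrite gt_eqF.
  have -> : b / 2 * b ^+ 2 = b ^+ 3 / 2 by field.
  lra.
have Lq : L1 P0 (fun w => #|Q|%:R ^+ 2 * \sum_i `|Y w i| ^+ 3) by apply: L1Z; exact: L1_sum.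
have L : L1 P0 (fun w => n1 (Y w) ^+ 3).
  apply: L1_dom Lq; first by apply: measurable_funX; apply: measurable_n1 => i; exact: (LY i).1.
  by move=> w; rewrite ger0_norm ?n1_cube// exprn_ge0// n1_ge0.
split => //; apply: (le_trans (Ex_le L Lq (fun w => n1_cube (Y w)))).
rewrite ExZ ?Ex_sum//; last exact: L1_sum.
apply: (@le_trans _ _ (#|Q|%:R ^+ 2 * \sum_(i : Q) b ^+ 3)).
  by rewrite ler_wpM2l ?sqr_ge0// ler_sum.
rewrite (_ : \sum_(i : Q) b ^+ 3 = #|Q|%:R * b ^+ 3); last by rewrite sumr_const -[_ *+ _]mulr_natl.
by rewrite exprMn mulrA -exprSr.
Qed.

(** [F j] carries the earlier blocks and [Gam j] the current block without its gap. A function of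
    the past bounded by L is decoupled by [cv_bound_L2] from Y and from products of two of its
    coordinates; these are the two terms with gam^(1/2). *)
Lemma block_lindeberg (L c gam bet dlt eps : R) n f g H (D Y : nat -> T -> Q -> R)
    (G : nat -> T' -> Q -> R) (s : nat -> Q -> Q -> R) (F Gam : nat -> set (set T)) :
  smooth L f g H -> 0 < L -> 0 <= c -> 0 < gam -> gam <= 1 -> 0 < bet -> 0 <= dlt -> 0 <= eps ->
  (forall j i, (j < n)%N -> [/\ L4 P (fun w => D j w i), L4 P (fun w => Y j w i) & L4 P' (fun w => G j w i)]) ->
  (forall j i, (j < n)%N -> Ex P (fun w => D j w i ^+ 2) <= dlt ^+ 2) ->
  (forall j i, (j < n)%N -> Ex P (fun w => Y j w i ^+ 4) <= bet ^+ 4) ->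
  (forall j i, (j < n)%N -> Ex P' (fun w => G j w i ^+ 4) <= bet ^+ 4) ->
  (forall j i, (j < n)%N -> Ex P (fun w => Y j w i) = 0) ->
  (forall j i, (j < n)%N -> Ex P' (fun w => G j w i) = 0) ->
  (forall j i i', (j < n)%N -> `|Ex P (fun w => Y j w i * Y j w i') - s j i i'| <= eps) ->
  (forall j i i', (j < n)%N -> Ex P' (fun w => G j w i * G j w i') = s j i i') ->
  (forall j, (j < n)%N -> [/\ F j `<=` measurable, Gam j `<=` measurable & mixing P (c * gam) (F j) (Gam j)]) ->
  (forall j k i, (j < n)%N -> (k < j)%N -> gmeas (F j) (fun w => D k w i) /\ gmeas (F j) (fun w => Y k w i)) ->
  (forall j i, (j < n)%N -> gmeas (Gam j) (fun w => Y j w i)) ->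
  `|Ex P (fun w => f (fun i => \sum_(k < n) (D k w i + Y k w i))) - avgs P' G n f (fun=> 0)| <=
    n%:R * (L * (#|Q|%:R * dlt) + #|Q|%:R * ((4 * c + 4) * L * bet * gam `^ 2^-1) +
      #|Q|%:R ^+ 2 * ((4 * c + 4) * L * bet ^+ 2 * gam `^ 2^-1 + L * eps) + 2 * L * (#|Q|%:R * bet) ^+ 3).
Proof.
move=> sf L0 c0 g0 g1 b0 dl0 ep0 HL4 HD HY HG Y0 G0 HYY HGG HF gF gG.
have gS j psi : (j < n)%N -> preserves_measurability psi ->
    gmeas (F j) (fun w => psi (fun i => \sum_(k < j) (D k w i + Y k w i))).
  move=> jn mpsi; apply: (mpsi _ (g_sigma_algebraType (F j)) (fun w i => \sum_(k < j) (D k w i + Y k w i))) => i.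
  apply: (@gmeas_sum _ _ _ (F j) _ _ (fun (k : 'I_j) w => D k w i + Y k w i)) => k.
  by have [h1 h2] := gF j k i jn (ltn_ord k); exact: measurable_funD.
have EY2 j i : (j < n)%N -> Ex P (fun w => Y j w i ^+ 2) <= bet ^+ 2.
  by move=> jn; have [_ hY _] := HL4 j i jn; apply: Ex_sqr_le => //; [exact: ltW|exact: HY].
apply: (@lindeberg _ _ _ _ P _ _ P' L _ _ (#|Q|%:R * dlt) _ n f g H D Y G s sf (ltW L0)).
- by move=> j jn; split => i; have [h1 h2 h3] := HL4 j i jn; [exact: h1.1|exact: h2.1|exact: h3.1].
- move=> j jn; have LD i : L1 P (fun w => `|D j w i|).
    by apply: L1_norm; apply: L4_L1; have [] := HL4 j i jn.
  split; first exact: L1_sum.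
  rewrite /n1 Ex_sum// (@le_trans _ _ (\sum_(i : Q) dlt))//.
    apply: ler_sum => i _; apply: Ex_norm_sqr => //; [by have [] := HL4 j i jn|exact: HD].
  by rewrite sumr_const -[_ *+ _]mulr_natl.
- by move=> j jn; apply: Ex_n1_cube => // i; [have [] := HL4 j i jn|exact: HY].
- by move=> j jn; apply: Ex_n1_cube => // i; [have [] := HL4 j i jn|exact: HG].
- move=> j jn; split => [i|i i']; first by apply: L4_L1; have [] := HL4 j i jn.
  by apply: L4_mul; [have [] := HL4 j i jn|have [] := HL4 j i' jn].
- by move=> j jn i; split; [apply: L4_L1; have [] := HL4 j i jn|exact: G0].
- move=> j jn i i'; split; last exact: HGG.
  by apply: L4_mul; [have [] := HL4 j i jn|have [] := HL4 j i' jn].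
- move=> j jn psi mpsi bpsi i; have [FT GT FG] := HF j jn.
  have [hD hY _] := HL4 j i jn.
  have [_ _ _] := cv_bound_L2 FT GT g0 g1 FG (gS j psi jn mpsi) (gG j i jn) L0 b0
    (fun w => bpsi _) (L4_L2 hY) (EY2 j i jn).
  by rewrite /cv Y0// mulr0 subr0.
- move=> j jn psi mpsi bpsi i i'; have [FT GT FG] := HF j jn.
  have [_ hY _] := HL4 j i jn; have [_ hY' _] := HL4 j i' jn.
  have gYY : gmeas (Gam j) (fun w => Y j w i * Y j w i').
    by apply: measurable_funM; exact: gG.
  have EYY : Ex P (fun w => (Y j w i * Y j w i') ^+ 2) <= (bet ^+ 2) ^+ 2.
    have m2 k : measurable_fun setT (fun w => Y j w k ^+ 2).
      by apply: measurable_funX; have [_ h _] := HL4 j k jn; exact: h.1.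
    have L22 k : L1 P (fun w => (Y j w k ^+ 2) ^+ 2).
      by have [_ h _] := HL4 j k jn; apply: eq_L1 h.2 => w; rewrite -exprM.
    have [_] := Ex_CS (m2 i) (m2 i') (L22 i) (L22 i').
    have ee k : (fun w => (Y j w k ^+ 2) ^+ 2) = (fun w => Y j w k ^+ 4) by apply/funext => w; rewrite -exprM.
    rewrite !ee => h.
    have -> : (fun w => (Y j w i * Y j w i') ^+ 2) = (fun w => Y j w i ^+ 2 * Y j w i' ^+ 2).
      by apply/funext => w; rewrite exprMn.
    rewrite -(@ler_pXn2r _ 2%N) ?nnegrE ?sqr_ge0//; last by apply: Ex_ge0 => w; rewrite -exprMn sqr_ge0.
    have hb : (bet ^+ 2) ^+ 2 = bet ^+ 4 by rewrite -exprM.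
    have e4 k : 0 <= Ex P (fun w => Y j w k ^+ 4) by apply: Ex_ge0 => w; rewrite exprn_even_ge0.
    by rewrite (le_trans h)// hb [leRHS]expr2 ler_pM ?HY.
  have b20 : 0 < bet ^+ 2 by rewrite exprn_gt0.
  have [LU _ _] := cv_bound_L2 FT GT g0 g1 FG (gS j psi jn mpsi) gYY L0 b20
    (fun w => bpsi _) (L4_L4 hY hY') EYY.
  rewrite /cv; set U := Ex P (fun w => psi _) => h.
  have hU : `|U| <= L by apply: Ex_bounded => //; exact: L1_mf LU.
  have -> : Ex P (fun w => psi (fun i => \sum_(k < j) (D k w i + Y k w i)) * (Y j w i * Y j w i')) - U * s j i i' =
     (Ex P (fun w => psi (fun i => \sum_(k < j) (D k w i + Y k w i)) * (Y j w i * Y j w i')) -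
        U * Ex P (fun w => Y j w i * Y j w i')) + U * (Ex P (fun w => Y j w i * Y j w i') - s j i i') by ring.
  rewrite (le_trans (ler_normD _ _))// lerD// normrM ler_pM//; exact: HYY.
Qed.

End block_lindeberg.

Lemma quarter_sum {R : realType} (a b c e : R) : a < e / 4 -> b <= e / 2 -> c < e / 4 -> a + b + c <= e.
Proof. by move=> *; lra. Qed.

(** * The two processes as random bounded functions *)

Section processes_in_Linf.
Context {R : realType}.

Lemma to_LinfE {Tp : Type} {D : set Tp} {V : normedModType R} (f : Tp -> V) t :
  bounded_on D f -> D t -> to_Linf D f t = f t.
Proof.
move=> bf Dt; rewrite /to_Linf.
have h : (fun t => if t \in D then f t else 0) \in Linf_pred (V := V) D.
  rewrite inE; split => [s nDs|]; first by rewrite memNset.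
  by have [K fK] := bf; exists K => s Ds; rewrite mem_set//; exact: fK.
by rewrite val_insubd h mem_set.
Qed.

Lemma Linf_dist_le {Tp : Type} {D : set Tp} {V : normedModType R} (f g : Linf D V) (e : R) :
  0 <= e -> (forall t, D t -> `|f t - g t| <= e) -> `|f - g| <= e.
Proof. by move=> e0 h; apply: supnorm_le. Qed.

Context {dO : measure_display} {Omega : measurableType dO}.
Variable P : probability Omega R.
Context {d : nat} {I : set R}.
Hypothesis dI : domain I.
Local Notation Ex := (Ex P).
Local Notation V := 'rV[R]_d.

Section brownian.
Variables (W : R -> Omega -> C0 I V) (c : 'I_d -> 'I_d -> R -> R -> R).
Hypothesis hW : brownian_motion P c W.

Let W_cont w : cont_in 0 1 (fun t => W t w).
Proof.
apply: (@cont_in_within _ _ `[0, 1]%classic); last exact: (bm_continuous hW (w := w)).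
by move=> u; rewrite /= in_itv.
Qed.

Let W_bounded w : bounded_on (`[0, 1]%classic `*` I) (fun p : R * R => W p.1 w p.2).
Proof.
have [K hK] := cont_in_bounded (@W_cont w); exists K => -[t u] [/= t01 Iu].
by rewrite (le_trans (C0_ub _ _))// hK//; move: t01; rewrite in_itv.
Qed.

Lemma as_LinfE w t u : 0 <= t <= 1 -> I u -> as_Linf W w (t, u) = W t w u.
Proof. by move=> t01 Iu; rewrite /as_Linf to_LinfE//; split => //=; rewrite in_itv. Qed.

(** An enumeration of the dyadic times; an index that codes none is sent to time 0. *)
Let dyad (l : nat) : R := if choice.unpickle l is Some (r, i) then
  (if (i < 2 ^ r)%N then i%:R / (2 ^ r)%:R else 0) else 0.

Let dyad01 l : 0 <= dyad l <= 1.
Proof.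
rewrite /dyad; case: (choice.unpickle l) => [[r i]|]; last by rewrite lexx ler01.
case: ifP => ir; last by rewrite lexx ler01.
by rewrite divr_ge0//= ler_pdivrMr ?ltr0n ?expn_gt0// mul1r ler_nat ltnW.
Qed.

(** Bounded functions are not separable in the sup-norm, but continuous paths in [C0] are, and they
    are determined uniformly by their values at dyadic times. *)
Lemma as_Linf_measurable :
  measurable_fun setT (as_Linf W : Omega -> borel (Linf (`[0, 1]%classic `*` I) V)).
Proof.
apply: (@measurable_of_cover _ _ _ _ _ (fun l => W (dyad l))).
- by move=> l; exact: bm_measurable hW _ (dyad01 l).
- move=> e e0; have cc : coverable (C0 I V) by exact: C0_coverable dI rV_coverable.
  have [U [U1 U2]] := cont_cover 0 1 cc e0.
  exists (fun n => [set w | U n (fun t => W t w)]); split.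
    by move=> w; have [n Un] := U1 _ (@W_cont w); exists n.
  by move=> n w w' h h' l; exact: U2 h h' _ (dyad01 l).
- move=> e e0; exists (e / 2); first by rewrite divr_gt0.
  move=> w w' h; have e80 : 0 < e / 4 by rewrite divr_gt0.
  have close t : 0 <= t <= 1 -> `|W t w - W t w'| <= e.
    move=> t01; have [d1 d10 h1] := @W_cont w _ _ t01 e80; have [d2 d20 h2] := @W_cont w' _ _ t01 e80.
    have d0 : 0 < Num.min d1 d2 by rewrite lt_min d10 d20.
    have [r [i [ir]]] := dyadic_approx t01 d0; rewrite lt_min => /andP[l1 l2].
    have := h (choice.pickle (r, i)); rewrite /dyad choice.pickleK ir => h3.
    set s := i%:R / (2 ^ r)%:R in h3 l1 l2.
    have s01 : 0 <= s <= 1.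
      by rewrite divr_ge0//= ler_pdivrMr ?ltr0n ?expn_gt0// mul1r ler_nat ltnW.
    have k1 := h1 s s01 l1; have k2 := h2 s s01 l2.
    have -> : W t w - W t w' = (W t w - W s w) + (W s w - W s w') + (W s w' - W t w').
      by rewrite !subrKA.
    rewrite (le_trans (ler_normD _ _))// (le_trans (lerD (ler_normD _ _) (lexx _)))//.
    by rewrite distrC in k2; exact: quarter_sum k1 h3 k2.
  apply: Linf_dist_le; first exact: ltW.
  move=> [t u] [/=]; rewrite in_itv/= => t01 Iu; rewrite !as_LinfE//.
  by rewrite -C0_subE (le_trans (C0_ub _ _))// close.
Qed.

End brownian.

Section sums.
Variables (Y : nat -> Omega -> C0 I V) (N : nat) (K : R).
Hypotheses (N0 : (0 < N)%N) (mY : forall i, (0 < i)%N -> measurable_fun setT (Y i : Omega -> borel (C0 I V))).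
Hypothesis KY : forall i u k, (0 < i)%N -> I u -> `|Ex (fun w => Y i w u ord0 k)| <= K.

Let K0 : 0 <= Num.max K 0. Proof. by rewrite le_max lexx orbT. Qed.

Lemma meanE i u k : mean P (Y i) u ord0 k = Ex (fun w => Y i w u ord0 k).
Proof. by rewrite !mxE unlock. Qed.

Lemma mean_norm i u : (0 < i)%N -> I u -> `|mean P (Y i) u| <= Num.max K 0.
Proof. by move=> i0 Iu; apply: rV_norm_le => // k; rewrite meanE le_max KY. Qed.

Let psum_bounded w : bounded_on (`[0, 1]%classic `*` I) (fun p : R * R => (Num.sqrt N%:R)^-1 *:
    \sum_(1 <= i < (Num.truncn (p.1 * N%:R)).+1) (Y i w p.2 - mean P (Y i) p.2)).
Proof.
pose b := \sum_(i < N) (`|Y i.+1 w| + Num.max K 0).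
exists ((Num.sqrt N%:R)^-1 * b) => -[t u] [/=]; rewrite in_itv/= => /andP[t0 t1] Iu.
rewrite normrZ (ger0_norm (_ : 0 <= (Num.sqrt N%:R)^-1)) ?invr_ge0 ?sqrtr_ge0// ler_wpM2l ?invr_ge0 ?sqrtr_ge0// big_add1/= big_mkord.
have tN : (Num.truncn (t * N%:R) <= N)%N.
  rewrite -(@ler_nat R) (@le_trans _ _ (t * N%:R))//; last by rewrite ler_piMl.
  by rewrite truncn_le mulr_ge0.
rewrite /b; move: (Num.truncn _) tN => q qN; rewrite -(subnKC qN) big_split_ord/=.
rewrite (le_trans (ler_norm_sum _ _ _))// -[leLHS]addr0 lerD//; last by apply: sumr_ge0 => i _; rewrite addr_ge0.
apply: ler_sum => i _; rewrite (le_trans (ler_normB _ _))// lerD ?C0_ub// mean_norm//.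
Qed.

Lemma partial_sum_processE w t u k : 0 <= t <= 1 -> I u ->
  partial_sum_process P Y N w (t, u) ord0 k = psum (centered P Y) N t u k w.
Proof.
move=> t01 Iu; rewrite /partial_sum_process to_LinfE; [|exact: psum_bounded|by split => //=; rewrite in_itv].
rewrite !mxE /psum big_add1/= big_mkord summxE; congr (_ * _).
by apply: eq_bigr => i _; rewrite !mxE unlock.
Qed.

Lemma finite_cover {M : normedModType R} (A : nat -> Omega -> M) (n : nat) : coverable M ->
  forall e : R, 0 < e -> exists U : nat -> set Omega, (forall w, exists j, U j w) /\
    forall j w w', U j w -> U j w' -> forall i, (i < n)%N -> `|A i w - A i w'| <= e.
Proof.
move=> cM e e0; elim: n => [|n [U [U1 U2]]].
  by exists (fun=> setT); split => // w; exists 0%N.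
have [U' [U'1 U'2]] := cM e e0.
exists (fun j => if choice.unpickle j is Some (a, b) then [set w | U a w /\ U' b (A n w)] else set0).
split=> [w|j w w'].
  have [a Ua] := U1 w; have [b Ub] := U'1 (A n w).
  by exists (choice.pickle (a, b)); rewrite choice.pickleK.
case: (choice.unpickle j) => [[a b]|//] [h1 h2] [h3 h4] i.
rewrite ltnS leq_eqVlt => /orP[/eqP ->|i_n]; [exact: U'2 h2 h4|exact: U2 h1 h3 _ i_n].
Qed.

(** The process is a Lipschitz function of N random elements of a separable space. *)
Lemma partial_sum_measurable : measurable_fun setT
  (partial_sum_process P Y N : Omega -> borel (Linf (`[0, 1]%classic `*` I) V)).
Proof.
have NR : 0 < N%:R :> R by rewrite ltr0n.
apply: (@measurable_of_cover _ _ _ _ _ (fun l => Y (if (l < N)%N then l.+1 else 1%N))).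
- by move=> l; apply: mY; case: ifP.
- move=> e e0; have [U [U1 U2]] := finite_cover (fun l => Y l.+1) N (C0_coverable dI rV_coverable) e0.
  exists U; split => // j w w' h h' l; case: ifP => lN; first exact: U2 h h' _ lN.
  exact: U2 h h' _ N0.
- move=> e e0; exists (e / N%:R); first by rewrite divr_gt0.
  move=> w w' h; apply: Linf_dist_le; first exact: ltW.
  move=> [t u] [/=]; rewrite in_itv/= => t01 Iu; apply: rV_norm_le; first exact: ltW.
  move=> k; rewrite !mxE !partial_sum_processE// /psum -mulrBr -sumrB.
  have tN : (Num.truncn (t * N%:R) <= N)%N.
    case/andP: t01 => t0 t1; rewrite -(@ler_nat R) (@le_trans _ _ (t * N%:R))//; last by rewrite ler_piMl.
    by rewrite truncn_le mulr_ge0.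
  have sN : (Num.sqrt N%:R)^-1 <= 1 :> R.
    by rewrite invf_le1 ?sqrtr_gt0// -[leLHS]sqrtr1 ler_wsqrtr// ler1n.
  rewrite normrM (ger0_norm (_ : 0 <= (Num.sqrt N%:R)^-1)); last by rewrite invr_ge0 sqrtr_ge0.
  rewrite (@le_trans _ _ (\sum_(i < Num.truncn (t * N%:R)) (e / N%:R)))//; last first.
    rewrite sumr_const card_ord -[_ *+ _]mulr_natl mulrCA -[leRHS]mulr1 ler_wpM2l ?(ltW e0)//.
    by rewrite ler_pdivrMr// mul1r ler_nat.
  rewrite -[leRHS]mul1r ler_pM// (le_trans (ler_norm_sum _ _ _))//; apply: ler_sum => i _.
  rewrite /centered opprB addrA subrK.
  have := h i; rewrite (leq_trans (ltn_ord i) tN); apply: le_trans.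
  have := rV_coord_le ((Y i.+1 w - Y i.+1 w') u) k; rewrite C0_subE !mxE => /le_trans; apply.
  by rewrite -C0_subE C0_ub.
Qed.

End sums.
End processes_in_Linf.

(** * Blocks of the partial sums against increments of the Brownian motion *)

Section comparison.
Context {R : realType} {dO : measure_display} {Omega : measurableType dO} (P : probability Omega R).
Context {dO' : measure_display} {Omega' : measurableType dO'} (P' : probability Omega' R).
Context {d : nat} {I : set R}.
Variables (Gs : nat -> set (set Omega)) (z : nat -> R -> 'I_d -> Omega -> R).
Variables (c : 'I_d -> 'I_d -> R -> R -> R) (C1 nu B eta : R).
Hypotheses (hC1 : 0 < C1) (nu0 : 0 < nu) (B0 : 0 < B) (eta0 : 0 <= eta).
Hypothesis az : array P Gs I z c C1 nu B eta.
Variable W : R -> Omega' -> C0 I 'rV[R]_d.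
Hypotheses (dI : domain I) (hW : brownian_motion P' c W).
Hypothesis cB : forall k u, I u -> c k k u u <= B.

Lemma mixing_sub {d0 : measure_display} {T0 : measurableType d0} (P0 : probability T0 R)
    (a a' : R) (F F' G G' : set (set T0)) : a <= a' ->
  F' `<=` F -> G' `<=` G -> mixing P0 a F G -> mixing P0 a' F' G'.
Proof.
move=> aa FF GG h A A' sA sA'; apply: le_trans aa; apply: h.
  by apply: sub_smallest2r sA => //; exact: smallest_sigma_algebra.
by apply: sub_smallest2r sA' => //; exact: smallest_sigma_algebra.
Qed.

(** c is a covariance, and the squares of U + V and U - V have nonnegative means. *)
Lemma lrv_offdiag k l u v : I u -> I v -> `|c k l u v| <= B.
Proof.
move=> Iu Iv.
have h k' l' u' v' : I u' -> I v' -> Ex P' (fun w => incr W (tq 1 0) (tq 1 (0 + 1)) u' k' w * incr W (tq 1 0) (tq 1 (0 + 1)) v' l' w) = c k' l' u' v'.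
  by move=> Iu' Iv'; rewrite (incr_cov dI hW (erefl : (0 < 1)%N) k' l' (leqnn (0 + 1)) Iu' Iv') divr1 mul1r.
have L u' k' : I u' -> L4 P' (incr W (tq 1 0) (tq 1 (0 + 1)) u' k').
  by move=> Iu'; apply: (tq_L4 hW).
have := h k l u v Iu Iv; have := h k k u u Iu Iu; have := h l l v v Iv Iv.
set U := incr W _ _ u k; set V := incr W _ _ v l => hV hU hUV.
have LU := L _ k Iu; have LV := L _ l Iv; rewrite -/U -/V in LU LV.
have l1 := L4_mul LU LU; have l2 := L4_mul LU LV; have l3 := L4_mul LV LV.
have s1 : 0 <= c k k u u + 2 * c k l u v + c l l v v.
  rewrite -hU -hUV -hV -(ExZ 2 l2) -(ExD l1 (L1Z 2 l2)) -(ExD (L1D l1 (L1Z 2 l2)) l3).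
  apply: Ex_ge0 => w; rewrite (_ : _ + _ = (U w + V w) ^+ 2) ?sqr_ge0//; ring.
have s2 : 0 <= c k k u u - 2 * c k l u v + c l l v v.
  rewrite -hU -hUV -hV -(ExZ 2 l2) -(ExB l1 (L1Z 2 l2)) -(ExD (L1B l1 (L1Z 2 l2)) l3).
  apply: Ex_ge0 => w; rewrite (_ : _ + _ = (U w - V w) ^+ 2) ?sqr_ge0//; ring.
have b1 := cB k Iu; have b2 := cB l Iv.
by rewrite ler_norml; lra.
Qed.

Lemma sum_ord_cut (F : nat -> R) (a b : nat) : (a <= b)%N ->
  \sum_(h < b) F h = \sum_(h < a) F h + \sum_(h < b - a) F (a + h)%N.
Proof.
move=> ab; have [p ->] : exists p, b = (a + p)%N by exists (b - a)%N; rewrite subnKC.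
by rewrite addKn big_split_ord.
Qed.

Variables (N m l n : nat) (Q : finType) (pt : Q -> R) (co : Q -> 'I_d) (act : nat -> Q -> bool).
Hypotheses (N0 : (0 < N)%N) (l0 : (0 < l)%N) (lm : (l < m)%N) (nmN : (n * m <= N)%N).
Hypothesis Ipt : forall i, I (pt i).

(** [act j i] tells whether block j precedes the time of the grid variable i; with it all grid
    values are sums over the same blocks. *)
Definition blockP (j : nat) (w : Omega) (i : Q) : R :=
  (act j i)%:R * ((Num.sqrt N%:R)^-1 * \sum_(h < m) z (j * m + h).+1 (pt i) (co i) w).
Definition blockW (j : nat) (w : Omega') (i : Q) : R :=
  (act j i)%:R * incr W (tq N (j * m)) (tq N (j.+1 * m)) (pt i) (co i) w.

(* The first [l] terms of a block separate the remaining ones from the past. *)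
Let Dp j w i : R := (act j i)%:R * ((Num.sqrt N%:R)^-1 * \sum_(h < l) z (j * m + h).+1 (pt i) (co i) w).
Let Yp j w i : R := (act j i)%:R * ((Num.sqrt N%:R)^-1 * \sum_(h < m - l) z (j * m + l + h).+1 (pt i) (co i) w).
Let s (j : nat) (i i' : Q) : R := (act j i)%:R * (act j i')%:R * (m%:R / N%:R * c (co i) (co i') (pt i) (pt i')).

Let NR : 0 < N%:R :> R. Proof. by rewrite ltr0n. Qed.
Let mR : 0 < m%:R :> R. Proof. by rewrite ltr0n (leq_ltn_trans _ lm). Qed.

Lemma blockP_split j w i : blockP j w i = Dp j w i + Yp j w i.
Proof.
rewrite /blockP /Dp /Yp -!mulrDr; congr (_ * (_ * _)).
rewrite (sum_ord_cut (fun h => z (j * m + h).+1 (pt i) (co i) w) (ltnW lm)); congr (_ + _).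
by apply: eq_bigr => h _; rewrite addnA.
Qed.

(** In this order: bounds for the L^4 norm of a block, for the L^2 norm of a gap and for the
    mismatch of covariances, and the mixing rate across a gap. *)
Let bet : R := Num.sqrt (@Kw R * B * (m%:R / N%:R)).
Let dlt : R := Num.sqrt (B * (l%:R / N%:R)).
Let eps : R := B / N%:R * (m%:R `^ (7 / 8) + m%:R * eta + l%:R).
Let gam : R := l%:R `^ (- nu).

Let Kw1 : 1 <= @Kw R.
Proof. by rewrite /Kw; lra. Qed.
Let bet0 : 0 < bet.
Proof. by rewrite sqrtr_gt0 !mulr_gt0 ?invr_gt0// (lt_le_trans ltr01). Qed.
Let bet4 : bet ^+ 4 = (@Kw R * B * (m%:R / N%:R)) ^+ 2.
Proof.
rewrite [bet ^+ 4](exprM bet 2 2) sqr_sqrtr// !mulr_ge0 ?invr_ge0 ?(ltW B0)//.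
Qed.
Let dlt4 : dlt ^+ 4 = (B * (l%:R / N%:R)) ^+ 2.
Proof. by rewrite [dlt ^+ 4](exprM dlt 2 2) sqr_sqrtr// mulr_ge0 ?divr_ge0 ?(ltW B0). Qed.

Let act4 j i (x : R) : ((act j i)%:R * x) ^+ 4 <= x ^+ 4.
Proof. by case: (act j i); rewrite ?mul1r// mul0r expr0n exprn_even_ge0. Qed.

Let scaled a p j i : L4 P (fun w => (act j i)%:R * ((Num.sqrt N%:R)^-1 * \sum_(h < p) z (a + h).+1 (pt i) (co i) w)) /\
  Ex P (fun w => ((act j i)%:R * ((Num.sqrt N%:R)^-1 * \sum_(h < p) z (a + h).+1 (pt i) (co i) w)) ^+ 4) <=
    (B * (p%:R / N%:R)) ^+ 2.
Proof.
have [L E] := ar_L4 az a p (co i) (Ipt i).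
have L' : L4 P (fun w => (Num.sqrt N%:R)^-1 * \sum_(h < p) z (a + h).+1 (pt i) (co i) w) by exact: L4Z.
have L'' := L4Z (act j i)%:R L'; split => //.
apply: (le_trans (Ex_le L''.2 L'.2 (fun w => act4 j i _))).
rewrite (_ : (fun w => _) = (fun w => (N%:R^-1) ^+ 2 * (\sum_(h < p) z (a + h).+1 (pt i) (co i) w) ^+ 4)); last first.
  by apply/funext => w; rewrite sqrtN4.
rewrite ExZ; last exact: L.2.
rewrite (_ : (B * (p%:R / N%:R)) ^+ 2 = N%:R^-1 ^+ 2 * (B * p%:R) ^+ 2); last by rewrite !exprMn; ring.
by rewrite ler_wpM2l ?sqr_ge0.
Qed.

Let tt_times : times (fun j => tq N (j * m)%N : R) n.
Proof.
split => j jn; first by apply: tq01 => //; rewrite (leq_trans _ nmN)// leq_mul2r jn orbT.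
by apply: tq_le; rewrite // leq_mul2r leqnSn orbT.
Qed.

Let jmN j : (j < n)%N -> (j * m + m <= N)%N.
Proof. by move=> jn; rewrite -mulSnr (leq_trans _ nmN)// leq_mul2r jn orbT. Qed.

Let blockW_facts j i : (j < n)%N -> [/\ L4 P' (fun w => blockW j w i),
  Ex P' (fun w => blockW j w i ^+ 4) <= bet ^+ 4, Ex P' (fun w => blockW j w i) = 0 &
  forall i', Ex P' (fun w => blockW j w i * blockW j w i') = s j i i'].
Proof.
move=> jn; have jm := jmN jn.
have ijq : (j * m <= j.+1 * m <= N)%N by rewrite leq_mul2r leqnSn orbT/= mulSnr.
have [L E] := bm_fourth dI hW (k := co i) N0 ijq (Ipt i) (cB (co i) (Ipt i)).
have L' := L4Z (act j i)%:R L.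
split => //.
- apply: (le_trans (Ex_le L'.2 L.2 (fun w => act4 j i _))); rewrite bet4 (le_trans E)//.
  by rewrite -mulnBl subSnn mul1n.
- rewrite ExZ; last exact: L4_L1.
  by rewrite mulSnr (incr_mean0 dI hW N0 (co i) jm (Ipt i)) mulr0.
- move=> i'; have [L2 _] := bm_fourth dI hW (k := co i') N0 ijq (Ipt i') (cB (co i') (Ipt i')).
  rewrite (_ : (fun w => _) = (fun w => ((act j i)%:R * (act j i')%:R) *
     (incr W (tq N (j * m)) (tq N (j.+1 * m)) (pt i) (co i) w * incr W (tq N (j * m)) (tq N (j.+1 * m)) (pt i') (co i') w))); last first.
    by apply/funext => w; rewrite /blockW mulrACA.
  by rewrite (ExZ _ (L4_mul L L2)) mulSnr (incr_cov dI hW N0 (co i) (co i') jm (Ipt i) (Ipt i')).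
Qed.

Definition lindeberg_error (L : R) : R :=
  n%:R * (L * (#|Q|%:R * dlt) + #|Q|%:R * ((4 * C1 + 4) * L * bet * gam `^ 2^-1) +
      #|Q|%:R ^+ 2 * ((4 * C1 + 4) * L * bet ^+ 2 * gam `^ 2^-1 + L * eps) + 2 * L * (#|Q|%:R * bet) ^+ 3).

Let gam0 : 0 < gam. Proof. by rewrite powR_gt0// ltr0n. Qed.
Let gam1 : gam <= 1. Proof. by rewrite powRN_le1 ?ler1n// ltW. Qed.
Let eps0 : 0 <= eps.
Proof. by rewrite mulr_ge0 ?divr_ge0 ?(ltW B0)// !addr_ge0 ?mulr_ge0 ?powR_ge0. Qed.

Lemma lindeberg_P L f g H : smooth L f g H -> 0 < L ->
  `|Ex P (fun w => f (fun i => \sum_(j < n) blockP j w i)) - avgs P' blockW n f (fun=> 0)| <= lindeberg_error L.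
Proof.
move=> sf L0.
have -> : (fun w => f (fun i => \sum_(j < n) blockP j w i)) =
    (fun w => f (fun i => \sum_(j < n) (Dp j w i + Yp j w i))).
  apply/funext => w; congr f; apply/funext => i; apply: eq_bigr => j _; exact: blockP_split.
have pn (x y : R) : 0 <= x -> x <= y -> x ^+ 2 <= y ^+ 2.
  by move=> x0 xy; rewrite ler_pXn2r ?nnegrE// (le_trans x0).
have KB : B <= @Kw R * B by rewrite ler_peMl// ltW.
apply: (@block_lindeberg _ _ _ _ P _ _ P' L C1 gam bet dlt eps n f g H Dp Yp blockW s
  (fun j => past Gs (j * m)) (fun j => future Gs (j * m + l).+1)) => //; rewrite ?(ltW hC1)//.
- by rewrite sqrtr_ge0.
- by move=> j i jn; split; [exact: (scaled _ _ _ _).1|exact: (scaled _ _ _ _).1|case: (blockW_facts i jn)].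
- move=> j i jn; apply: Ex_sqr_le; [exact: sqrtr_ge0|exact: (scaled _ _ _ _).1|].
  by rewrite dlt4; exact: (scaled _ _ _ _).2.
- move=> j i jn; rewrite bet4 (le_trans (scaled _ _ _ _).2)// pn//.
    by rewrite mulr_ge0 ?divr_ge0// ltW.
  rewrite ler_pM ?divr_ge0 ?(ltW B0)// ler_pM2r ?invr_gt0// ler_nat leq_subr//.
- by move=> j i jn; case: (blockW_facts i jn).
- move=> j i jn; have [L4s _] := ar_L4 az (j * m + l) (m - l) (co i) (Ipt i).
  rewrite /Yp ExZ; last by apply: L1Z; exact: L4_L1.
  rewrite ExZ; last exact: L4_L1.
  rewrite Ex_sum; last first.
    move=> h; have [+ _] := ar_L4 az (j * m + l + h) 1 (co i) (Ipt i) => /L4_L1.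
    by apply: eq_L1 => w; rewrite big_ord1 addn0.
  by rewrite big1 ?mulr0// => h _; exact: ar_mean az _ _ _ _ (Ipt i).
- by move=> j i jn; case: (blockW_facts i jn).
- move=> j i i' jn; have [L4i _] := ar_L4 az (j * m + l) (m - l) (co i) (Ipt i).
  have [L4i' _] := ar_L4 az (j * m + l) (m - l) (co i') (Ipt i').
  have := ar_cov az (j * m + l) (m - l) (co i) (co i') (Ipt i) (Ipt i').
  set U := fun w => \sum_(h < m - l) z (j * m + l + h).+1 (pt i) (co i) w.
  set V := fun w => \sum_(h < m - l) z (j * m + l + h).+1 (pt i') (co i') w.
  rewrite -/(U _) => hc.
  have -> : (fun w => Yp j w i * Yp j w i') = (fun w => ((act j i)%:R * (act j i')%:R * N%:R^-1) * (U w * V w)).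
    apply/funext => w; rewrite /Yp -/(U w) -/(V w).
    have e : (Num.sqrt N%:R)^-1 * (Num.sqrt N%:R)^-1 = N%:R^-1 :> R by rewrite -invfM -expr2 sqr_sqrtr.
    by rewrite -e; ring.
  rewrite (ExZ _ (L4_mul L4i L4i')) /s -[_ * _ * N%:R^-1 * _]mulrA -mulrBr normrM.
  have a1 : `|(act j i)%:R * (act j i')%:R| <= 1 :> R.
    by case: (act j i); case: (act j i'); rewrite ?mulr0 ?mul0r ?mulr1 ?normr0 ?normr1 ?ler01 ?lexx.
  rewrite -[leRHS]mul1r ler_pM//.
  set ck := c _ _ _ _ in hc *; set E := Ex _ _ in hc *.
  have cb : `|ck| <= B by exact: lrv_offdiag.
  (* The shortened block has m - l terms, whereas the increment of W has the covariance of m; the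
     missing ones cost l B / N. *)
  rewrite (_ : N%:R^-1 * E - m%:R / N%:R * ck = N%:R^-1 * ((E - (m - l)%:R * ck) - l%:R * ck)); last first.
    by rewrite natrB ?(ltnW lm)//; ring.
  rewrite normrM ger0_norm ?invr_ge0// /eps (mulrC B) -mulrA ler_wpM2l ?invr_ge0//.
  rewrite (le_trans (ler_normB _ _))// mulrDr lerD//; last first.
    by rewrite normrM mulrC ler_pM// ger0_norm.
  apply: (le_trans hc); rewrite ler_pM2l// lerD//.
    by apply: ge0_ler_powR; rewrite ?nnegrE ?divr_ge0// ler_nat leq_subr.
  by rewrite ler_wpM2r// ler_nat leq_subr.
- by move=> j i i' jn; case: (blockW_facts i jn) => _ _ _; exact.
- move=> j jn; split.
  + by apply: past_measurable; exact: ar_sub az.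
  + by apply: future_measurable; exact: ar_sub az.
  + have fsub a b : (a <= b)%N -> future Gs b `<=` future Gs a.
      by move=> ab A [i /= ib GA]; exists i => //=; exact: leq_trans ib.
    (* The first block has an empty past, while [ar_mix] asks for a positive index. *)
    case: j jn => [|j] jn.
      rewrite mul0n add0n -[l.+1]add1n.
      apply: mixing_sub (ar_mix az (erefl : (0 < 1)%N) l0) => // A [i /= /andP[i1 i0]].
      by move: i0; rewrite leqn0 => /eqP i0; rewrite i0 in i1.
    have jm0 : (0 < j.+1 * m)%N by rewrite muln_gt0/= (leq_ltn_trans _ lm).
    by apply: mixing_sub (ar_mix az jm0 l0) => //; exact: fsub.
- move=> j k i jn kj; have kjm : (k * m + m <= j * m)%N by rewrite -mulSnr leq_mul2r kj orbT.
  split; (apply: measurable_funM; first exact: measurable_cst);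
    (apply: measurable_funM; first exact: measurable_cst).
    apply: (@gmeas_sum _ _ _ (past Gs (j * m)) _ _ (fun (h : 'I_l) w => z (k * m + h).+1 (pt i) (co i) w)) => h.
    apply: (@gmeas_past _ _ _ Gs _ (k * m + h).+1); last exact: ar_gmeas az _ _ _ _ (Ipt i).
    by rewrite /= (leq_trans _ kjm)// ltn_add2l (ltn_trans (ltn_ord h) lm).
  apply: (@gmeas_sum _ _ _ (past Gs (j * m)) _ _ (fun (h : 'I_(m - l)) w => z (k * m + l + h).+1 (pt i) (co i) w)) => h.
  apply: (@gmeas_past _ _ _ Gs _ (k * m + l + h).+1); last exact: ar_gmeas az _ _ _ _ (Ipt i).
  by rewrite /= (leq_trans _ kjm)// -addnA ltn_add2l -ltn_subRL.
- move=> j i jn; (apply: measurable_funM; first exact: measurable_cst);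
    (apply: measurable_funM; first exact: measurable_cst).
  apply: (@gmeas_sum _ _ _ (future Gs (j * m + l).+1) _ _ (fun (h : 'I_(m - l)) w => z (j * m + l + h).+1 (pt i) (co i) w)) => h.
  apply: (@gmeas_future _ _ _ Gs _ (j * m + l + h).+1); last exact: ar_gmeas az _ _ _ _ (Ipt i).
  by rewrite ltnS leq_addr.
Qed.

(** The same deterministic average is reached from the Brownian motion itself; its increments are
    independent, so there are no gaps and the mixing coefficient is 0. *)
Lemma lindeberg_W L f g H : smooth L f g H -> 0 < L ->
  `|Ex P' (fun w => f (fun i => \sum_(j < n) blockW j w i)) - avgs P' blockW n f (fun=> 0)| <= lindeberg_error L.
Proof.
move=> sf L0; pose t j : R := tq N (j * m)%N.
have -> : (fun w => f (fun i => \sum_(j < n) blockW j w i)) =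
    (fun w => f (fun i => \sum_(j < n) ((fun _ _ _ => 0) j w i + blockW j w i))).
  by apply/funext => w; congr f; apply/funext => i; apply: eq_bigr => j _; rewrite add0r.
apply: (@block_lindeberg _ _ _ _ P' _ _ P' L C1 gam bet dlt eps n f g H (fun _ _ _ => 0) blockW blockW s
  (Fincr W t) (Gincr W t)) => //; rewrite ?(ltW hC1)//.
- by rewrite sqrtr_ge0.
- by move=> j i jn; split; [exact: L4_cst|case: (blockW_facts i jn)|case: (blockW_facts i jn)].
- move=> j i jn; rewrite (_ : (fun w => _) = cst 0) ?(Ex_cst P') ?sqr_ge0//.
  by apply/funext => w; rewrite expr0n.
- by move=> j i jn; case: (blockW_facts i jn).
- by move=> j i jn; case: (blockW_facts i jn).
- by move=> j i jn; case: (blockW_facts i jn).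
- by move=> j i jn; case: (blockW_facts i jn).
- by move=> j i i' jn; case: (blockW_facts i jn) => _ _ _ ->; rewrite subrr normr0.
- by move=> j i i' jn; case: (blockW_facts i jn) => _ _ _; exact.
- move=> j jn; split.
  + exact: (Fincr_sub dI hW tt_times (ltnW jn)).
  + exact: (Gincr_sub dI hW tt_times jn).
  + apply: mixing_sub (mixing_incr dI hW tt_times jn) => //.
    by rewrite mulr_ge0// ltW.
- move=> j k i jn kj; split; first exact: measurable_cst.
  by apply: measurable_funM; [exact: measurable_cst|exact: gmeas_Fincr].
- by move=> j i jn; apply: measurable_funM; [exact: measurable_cst|exact: gmeas_Gincr].
Qed.

Lemma comparison L f g H : smooth L f g H -> 0 < L ->
  `|Ex P (fun w => f (fun i => \sum_(j < n) blockP j w i)) -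
    Ex P' (fun w => f (fun i => \sum_(j < n) blockW j w i))| <= 2 * lindeberg_error L.
Proof.
move=> sf L0; have h1 := lindeberg_P sf L0; have h2 := lindeberg_W sf L0.
rewrite -(subrKA (avgs P' blockW n f (fun=> 0))) (le_trans (ler_normD _ _))//.
by rewrite mulr_natl mulr2n lerD// distrC.
Qed.

End comparison.

(** * Choice of the scales *)

Section grid_blocks.
Context {R : realType} {d : nat} {I : set R}.

Lemma sum_blocks (F : nat -> R) (p m : nat) :
  \sum_(h < p * m) F h = \sum_(j < p) \sum_(h < m) F (j * m + h)%N.
Proof.
elim: p => [|p IH]; first by rewrite mul0n !big_ord0.
by rewrite big_ord_recr/= -IH mulSnr big_split_ord.
Qed.

Lemma sum_act (F : nat -> R) (p n : nat) : (p <= n)%N ->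
  \sum_(j < n) (j < p)%N%:R * F j = \sum_(j < p) F j.
Proof.
move=> pn; have [q ->] : exists q, n = (p + q)%N by exists (n - p)%N; rewrite subnKC.
rewrite big_split_ord/= [X in _ + X]big1 ?addr0; last by move=> i _; rewrite ltnNge leq_addr mul0r.
by apply: eq_bigr => i _; rewrite ltn_ord mul1r.
Qed.

Variables (N m r K n a : nat) (x y : R).
Hypotheses (N0 : (0 < N)%N) (m0 : (0 < m)%N) (rm : (2 ^ a = r * m)%N).

(** The second condition discards the time cells beginning after N, at which [gridval] is 0. *)
Definition act (j : nat) (i : 'I_K * 'I_n.+2 * 'I_d) : bool :=
  ((j < i.1.1 * r) && (i.1.1 * r <= N %/ m))%N.

Let cellN (i : nat) : (i * 2 ^ a <= N)%N = (i * r <= N %/ m)%N.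
Proof. by rewrite leq_divRL// rm mulnA. Qed.

Lemma gridval_P {dT : measure_display} {T : measurableType dT} (z : nat -> R -> 'I_d -> T -> R) (i : 'I_K * 'I_n.+2 * 'I_d) w :
  gridval N (psum z N) x y a w i =
  \sum_(j < N %/ m) blockP z N m (fun i : 'I_K * 'I_n.+2 * 'I_d => grid x y n i.1.2) snd act j w i.
Proof.
rewrite /gridval cellN /blockP /act; have [h|h] := boolP (i.1.1 * r <= N %/ m)%N; last first.
  by rewrite big1// => j _; rewrite andbF mul0r.
under eq_bigr => j _ do rewrite andbT.
rewrite (sum_act (fun j => (Num.sqrt N%:R)^-1 * \sum_(l < m) z (j * m + l).+1 (grid x y n i.1.2) i.2 w) h).
rewrite /psum truncn_grid// -mulr_sumr; congr (_ * _).
by rewrite rm mulnA (sum_blocks (fun l => z l.+1 (grid x y n i.1.2) i.2 w)).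
Qed.

Lemma gridval_W {dT : measure_display} {T : measurableType dT} (W : R -> T -> C0 I 'rV[R]_d) (i : 'I_K * 'I_n.+2 * 'I_d) w :
  (forall w, W 0 w = 0) ->
  gridval N (fun t u k w => W t w u ord0 k) x y a w i =
  \sum_(j < N %/ m) blockW W N m (fun i : 'I_K * 'I_n.+2 * 'I_d => grid x y n i.1.2) snd act j w i.
Proof.
move=> W0; rewrite /gridval cellN /blockW /act; have [h|h] := boolP (i.1.1 * r <= N %/ m)%N; last first.
  by rewrite big1// => j _; rewrite andbF mul0r.
under eq_bigr => j _ do rewrite andbT.
rewrite (sum_act (fun j => incr W (tq N (j * m)) (tq N (j.+1 * m)) (grid x y n i.1.2) i.2 w) h).
rewrite rm mulnA; elim: (i.1.1 * r)%N => [|p IH].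
  by rewrite big_ord0 mul0n mul0r W0 [LHS](_ : _ = 0)// mxE.
by rewrite big_ord_recr/= -IH /incr /tq addrC subrK.
Qed.

End grid_blocks.

(** * Bookkeeping of powers of k *)

Section powers_of_k.
Context {R : realType} {T : Type}.
Variable k : T -> R.
Hypothesis k1 : forall t, 1 <= k t.
Let k0 t : 0 < k t. Proof. exact: lt_le_trans (k1 t). Qed.
Let kX t p : 0 < k t ^+ p. Proof. exact: exprn_gt0. Qed.
Let kpq t p q : 0 <= k t ^+ p / k t ^+ q. Proof. by rewrite ltW// divr_gt0. Qed.

(** The order O(k^(p - q)), with a constant common to all scales; two natural exponents avoid
    negative ones. *)
Definition power_bounded (f : T -> R) (p q : nat) : Prop :=
  exists2 c, 0 <= c & forall t, 0 <= f t <= c * (k t ^+ p / k t ^+ q).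

Lemma power_boundedM f g p q p' q' : power_bounded f p q -> power_bounded g p' q' ->
  power_bounded (fun t => f t * g t) (p + p') (q + q').
Proof.
move=> [c c0 hf] [c' c'0 hg]; exists (c * c') => [|t]; first exact: mulr_ge0.
have /andP[f0 fc] := hf t; have /andP[g0 gc] := hg t.
rewrite mulr_ge0//= (le_trans (ler_pM f0 g0 fc gc))// !exprD le_eqVlt; apply/orP; left; apply/eqP.
by field; rewrite ?gt_eqF.
Qed.

Lemma power_bounded_cst x : 0 <= x -> power_bounded (fun=> x) 0 0.
Proof. by move=> x0; exists x => // t; rewrite !expr0 divr1 mulr1 x0 lexx. Qed.

Lemma power_bounded_le f g p q : (forall t, 0 <= g t <= f t) -> power_bounded f p q -> power_bounded g p q.
Proof.
move=> gf [c c0 h]; exists c => // t; have /andP[-> gt] := gf t.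
by have /andP[_ ft] := h t; exact: le_trans gt ft.
Qed.

Lemma power_bounded_pow p q : power_bounded (fun t => k t ^+ p / k t ^+ q) p q.
Proof. by exists 1 => // t; rewrite mul1r lexx kpq. Qed.

Lemma power_boundedX f p q n : power_bounded f p q -> power_bounded (fun t => f t ^+ n) (p * n) (q * n).
Proof.
move=> h; elim: n => [|n IH]; first by rewrite !muln0; apply: (power_bounded_cst ler01).
by rewrite !mulnS; have := power_boundedM h IH; apply: power_bounded_le => t; rewrite -exprS lexx andbT exprn_ge0//; case: h => c _ /(_ t) /andP[].
Qed.

Lemma power_bounded_weak p' q' f p q : power_bounded f p q -> (p + q' <= p' + q)%N -> power_bounded f p' q'.
Proof.
move=> [c c0 h] pq; exists c => // t; have /andP[-> ft] := h t; apply: (le_trans ft); rewrite ler_wpM2l//.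
by rewrite ler_pdivrMr// mulrAC ler_pdivlMr// -!exprD ler_weXn2l.
Qed.

Lemma power_boundedD f g p q : power_bounded f p q -> power_bounded g p q ->
  power_bounded (fun t => f t + g t) p q.
Proof.
move=> [c c0 hf] [c' c'0 hg]; exists (c + c') => [|t]; first exact: addr_ge0.
have /andP[f0 fc] := hf t; have /andP[g0 gc] := hg t.
by rewrite addr_ge0//= mulrDl lerD.
Qed.

Lemma power_bounded_fin f p q : power_bounded f p q -> (p < q)%N ->
  exists2 c, 0 <= c & forall t, f t <= c / k t.
Proof.
move=> h pq; have [|c c0 hc] := power_bounded_weak (p' := 0) (q' := 1) h; first by rewrite addn1.
by exists c => // t; have /andP[_] := hc t; rewrite expr0 expr1 mul1r.
Qed.

End powers_of_k.

Section parameters.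
Context {R : realType}.
Variables (C1 nu B : R) (d c0 : nat).
Hypotheses (hC1 : 0 < C1) (nu3 : 3 <= nu) (B0 : 0 < B) (d0 : (0 < d)%N) (c00 : (0 < c0)%N).

(* With [k = 2 ^ s], a small power of [N]: time cells have length about k^-12,
   space cells k^-6, Lindeberg blocks k^-200 and the gaps between them at most
   k^-600. There are then O(k^19) grid variables, and the smoothed indicator has
   derivatives O(k^27). *)
Record scale := Scale {
  sc_N : nat ; sc_s : nat ; sc_eta : R ; sc_w : R ; sc_e : R ;
  sc_s0 : (0 < sc_s)%N ; sc_N0 : (0 < sc_N)%N ; sc_L : (800 * sc_s <= trunc_log 2 sc_N)%N ;
  sc_eta0 : 0 <= sc_eta ; sc_eta66 : sc_eta <= 1 / (2 ^ sc_s)%:R ^+ 66 ;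
  sc_w0 : 0 <= sc_w ; sc_wk : sc_w <= c0%:R * (2 ^ sc_s)%:R ;
  sc_ek : 1 / (2 ^ sc_s)%:R <= sc_e }.

Implicit Type t : scale.
Definition kk t : nat := (2 ^ sc_s t)%N.
Definition kr t : R := (kk t)%:R.
Definition lg t : nat := trunc_log 2 (sc_N t).
Definition cell_exp t : nat := (lg t - 12 * sc_s t)%N.
Definition block t : nat := (2 ^ (lg t - 200 * sc_s t))%N.
(** The number of blocks in a time cell: 188 = 200 - 12. *)
Definition ratio t : nat := (2 ^ (188 * sc_s t))%N.
Definition gap t : nat := (2 ^ (200 * sc_s t))%N.
Definition ncell t : nat := (sc_N t %/ 2 ^ cell_exp t).+1.
Definition nblock t : nat := (sc_N t %/ block t)%N.
Definition ngrid t : nat := (c0 * kk t ^ 7).-1.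
(** The splines must cover [-k^5, k^5] with a mesh e that may be as small as 1/k. *)
Definition nspline t : nat := (2 * kk t ^ 6)%N.
Definition nvar t : nat := (ncell t * (ngrid t).+2 * d)%N.
Definition sconst t : R := ((nspline t).+1%:R * (16 / sc_e t ^+ 3)) ^+ 3.

Lemma kk_gt0 t : (0 < kk t)%N. Proof. by rewrite expn_gt0. Qed.
Lemma kr_ge1 t : 1 <= kr t. Proof. by rewrite ler1n kk_gt0. Qed.
Lemma kr_gt0 t : 0 < kr t. Proof. exact: lt_le_trans (kr_ge1 t). Qed.
Lemma krX_gt0 t p : 0 < kr t ^+ p. Proof. exact: exprn_gt0 (kr_gt0 t). Qed.

Lemma expk t p : (2 ^ (p * sc_s t))%:R = kr t ^+ p.
Proof. by rewrite mulnC expnM natrX. Qed.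

Let NR t : 0 < (sc_N t)%:R :> R. Proof. by rewrite ltr0n sc_N0. Qed.

Lemma lg_split t p : (p <= 800)%N -> (2 ^ lg t = 2 ^ (lg t - p * sc_s t) * 2 ^ (p * sc_s t))%N.
Proof.
move=> p8; rewrite -expnD subnK// (leq_trans _ (sc_L t))// leq_mul2r p8 orbT//.
Qed.

Lemma part_ratio t p : (p <= 800)%N -> (2 ^ (lg t - p * sc_s t))%:R / (sc_N t)%:R <= 1 / kr t ^+ p.
Proof.
move=> p8; rewrite ler_pdivrMr// mulrAC mul1r ler_pdivlMr ?krX_gt0// -expk -natrM -lg_split// ler_nat.
by rewrite trunc_logP// sc_N0.
Qed.

Lemma quotient_le t p : (p <= 800)%N -> (sc_N t %/ 2 ^ (lg t - p * sc_s t) < 2 * 2 ^ (p * sc_s t))%N.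
Proof.
move=> p8; rewrite ltn_divLR ?expn_gt0// -mulnA [(2 ^ (p * _) * _)%N]mulnC -lg_split// -expnS.
exact: trunc_log_ltn.
Qed.

Let PB := power_bounded kr.
Let PBM := power_boundedM kr_ge1.
Let PBD := @power_boundedD R scale kr.

Lemma pb_block : PB (fun t => (block t)%:R / (sc_N t)%:R) 0 200.
Proof.
apply: (power_bounded_le (fun t => _) (power_bounded_pow kr_ge1 0 200)) => t.
by rewrite divr_ge0//= part_ratio.
Qed.

Lemma pb_cell : PB (fun t => (2 ^ cell_exp t)%:R / (sc_N t)%:R) 0 12.
Proof.
apply: (power_bounded_le _ (power_bounded_pow kr_ge1 0 12)) => t.
by rewrite divr_ge0//= part_ratio.
Qed.

Lemma pb_ncell : PB (fun t => (ncell t)%:R) 12 0.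
Proof.
have := PBM (power_bounded_cst kr (ler0n R 2)) (power_bounded_pow kr_ge1 12 0).
apply: power_bounded_le => t; rewrite ler0n/= expr0 divr1 -expk -natrM ler_nat.
exact: quotient_le.
Qed.

Lemma pb_nblock : PB (fun t => (nblock t)%:R) 200 0.
Proof.
have := PBM (power_bounded_cst kr (ler0n R 2)) (power_bounded_pow kr_ge1 200 0).
apply: power_bounded_le => t; rewrite ler0n/= expr0 divr1 -expk -natrM ler_nat ltnW//.
exact: quotient_le.
Qed.

Lemma pb_gap : PB (fun t => (gap t)%:R / (sc_N t)%:R) 0 600.
Proof.
apply: (power_bounded_le _ (power_bounded_pow kr_ge1 0 600)) => t.
rewrite divr_ge0//= ler_pdivrMr// mulrAC mul1r ler_pdivlMr ?krX_gt0// -expk -natrM ler_nat -expnD -mulnDl.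
apply: leq_trans (trunc_logP (isT : (1 < 2)%N) (sc_N0 t)); rewrite leq_exp2l//.
exact: sc_L t.
Qed.

Lemma ngridE t : ((ngrid t).+1 = c0 * kk t ^ 7)%N.
Proof. by rewrite /ngrid prednK// muln_gt0 c00 expn_gt0 kk_gt0. Qed.

Lemma pb_ngrid : PB (fun t => (ngrid t).+2%:R) 7 0.
Proof.
have := PBM (power_bounded_cst kr (ler0n R (2 * c0))) (power_bounded_pow kr_ge1 7 0).
apply: power_bounded_le => t; rewrite ler0n/= expr0 divr1 ngridE /kr -natrX -natrM ler_nat -mulnA mul2n -addnn.
by rewrite -add1n leq_add2r muln_gt0 c00 expn_gt0 kk_gt0.
Qed.

Lemma grid_width t : sc_w t / (ngrid t).+1%:R <= 1 / kr t ^+ 6.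
Proof.
rewrite ngridE ler_pdivrMr; last by rewrite ltr0n muln_gt0 c00 expn_gt0 kk_gt0.
rewrite mulrAC mul1r ler_pdivlMr ?krX_gt0//.
have -> : (c0 * kk t ^ 7)%:R = c0%:R * kr t * kr t ^+ 6 by rewrite natrM natrX -mulrA -exprS.
by rewrite ler_pM2r ?krX_gt0//; exact: sc_wk.
Qed.

Lemma pb_width : PB (fun t => sc_w t / (ngrid t).+1%:R) 0 6.
Proof.
apply: (power_bounded_le _ (power_bounded_pow kr_ge1 0 6)) => t.
by rewrite grid_width divr_ge0// sc_w0.
Qed.

Lemma pb_nvar : PB (fun t => (nvar t)%:R) 19 0.
Proof.
have := PBM (PBM pb_ncell pb_ngrid) (power_bounded_cst kr (ler0n R d)).
by apply: power_bounded_le => t; rewrite ler0n/= /nvar !natrM.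
Qed.

Lemma sc_e_gt0 t : 0 < sc_e t.
Proof. by apply: lt_le_trans (sc_ek t); rewrite divr_gt0// kr_gt0. Qed.

Lemma pb_invX (c : R) (p : nat) : 0 < c -> PB (fun t => 1 / (sc_e t / c) ^+ p) p 0.
Proof.
move=> c_gt0; have h : PB (fun t => 1 / (sc_e t / c)) 1 0.
  have := PBM (power_bounded_cst kr (ltW c_gt0)) (power_bounded_pow kr_ge1 1 0).
  apply: power_bounded_le => t; rewrite divr_ge0 ?divr_ge0 ?(ltW (sc_e_gt0 t)) ?(ltW c_gt0)//=.
  rewrite expr0 divr1 expr1 div1r invf_div ler_pM2l//.
  have := sc_ek t; rewrite -/(kr t) ler_pdivrMr ?kr_gt0// mulrC -ler_pdivrMr ?sc_e_gt0//.
  by rewrite div1r.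
have := power_boundedX kr_ge1 p h; rewrite mul1n mul0n.
apply: power_bounded_le => t; rewrite !expr_div_n expr1n lexx andbT.
by rewrite divr_ge0// divr_ge0 ?exprn_ge0 ?(ltW (sc_e_gt0 t)) ?(ltW c_gt0).
Qed.

Lemma pb_sconst : PB sconst 27 0.
Proof.
have k6 : PB (fun t => (nspline t).+1%:R) 6 0.
  have := PBM (power_bounded_cst kr (ler0n R 3)) (power_bounded_pow kr_ge1 6 0).
  apply: power_bounded_le => t; rewrite ler0n/= expr0 divr1 /kr -natrX -natrM ler_nat /nspline.
  have : (0 < kk t ^ 6)%N by rewrite expn_gt0 kk_gt0.
clear; lia.
have e3 := PBM (power_bounded_cst kr (ler0n R 16)) (pb_invX 3 ltr01).
have := power_boundedX kr_ge1 3 (PBM k6 e3).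
apply: power_bounded_le => t; rewrite divr1 mul1r lexx andbT exprn_ge0// mulr_ge0// divr_ge0 ?exprn_ge0 ?(ltW (sc_e_gt0 t))//.
Qed.

Lemma gap_lt_block t : (gap t < block t)%N.
Proof.
have s0 := sc_s0 t; have sL := sc_L t; rewrite /gap /block ltn_exp2l// /lg.
move: s0 sL; clear; lia.
Qed.

Lemma block_scale t : (2 ^ cell_exp t = ratio t * block t)%N.
Proof.
rewrite /ratio /block -expnD; congr (2 ^ _)%N; have sL := sc_L t.
rewrite /cell_exp /lg; move: sL; clear; lia.
Qed.

Lemma pb_sqrt f p q : PB f (p * 2) (q * 2) -> PB (fun t => Num.sqrt (f t)) p q.
Proof.
move=> [c c_ge0 h]; exists (Num.sqrt c); first exact: sqrtr_ge0.
move=> t; rewrite sqrtr_ge0/=; have /andP[_ ft] := h t.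
have e : kr t ^+ (p * 2) / kr t ^+ (q * 2) = (kr t ^+ p / kr t ^+ q) ^+ 2 by rewrite expr_div_n -!exprM.
rewrite e in ft; apply: (le_trans (ler_wsqrtr ft)).
by rewrite sqrtrM// sqrtr_sqr ger0_norm// divr_ge0// ltW// krX_gt0.
Qed.

(** The gap is k^200, and nu >= 3 provides the power 3/2. *)
Lemma pb_gap_power : PB (fun t => ((gap t)%:R `^ (- nu)) `^ 2^-1) 0 300.
Proof.
apply: (power_bounded_le _ (power_bounded_pow kr_ge1 0 300)) => t; rewrite powR_ge0/=.
have g1 : 1 <= (gap t)%:R :> R by rewrite ler1n expn_gt0.
rewrite -powRrM mulNr.
have -> : kr t ^+ 0 / kr t ^+ 300 = (gap t)%:R `^ (- (3 / 2)) :> R.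
  have k0 := ltW (kr_gt0 t); rewrite expr0 div1r powRN; congr (_^-1); rewrite expk.
  rewrite -(powR_mulrn 200 k0) -(powR_mulrn 300 k0) -powRrM; congr (_ `^ _).
  by rewrite mulrA -natrM -[LHS](mulfK (_ : 2 != 0 :> R))// -natrM.
rewrite ler_powR// lerN2 ler_pM2r// ltW//.
Qed.

(** A block has at least k^600 terms, because [sc_L] makes log N at least 800 times log k. *)
Lemma pb_block_power : PB (fun t => (block t)%:R `^ (- 8^-1)) 0 75.
Proof.
apply: (power_bounded_le _ (power_bounded_pow kr_ge1 0 75)) => t; rewrite powR_ge0/=.
have k0 := kr_gt0 t.
have h : kr t ^+ 600 <= (block t)%:R.
  rewrite -expk ler_nat leq_exp2l// /lg; have := sc_L t; clear; lia.
rewrite expr0 powRN div1r lef_pV2 ?posrE ?powR_gt0 ?krX_gt0 ?ltr0n ?expn_gt0//.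
apply: le_trans (_ : (kr t ^+ 600) `^ 8^-1 <= _); last first.
  by rewrite ge0_ler_powR ?nnegrE// exprn_ge0// ltW.
rewrite -!powR_mulrn ?(ltW k0)// -powRrM.
by rewrite (_ : 600%:R / 8 = 75%:R :> R)//; apply: (mulIf (_ : 8 != 0 :> R)) => //; rewrite divfK// -natrM.
Qed.

Let bet t : R := Num.sqrt (@Kw R * B * ((block t)%:R / (sc_N t)%:R)).
Let dlt t : R := Num.sqrt (B * ((gap t)%:R / (sc_N t)%:R)).
Let eps t : R := B / (sc_N t)%:R * ((block t)%:R `^ (7 / 8) + (block t)%:R * sc_eta t + (gap t)%:R).

Lemma pb_bet : PB bet 0 100.
Proof.
apply: (pb_sqrt (p := 0) (q := 100)).
have K0 : 0 <= @Kw R * B by rewrite ltW// mulr_gt0// Kw_gt0.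
exact: PBM (power_bounded_cst kr K0) pb_block.
Qed.

Lemma pb_dlt : PB dlt 0 300.
Proof. apply: (pb_sqrt (p := 0) (q := 300)); exact: PBM (power_bounded_cst kr (ltW B0)) pb_gap. Qed.

(** The rate of the covariances, the sparse error and the gaps contribute k^(-75), k^(-66) and
    k^(-400). *)
Lemma pb_neps : PB (fun t => (nblock t)%:R * eps t) 0 66.
Proof.
have b1 := PBM pb_nblock (PBM pb_block pb_block_power).
have e66 : PB sc_eta 0 66.
  apply: (power_bounded_le _ (power_bounded_pow kr_ge1 0 66)) => t.
  by rewrite sc_eta0 sc_eta66.
have b2 := PBM pb_nblock (PBM pb_block e66).
have b3 := PBM pb_nblock pb_gap.
have b1' := power_bounded_weak kr_ge1 (p' := 0) (q' := 66) b1 isT.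
have b2' := power_bounded_weak kr_ge1 (p' := 0) (q' := 66) b2 isT.
have b3' := power_bounded_weak kr_ge1 (p' := 0) (q' := 66) b3 isT.
have := PBM (power_bounded_cst kr (ltW B0)) (PBD (PBD b1' b2') b3').
apply: power_bounded_le => t.
have m0 : 0 < (block t)%:R :> R by rewrite ltr0n expn_gt0.
have e : (block t)%:R `^ (7 / 8) = (block t)%:R * (block t)%:R `^ (- 8^-1) :> R.
  rewrite -{2}(powRr1 (ltW m0)) -powRD; last by rewrite (gt_eqF m0) implybT.
  by congr (_ `^ _); field.
apply/andP; split.
  rewrite mulr_ge0// mulr_ge0 ?divr_ge0 ?(ltW B0)// !addr_ge0 ?powR_ge0// mulr_ge0// sc_eta0//.
rewrite /eps e le_eqVlt; apply/orP; left; apply/eqP.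
by field; rewrite gt_eqF.
Qed.

(** The five terms have the exponents 200 + 27 + 19 - 300 = -54, then -154, -235, 38 + 27 - 66 = -1
    and -16. The fourth one dictates the power 66 required of [sc_eta]. *)
Lemma lindeberg_error_small : exists2 A, 0 <= A & forall t,
  2 * lindeberg_error C1 nu B (sc_eta t) (sc_N t) (block t) (gap t) (nblock t)
    ('I_(ncell t) * 'I_(ngrid t).+2 * 'I_d)%type (sconst t) <= A / kr t.
Proof.
have cC : 0 <= 4 * C1 + 4 by rewrite addr_ge0 ?mulr_ge0// ltW.
have hC := power_bounded_cst kr cC; have h2 := power_bounded_cst kr (ler0n R 2).
have q2 := power_boundedX kr_ge1 2 pb_nvar.
have q3 := power_boundedX kr_ge1 3 (PBM pb_nvar pb_bet).
have bet2 := power_boundedX kr_ge1 2 pb_bet.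
have t1 := PBM pb_nblock (PBM pb_sconst (PBM pb_nvar pb_dlt)).
have t2 := PBM pb_nblock (PBM pb_nvar (PBM (PBM (PBM hC pb_sconst) pb_bet) pb_gap_power)).
have t3 := PBM pb_nblock (PBM q2 (PBM (PBM (PBM hC pb_sconst) bet2) pb_gap_power)).
have t4 := PBM q2 (PBM pb_sconst pb_neps).
have t5 := PBM pb_nblock (PBM (PBM h2 pb_sconst) q3).
have w f p q (h : PB f p q) := power_bounded_weak kr_ge1 (p' := 0) (q' := 1) h.
have [||||||A A0 hA] := power_bounded_fin kr_ge1 (PBM h2 (PBD (PBD (PBD (PBD (w _ _ _ t1 _) (w _ _ _ t2 _)) (w _ _ _ t3 _)) (w _ _ _ t4 _)) (w _ _ _ t5 _))) => //.
exists A => // t; apply: le_trans (hA t); rewrite /lindeberg_error !card_prod !card_ord -/(nvar t).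
rewrite -/(bet t) -/(dlt t) -/(eps t) le_eqVlt; apply/orP; left; apply/eqP; ring.
Qed.

(** The exponents are 7 + 4 - 12 for space, 19 + 4 - 24 for time and 19 - 20 for the range, each
    equal to -1, with 4 coming from e^(-4). This is the origin of the cells k^(-6) and k^(-12) and
    of the range k^5. *)
Lemma discretization_small (b : R) : 0 <= b -> exists2 A, 0 <= A & forall t,
  ((ngrid t).+2 * d)%:R * (@Kch R * (b * (sc_w t / (ngrid t).+1%:R) ^+ 2 / (sc_e t / 2) ^+ 4)) +
  (nvar t)%:R * (b * ((2 ^ cell_exp t)%:R / (sc_N t)%:R) ^+ 2 / (sc_e t / 2) ^+ 4) +
  (nvar t)%:R * (b / (kr t ^+ 5) ^+ 4) <= A / kr t.
Proof.
move=> b0; have hb := power_bounded_cst kr b0; have hd := power_bounded_cst kr (ler0n R d).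
have hK := power_bounded_cst kr (ltW (@Kch_gt0 R)).
have e4 := pb_invX 4 (ltr0n R 2).
have t1 := PBM (PBM pb_ngrid hd) (PBM hK (PBM (PBM hb (power_boundedX kr_ge1 2 pb_width)) e4)).
have t2 := PBM pb_nvar (PBM (PBM hb (power_boundedX kr_ge1 2 pb_cell)) e4).
have t3 := PBM pb_nvar (PBM hb (power_boundedX kr_ge1 4 (power_bounded_pow kr_ge1 0 5))).
have w f p q (h : PB f p q) := power_bounded_weak kr_ge1 (p' := 0) (q' := 1) h.
have [||||A A0 hA] := power_bounded_fin kr_ge1 (PBD (PBD (w _ _ _ t1 _) (w _ _ _ t2 _)) (w _ _ _ t3 _)) => //.
exists A => // t; apply: le_trans (hA t); by rewrite natrM expr0 !div1r exprVn !mulrA lexx.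
Qed.

End parameters.

Section tight_monotone.
Context {R : realType} {dO : measure_display} {Omega : measurableType dO} (P : probability Omega R).
Context {d : nat} {I : set R}.

Lemma tight_le (N : nat) (Z : R -> R -> 'I_d -> Omega -> R) (b b' : R) : b <= b' ->
  tight (I := I) P N Z b -> tight (I := I) P N Z b'.
Proof.
move=> bb [h1 h2 h3 h4]; split => //.
- move=> u v k e Iu Iv uv e0; apply: small_sub (h2 u v k e Iu Iv uv e0) => //.
  by rewrite ler_pM2r ?invr_gt0 ?exprn_gt0// ler_wpM2r ?sqr_ge0.
- move=> u k j a e Iu jN e0; apply: small_sub (h3 u k j a e Iu jN e0) => //.
  by rewrite ler_pM2r ?invr_gt0 ?exprn_gt0// ler_wpM2r ?sqr_ge0.
- by move=> j u k jN Iu; have [L E] := h4 j u k jN Iu; split => //; exact: le_trans E bb.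
Qed.

End tight_monotone.

(** * The Prokhorov bound at one scale *)

Section bound_at_scale.
Context {R : realType} {dO : measure_display} {Omega : measurableType dO} (P : probability Omega R).
Context {dO' : measure_display} {Omega' : measurableType dO'} (P' : probability Omega' R).
Context {d : nat} {I : set R}.
Variables (Gs : nat -> set (set Omega)) (z : nat -> R -> 'I_d -> Omega -> R).
Variables (c : 'I_d -> 'I_d -> R -> R -> R) (C1 nu B : R) (c0 : nat).
Hypotheses (hC1 : 0 < C1) (nu0 : 0 < nu) (B0 : 0 < B) (c00 : (0 < c0)%N).
Variable s : @scale R c0.
Hypothesis az : array P Gs I z c C1 nu B (sc_eta s).
Variable W : R -> Omega' -> C0 I 'rV[R]_d.
Hypotheses (dI : domain I) (hW : brownian_motion P' c W).
Hypothesis cB : forall k u, I u -> c k k u u <= B.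
Hypothesis cD : forall k u v, I u -> I v -> `|u - v| <= 1 ->
  c k k u u - c k k u v - c k k v u + c k k v v <= B * `|u - v|.
Variables (x y Ct A1 A2 : R).
Hypothesis cz : forall i k w x y, (forall u, x <= u <= y -> I u) ->
  cont_on x y (fun u => z i.+1 u k w).
Hypotheses (Ixy : forall u, x <= u <= y -> I u) (wE : sc_w s = y - x).
Variable Y : Omega -> Linf (`[(0 : R), 1]%classic `*` I) 'rV[R]_d.
Hypothesis mY : measurable_fun setT (Y : Omega -> borel (Linf (`[(0 : R), 1]%classic `*` I) 'rV[R]_d)).
Local Notation N := (sc_N s).
Local Notation e := (sc_e s).
Hypothesis YE : forall w (t u : R) k, 0 <= t <= 1 -> I u -> Y w (t, u) ord0 k = psum z N t u k w.
Hypothesis tailP : small P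
  [set w | exists (t u : R) (k : 'I_d), [/\ 0 <= t <= 1, I u, ~ (x <= u <= y) & e < `|psum z N t u k w|]] (Ct / kr s).
Hypothesis tailW : small P'
  [set w | exists (t u : R) (k : 'I_d), [/\ 0 <= t <= 1, I u, ~ (x <= u <= y) & e < `|W t w u ord0 k|]] (Ct / kr s).
Let b := @Kch R * ((@Kw R * B) ^+ 2 * 4).
Hypothesis hA1 : 2 * lindeberg_error C1 nu B (sc_eta s) (sc_N s) (block s) (gap s) (nblock s)
    ('I_(ncell s) * 'I_(ngrid s).+2 * 'I_d)%type (sconst s) <= A1 / kr s.
Hypothesis hA2 : ((ngrid s).+2 * d)%:R * (@Kch R * (b * (sc_w s / (ngrid s).+1%:R) ^+ 2 / (sc_e s / 2) ^+ 4)) +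
  (nvar d s)%:R * (b * ((2 ^ cell_exp s)%:R / (sc_N s)%:R) ^+ 2 / (sc_e s / 2) ^+ 4) +
  (nvar d s)%:R * (b / (kr s ^+ 5) ^+ 4) <= A2 / kr s.
Hypotheses (A1e : A1 / kr s <= e) (A2e : (A2 + Ct) / kr s <= e) (e1 : e <= 1).

Let N0 : (0 < N)%N := sc_N0 s.
Let b0 : 0 <= b.
Proof. by rewrite mulr_ge0 ?(ltW (@Kch_gt0 R))// mulr_ge0// sqr_ge0. Qed.
Let e0 : 0 < e := sc_e_gt0 s.

Lemma psum_tight_b : tight (I := I) P N (psum z N) b.
Proof.
apply: tight_le (psum_tight az cz N0); rewrite ler_pM2l ?Kch_gt0// ler_pM2r//.
have Kw1 : 1 <= @Kw R by rewrite /Kw; lra.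
by rewrite ler_pXn2r ?nnegrE ?(ltW B0) ?mulr_ge0 ?(ltW B0) ?(ltW (@Kw_gt0 R))// ler_peMl// ltW.
Qed.

Let xy : x <= y. Proof. by rewrite -subr_ge0 -wE sc_w0. Qed.
Let width1 : (y - x) / (ngrid s).+1%:R <= 1.
Proof.
rewrite -wE (le_trans (grid_width c00 s))// ler_pdivrMr ?krX_gt0// mul1r exprn_ege1// kr_ge1//.
Qed.
Let cells : (N < ncell s * 2 ^ cell_exp s)%N.
Proof. by rewrite ltn_ceil// expn_gt0. Qed.
Let M0 : 0 < kr s ^+ 5. Proof. exact: krX_gt0. Qed.

Let total : ((ngrid s).+2 * d)%:R * (@Kch R * (b * ((y - x) / (ngrid s).+1%:R) ^+ 2 / (e / 2) ^+ 4)) +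
  (ncell s * (ngrid s).+2 * d)%:R * (b * ((2 ^ cell_exp s)%:R / N%:R) ^+ 2 / (e / 2) ^+ 4) +
  (ncell s * (ngrid s).+2 * d)%:R * (b / (kr s ^+ 5) ^+ 4) + Ct / kr s <= e.
Proof. by apply: le_trans A2e; rewrite -wE mulrDl lerD2r. Qed.

Lemma prokhorov_at_scale : prokhorov_rv P Y P' (as_Linf W) <= 7 * e.
Proof.
have tP := psum_tight_b; have tW := bm_tight dI hW B0 cB cD N0.
have dP := @discretized_of_tight _ _ _ P d I N _ b b0 tP x y (ngrid s) (ncell s) (cell_exp s) xy Ixy cells width1
  Y _ e (kr s ^+ 5) e0 M0 mY YE tailP total.
have WE w (t u : R) k : 0 <= t <= 1 -> I u -> as_Linf W w (t, u) ord0 k = W t w u ord0 k.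
  by move=> t01 Iu; rewrite (as_LinfE hW).
have dW := @discretized_of_tight _ _ _ P' d I N _ b b0 tW x y (ngrid s) (ncell s) (cell_exp s) xy Ixy cells width1
  (as_Linf W) _ e (kr s ^+ 5) e0 M0 (as_Linf_measurable dI hW) WE tailW total.
apply: (prokhorov_rv_le (m := nspline s) _ e0 e1 (ltW M0) _ dP dW).
- by move=> v v' a a0 h p; exact: rec_lip.
- have ek := sc_ek s; have k0 := kr_gt0 s.
  apply: le_trans (_ : 1 / kr s * (nspline s)%:R <= _).
    rewrite div1r ler_pdivlMl// /nspline natrM natrX mulrCA ler_pM2l// -exprS//.
  rewrite ler_pM ?divr_ge0 ?(ltW k0)// ler_nat//.
  by rewrite -addn4 leq_addr.
- move=> f g H sf; have L0 : 0 < sconst s.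
    by rewrite exprn_gt0// mulr_gt0// divr_gt0// exprn_gt0.
  have bm0 : (0 < block s)%N by rewrite expn_gt0.
  have gl0 : (0 < gap s)%N by rewrite expn_gt0.
  have nm : (nblock s * block s <= N)%N by rewrite leq_divM.
  have Ipt (i : 'I_(ncell s) * 'I_(ngrid s).+2 * 'I_d) : I (grid x y (ngrid s) i.1.2).
    exact: grid_in xy Ixy _.
  have := comparison hC1 nu0 B0 (sc_eta0 s) az dI hW cB (snd : 'I_(ncell s) * 'I_(ngrid s).+2 * 'I_d -> 'I_d)
    (act N (block s) (ratio s) (n := ngrid s)) N0 gl0 (gap_lt_block s) nm Ipt sf L0.
  move=> h; apply: le_trans A1e; apply: le_trans hA1; apply: le_trans h.
  have -> : (fun w => f (gridval N (psum z N) x y (cell_exp s) w)) = (fun w => f (fun i => \sum_(j < nblock s)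
      blockP z N (block s) (fun i : 'I_(ncell s) * 'I_(ngrid s).+2 * 'I_d => grid x y (ngrid s) i.1.2) snd
        (act N (block s) (ratio s) (n := ngrid s)) j w i)).
    apply/funext => w; congr f; apply/funext => i; exact: (gridval_P x y N0 bm0 (block_scale s)).
  rewrite le_eqVlt; apply/orP; left; apply/eqP; congr (`|_ - Ex P' _|).
  apply/funext => w; congr f; apply/funext => i; apply: (gridval_W N x y bm0 (block_scale s) i w).
  exact: bm_start hW.
Qed.

End bound_at_scale.

(** * Tails on the infinite domain *)

(** The exponential of x^kappa exceeds x^(kappa (n + 1)) / (n + 1)!, and n is chosen with kappa (n +
    1) > p. *)
Lemma stretched_exp_decay {R : realType} (kappa : R) (p : nat) : 0 < kappa ->
  exists2 K, 0 < K & forall x : R, 0 <= x -> x ^+ p * expR (- (x `^ kappa)) <= K.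
Proof.
move=> ka0; pose n := Num.truncn (p%:R / kappa).
have n0 : 0 < (n.+1`!)%:R :> R by rewrite ltr0n fact_gt0.
exists (n.+1`!)%:R => // x x0; rewrite expRN ler_pdivrMr ?expR_gt0//.
have f1 : 1 <= (n.+1`!)%:R :> R by rewrite ler1n fact_gt0.
have e1 : 1 <= expR (x `^ kappa) by apply: le_trans (expR_ge1Dx _); rewrite lerDl powR_ge0.
have [x1|x1] := leP x 1.
  by rewrite (le_trans (_ : _ <= 1)) ?exprn_ile1// mulr_ege1.
have := expR_ge1Dxn n (powR_ge0 x kappa).
rewrite -(powR_mulrn n.+1 (powR_ge0 _ _)) -powRrM => h.
have pn : x ^+ p <= x `^ (kappa * n.+1%:R).
  rewrite -powR_mulrn//; apply: ler_powR; first exact: ltW.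
  have := truncnS_gt (p%:R / kappa); rewrite ltr_pdivrMr// -/n mulrC => /ltW//.
apply: (le_trans pn); rewrite -ler_pdivrMl// mulrC; apply: le_trans h.
by rewrite lerDr.
Qed.

Section tail_of_partial_sums.
Context {R : realType} {dO : measure_display} {Omega : measurableType dO}.
Variable P : probability Omega R.
Context {d : nat} {I : set R}.
Local Notation Ex := (Ex P).
Hypothesis IT : forall u, I u.
Variable Y : nat -> Omega -> C0 I 'rV[R]_d.
Hypothesis mY : forall i u k, (0 < i)%N -> measurable_fun setT (fun w => Y i w u ord0 k).
Variables (y tau : R).
Hypothesis tail : forall i, (0 < i)%N ->
  ('E_P[fun w => (supnorm [set u | y < `|u|] (Y i w) ^+ 2)%R] <= tau%:E)%E.

Definition exceeds (i : nat) (k : 'I_d) (c : R) : set Omega :=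
  [set w | exists u, y < `|u| /\ c < `|Y i w u ord0 k|].

(** The paths are continuous, so rational points decide. *)
Lemma exceeds_measurable i k c : (0 < i)%N -> measurable (exceeds i k c).
Proof.
move=> i0; have -> : exceeds i k c =
    \bigcup_(q : rat) (if y < `|ratr q : R| then [set w | c < `|Y i w (ratr q) ord0 k|] else set0).
  apply/seteqP; split => [w [u [yu cu]]|w [q _]]; last first.
    by case: ifP => // yq cq; exists (ratr q).
  have ui : u - 1 <= u <= u + 1 by rewrite gerBl lerDl ler01.
  have e0 : 0 < `|Y i w u ord0 k| - c by rewrite subr_gt0.
  have [dl dl0 h] := C0_cont_in (Y i w) (fun u _ => IT u) ui e0.
  have r0 : 0 < Num.min dl (Num.min (`|u| - y) 1) by rewrite !lt_min dl0 subr_gt0 yu ltr01.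
  set r := Num.min _ _ in r0; have [q] := @rat_in_itvoo R (u - r) (u + r) ltac:(by rewrite ltrBlDr -addrA ltrDl addr_gt0).
  rewrite in_itv/= => /andP[q1 q2].
  have uq : `|u - ratr q| < r by rewrite ltr_norml; apply/andP; split; lra.
  move: (uq); rewrite !lt_min => /andP[ud /andP[uy u1]].
  exists q => //; have yq : y < `|ratr q : R|.
    have := lerB_normD u (- ratr q); rewrite normrN; lra.
  rewrite yq /=; have qi : u - 1 <= ratr q <= u + 1.
    by move: u1; rewrite ltr_norml => /andP[? ?]; apply/andP; split; lra.
  have := h _ qi ud; have := rV_coord_le (Y i w u - Y i w (ratr q)) k; rewrite !mxE => h1 h2.
  have := lerB_normD (Y i w u ord0 k) (- Y i w (ratr q) ord0 k); rewrite normrN.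
  move: (le_lt_trans h1 h2); lra.
apply: bigcupT_measurable_rat => q; case: ifP => // _.
rewrite (_ : [set w | _] = (fun w => `|Y i w (ratr q) ord0 k|) @^-1` `]c, +oo[%classic); last first.
  by apply/seteqP; split => w /=; rewrite in_itv/= andbT.
rewrite -[X in measurable X]setTI.
have m1 : measurable_fun setT (fun w => `|Y i w (ratr q) ord0 k|).
  by apply: measurableT_comp => //; exact: mY.
exact: m1.
Qed.

Let le_sup i u k w : y < `|u| -> `|Y i w u ord0 k| <= supnorm [set u | y < `|u|] (Y i w).
Proof.
move=> yu; apply: le_trans (rV_coord_le _ _) _; apply: (supnorm_ub (A := [set u | y < `|u|])) => //.
exact: Linf_bounded_on.
Qed.

Let sup0 i w : 0 <= supnorm [set u | y < `|u|] (Y i w).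
Proof. exact: supnorm_ge0. Qed.

Lemma exceeds_small i k c : (0 < i)%N -> 0 < c -> small P (exceeds i k c) (tau / c ^+ 2).
Proof.
move=> i0 c0; have mE := exceeds_measurable k c i0; apply: small_meas => //.
have c2 : 0 < c ^+ 2 by rewrite exprn_gt0.
have [|||L E] := L1_expectation_le (P := P) (f := fun w => c ^+ 2 * \1_(exceeds i k c) w) _ _ _ (tail i0).
- by apply: measurable_funM => //; exact: measurable_indic.
- by move=> w; rewrite mulr_ge0 ?(ltW c2)// indicE.
- move=> w; rewrite indicE; case: (boolP (w \in _)) => [|_]; last by rewrite mulr0 sqr_ge0.
  rewrite inE => -[u [yu cu]]; rewrite mulr1 ler_pXn2r ?nnegrE ?(ltW c0)//.
  exact: le_trans (ltW cu) (le_sup _ _ _ _).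
rewrite ler_pdivlMr// mulrC -Pr_indic// -ExZ//.
exact: L1_indic.
Qed.

Lemma tail_sqr i u k : (0 < i)%N -> y < `|u| ->
  L1 P (fun w => Y i w u ord0 k ^+ 2) /\ Ex (fun w => Y i w u ord0 k ^+ 2) <= tau.
Proof.
move=> i0 yu; apply: L1_expectation_le (tail i0).
- by apply: measurable_funX; exact: mY.
- by move=> w; exact: sqr_ge0.
- by move=> w; rewrite -[leLHS]real_normK ?num_real// ler_pXn2r ?nnegrE// le_sup.
Qed.

Lemma tail_mean i u k : (0 < i)%N -> y < `|u| -> `|Ex (fun w => Y i w u ord0 k)| ^+ 2 <= tau.
Proof.
move=> i0 yu; rewrite real_normK ?num_real//; have [L2 h] := tail_sqr k i0 yu; apply: le_trans h.
have [] := Ex_CS (P := P) (mY u k i0) (measurable_cst (1 : R)) L2 _.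
  by rewrite (_ : (fun w => _) = cst 1); [exact: L1_cst|apply/funext => w; rewrite /= expr1n].
move=> _; rewrite (_ : (fun w => _ * _) = (fun w => Y i w u ord0 k)); last by apply/funext => w; rewrite /= mulr1.
rewrite (_ : (fun w => cst 1 w ^+ 2) = cst 1); last by apply/funext => w; rewrite /= expr1n.
by rewrite Ex_cst mulr1.
Qed.

(** A union bound over the N summands that ignores their cancellation; the stretched exponential
    tail will absorb the powers of N. *)
Lemma psum_tail (N : nat) (e : R) : (0 < d)%N -> (0 < N)%N -> 0 < e ->
  small P [set w | exists (t u : R) (k : 'I_d), [/\ 0 <= t <= 1, y < `|u| &
      e < `|psum (centered P Y) N t u k w|]] ((N * d)%:R * (tau * (4 * N%:R / e ^+ 2))).
Proof.
move=> d0 N0 e0; have NR : 0 < N%:R :> R by rewrite ltr0n.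
have sN0 : 0 < Num.sqrt N%:R :> R by rewrite sqrtr_gt0.
(* N summands, each with value and mean at most c, give 2 c N^(1/2) = e after normalisation. *)
pose c := e / (2 * Num.sqrt N%:R); have c0 : 0 < c by rewrite divr_gt0// mulr_gt0.
have c2 : c ^+ 2 = e ^+ 2 / (4 * N%:R).
  by rewrite /c expr_div_n exprMn sqr_sqrtr ?(ltW NR)// -[2 ^+ 2]natrX.
have cE : tau * (4 * N%:R / e ^+ 2) = tau / c ^+ 2 by rewrite c2 invf_div.
(* If tau exceeds c^2 the asserted bound is at least 1. *)
have [tc|ct] := leP tau (c ^+ 2); last first.
  apply: (small_sub (B := setT) (c := 1)) => //; last by apply: small_meas => //; exact: Pr_le1.
  rewrite cE mulr_ege1 ?ler1n ?muln_gt0 ?N0//.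
  by rewrite ler_pdivlMr ?exprn_gt0// mul1r ltW.
rewrite cE; have := small_bigU_cst (fun i : 'I_N * 'I_d => exceeds_small i.2 (ltn0Sn i.1) c0).
rewrite card_prod !card_ord; apply: small_sub => // w [t [u [k [t01 yu eh]]]].
apply: contrapT => nex; move: eh; apply/negP; rewrite -leNgt.
have Yc (i : 'I_N) : `|Y i.+1 w u ord0 k| <= c.
  by rewrite leNgt; apply/negP => h; apply: nex; exists (i, k), u.
have Ec i : `|Ex (fun w => Y i.+1 w u ord0 k)| <= c.
  by rewrite -(@ler_pXn2r _ 2) ?nnegrE ?(ltW c0)//; apply: le_trans tc; exact: tail_mean.
have tN : (Num.truncn (t * N%:R) <= N)%N.
  have /andP[t0 t1] := t01; rewrite -(@ler_nat R); apply: le_trans (_ : t * N%:R <= _).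
    by rewrite truncn_le mulr_ge0.
  by rewrite ler_piMl.
rewrite /psum normrM ger0_norm ?invr_ge0 ?sqrtr_ge0// ler_pdivrMl//.
apply: (@le_trans _ _ (N%:R * (2 * c))); last first.
  rewrite -[N%:R in leLHS](sqr_sqrtr (ltW NR)) /c le_eqVlt; apply/orP; left; apply/eqP.
  by field; rewrite gt_eqF.
apply: le_trans (ler_norm_sum _ _ _) _.
apply: (@le_trans _ _ (\sum_(i < Num.truncn (t * N%:R)) (2 * c))); last first.
  by rewrite sumr_const card_ord -[leLHS]mulr_natl ler_wpM2r ?ler_nat// mulr_ge0// ltW.
apply: ler_sum => i _; rewrite /centered mulr_natl mulr2n (le_trans (ler_normB _ _))// lerD//.
exact: (Yc (Ordinal (leq_trans (ltn_ord i) tN))).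
Qed.

End tail_of_partial_sums.

Section tail_of_brownian_motion.
Context {R : realType} {dO : measure_display} {Omega : measurableType dO}.
Variable P : probability Omega R.
Context {d : nat} {I : set R}.
Hypothesis IT : forall u, I u.
Variables (W : R -> Omega -> C0 I 'rV[R]_d) (c : 'I_d -> 'I_d -> R -> R -> R).
Hypotheses (dI : domain I) (hW : brownian_motion P c W).
Variable B : R.
Hypothesis B0 : 0 < B.
Hypothesis cB : forall k u, I u -> c k k u u <= B.
Hypothesis cD : forall k u v, I u -> I v -> `|u - v| <= 1 ->
  c k k u u - c k k u v - c k k v u + c k k v v <= B * `|u - v|.

(** Half of e is spent on chaining inside q subcells, with the global constant B, the other half on
    the q + 1 grid points, where the small variance v enters. *)
Lemma bm_cell (x v e : R) (q : nat) : (0 < q)%N -> 0 < e ->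
  (forall k u, x <= u <= x + 1 -> c k k u u <= v) ->
  small P [set w | exists (t u : R) (k : 'I_d), [/\ 0 <= t <= 1, x <= u <= x + 1 & e < `|W t w u ord0 k|]]
    ((q.+1 * d)%:R * (@Kch R * ((@Kch R * ((@Kw R * B) ^+ 2 * 4)) * q%:R^-1 ^+ 2 / (e / 2) ^+ 4) +
      @Kch R * ((@Kw R * v) ^+ 2 * 4 / (e / 2) ^+ 4))).
Proof.
move=> q0 e0 cv; have e20 : 0 < e / 2 by rewrite divr_gt0.
have xx : x <= x + 1 by rewrite lerDl.
have qE : q.-1.+1 = q by rewrite prednK.
have w1 : (x + 1 - x) / q.-1.+1%:R = q%:R^-1 by rewrite qE addrC addrA addNr add0r div1r.
have b0 : 0 <= @Kch R * ((@Kw R * B) ^+ 2 * 4) by rewrite mulr_ge0 ?(ltW (@Kch_gt0 R))// mulr_ge0// sqr_ge0.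
have w2 : (x + 1 - x) / q.-1.+1%:R <= 1 by rewrite w1 invf_le1 ?ltr0n// ler1n.
have tW := bm_tight dI hW B0 cB cD (erefl : (0 < 1)%N).
have Ixx u : x <= u <= x + 1 -> I u by [].
have gi (g : 'I_q.-1.+2) : x <= grid x (x + 1) q.-1 g <= x + 1.
  exact: (grid_in (I := [set u | x <= u <= x + 1]) xx (fun u h => h)).
have s i := smallU (space_small b0 tW xx Ixx w2 i.1 i.2 e20) (bm_small (k := i.2) dI hW e20 (Ixx _ (gi i.1)) (cv i.2 _ (gi i.1))).
have := small_bigU_cst (J := ('I_q.-1.+2 * 'I_d)%type) s.
rewrite card_prod !card_ord w1; apply: small_sub; last by rewrite qE.
move=> w [t [u [k [t01 ux h]]]].
have [cn _ _] := grid_cell q.-1 ux.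
exists (Ordinal (cn : (cell x (x + 1) q.-1 u < q.-1.+2)%N), k); set g := Ordinal _.
have [h1|h1] := ltP (e / 2) `|W t w (grid x (x + 1) q.-1 g) ord0 k|; first by right; exists t.
left; exists t, u; split => //=.
have := lerB_normD (W t w u ord0 k) (- W t w (grid x (x + 1) q.-1 g) ord0 k); rewrite normrN.
by move: h h1; rewrite /=; lra.
Qed.

Definition Dtail (Cv : R) : R :=
  64 * d%:R * (@Kch R * (@Kch R * ((@Kw R * B) ^+ 2 * 4)) + @Kch R * ((@Kw R * Cv) ^+ 2 * 4)).

Lemma Dtail_ge0 Cv : 0 <= Dtail Cv.
Proof.
have K0 := ltW (@Kch_gt0 R).
have sq x : 0 <= @Kch R * (x ^+ 2 * 4) := mulr_ge0 K0 (mulr_ge0 (sqr_ge0 x) (ler0n R 4)).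
exact: mulr_ge0 (mulr_ge0 (ler0n R 64) (ler0n R d)) (addr_ge0 (mulr_ge0 K0 (sq _)) (sq _)).
Qed.

Lemma cell_cost (Cv e : R) (j : nat) : (0 < j)%N -> 0 < e ->
  ((j ^ 7).+1 * d)%:R * (@Kch R * ((@Kch R * ((@Kw R * B) ^+ 2 * 4)) * ((j ^ 7)%:R^-1) ^+ 2 / (e / 2) ^+ 4) +
      @Kch R * ((@Kw R * (Cv / j%:R ^+ 7)) ^+ 2 * 4 / (e / 2) ^+ 4)) <= Dtail Cv / e ^+ 4 / j%:R ^+ 7 / 2.
Proof.
move=> j0 e0; have jR : 0 < j%:R :> R by rewrite ltr0n.
have j7 : 0 < j%:R ^+ 7 :> R by rewrite exprn_gt0.
rewrite natrM natrX; set x : R := j%:R ^+ 7 in j7 *.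
have x1 : (j ^ 7).+1%:R <= 2 * x.
  have : 1 <= x by rewrite exprn_ege1// ler1n.
  by rewrite -natr1 natrX -/x; lra.
set K := @Kch R * ((@Kw R * B) ^+ 2 * 4).
have -> : @Kch R * (K * x^-1 ^+ 2 / (e / 2) ^+ 4) + @Kch R * ((@Kw R * (Cv / x)) ^+ 2 * 4 / (e / 2) ^+ 4) =
    16 * (@Kch R * K + @Kch R * ((@Kw R * Cv) ^+ 2 * 4)) / (x ^+ 2 * e ^+ 4).
  by field; rewrite !gt_eqF.
have K0 := ltW (@Kch_gt0 R).
have D0 : 0 <= 16 * (@Kch R * K + @Kch R * ((@Kw R * Cv) ^+ 2 * 4)) / (x ^+ 2 * e ^+ 4).
  apply: divr_ge0; last by rewrite mulr_ge0 ?exprn_ge0 ?(ltW e0) ?(ltW j7).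
  have sq y : 0 <= @Kch R * (y ^+ 2 * 4) := mulr_ge0 K0 (mulr_ge0 (sqr_ge0 y) (ler0n R 4)).
  exact: mulr_ge0 (ler0n R 16) (addr_ge0 (mulr_ge0 K0 (sq _)) (sq _)).
apply: le_trans (ler_wpM2r D0 (ler_wpM2r (ler0n R d) x1)) _.
rewrite le_eqVlt; apply/orP; left; apply/eqP; rewrite /Dtail -/K.
by field; rewrite !gt_eqF.
Qed.

(** (k + i)^7 >= (i + 1)^2 k^5, and the inverse squares are summed through the series with exponent
    9/8. *)
Lemma sum_shifted_pow7 (k n : nat) : (0 < k)%N ->
  \sum_(i < n) ((k + i)%:R ^+ 7 : R)^-1 <= 9 / k%:R ^+ 5.
Proof.
move=> k0; have kR : 0 < k%:R :> R by rewrite ltr0n.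
apply: (@le_trans _ _ (\sum_(i < n) (i.+1%:R `^ (- (9 / 8))) / k%:R ^+ 5)); last first.
  by rewrite -mulr_suml ler_pM2r ?invr_gt0 ?exprn_gt0// sum_pow98.
apply: ler_sum => i _; have i1 : 1 <= i.+1%:R :> R by rewrite ler1n.
have i0 := lt_le_trans ltr01 i1.
have ki : k%:R <= (k + i)%:R :> R by rewrite ler_nat leq_addr.
have ik : i.+1%:R <= (k + i)%:R :> R by rewrite ler_nat -add1n leq_add2r.
apply: (@le_trans _ _ ((i.+1%:R ^+ 2)^-1 / k%:R ^+ 5)).
  have ki0 := lt_le_trans kR ki.
  rewrite -invfM lef_pV2 ?posrE ?mulr_gt0 ?exprn_gt0//.
  rewrite (exprD (k + i)%:R 2 5) ler_pM ?exprn_ge0 ?(ltW i0) ?(ltW kR)//.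
    by rewrite ler_pXn2r ?nnegrE ?(ltW i0) ?(le_trans (ltW i0)).
  by rewrite ler_pXn2r ?nnegrE ?(ltW kR) ?(le_trans (ltW kR)).
rewrite ler_pM2r ?invr_gt0 ?exprn_gt0// -powR_mulrn ?(ltW i0)// -powRN ler_powR// lerN2.
by rewrite ler_pdivrMr// -natrM ler_nat.
Qed.

(* On the unit cells at distance [j] the variance is O(j^-7): cutting them into
   j^7 subcells makes the chaining bound and the bound at the grid points both
   O(j^-7), which is summable. *)
Lemma bm_tail (Cv e : R) (k0 : nat) : (0 < k0)%N -> 0 < e ->
  (forall k u (j : nat), (k0 <= j)%N -> j%:R <= `|u| -> c k k u u <= Cv / j%:R ^+ 7) ->
  small P [set w | exists (t u : R) (k : 'I_d), [/\ 0 <= t <= 1, k0%:R < `|u| & e < `|W t w u ord0 k|]]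
    (9 * (Dtail Cv / e ^+ 4) / k0%:R ^+ 5).
Proof.
move=> k00 e0 cv.
pose A (x : R) := [set w | exists (t u : R) (k : 'I_d), [/\ 0 <= t <= 1, x <= u <= x + 1 & e < `|W t w u ord0 k|]].
pose F i := A (k0 + i)%:R `|` A (- (k0 + i)%:R - 1).
have sF i : small P (F i) (Dtail Cv / e ^+ 4 / (k0 + i)%:R ^+ 7).
  have j0 : (0 < k0 + i)%N by rewrite addn_gt0 k00.
  have q0 : (0 < (k0 + i) ^ 7)%N by rewrite expn_gt0 j0.
  have jR : 0 <= (k0 + i)%:R :> R by [].
  have h1 := @bm_cell (k0 + i)%:R (Cv / (k0 + i)%:R ^+ 7) e _ q0 e0 _.
  have h2 := @bm_cell (- (k0 + i)%:R - 1) (Cv / (k0 + i)%:R ^+ 7) e _ q0 e0 _.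
  apply: (small_sub (fun w h => h) _ (smallU (h1 _) (h2 _))).
  - by rewrite [leRHS]splitr lerD//; exact: cell_cost.
  - move=> k u /andP[ju _]; apply: cv; first exact: leq_addr.
    by rewrite (le_trans ju)// ler_norm.
  - move=> k u /andP[_ uj]; apply: cv; first exact: leq_addr.
    by rewrite -normrN (le_trans _ (ler_norm _))//; move: uj; rewrite subrK lerNr.
have := small_series sF (C := 9 * (Dtail Cv / e ^+ 4) / k0%:R ^+ 5).
move=> H; apply: (small_sub _ (lexx _) (H _)); last first.
  move=> n; rewrite -mulr_sumr (mulrC 9) -[leRHS]mulrA; apply: ler_wpM2l (sum_shifted_pow7 n k00).
  by rewrite divr_ge0 ?Dtail_ge0// exprn_ge0// ltW.
move=> w [t [u [k [t01 ku eh]]]]; have u0 := normr_ge0 u.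
have /andP[j1 j2] := truncn_itv u0; set j := Num.truncn `|u| in j1 j2.
have kj : (k0 <= j)%N by rewrite -ltnS -(ltr_nat R); exact: lt_trans ku j2.
exists (j - k0)%N => //; rewrite /F subnKC// -natr1 in j2 *.
have [up|un] := leP 0 u.
  by left; exists t, u, k; split => //; move: j1 j2; rewrite ger0_norm// => -> /ltW.
right; exists t, u, k; split => //; move: j1 j2; rewrite ltr0_norm// => h1 h2.
by apply/andP; split; lra.
Qed.

End tail_of_brownian_motion.

(** * The rate of convergence *)

Section sparse_estimators_bound.
Context {R : realType} {dO : measure_display} {Omega : measurableType dO}.
Variable P : probability Omega R.
Context {d : nat} {I1 : set R}.
Variables (X : nat -> Omega -> C0 I1 'rV[R]_d) (S : nat -> pmetricType R).
Variable delta : nat -> forall M : nat, Omega -> S M.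
Variable A : forall (M : nat) (I : set R), C0 I1 'rV[R]_d * S M -> C0 I 'rV[R]_d.
Variables (I2 : nat -> set R) (MN : nat -> nat).
Variables (C1 C2 C3 J nu xi gamma : R).
Hypotheses (hC1 : 0 < C1) (hC2 : 0 < C2) (hC3 : 0 < C3)
  (hJ : 4 < J) (hxi : 2^-1 < xi) (hnu : 0 < nu) (hJnu : 3 + 9 / (J - 4) < nu)
  (hgamma : 0 < gamma).
Hypothesis se : sparse_estimators X delta A I2 MN.
Hypothesis aA : assumptionA P X delta A I2 MN C1 C2 C3 J nu xi gamma.
Variable N : nat.
Hypothesis N0 : (0 < N)%N.
Local Notation Ex := (Ex P).
Local Notation I := (I2 N).
Local Notation Sp := (sparse X delta A (MN N) (I2 N)).
Local Notation c := (long_run_variance P X).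

Let J1 : 1 <= J. Proof. by rewrite ltW// (lt_trans _ hJ)// ltr1n. Qed.

Lemma sparse_measurable i : (0 < i)%N -> measurable_fun setT (Sp i : Omega -> borel (C0 I 'rV[R]_d)).
Proof.
move=> i0; have M0 := se_MN_gt0 se N0.
apply: (measurableT_comp (se_measurable_A se M0 N0)); exact: joint_measurable se _ N0 _ i0.
Qed.

Lemma sparse_coord_measurable i u k : (0 < i)%N -> measurable_fun setT (fun w => Sp i w u ord0 k).
Proof. by move=> i0; apply: gmeas_measurable (gmeas_sparse se N0 u k i0); exact: (Gjoint_sub se N0). Qed.

Lemma sparse_mean i u k : (0 < i)%N -> I u ->
  `|Ex (fun w => Sp i w u ord0 k)| <= 2 * (4 * (C2 `^ J^-1 + C3 `^ J^-1)).
Proof.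
move=> i0 Iu; have b0 : 0 < 4 * (C2 `^ J^-1 + C3 `^ J^-1) by rewrite mulr_gt0// addr_gt0// powR_gt0.
exact: (LJ_L1 J1 b0 (LJ_S hC2 hC3 hJ hgamma se aA N0 k i0 Iu)).2.
Qed.

(** The path is continuous, and the mean inherits continuity from the Hoelder moment bound. *)
Lemma sparse_cont i k w x y : (forall u, x <= u <= y -> I u) ->
  cont_on x y (fun u => centered P Sp i.+1 u k w).
Proof.
move=> Ixy u e ui e0; have Iu := Ixy _ ui.
have [d1 d10 h1] := C0_cont_in (Sp i.+1 w) Ixy ui (divr_gt0 e0 (ltr0n R 2)).
set c2 := C3 `^ J^-1; have c20 : 0 < c2 by exact: powR_gt0.
have xi0 : 0 < xi by rewrite (lt_trans _ hxi)// invr_gt0.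
pose r := e / (8 * c2); have r0 : 0 < r by rewrite divr_gt0// mulr_gt0.
exists (Num.min d1 (r `^ xi^-1)); first by rewrite lt_min d10 powR_gt0.
move=> v vi; rewrite lt_min => /andP[uv1 uv2]; have Iv := Ixy _ vi.
have [->|uv] := eqVneq u v; first by rewrite subrr normr0.
have L z : I z -> L1 P (fun w => Sp i.+1 w z ord0 k).
  move=> Iz; have b0 : 0 < 4 * (C2 `^ J^-1 + C3 `^ J^-1) by rewrite mulr_gt0// addr_gt0// powR_gt0.
  exact: (LJ_L1 J1 b0 (LJ_S hC2 hC3 hJ hgamma se aA N0 k (ltn0Sn i) Iz)).1.
have uv0 : 0 < `|u - v| by rewrite normr_gt0 subr_eq0.
have b0 : 0 < `|u - v| `^ xi * c2 by rewrite mulr_gt0// powR_gt0.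
have [_ hE] := LJ_L1 J1 b0 (LJ_Sdiff hC3 hJ se aA N0 k (ltn0Sn i) Iu Iv uv).
rewrite (ExB (L _ Iu) (L _ Iv)) in hE.
have pr : `|u - v| `^ xi <= r.
  rewrite -[r](powRr1 (ltW r0)) -(mulVf (lt0r_neq0 xi0)) powRrM.
  by rewrite ge0_ler_powR ?nnegrE ?powR_ge0 ?(ltW xi0)// ltW.
have E4 : 2 * (`|u - v| `^ xi * c2) <= e / 4.
  rewrite mulrA -ler_pdivlMr// mulrC -ler_pdivlMr// (le_trans pr)// /r le_eqVlt; apply/orP; left; apply/eqP.
  by field; rewrite gt_eqF.
have h2 := h1 v vi uv1; have h3 := rV_coord_le (Sp i.+1 w u - Sp i.+1 w v) k; rewrite !mxE in h3.
have h4 := le_lt_trans h3 h2; rewrite /centered.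
set a := Sp _ _ u _ _ in h4 *; set a' := Sp _ _ v _ _ in h4 *.
set m := Ex _ in hE *; set m' := Ex _ in hE *.
rewrite (_ : _ - _ = (a - a') - (m - m')); last by ring.
by rewrite (le_lt_trans (ler_normB _ _))//; lra.
Qed.

Context {dO' : measure_display} {Omega' : measurableType dO'} (P' : probability Omega' R).
Variable W : R -> Omega' -> C0 I 'rV[R]_d.
Hypothesis hW : brownian_motion P' c W.

Let dI : domain I := (se_domain2 se N0).1.
Let csym k l u v (Iu : I u) (Iv : I v) : c k l u v = c l k v u := bm_sym dI hW k l Iu Iv.

Lemma partial_sums_measurable : measurable_fun setT
  (partial_sum_process P Sp N : Omega -> borel (Linf (`[0, 1]%classic `*` I) 'rV[R]_d)).
Proof. exact: (partial_sum_measurable dI N0 (fun i i0 => sparse_measurable i0) (fun i u k i0 Iu => sparse_mean k i0 Iu)). Qed.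

(** The trivial bound, for those N that are too small for the choice of scales. *)
Lemma prokhorov_le1 : prokhorov_rv P (partial_sum_process P Sp N) P' (as_Linf W) <= 1.
Proof.
apply: prokhorov_le => // B mB.
have mP : measurable (partial_sum_process P Sp N @^-1` B).
  by rewrite -[X in measurable X]setTI; exact: partial_sums_measurable.
have mW : measurable (as_Linf W @^-1` B).
  by rewrite -[X in measurable X]setTI; exact: (as_Linf_measurable dI hW).
have mE : measurable (enlargement B 1 : set (borel (Linf (`[(0 : R), 1]%classic `*` I) 'rV[R]_d))).
  by apply: sub_sigma_algebra; exact: open_enlargement.
split; rewrite /pushforward; apply: (le_trans (probability_le1 _ _)) => //; exact: leeDr.
Qed.

Section at_scale.
Variables (c0 : nat) (s : @scale R c0) (x y Ct A1 A2 : R).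
Hypotheses (c00 : (0 < c0)%N) (sN : sc_N s = N) (seta : sc_eta s = N%:R `^ (- (gamma / J))).
Hypotheses (Ixy : forall u, x <= u <= y -> I u) (wE : sc_w s = y - x).
Let B := Bz C1 C2 C3 J.
Hypothesis tailP : small P [set w | exists (t u : R) (k : 'I_d),
  [/\ 0 <= t <= 1, I u, ~ (x <= u <= y) & sc_e s < `|psum (centered P Sp) N t u k w|]] (Ct / kr s).
Hypothesis tailW : small P' [set w | exists (t u : R) (k : 'I_d),
  [/\ 0 <= t <= 1, I u, ~ (x <= u <= y) & sc_e s < `|W t w u ord0 k|]] (Ct / kr s).
Hypothesis hA1 : 2 * lindeberg_error C1 nu B (sc_eta s) (sc_N s) (block s) (gap s) (nblock s)
    ('I_(ncell s) * 'I_(ngrid s).+2 * 'I_d)%type (sconst s) <= A1 / kr s.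
Let b := @Kch R * ((@Kw R * B) ^+ 2 * 4).
Hypothesis hA2 : ((ngrid s).+2 * d)%:R * (@Kch R * (b * (sc_w s / (ngrid s).+1%:R) ^+ 2 / (sc_e s / 2) ^+ 4)) +
  (nvar d s)%:R * (b * ((2 ^ cell_exp s)%:R / (sc_N s)%:R) ^+ 2 / (sc_e s / 2) ^+ 4) +
  (nvar d s)%:R * (b / (kr s ^+ 5) ^+ 4) <= A2 / kr s.
Hypotheses (A1e : A1 / kr s <= sc_e s) (A2e : (A2 + Ct) / kr s <= sc_e s) (e1 : sc_e s <= 1).

Lemma sparse_prokhorov : prokhorov_rv P (partial_sum_process P Sp N) P' (as_Linf W) <= 7 * sc_e s.
Proof.
have az : array P (Gjoint X delta MN N) I (centered P Sp) c C1 nu B (sc_eta s).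
  by rewrite seta; exact: (array_model hC1 hC2 hC3 hJ hxi hnu hJnu hgamma se aA N0 csym).
apply: (prokhorov_at_scale hC1 hnu (Bz_gt0 J hC1 hC2 hC3) c00 az dI hW _ _ sparse_cont Ixy wE
  partial_sums_measurable _ _ tailW hA1 hA2 A1e A2e e1).
- by move=> k u Iu; have /andP[] := lrv_bound hC1 hC2 hC3 hJ hnu hJnu se aA N0 csym k Iu.
- move=> k u v Iu Iv uv; exact: (lrv_diff hC1 hC2 hC3 hJ hxi hnu hJnu se aA N0 csym).
- by move=> w t u k t01 Iu; rewrite sN; exact: (partial_sum_processE N (fun i u k i0 Iu => sparse_mean k i0 Iu)).
- by rewrite sN.
Qed.

End at_scale.

Section infinite_domain.
Hypotheses (d0 : (0 < d)%N) (IT : forall u, I u).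
Variables (C5 kappa : R).
Hypotheses (hC5 : 0 < C5) (hka : 0 < kappa).
Hypothesis tX : forall n (y : R), (0 < n)%N -> 0 < y ->
  ('E_P[fun w => ((supnorm [set u | (y < `|u|)%R] (X n w)) ^+ 2)%R] <= (C5 * expR (- (y `^ kappa)))%:E)%E.
Hypothesis tS : forall n (y : R), (0 < n)%N -> 0 < y ->
  ('E_P[fun w => ((supnorm [set u | (y < `|u|)%R] (Sp n w)) ^+ 2)%R] <= (C5 * expR (- (y `^ kappa)))%:E)%E.
Variable K63 : R.
Hypothesis hK63 : forall x : R, 0 <= x -> x ^+ 63 * expR (- (x `^ kappa)) <= K63.

Definition Ctail : R := 3 * C5 * (2 ^+ 63 * K63) + 16 * Dz C1 C2 C3 J.

(** [lrv_decay] with j^56 lags: mixing leaves (j^56)^(-1/8) = j^(-7), and the lags kept cost j^56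
    times a variance of order exp(-(j/2)^kappa), whence the power 63 = 56 + 7. The tail assumption
    concerns |u| > y strictly, so it is used at y = j/2. *)
Lemma lrv_tail k u (j : nat) : (0 < j)%N -> j%:R <= `|u| -> c k k u u <= Ctail / j%:R ^+ 7.
Proof.
move=> j0 ju; have jR : 0 < j%:R :> R by rewrite ltr0n.
have j20 : 0 < j%:R / 2 :> R by rewrite divr_gt0.
have j2u : j%:R / 2 < `|u| by rewrite (lt_le_trans _ ju)// ltr_pdivrMr// ltr_pMr// ltr1n.
pose tau := C5 * expR (- ((j%:R / 2) `^ kappa)).
have tau0 : 0 <= tau by rewrite mulr_ge0 ?expR_ge0// ltW.
have mX i u' k' : (0 < i)%N -> measurable_fun setT (fun w => X i w u' ord0 k').
  by move=> i0; apply: C0_coord_measurable; exact: se_measurable_X se _ i0.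
have h : forall i, (0 < i)%N -> Ex (fun w => centered P X i u k w ^+ 2) <= tau.
  move=> i i0; have [L2 E2] := tail_sqr mX (fun i i0 => tX i0 j20) k i0 j2u.
  have L := (LJ_L1 J1 (powR_gt0 J^-1 hC2) (LJ_X hC2 hJ se aA N0 u k i0)).1.
  set m := Ex (fun w => X i w u ord0 k).
  rewrite (_ : (fun w => _) = (fun w => (X i w u ord0 k ^+ 2 - (2 * m) * X i w u ord0 k) + cst (m ^+ 2) w)); last first.
    by apply/funext => w; rewrite /centered -/m /=; ring.
  rewrite (ExD (L1B L2 (L1Z (2 * m) L)) (L1_cst P _)) (ExB L2 (L1Z (2 * m) L)) (ExZ _ L) (Ex_cst P) -/m.
  apply: le_trans E2; rewrite -mulrA -[m * m]expr2 -addrA gerDl.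
  by have := sqr_ge0 m; lra.
have q0 : (0 < j ^ 56)%N by rewrite expn_gt0 j0.
have := lrv_decay hC1 hC2 hC3 hJ hnu hJnu se aA N0 (j ^ 56).-1 (IT u) tau0 h.
rewrite prednK// natrX => hd; apply: (le_trans hd); rewrite /Ctail [leRHS]mulrDl lerD//; last first.
  rewrite ler_wpM2l//; last first.
    rewrite -powR_mulrn ?(ltW jR)// -powRrM -powR_mulrn ?(ltW jR)// -powRN ler_powR ?ler1n//.
    by rewrite mulrN lerN2 mulrA mulr1 ler_pdivlMr// -natrM.
  have Kz0 := Kz_gt0 J hC2 hC3.
  have C40 : 0 <= 4 * C1 + 10 by rewrite addr_ge0// mulr_ge0// ltW.
  exact: mulr_ge0 (ler0n R 16) (mulr_ge0 (mulr_ge0 (mulr_ge0 (ler0n R 4) C40) (ltW Kz0)) (ltW Kz0)).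
have hK := hK63 (ltW j20); set E := expR _ in hK.
have E0 : 0 <= E := expR_ge0 _.
rewrite ler_pdivlMr ?exprn_gt0// /tau -/E.
have e63 : j%:R ^+ 63 = 2 ^+ 63 * (j%:R / 2) ^+ 63 :> R by rewrite -exprMn mulrCA divff// mulr1.
apply: (@le_trans _ _ (3 * C5 * (j%:R ^+ 63 * E))); last first.
  rewrite ler_wpM2l ?mulr_ge0 ?(ltW hC5)// e63 -mulrA ler_wpM2l ?exprn_ge0//.
have x1 : 1 <= j%:R ^+ 56 :> R by rewrite exprn_ege1// ler1n.
rewrite (exprD j%:R 56 7); set x56 := j%:R ^+ 56 in x1 *; set x7 := j%:R ^+ 7.
have x70 : 0 <= x7 by rewrite exprn_ge0// ltW.
have : 0 <= C5 * E * x7 * (x56 - 1) by rewrite !mulr_ge0 ?(ltW hC5)// subr_ge0.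
rewrite (_ : 3 * C5 * (x56 * x7 * E) = (2 * x56 + 1) * (C5 * E) * x7 + C5 * E * x7 * (x56 - 1)); last by ring.
by move=> h0; rewrite lerDl.
Qed.

Variables (k : nat) (e : R) (q : nat) (K : R).
Hypotheses (k0 : (0 < k)%N) (ke : 1 / k%:R <= e) (Nk : N%:R <= (2 * k%:R) ^+ q :> R).
(** The exponent collects N^2 <= (2k)^(2q), e^(-2) <= k^2 and the factor k of the claimed rate
    1/k. *)
Hypothesis hK : forall x : R, 0 <= x -> x ^+ (q * 2 + 3) * expR (- (x `^ kappa)) <= K.

Definition Ctails : R := 4 * d%:R * C5 * 2 ^+ (q * 2) * K + 9 * (@Dtail R d (Bz C1 C2 C3 J) Ctail).

Let kR : 0 < k%:R :> R. Proof. by rewrite ltr0n. Qed.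
Let e0 : 0 < e. Proof. by apply: lt_le_trans ke; rewrite divr_gt0. Qed.
Let ek : e^-1 <= k%:R.
Proof. by rewrite -[leRHS]invrK lef_pV2 ?posrE ?invr_gt0// -div1r. Qed.
Let t10 : 0 <= 4 * d%:R * C5 * 2 ^+ (q * 2) * K / k%:R.
Proof.
have K0 : 0 <= K by apply: le_trans (hK (ltW kR)); rewrite mulr_ge0 ?expR_ge0 ?exprn_ge0// ltW.
by rewrite !mulr_ge0 ?(ltW hC5) ?exprn_ge0 ?invr_ge0.
Qed.
Let t20 : 0 <= 9 * (@Dtail R d (Bz C1 C2 C3 J) Ctail) / k%:R.
Proof. by apply: mulr_ge0; [apply: mulr_ge0 => //; exact: Dtail_ge0|rewrite invr_ge0]. Qed.

Let CtailsE : Ctails / k%:R = 4 * d%:R * C5 * 2 ^+ (q * 2) * K / k%:R + 9 * (@Dtail R d (Bz C1 C2 C3 J) Ctail) / k%:R.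
Proof. exact: mulrDl. Qed.

Lemma sparse_tail : small P [set w | exists (t u : R) (k' : 'I_d),
  [/\ 0 <= t <= 1, I u, ~ (- k%:R <= u <= k%:R) & e < `|psum (centered P Sp) N t u k' w|]] (Ctails / k%:R).
Proof.
apply: small_sub (psum_tail IT sparse_coord_measurable (fun i i0 => tS i0 kR) d0 N0 e0).
  by move=> w [t [u [k' [t01 _ nu' h]]]]; exists t, u, k'; split => //; rewrite ltNge ler_norml; exact/negP.
apply: (@le_trans _ _ (4 * d%:R * C5 * 2 ^+ (q * 2) * K / k%:R)); last by rewrite CtailsE lerDl.
have := hK (ltW kR); set E := expR _ => hE; have E0 : 0 <= E := expR_ge0 _.
have N2 : N%:R * N%:R <= (2 * k%:R) ^+ (q * 2) :> R.
  by rewrite exprM expr2 ler_pM.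
have e2 : (e ^+ 2)^-1 <= k%:R ^+ 2.
  by rewrite -exprVn ler_pXn2r ?nnegrE ?invr_ge0 ?(ltW e0).
rewrite (_ : (N * d)%:R * _ = 4 * d%:R * C5 * (N%:R * N%:R * (e ^+ 2)^-1 * E)); last by rewrite natrM; ring.
rewrite -!(mulrA (4 * d%:R * C5)) ler_wpM2l ?mulr_ge0 ?(ltW hC5)//.
apply: (@le_trans _ _ ((2 * k%:R) ^+ (q * 2) * k%:R ^+ 2 * E)).
  by rewrite ler_wpM2r// ler_pM// ?mulr_ge0 ?invr_ge0 ?exprn_ge0 ?(ltW e0).
rewrite exprMn -!mulrA ler_wpM2l ?exprn_ge0// ler_pdivlMr//.
apply: le_trans hE; rewrite !exprD le_eqVlt; apply/orP; left; apply/eqP; ring.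
Qed.

Lemma limit_tail : small P' [set w | exists (t u : R) (k' : 'I_d),
  [/\ 0 <= t <= 1, I u, ~ (- k%:R <= u <= k%:R) & e < `|W t w u ord0 k'|]] (Ctails / k%:R).
Proof.
have B0 := Bz_gt0 J hC1 hC2 hC3.
have cB k' u : I u -> c k' k' u u <= Bz C1 C2 C3 J.
  by move=> Iu; have /andP[] := lrv_bound hC1 hC2 hC3 hJ hnu hJnu se aA N0 csym k' Iu.
have cD k' u v Iu Iv h := @lrv_diff _ _ _ _ _ _ _ _ _ _ _ _ _ _ _ _ _ _ _ hC1 hC2 hC3 hJ hxi hnu hJnu se aA _ N0 csym k' u v Iu Iv h.
have cT k' u j : (k <= j)%N -> j%:R <= `|u| -> c k' k' u u <= Ctail / j%:R ^+ 7.
  by move=> kj; apply: lrv_tail; exact: leq_trans kj.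
apply: small_sub (bm_tail IT dI hW B0 cB cD k0 e0 cT).
  by move=> w [t [u [k' [t01 _ nu' h]]]]; exists t, u, k'; split => //; rewrite ltNge ler_norml; exact/negP.
apply: (@le_trans _ _ (9 * (@Dtail R d (Bz C1 C2 C3 J) Ctail) / k%:R)); last by rewrite CtailsE lerDr.
have e4 : (e ^+ 4)^-1 <= k%:R ^+ 4.
  by rewrite -exprVn ler_pXn2r ?nnegrE ?invr_ge0 ?(ltW e0).
have h : (e ^+ 4)^-1 / k%:R ^+ 5 <= k%:R^-1.
  rewrite ler_pdivrMr ?exprn_gt0//; apply: (le_trans e4).
  by rewrite [k%:R ^+ 5]exprS mulKf// gt_eqF.
have D0 := @Dtail_ge0 R d (Bz C1 C2 C3 J) Ctail; set D := Dtail _ _ in D0 *.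
rewrite (_ : 9 * (D / e ^+ 4) / k%:R ^+ 5 = 9 * D * ((e ^+ 4)^-1 / k%:R ^+ 5)); last by rewrite !mulrA.
by rewrite ler_wpM2l// mulr_ge0.
Qed.

End infinite_domain.
End sparse_estimators_bound.

(** * The scale k as an approximate root of N *)

Section scales.
Context {R : realType}.
Variables (b N : nat).
Hypotheses (b0 : (0 < b)%N) (N0 : (0 < N)%N).

(** k = 2^scale_exp lies between half of N^(1/b) and N^(1/b), and is a power of two for the sake of
    dyadic chaining. *)
Definition scale_exp : nat := (trunc_log 2 N %/ b)%N.
Local Notation k := (2 ^ scale_exp)%N.
Let kR : 0 < k%:R :> R. Proof. by rewrite ltr0n expn_gt0. Qed.
Let NR : 0 < N%:R :> R. Proof. by rewrite ltr0n. Qed.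
Let bR : 0 < b%:R :> R. Proof. by rewrite ltr0n. Qed.

Lemma N_le_pow : N%:R <= (2 * k%:R) ^+ b :> R.
Proof.
rewrite -natrM -natrX ler_nat -expnS -expnM ltnW// (leq_trans (trunc_log_ltn N (isT : (1 < 2)%N)))//.
by rewrite leq_exp2l// ltn_ceil.
Qed.

Lemma pow_le_N : k%:R ^+ b <= N%:R :> R.
Proof.
rewrite -natrX ler_nat -expnM; apply: leq_trans (trunc_logP (isT : (1 < 2)%N) N0).
by rewrite leq_exp2l// leq_divM.
Qed.

Lemma N_root_le (r : R) : 0 <= r <= b%:R^-1 -> N%:R `^ r <= 2 * k%:R.
Proof.
move=> /andP[r0 rb]; have k2 : 0 <= 2 * k%:R :> R by rewrite mulr_ge0// ltW.
apply: le_trans (_ : N%:R `^ b%:R^-1 <= _); first by rewrite ler_powR// ler1n.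
apply: le_trans (_ : ((2 * k%:R) `^ b%:R) `^ b%:R^-1 <= _).
  rewrite ge0_ler_powR ?nnegrE ?powR_ge0 ?invr_ge0//.
  by rewrite powR_mulrn//; exact: N_le_pow.
by rewrite -powRrM divff ?gt_eqF// powRr1.
Qed.

Lemma invk_le : 1 / k%:R <= 2 * N%:R `^ (- b%:R^-1) :> R.
Proof.
rewrite powRN ler_pdivrMr// -mulrA -ler_pdivrMl// mulrC ler_pdivlMl ?powR_gt0// mulrC.
have := @N_root_le b%:R^-1; rewrite invr_ge0 ler0n lexx => /(_ isT); lra.
Qed.

Lemma N_power_le (r : R) (p : nat) : 0 < r -> p%:R <= r * b%:R -> N%:R `^ (- r) <= 1 / k%:R ^+ p.
Proof.
move=> r0 pr; rewrite powRN div1r lef_pV2 ?posrE ?powR_gt0 ?exprn_gt0//.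
apply: le_trans (_ : (k%:R ^+ b) `^ r <= _); last first.
  by rewrite ge0_ler_powR ?nnegrE ?(ltW r0) ?exprn_ge0 ?(ltW kR)// pow_le_N.
rewrite -powR_mulrn ?(ltW kR)// -powRrM -powR_mulrn ?(ltW kR)// ler_powR//; last by rewrite mulrC.
by rewrite ler1n expn_gt0.
Qed.

End scales.

Unset Implicit Arguments.

Theorem theorem4p1 (R : realType) (C1 C2 C3 J nu xi gamma : R)
  (hC1 : 0 < C1) (hC2 : 0 < C2) (hC3 : 0 < C3)
  (hJ : 4 < J) (hxi : 2^-1 < xi) (hnu : 0 < nu) (hJnu : 3 + 9 / (J - 4) < nu)
  (hgamma : 0 < gamma) :
  exists rho0 : R, 0 < rho0 /\
  forall (d : nat) (C4 C5 rho kappa : R),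
    (0 < d)%N -> 0 < C4 -> 0 < C5 -> 0 < rho <= rho0 -> 0 < kappa ->
  exists tau : R, 0 < tau /\
  forall ell : R, 0 <= ell ->
  exists C : R, 0 < C /\
  forall (dO : measure_display) (Omega : measurableType dO)
    (P : probability Omega R) (I1 : set R) (I2 : nat -> set R)
    (X : nat -> Omega -> C0 I1 'rV[R]_d)
    (S : nat -> pmetricType R) (delta : nat -> forall M : nat, Omega -> S M)
    (A : forall (M : nat) (I : set R), C0 I1 'rV[R]_d * S M -> C0 I 'rV[R]_d)
    (MN : nat -> nat),
    sparse_estimators X delta A I2 MN ->
    assumptionA P X delta A I2 MN C1 C2 C3 J nu xi gamma ->
    assumptionB P X delta A I2 ell C4 rho C5 kappa ->
  forall N : nat, (0 < N)%N ->
  forall (dO' : measure_display) (Omega' : measurableType dO')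
    (P' : probability Omega' R) (W : R -> Omega' -> C0 (I2 N) 'rV[R]_d),
    brownian_motion P' (long_run_variance P X) W ->
  prokhorov_rv
    P (partial_sum_process P (sparse X delta A (MN N) (I2 N)) N)
    P' (as_Linf W)
  <= C * N%:R `^ (- tau).

Proof.
have [B0 nu3] : 0 < Bz C1 C2 C3 J /\ 3 <= nu.
  by split; [exact: Bz_gt0|rewrite ltW// (moment_exponent hJ hJnu).2].
set B := Bz C1 C2 C3 J in B0.
have J0 : 0 < J by rewrite (lt_trans _ hJ).
(* 800 is demanded by [sc_L], and 66 J / gamma makes the sparse error N^(-gamma/J) at most k^(-66).
   Both rho0 and tau will be 1/b. *)
pose b := (800 + Num.truncn (66 * J / gamma)).+1.
have b0 : (0 < b)%N by [].
have bR : 0 < b%:R :> R by rewrite ltr0n.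
have b66 : 66%:R <= gamma / J * b%:R.
  have := truncnS_gt (66 * J / gamma); rewrite ltr_pdivrMr// => h.
  rewrite mulrAC ler_pdivlMr// (le_trans (ltW h))// mulrC ler_pM2l// ler_nat /b.
  by rewrite ltnS leq_addl.
exists b%:R^-1; split; first by rewrite invr_gt0.
move=> d C4 C5 rho kappa d0 hC4 hC5 /andP[rho0 rhob] hka.
exists b%:R^-1; split; first by rewrite invr_gt0.
move=> ell ell0.
(* In all scenarios the core has width at most c0 k: it is ell, or C4 N^rho <= 2 C4 k, or 2 k for
   [-k, k]. *)
pose c0 := (Num.truncn (2 * C4 + ell)).+3.
have c00 : (0 < c0)%N by [].
have [A1 A10 hA1] := lindeberg_error_small d hC1 nu3 B0 c00.
have bt0 : 0 <= @Kch R * ((@Kw R * B) ^+ 2 * 4).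
  by rewrite mulr_ge0 ?(ltW (@Kch_gt0 R))// mulr_ge0// sqr_ge0.
have [A2 A20 hA2] := discretization_small d c00 bt0.
have [K63 K630 hK63] := stretched_exp_decay 63 hka.
have [K K0 hK] := stretched_exp_decay (b * 2 + 3) hka.
pose Ct := Num.max 0 (@Ctails R d C1 C2 C3 J C5 K63 b K).
(* The construction runs with e = AA / k, so AA must dominate the constants of all the errors. *)
pose AA := Num.max 1 (Num.max A1 (A2 + Ct)).
have AA1 : 1 <= AA by rewrite le_max lexx.
have AA0 : 0 < AA := lt_le_trans ltr01 AA1.
(* 7 from the discretisation, 2 from 1/k <= 2 N^(-1/b). *)
exists (14 * AA); split; first by rewrite mulr_gt0.
move=> dO Omega P I1 I2 X S delta A MN se aA aB N N0 dO' Omega' P' W hW.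
set k := (2 ^ scale_exp b N)%N; have kR : 0 < k%:R :> R by rewrite ltr0n expn_gt0.
have k1 : 1 <= k%:R :> R by rewrite ler1n expn_gt0.
have ik := invk_le (R := R) b0 N0; rewrite -/k in ik.
suff h : prokhorov_rv P (partial_sum_process P (sparse X delta A (MN N) (I2 N)) N) P' (as_Linf W) <= 7 * (AA / k%:R).
  apply: (le_trans h); rewrite (_ : 14 * AA * _ = 7 * AA * (2 * N%:R `^ (- b%:R^-1))); last by ring.
  rewrite (_ : 7 * (AA / k%:R) = 7 * AA * (1 / k%:R)); last by rewrite div1r mulrA.
  by rewrite ler_wpM2l// mulr_ge0// ltW.
(* As long as AA / k >= 1 the trivial bound is enough; afterwards k > 1 and e <= 1 may be
   assumed. *)
have small1 : 1 <= AA / k%:R -> prokhorov_rv P (partial_sum_process P (sparse X delta A (MN N) (I2 N)) N) P' (as_Linf W) <= 7 * (AA / k%:R).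
  move=> h1; apply: (le_trans (prokhorov_le1 hC2 hC3 hJ hgamma se aA N0 hW)).
  by apply: le_trans h1 _; rewrite ler_peMl ?divr_ge0 ?(ltW AA0) ?(ltW kR)// ler1n.
have [s0|s0] := posnP (scale_exp b N); first by apply: small1; rewrite /k s0 expn0 divr1.
have [kA|Ak] := ltP k%:R AA; first by apply: small1; rewrite ler_pdivlMr// mul1r ltW.
have e1 : AA / k%:R <= 1 by rewrite ler_pdivrMr// mul1r.
have ek : 1 / k%:R <= AA / k%:R by rewrite ler_pM2r ?invr_gt0.
have e0 : 0 < AA / k%:R by rewrite divr_gt0.
have sL : (800 * scale_exp b N <= trunc_log 2 N)%N.
  by rewrite (leq_trans _ (leq_divM (trunc_log 2 N) b))// mulnC leq_mul2l /b -addSn leq_addr orbT.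
have gJ : 0 < gamma / J by rewrite divr_gt0.
have eta66 := N_power_le N0 gJ b66; have eta0 : 0 <= N%:R `^ (- (gamma / J)) := powR_ge0 _ _.
have A1e : A1 / k%:R <= AA / k%:R by rewrite ler_pM2r ?invr_gt0// !le_max lexx orbT.
have A2e : (A2 + Ct) / k%:R <= AA / k%:R by rewrite ler_pM2r ?invr_gt0// !le_max lexx !orbT.
have Ct0 : 0 <= Ct / k%:R by rewrite divr_ge0 ?(ltW kR)// le_max lexx.
have core (x y : R) (w0 : 0 <= y - x) (wk : y - x <= c0%:R * k%:R) (Ixy : forall u, x <= u <= y -> I2 N u) :
    small P [set w | exists (t u : R) (k' : 'I_d), [/\ 0 <= t <= 1, I2 N u, ~ (x <= u <= y) &
      AA / k%:R < `|psum (centered P (sparse X delta A (MN N) (I2 N))) N t u k' w|]] (Ct / k%:R) ->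
    small P' [set w | exists (t u : R) (k' : 'I_d), [/\ 0 <= t <= 1, I2 N u, ~ (x <= u <= y) &
      AA / k%:R < `|W t w u ord0 k'|]] (Ct / k%:R) ->
    prokhorov_rv P (partial_sum_process P (sparse X delta A (MN N) (I2 N)) N) P' (as_Linf W) <= 7 * (AA / k%:R).
  move=> tP tW; pose s := Scale s0 N0 sL eta0 eta66 w0 wk ek.
  exact: (sparse_prokhorov hC1 hC2 hC3 hJ hxi hnu hJnu hgamma se aA N0 hW (s := s) c00 erefl erefl Ixy erefl
    tP tW (hA1 s) (hA2 s) A1e A2e e1).
have c0r : 2 * C4 + ell <= c0%:R :> R.
  by rewrite (le_trans (ltW (truncnS_gt _)))// ler_nat /c0 !ltnS leqW.
have compact (x y : R) : I2 N = `[x, y]%classic -> x <= y -> y - x <= c0%:R * k%:R ->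
    prokhorov_rv P (partial_sum_process P (sparse X delta A (MN N) (I2 N)) N) P' (as_Linf W) <= 7 * (AA / k%:R).
  move=> IE xy wk; have Ixy u : x <= u <= y <-> I2 N u by rewrite IE /= in_itv.
  apply: (core x y) => //; first by rewrite subr_ge0.
  - by move=> u /Ixy.
  - by apply: small_sub (small0 P Ct0) => // w [t [u [k' [_ /Ixy]]]].
  - by apply: small_sub (small0 P' Ct0) => // w [t [u [k' [_ /Ixy]]]].
case: aB => [[x [y [xy /(_ _ N0)[xy0 IE]]]]|[_ _ /(_ _ N0)[x [y [[xy0 IE] xy]]]]|[I1T IT tX tS]].
- apply: (compact x y IE xy0); rewrite xy; apply: le_trans (_ : c0%:R <= _); last by rewrite ler_peMr.
  by apply: le_trans c0r; rewrite lerDr mulr_ge0// ltW.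
- apply: (compact x y IE xy0); apply: (le_trans xy).
  have rb : 0 <= rho <= b%:R^-1 by rewrite (ltW rho0).
  have := N_root_le b0 N0 rb; rewrite -/k => h.
  apply: le_trans (_ : C4 * (2 * k%:R) <= _); first by rewrite ler_wpM2l// ltW.
  rewrite mulrCA mulrA ler_wpM2r ?(ltW kR)//; apply: le_trans c0r.
  by rewrite lerDl.
- have IN := IT _ N0; have INu u : I2 N u by rewrite IN.
  have tS' n (y : R) : (0 < n)%N -> 0 < y ->
    ('E_P[fun w => ((supnorm [set u | (y < `|u|)%R] (sparse X delta A (MN N) (I2 N) n w)) ^+ 2)%R]
      <= (C5 * expR (- (y `^ kappa)))%:E)%E.
    move=> n0 y0; have := tS n (MN N) y n0 (se_MN_gt0 se N0) y0.
    by move: (I2 N) IN => I ->.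
  have CtC : @Ctails R d C1 C2 C3 J C5 K63 b K / k%:R <= Ct / k%:R by rewrite ler_pM2r ?invr_gt0// le_max lexx orbT.
  have k0 : (0 < k)%N by rewrite expn_gt0.
  have wk : k%:R - - k%:R = 2 * k%:R :> R by rewrite opprK -mulr2n mulr_natl.
  have w0 : 0 <= k%:R - - k%:R :> R by rewrite wk mulr_ge0// ltW.
  have wc : k%:R - - k%:R <= c0%:R * k%:R :> R by rewrite wk ler_wpM2r ?(ltW kR)// ler_nat.
  apply: (core _ _ w0 wc (fun u _ => INu u)).
  + have T := sparse_tail C1 C2 C3 J se N0 d0 INu hC5 tS' K63 k0 ek (N_le_pow N b0) hK.
    exact: (small_sub (fun w h => h) CtC T).
  + have T := limit_tail hC1 hC2 hC3 hJ hxi hnu hJnu se aA N0 hW INu hC5 tX hK63 k0 ek hK.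
    exact: (small_sub (fun w h => h) CtC T).
Qed.
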